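(* There is an FPTAS for the number of proper $q$-vertex-colourings of any finite subgraph of each of the following lattice graphs: the $\mathbb{Z}^2$ lattice if $q\geq 6$; the $\mathbb{Z}^3$ lattice if $q\geq 10$; the triangular lattice if $q\geq 10$; the honeycomb lattice if $q\geq 5$; the Kagome lattice if $q\geq 5$.
   Context: A proper $q$-colouring of a graph assigns colours from $[q]$ to vertices so that adjacent vertices receive distinct colours. An FPTAS is a deterministic algorithm which, given a finite graph with $n$ vertices and $\varepsilon\in(0,1)$, outputs a number within a factor $1\pm\varepsilon$ of the count in time polynomial in $n$ and $1/\varepsilon$. *)

(* Defs.v *)
From HB Require Import structures.
From mathcomp Require Import all_boot all_order all_algebra.

Set Implicit Arguments.
Unset Strict Implicit.
Unset Printing Implicit Defensive.

Import Order.TTheory GRing.Theory Num.Theory.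

Record graph := Graph {
  order : nat;
  adj : rel 'I_order;
  adj_sym : symmetric adj;
  adj_irr : irreflexive adj }.

Definition proper_colouring (q : nat) (G : graph)
    (c : {ffun 'I_(order G) -> 'I_q}) : bool :=
  [forall x, forall y, adj x y ==> (c x != c y)].

Definition num_colourings (q : nat) (G : graph) : nat :=
  #|[set c : {ffun 'I_(order G) -> 'I_q} | proper_colouring c]|.

(* G is isomorphic to a (not necessarily induced) subgraph of L. *)
Definition subgraph_of (T : Type) (L : rel T) (G : graph) : Prop :=
  exists2 f : 'I_(order G) -> T,
    injective f & forall x y, adj x y -> L (f x) (f y).

Section Lattices.
Local Open Scope ring_scope.

Definition Z2_lattice : rel (int * int) := fun u v =>
  `|u.1 - v.1| + `|u.2 - v.2| == 1.

Definition Z3_lattice : rel (int * int * int) := fun u v =>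
  `|u.1.1 - v.1.1| + `|u.1.2 - v.1.2| + `|u.2 - v.2| == 1.

(* (x, y) stands for the point x * (1, 0) + y * (1/2, sqrt 3 / 2): the six
   shortest vectors are +-(1, 0), +-(0, 1) and +-(1, -1). *)
Definition triangular_lattice : rel (int * int) := fun u v =>
  (v.1 - u.1, v.2 - u.2) \in
    [:: (1, 0); (-1, 0); (0, 1); (0, -1); (1, -1); (-1, 1)].

(* (x, y, b) is the vertex of class b in the cell (x, y); a vertex of class
   false is joined to the vertices of class true in three cells. *)
Definition honeycomb_lattice : rel (int * int * bool) := fun u v =>
  let nbr (a b : int * int * bool) :=
    [&& ~~ a.2, b.2 &
        (a.1.1 - b.1.1, a.1.2 - b.1.2) \in [:: (0, 0); (1, 0); (0, 1)]] in
  nbr u v || nbr v u.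

(* The triangular lattice with the points having two even coordinates
   deleted. *)
Definition kagome_vertex : Type :=
  {u : int * int | ~~ ((2 %| u.1)%Z && (2 %| u.2)%Z)}.

Definition kagome_lattice : rel kagome_vertex := fun u v =>
  triangular_lattice (sval u) (sval v).

End Lattices.

(* Model of computation: the WHILE language of N. D. Jones, "Computability and
   Complexity: From a Programming Perspective" (MIT Press, 1997). Data are
   binary trees, and each elementary operation costs one time unit. Subtrees
   can be shared and only the test against Leaf is available, so this time
   measure is polynomially related to that of Turing machines. *)
Inductive tree := Leaf | Node of tree & tree.

Inductive expr :=
  | EVar of nat
  | ELeaf
  | ENode of expr & expr
  | EFst of expr
  | ESnd of expr.

Inductive cmd :=
  | Assign of nat & expr
  | Seq of cmd & cmd
  | If of expr & cmd & cmd
  | While of expr & cmd.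

Definition store := nat -> tree.

Definition update (s : store) (x : nat) (t : tree) : store :=
  fun y => if y == x then t else s y.

Fixpoint eval (s : store) (E : expr) : tree :=
  match E with
  | EVar x => s x
  | ELeaf => Leaf
  | ENode E1 E2 => Node (eval s E1) (eval s E2)
  | EFst E1 => if eval s E1 is Node t _ then t else Leaf
  | ESnd E1 => if eval s E1 is Node _ t then t else Leaf
  end.

Fixpoint cost (E : expr) : nat :=
  match E with
  | EVar _ | ELeaf => 1
  | ENode E1 E2 => (cost E1 + cost E2).+1
  | EFst E1 | ESnd E1 => (cost E1).+1
  end.

Definition truthy (t : tree) : bool := if t is Node _ _ then true else false.

(* exec c s k s': started in the store s, c halts after k time units in s'. *)
Inductive exec : cmd -> store -> nat -> store -> Prop :=
  | exec_assign s x E :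
      exec (Assign x E) s (cost E).+1 (update s x (eval s E))
  | exec_seq s1 s2 s3 c1 c2 k1 k2 :
      exec c1 s1 k1 s2 -> exec c2 s2 k2 s3 ->
      exec (Seq c1 c2) s1 (k1 + k2).+1 s3
  | exec_if s s' E c1 c2 k :
      exec (if truthy (eval s E) then c1 else c2) s k s' ->
      exec (If E c1 c2) s (cost E + k).+1 s'
  | exec_while_done s E c :
      ~~ truthy (eval s E) -> exec (While E c) s (cost E).+1 s
  | exec_while_step s1 s2 s3 E c k1 k2 :
      truthy (eval s1 E) -> exec c s1 k1 s2 -> exec (While E c) s2 k2 s3 ->
      exec (While E c) s1 (cost E + k1 + k2).+1 s3.

Definition computes (p : cmd) (input : tree) (k : nat) (output : tree) : Prop :=
  exists2 s, exec p (update (fun=> Leaf) 0 input) k s & s 0 = output.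

Definition tree_of_bool (b : bool) : tree := if b then Node Leaf Leaf else Leaf.

Definition tree_of_seq : seq tree -> tree := foldr Node Leaf.

Definition tree_of_graph (G : graph) : tree :=
  tree_of_seq [seq tree_of_seq [seq tree_of_bool (adj x y)
    | y <- enum 'I_(order G)] | x <- enum 'I_(order G)].

Definition binary_digit (a i : nat) : bool := odd (a %/ 2 ^ i).

(* The fraction a / b, with both numbers in binary, most significant digit
   first, and padded to a common length: the list of the pairs (digit of a,
   digit of b). With this aligned layout log(1 / (a / b)) steps suffice to read
   off a lower bound for a / b up to a constant factor, however long a and b
   are, so that a running time polynomial in 1 / (a / b) only is meaningful. *)
Definition tree_of_fraction (a b : nat) : tree :=
  tree_of_seq
    [seq Node (tree_of_bool (binary_digit a i)) (tree_of_bool (binary_digit b i))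
    | i <- rev (iota 0 (up_log 2 (maxn a b).+1))].

Definition represents (t : tree) (x : rat) : Prop :=
  exists a b : nat,
    [/\ 0 < b, x = (a%:R / b%:R)%R & t = tree_of_fraction a b].

(* As 1 / eps > 1, the bounds K * (n + 1 / eps) ^ d dominate all polynomials in n
   and 1 / eps. *)
Definition has_FPTAS (C : graph -> Prop) (Z : graph -> nat) : Prop :=
  exists (p : cmd) (K d : nat),
    forall (G : graph) (eps : rat) (t : tree),
      C G -> (0 < eps < 1)%R -> represents t eps ->
      exists (k : nat) (out : tree) (x : rat),
        [/\ computes p (Node (tree_of_graph G) t) k out,
            (k%:R <= K%:R * ((order G)%:R + eps^-1) ^+ d :> rat)%R,
            represents out x
          & ((1 - eps) * (Z G)%:R <= x <= (1 + eps) * (Z G)%:R)%R].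

(* Main.v *)
Require Import Defs.
From mathcomp Require Import all_boot all_order all_algebra.
From mathcomp Require Import zify ring lra.

(** Counting reduces to marginals: the number of colourings is the product, over
    the vertices taken in turn, of the inverse probability that a vertex receives
    a chosen colour given the colours already pinned.  Such a marginal is a ratio
    of sums, over the colourings of a sphere of constant radius r, of weights
    that depend on the enclosed ball only and of the marginal of the sphere
    colouring itself; revealing the sphere vertex by vertex expresses the latter
    through marginals of the same kind.  Strong spatial mixing makes each
    evaluation halve the error of its inputs, so that a logarithmic depth
    suffices and the tree of recursive calls has polynomial size.

    Strong spatial mixing is shown by induction on the graph: the influence of
    recolouring s on a distant vertex is bounded by a potential which sums over
    the neighbours of s weights depending on the size of their colour lists, and
    exposing the neighbours one at a time contracts this potential.  For Kagome
    subgraphs the potential is taken per triangle, that is, jointly over the two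
    other corners of a triangle at s.

    Programs are obtained by showing that the functions on trees computable in
    time polynomial in a unary clock are closed under the constructions needed;
    the clock is a power of (n + 2) 2^j, where 2^-j is the leading digit of the
    accuracy. *)

Set Implicit Arguments.
Unset Strict Implicit.
Unset Printing Implicit Defensive.

(** At the smallest admissible numbers of colours, counting one lost colour per neighbour does not
    make the influence contract. Two gains do. And a neighbour with all its other lattice neighbours
    present has a complete list, hence takes any given colour with probability bounded below, so a
    colour available to many such neighbours has a small weight.

    Degrees and triangles are taken in the host lattice [lat], not in the graph [e]: the invariant
    [cls] says that a list has lost at most one colour per missing lattice neighbour, so it survives
    deletions and pinnings.

    The error halves because the estimated marginals sum to one exactly: the error of an input is
    then multiplied by the influence of its vertex instead of being added to it. Balls grow
    polynomially and influence decays exponentially, so a constant radius beats the size of the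
    sphere.

    The machine has no recursion, so the tree of calls is unfolded into layers and evaluated from
    the deepest one. Fractions are never reduced: a level multiplies their length by a constant,
    which is harmless at logarithmic depth. *)

(** * Weighted sums over list colourings, deletion of vertices, lifting of local inequalities *)

Module Colourings.
Import Order.TTheory GRing.Theory Num.Theory.
Local Open Scope ring_scope.

Section Sums.
Variables (V C : finType) (c0 : C) (e : rel V).
Hypothesis e_sym : symmetric e.
Hypothesis e_irr : irreflexive e.
Implicit Types (H A Q I : {set V}) (L M : V -> {set C}) (c : {ffun V -> C}).
Implicit Types (f : {ffun V -> C} -> rat).

(** Colourings of a subset are total functions frozen at [c0] off [H]: all sums then range over one
    type, and deleting a vertex changes only the predicate. *)
Definition good H L c : bool :=
  [forall v, if v \in H then c v \in L v else c v == c0] &&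
  [forall v in H, forall w in H, e v w ==> (c v != c w)].

Lemma goodP H L c :
  reflect [/\ forall v, v \in H -> c v \in L v,
              forall v, v \notin H -> c v = c0
            & forall v w, v \in H -> w \in H -> e v w -> c v != c w]
    (good H L c).
Proof.
apply: (iffP andP) => [[/forallP h1 /forall_inP h2]|[h1 h2 h3]].
  split=> [v vH|v vH|v w vH wH evw].
  - by have := h1 v; rewrite vH.
  - by have := h1 v; rewrite (negPf vH) => /eqP.
  - by have /forall_inP/(_ w wH)/implyP/(_ evw) := h2 v vH.
split.
  by apply/forallP=> v; case: ifP => [/h1|/negbT/h2/eqP].
apply/forall_inP=> v vH; apply/forall_inP=> w wH; apply/implyP; exact: h3.
Qed.

Definition csum H L f : rat := \sum_(c | good H L c) f c.

Definition upd c v a : {ffun V -> C} := [ffun w => if w == v then a else c w].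

Definition rem L Q (a : C) : V -> {set C} :=
  fun w => if w \in Q then L w :\ a else L w.

Definition nbr (v : V) : {set V} := [set w | e v w].

Lemma eq_csum H L M f g :
  (forall v, v \in H -> L v = M v) -> (forall c, good H L c -> f c = g c) ->
  csum H L f = csum H M g.
Proof.
move=> eL ef; rewrite /csum.
have gE : good H L =1 good H M.
  move=> c; rewrite /good; congr (_ && _).
  by apply: eq_forallb => v; case: ifP => // vH; rewrite eL.
by rewrite -(eq_bigl _ _ gE); apply: eq_bigr.
Qed.

Lemma eq_csum_lists H L M f :
  (forall v, v \in H -> L v = M v) -> csum H L f = csum H M f.
Proof. by move=> eL; apply: eq_csum. Qed.

Lemma eq_csum_fun H L f g : f =1 g -> csum H L f = csum H L g.
Proof. by move=> ef; apply: eq_csum. Qed.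

(** Colouring [v] first turns its edge constraints into the removal of its colour from the lists of
    its neighbours. This is the basis of the inductions on vertex sets below. *)
Lemma csum_peel H L f v : v \in H ->
  csum H L f =
  \sum_(a in L v) csum (H :\ v) (rem L (nbr v) a) (fun c => f (upd c v a)).
Proof.
move=> vH; rewrite /csum.
rewrite (partition_big (fun c : {ffun V -> C} => c v) (mem (L v))) /=; last first.
  by move=> c /goodP[h _ _]; exact: h.
apply: eq_bigr => a aL.
rewrite (reindex_onto (fun c => upd c v a) (fun c => upd c v c0)) /=; last first.
  move=> c /andP[_ /eqP cv]; apply/ffunP=> w; rewrite !ffunE.
  by case: eqP => // ->.
apply: eq_bigl => c; apply/andP/idP.
  case=> /andP[/goodP[h1 h2 h3] _] /eqP cE.
  have cv : c v = c0 by rewrite -cE !ffunE eqxx.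
  apply/goodP; split=> [w|w|w w'].
  - rewrite !inE => /andP[wv wH]; have := h1 w wH; rewrite ffunE (negPf wv) => cw.
    rewrite /rem inE; case: ifP => // evw; rewrite !inE cw andbT.
    by have := h3 v w vH wH evw; rewrite !ffunE eqxx (negPf wv) eq_sym.
  - rewrite !inE; case: eqP => [->//|/eqP wv /= wH].
    by have := h2 w wH; rewrite ffunE (negPf wv).
  - rewrite !inE => /andP[wv wH] /andP[wv' wH'] ew.
    by have := h3 w w' wH wH' ew; rewrite !ffunE (negPf wv) (negPf wv').
move=> /goodP[h1 h2 h3].
have cv : c v = c0 by apply: h2; rewrite !inE eqxx.
split; last by apply/eqP/ffunP=> w; rewrite !ffunE; case: eqP => // ->.
rewrite ffunE !eqxx andbT; apply/goodP.
have h1' w : w != v -> w \in H -> (c w \in L w) && (e v w ==> (c w != a)).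
  move=> wv wH; have := h1 w; rewrite !inE wv wH => /(_ isT).
  rewrite /rem inE; case: ifP => evw; last by move->.
  by rewrite !inE => /andP[-> ->].
split=> [w wH|w wH|w w' wH wH' ew].
- rewrite ffunE; case: eqP => [->//|/eqP wv].
  by have /andP[] := h1' w wv wH.
- rewrite ffunE; case: eqP => [ww|/eqP wv]; first by rewrite ww vH in wH.
  by apply: h2; rewrite !inE negb_and wH orbT.
- rewrite !ffunE; case: (eqVneq w v) => [wv|wv]; case: (eqVneq w' v) => [wv'|wv'].
  + by rewrite wv wv' e_irr in ew.
  + by have /andP[_ /implyP] := h1' w' wv' wH'; rewrite -wv ew eq_sym; apply.
  + have /andP[_ /implyP] := h1' w wv wH; rewrite -wv' e_sym ew; exact.
  + by apply: h3; rewrite ?inE ?wv ?wv'.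
Qed.

Lemma csum0 L f : csum set0 L f = f [ffun => c0].
Proof.
rewrite /csum (big_pred1 [ffun=> c0]) // => c /=.
apply/goodP/eqP => [[_ h _]|->].
  by apply/ffunP=> v; rewrite ffunE h ?inE.
by split=> [v|v _|v w]; rewrite ?inE ?ffunE.
Qed.

Lemma csum_add H L f g : csum H L (fun c => f c + g c) = csum H L f + csum H L g.
Proof. by rewrite /csum big_split. Qed.

Lemma csum_scale H L k f : csum H L (fun c => k * f c) = k * csum H L f.
Proof. by rewrite /csum big_distrr. Qed.

Lemma csum_opp H L f : csum H L (fun c => - f c) = - csum H L f.
Proof. by rewrite /csum sumrN. Qed.

Lemma csum_bigsum (J : finType) (P : pred J) (F : J -> {ffun V -> C} -> rat) H L :
  csum H L (fun c => \sum_(j | P j) F j c) = \sum_(j | P j) csum H L (F j).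
Proof. by rewrite /csum exchange_big. Qed.

Lemma csum_ge0 H L f : (forall c, 0 <= f c) -> 0 <= csum H L f.
Proof. by move=> h; apply: sumr_ge0. Qed.

Lemma csum_le H L f g : (forall c, good H L c -> f c <= g c) ->
  csum H L f <= csum H L g.
Proof. by move=> h; apply: ler_sum. Qed.

Definition count H L : rat := csum H L (fun=> 1).

Lemma count_ge0 H L : 0 <= count H L.
Proof. by apply: csum_ge0 => ?; apply: ler01. Qed.

Lemma csum_cst H L (k : rat) : csum H L (fun=> k) = k * count H L.
Proof. by rewrite -csum_scale; apply: eq_csum_fun => c; rewrite mulr1. Qed.

Definition edeg H v := #|[set w in H | e v w]|.

Lemma edegD1 H v w : v \in H -> edeg H w = (e w v + edeg (H :\ v) w)%N.
Proof.
move=> vH; rewrite /edeg (cardsD1 v) !inE vH /=; congr (_ + _)%N.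
by apply: eq_card => x; rewrite !inE andbA.
Qed.

Lemma card_rem L Q a w : (#|L w| <= #|rem L Q a w| + (w \in Q))%N.
Proof.
rewrite /rem; case: (w \in Q); last by rewrite addn0.
by rewrite (cardsD1 a (L w)) addnC leq_add2l; case: (_ \in _).
Qed.

Lemma rem_sub L Q a w : rem L Q a w \subset L w.
Proof. by rewrite /rem; case: ifP => // _; rewrite subD1set. Qed.

Lemma count_gt0 H L : (forall v, v \in H -> (edeg H v < #|L v|)%N) -> 0 < count H L.
Proof.
have [n] := ubnP #|H|; elim: n => // n IH in H L * => lt hL.
have [->|/set0Pn[v vH]] := eqVneq H set0; first by rewrite /count csum0.
rewrite /count (csum_peel _ _ vH).
have /card_gt0P[a aL] : (0 < #|L v|)%N by apply: leq_ltn_trans (hL v vH).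
rewrite (bigD1 a) //=; apply: ltr_wpDr; first by apply: sumr_ge0 => b _; apply: csum_ge0 => ?; apply: ler01.
apply: IH; first by move: lt; rewrite (cardsD1 v) vH.
move=> w; rewrite !inE => /andP[wv wH].
have := hL w wH; rewrite (edegD1 w vH); have := card_rem L (nbr v) a w.
by rewrite inE (e_sym v w); lia.
Qed.

Definition only_on A f := forall c c' : {ffun V -> C}, {in A, c =1 c'} -> f c = f c'.

Lemma only_on_upd A f c v a : only_on A f -> v \notin A -> f (upd c v a) = f c.
Proof.
move=> hf vA; apply: hf => w wA; rewrite ffunE.
by case: eqP => // wv; rewrite -wv wA in vA.
Qed.

(** Reveal all colours outside [A]: each revealed vertex strikes at most one colour from the list of
    each neighbour in [A]. A linear inequality about [A] that holds for all such reduced lists is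
    therefore preserved by averaging. *)
Lemma csum_lift H L A f : A \subset H -> only_on A f ->
  (forall M, (forall w, w \in A -> M w \subset L w /\
      (#|L w| <= #|M w| + edeg (H :\: A) w)%N) -> 0 <= csum A M f) ->
  0 <= csum H L f.
Proof.
have [n] := ubnP #|H :\: A|; elim: n => // n IH in H L * => lt AH hf hM.
have [E|/set0Pn[v]] := eqVneq (H :\: A) set0.
  have -> : H = A.
    apply/eqP; rewrite eqEsubset AH andbT; apply/subsetP=> w wH.
    by apply: contraT => wA; move/setP/(_ w): E; rewrite !inE wH wA.
  by apply: hM => w wA; split=> //; rewrite leq_addr.
rewrite inE => /andP[vA vH]; rewrite (csum_peel _ _ vH); apply: sumr_ge0 => a aL.
have HDv : (H :\ v) :\: A = (H :\: A) :\ v.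
  by apply/setP=> w; rewrite !inE; case: (w == v) => //=; rewrite ?andbF.
have vHA : v \in H :\: A by rewrite inE vA vH.
rewrite (eq_csum_fun _ _ (g := f)); last by move=> c; exact: (only_on_upd _ _ hf vA).
apply: IH => //.
- by move: lt; rewrite HDv (cardsD1 v (H :\: A)) vHA.
- by rewrite subsetD1 AH.
move=> M hMM; apply: hM => w wA; have [s1 s2] := hMM w wA; split.
  by apply: subset_trans s1 _; apply: rem_sub.
rewrite (edegD1 w vHA); have := card_rem L (nbr v) a w; rewrite -HDv inE (e_sym v w); lia.
Qed.

(** Without edges leaving [A] the lists on [A] cannot shrink, so [csum_lift] applies to both [f] and
    its negative. *)
Lemma csum_lift_eq0 H L A f : A \subset H -> only_on A f ->
  (forall w y, w \in A -> y \in H -> y \notin A -> ~~ e w y) ->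
  csum A L f = 0 -> csum H L f = 0.
Proof.
move=> AH hf sep z; apply/eqP; rewrite eq_le -oppr_ge0 -csum_opp.
have key g : only_on A g -> csum A L g = 0 -> 0 <= csum H L g.
  move=> hg zg; apply: (csum_lift AH hg) => M hM.
  rewrite (eq_csum_lists _ (M := L)) ?zg // => w wA.
  have [sM] := hM w wA; rewrite (_ : edeg _ _ = 0%N) ?addn0.
    by move=> le; apply/eqP; rewrite eqEcard sM.
  apply/eqP; rewrite cards_eq0; apply/eqP/setP=> y; rewrite !inE.
  case yA: (y \in A) => //=; case yH: (y \in H) => //=.
  by apply/negbTE/sep; rewrite ?yA.
rewrite !key //.
  by move=> c c' cc; rewrite (hf _ _ cc).
by rewrite csum_opp z oppr0.
Qed.

Definition avoid A (k : C) c : bool := [forall w in A, c w != k].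

Definition avoidr A k c : rat := (avoid A k c)%:R.

(** Striking [k] from lists and asking the vertices to avoid [k] are the same restriction. Counts
    for different struck colours thus become expectations over one and the same list assignment. *)
Lemma csum_rem H L Q k f :
  csum H (rem L Q k) f = csum H L (fun c => f c * avoidr (H :&: Q) k c).
Proof.
rewrite /csum /avoidr.
rewrite (bigID (avoid (H :&: Q) k) (good H L)) /= [X in _ + X]big1; last first.
  by move=> c /andP[_ /negbTE ->]; rewrite mulr0.
rewrite addr0 (eq_bigl (fun c => good H L c && avoid (H :&: Q) k c)).
  by apply: eq_bigr => c /andP[_ ->]; rewrite mulr1.
move=> c; apply/goodP/andP => [[h1 h2 h3]|[/goodP[h1 h2 h3] /forall_inP av]].
  split; last first.
    apply/forall_inP=> w; rewrite inE => /andP[wH wQ].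
    by have := h1 w wH; rewrite /rem wQ !inE => /andP[].
  by apply/goodP; split=> // v vH; apply: (subsetP (rem_sub L Q k v)); exact: h1.
split=> // v vH; rewrite /rem; case: ifP => vQ; last exact: h1.
by rewrite !inE h1 // av // inE vH.
Qed.

Lemma count_rem H L Q k : count H (rem L Q k) = csum H L (avoidr (H :&: Q) k).
Proof. by rewrite /count csum_rem; apply: eq_csum_fun => c; rewrite mul1r. Qed.

Lemma avoidr_ge0 A k c : 0 <= avoidr A k c. Proof. exact: ler0n. Qed.
Lemma avoidr_le1 A k c : avoidr A k c <= 1.
Proof. by rewrite /avoidr; case: avoid. Qed.

Lemma only_on_avoidr A k : only_on A (avoidr A k).
Proof.
move=> c c' cc; rewrite /avoidr /avoid; congr (_%:R).
by congr (nat_of_bool _); apply: eq_forallb => w; case wA: (w \in A) => //=; rewrite cc.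
Qed.

Lemma avoid0 k c : avoid set0 k c.
Proof. by apply/forall_inP=> w; rewrite inE. Qed.

Lemma avoidU1 A v k c : avoid (v |: A) k c = (c v != k) && avoid A k c.
Proof.
apply/forall_inP/andP => [h|[h1 /forall_inP h2] w]; last first.
  by rewrite !inE => /orP[/eqP->|/h2].
split; first by apply: h; rewrite !inE eqxx.
by apply/forall_inP=> w wA; apply: h; rewrite !inE wA orbT.
Qed.

Lemma avoid_upd A v k c a : avoid A k (upd c v a) =
  ((v \in A) ==> (a != k)) && avoid (A :\ v) k c.
Proof.
apply/forall_inP/andP => [h|[/implyP h1 /forall_inP h2] w wA].
  split; first by apply/implyP=> /h; rewrite ffunE eqxx.
  apply/forall_inP=> w; rewrite !inE => /andP[wv wA].
  by have := h w wA; rewrite ffunE (negPf wv).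
rewrite ffunE; case: (eqVneq w v) => [wv|wv]; first by apply: h1; rewrite -wv.
by apply: h2; rewrite !inE wv.
Qed.

(** The right side is affine in each [p i], hence minimal at a corner of the box, where some [n]
    coordinates equal [1/m] and the others vanish; the last hypothesis checks these corners. [P] and
    [X] accumulate the coordinates already fixed by the induction. *)
Lemma multiaffine (T : finType) (J : {set T}) (p : T -> rat) (m : nat) (A0 B P X : rat) :
  (0 < m)%N -> (forall i, i \in J -> 0 <= p i <= m%:R^-1) ->
  (forall n, (n <= #|J|)%N -> A0 <= P * (1 - m%:R^-1) ^+ n + B * (X + n%:R / m%:R)) ->
  A0 <= P * \prod_(i in J) (1 - p i) + B * (X + \sum_(i in J) p i).
Proof.
move=> m0; have [n] := ubnP #|J|; elim: n => // n IH in J P X * => lt hp h.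
have [->|/set0Pn[v vJ]] := eqVneq J set0.
  by rewrite !big_set0; have := h 0%N isT; rewrite expr0 mul0r.
have cJ := cardsD1 v J; rewrite vJ in cJ.
have mr : 0 < m%:R :> rat by rewrite ltr0n.
have mi := divff (lt0r_neq0 mr).
have lt' : (#|J :\ v| < n)%N by move: lt; rewrite cJ.
have hp' i : i \in J :\ v -> 0 <= p i <= m%:R^-1 by rewrite inE => /andP[_ /hp].
have i0 := IH (J :\ v) P X lt' hp'.
have i1 := IH (J :\ v) (P * (1 - m%:R^-1)) (X + m%:R^-1) lt' hp'.
have {}i0 := i0 (fun n hn => h n (leq_trans hn (subset_leq_card (subD1set _ _)))).
have {}i1 : A0 <= P * (1 - m%:R^-1) * \prod_(i in J :\ v) (1 - p i) + B * (X + m%:R^-1 + \sum_(i in J :\ v) p i).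
  apply: i1 => k hk; have := h k.+1; rewrite cJ ltnS => /(_ hk).
  move=> hh; apply: le_trans hh _; rewrite exprS -natr1.
  by rewrite le_eqVlt; apply/orP; left; apply/eqP; ring.
rewrite (big_setD1 v vJ) /= [\sum_(i in J) _](big_setD1 v vJ) /=.
set Pr := \prod_(i in _) _ in i0 i1 *; set Sm := \sum_(i in _) _ in i0 i1 *.
have /andP[pv0 pv1] := hp v vJ.
have pm : p v = (p v * m%:R) * m%:R^-1 by rewrite -mulrA mi mulr1.
(* [t] is the relative position of [p v] in [[0, 1/m]]: the claim is the convex combination of [i0]
   and [i1] with weights [1 - t] and [t]. *)
set t := p v * m%:R in pm *.
have t0 : 0 <= t by rewrite mulr_ge0 // ltW.
have t1 : t <= 1 by rewrite /t -ler_pdivlMr // div1r.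
rewrite pm; move: i0 i1; set z := m%:R^-1; move=> i0 i1.
have -> : P * ((1 - t * z) * Pr) + B * (X + (t * z + Sm)) =
  (1 - t) * (P * Pr + B * (X + Sm)) + t * (P * (1 - z) * Pr + B * (X + z + Sm)).
  by ring.
nra.
Qed.

End Sums.
End Colourings.

Module EdgeBounds.
Import Colourings.
Import Order.TTheory GRing.Theory Num.Theory.
Local Open Scope ring_scope.

Section Bounds.
Variables (V C : finType) (c0 : C) (e : rel V).
Hypothesis e_sym : symmetric e.
Hypothesis e_irr : irreflexive e.
Implicit Types (H A Q I : {set V}) (L M : V -> {set C}) (c : {ffun V -> C}).
Notation csum := (csum c0 e).
Notation count := (count c0 e).
Notation nbr := (nbr e).
Notation edeg := (edeg e).

Lemma count_indep I L : {in I &, forall v w, ~~ e v w} ->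
  count I L = \prod_(w in I) #|L w|%:R.
Proof.
have [n] := ubnP #|I|; elim: n => // n IH in I * => lt ind.
have [->|/set0Pn[v vI]] := eqVneq I set0; first by rewrite big_set0 /Colourings.count csum0.
rewrite /Colourings.count (csum_peel c0 e_sym e_irr _ _ vI) (big_setD1 v vI) /=.
rewrite -IH; last 2 first.
- by move: lt; rewrite (cardsD1 v) vI.
- by move=> x y /setD1P[_ xI] /setD1P[_ yI]; apply: ind.
rewrite (eq_bigr (fun=> count (I :\ v) L)); last first.
  move=> a _; apply: eq_csum_lists => w /setD1P[_ wI].
  by rewrite /rem inE (negPf (ind v w vI wI)).
by rewrite sumr_const mulr_natl.
Qed.

Lemma unused_lb H L A I (K : {set C}) (m kap : nat) (A0 B0 : rat) :
  I \subset A -> A \subset H -> {in I &, forall v w, ~~ e v w} ->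
  (0 < m)%N -> 0 <= A0 -> 0 <= B0 ->
  (forall w, w \in I -> (m + edeg (H :\: I) w <= #|L w|)%N) ->
  (kap + #|A :\: I| <= #|K|)%N ->
  (forall n, (n <= #|I|)%N -> A0 <= (1 - m%:R^-1) ^+ n + B0 * (n%:R / m%:R)) ->
  (kap%:R * A0 - #|I|%:R * B0) * count H L <= \sum_(k in K) csum H L (avoidr A k).
Proof.
move=> IA AH ind m0 A00 B00 hL hK chord.
have [n] := ubnP #|H :\: I|; elim: n => // n IH in H L A K IA AH hL hK * => lt.
have [E|/set0Pn[v]] := eqVneq (H :\: I) set0.
  have HI : H \subset I.
    apply/subsetP=> w wH; apply: contraT => wI.
    by move/setP/(_ w): E; rewrite !inE wH wI.
  have EA : A = I by apply/eqP; rewrite eqEsubset IA (subset_trans AH).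
  have EH : H = I by apply/eqP; rewrite eqEsubset HI -{1}EA AH.
  subst H A; rewrite setDv cards0 addn0 in hK.
  have L0 w : w \in I -> 0 < #|L w|%:R :> rat.
    by move=> wI; rewrite ltr0n; apply: leq_trans (hL w wI); rewrite addn_gt0 m0.
  pose p w k : rat := (k \in L w)%:R / #|L w|%:R.
  have pE k : csum I L (avoidr I k) = count I L * \prod_(w in I) (1 - p w k).
    have := count_rem c0 e I L I k; rewrite setIid => <-.
    rewrite !count_indep // -big_split /=; apply: eq_bigr => w wI.
    rewrite /rem wI /p mulrBr mulr1 mulrCA divff ?lt0r_neq0 ?L0 // mulr1.
    by rewrite (cardsD1 k (L w)) natrD addrAC subrr add0r.
  have p01 w k : w \in I -> 0 <= p w k <= m%:R^-1.
    move=> wI; rewrite /p divr_ge0 //=; case: (k \in L w); last by rewrite mul0r invr_ge0.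
    rewrite mul1r lef_pV2 ?posrE ?L0 ?ltr0n // ler_nat.
    by apply: leq_trans (hL w wI); rewrite leq_addr.
  have lb k : A0 - B0 * \sum_(w in I) p w k <= \prod_(w in I) (1 - p w k).
    rewrite lerBlDr -[X in X + _]mul1r -[X in B0 * X]add0r.
    apply: (multiaffine m0) => [w wI|j hj]; first exact: p01.
    by rewrite mul1r add0r; exact: chord.
  have ps w : w \in I -> \sum_(k in K) p w k <= 1.
    move=> wI; rewrite /p -mulr_suml ler_pdivrMr ?L0 // mul1r.
    rewrite -natr_sum ler_nat -sum1_card big_mkcond [leqRHS]big_mkcond /=.
    by apply: leq_sum => k _; case: (k \in K); case: (k \in L w).
  under [leRHS]eq_bigr do rewrite pE.
  rewrite -mulr_sumr mulrC ler_wpM2l ?count_ge0 //.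
  apply: le_trans (_ : \sum_(k in K) (A0 - B0 * \sum_(w in I) p w k) <= _); last first.
    by apply: ler_sum.
  rewrite sumrB sumr_const -(mulr_natl A0) -mulr_sumr exchange_big /=.
  apply: lerB; first by rewrite ler_wpM2r // ler_nat.
  rewrite mulrC ler_wpM2r //.
  apply: le_trans (_ : \sum_(w in I) 1 <= _); first by apply: ler_sum.
  by rewrite sumr_const.
rewrite inE => /andP[vI vH].
(* A revealed vertex of [A] spoils at most its own colour. Since [A :\: I] loses a vertex at the
   same time, [kap] is unchanged. *)
pose K' a := if v \in A then K :\ a else K.
rewrite /Colourings.count (csum_peel c0 e_sym e_irr _ _ vH).
rewrite [leRHS](eq_bigr (fun k => \sum_(a in L v) csum (H :\ v) (rem L (nbr v) a)
   (fun c => avoidr A k (upd c v a)))); last by move=> k _; exact: (csum_peel c0 e_sym e_irr _ _ vH).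
rewrite exchange_big /= mulr_sumr; apply: ler_sum => a aL.
have EHv : (H :\ v) :\: I = (H :\: I) :\ v.
  by apply/setP=> w; rewrite !inE; case: (w == v); rewrite ?andbF.
have vHI : v \in H :\: I by rewrite inE vI.
apply: le_trans (_ : \sum_(k in K' a) csum (H :\ v) (rem L (nbr v) a) (avoidr (A :\ v) k) <= _).
  apply: IH.
  - by rewrite subsetD1 IA.
  - exact: setSD.
  - move=> w wI; have := hL w wI; rewrite (edegD1 _ w vHI) -EHv.
    have := card_rem L (nbr v) a w; rewrite inE (e_sym v w); lia.
  - rewrite /K'; have -> : A :\ v :\: I = (A :\: I) :\ v.
      by apply/setP=> w; rewrite !inE; case: (w == v); rewrite ?andbF.
    move: hK; rewrite (cardsD1 v (A :\: I)) inE vI /=.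
    have := cardsD1 a K; case: (v \in A); last by move=> _; rewrite add0n.
    by case: (a \in K); lia.
  - by move: lt; rewrite EHv (cardsD1 v (H :\: I)) vHI.
rewrite /K'; case: ifP => vA.
  rewrite [leRHS](bigID (fun k => k == a)) /= addrC.
  rewrite (eq_bigl (fun k => (k \in K) && (k != a))); last first.
    by move=> k; rewrite !inE andbC.
  apply: ler_wpDr; first by apply: sumr_ge0 => k _; apply: csum_ge0 => c; exact: avoidr_ge0.
  apply: ler_sum => k /andP[kK ka]; rewrite le_eqVlt; apply/orP; left; apply/eqP.
  by apply: eq_csum_fun => c; rewrite /avoidr avoid_upd vA /= eq_sym ka.
apply: ler_sum => k kK; rewrite le_eqVlt; apply/orP; left; apply/eqP.
by apply: eq_csum_fun => c; rewrite /avoidr avoid_upd vA.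
Qed.

Lemma unused_trivial H L A (K : {set C}) (kap : nat) : A \subset H ->
  (kap + #|A| <= #|K|)%N ->
  kap%:R * count H L <= \sum_(k in K) csum H L (avoidr A k).
Proof.
move=> AH hK.
have := @unused_lb H L A set0 K 1 kap 1 0; rewrite !setD0 cards0 mul0r mulr1 subr0.
apply=> //; rewrite ?sub0set //.
- by move=> v w; rewrite inE.
- by move=> w; rewrite inE.
- by case=> // _; rewrite expr0 mul0r addr0.
Qed.

Definition is_at (w : V) (z : C) : {ffun V -> C} -> rat := fun c => (c w == z)%:R.

(** Once all other vertices are revealed, [w] is uniform on a list that still has [m] colours. *)
Lemma csum_is_at_ub H L w z (m : nat) : w \in H -> (m + edeg H w <= #|L w|)%N ->
  m%:R * csum H L (is_at w z) <= count H L.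
Proof.
move=> wH hL; rewrite -subr_ge0 /Colourings.count -csum_scale -csum_opp -csum_add.
have wsub : [set w] \subset H by rewrite sub1set.
apply: (csum_lift e_sym e_irr wsub) => [c c' cc|M /(_ w (set11 w))[sM hM]].
  by rewrite /is_at cc // set11.
rewrite csum_add csum_opp csum_scale (csum_peel c0 e_sym e_irr _ _ (set11 w)).
rewrite [X in _ - m%:R * X](csum_peel c0 e_sym e_irr _ _ (set11 w)).
rewrite setDv; under eq_bigr do rewrite csum0.
under [X in _ - m%:R * X]eq_bigr do rewrite csum0 /is_at ffunE eqxx.
have hm : (m <= #|M w|)%N.
  have : (edeg (H :\: [set w]) w <= edeg H w)%N.
    by apply: subset_leq_card; apply/subsetP=> y; rewrite !inE => /andP[/andP[_ ->] ->].
  by lia.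
rewrite sumr_const subr_ge0.
apply: le_trans (_ : m%:R * 1 <= _); last by rewrite mulr1 ler_nat.
rewrite ler_wpM2l // -natr_sum (ler_nat _ _ 1).
have [zM|zM] := boolP (z \in M w).
  by rewrite (bigD1 z) //= eqxx big1 // => a /andP[_ /negbTE->].
by rewrite big1 // => a aM; apply/eqP; rewrite eqb0; apply: contraNneq zM => <-.
Qed.

(** Chain rule over [A]: given that the vertices treated before avoid [z], which only shortens their
    lists, the next one takes [z] with probability at most [1/m], or zero if its list lacks [z]. *)
Lemma avoid_lb H L A z (m : nat) : (0 < m)%N -> A \subset H ->
  (forall w, w \in A -> z \in L w -> (m + edeg H w <= #|L w|)%N) ->
  (1 - m%:R^-1) ^+ #|A| * count H L <= csum H L (avoidr A z).
Proof.
move=> m0; have [n] := ubnP #|A|; elim: n => // n IH in A * => lt AH hL.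
have [->|/set0Pn[v vA]] := eqVneq A set0.
  rewrite cards0 expr0 mul1r le_eqVlt; apply/orP; left; apply/eqP.
  by apply: eq_csum_fun => c; rewrite /avoidr avoid0.
have mr : 0 < m%:R :> rat by rewrite ltr0n.
have m1 : m%:R^-1 <= 1 :> rat by rewrite invf_le1 // ler1n.
have mi : 0 < m%:R^-1 :> rat by rewrite invr_gt0.
have vH := subsetP AH v vA.
have ih := IH (A :\ v) _ (subset_trans (subD1set _ _) AH) _.
rewrite (cardsD1 v A) vA exprS -mulrA.
apply: le_trans (_ : (1 - m%:R^-1) * csum H L (avoidr (A :\ v) z) <= _).
  rewrite ler_wpM2l ?subr_ge0 //; apply: ih.
    by move: lt; rewrite (cardsD1 v) vA.
  by move=> w /setD1P[_ wA]; exact: hL.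
have EA : avoidr A z =1 fun c => avoidr (A :\ v) z c + - (is_at v z c * avoidr (A :\ v) z c).
  move=> c; rewrite -{1}(setD1K vA) /avoidr avoidU1 /is_at.
  by case: (_ == z); case: avoid => /=; rewrite ?mulr0 ?mul0r ?mulr1 ?subrr ?subr0.
rewrite (eq_csum_fun _ _ _ _ EA) csum_add csum_opp mulrBl mul1r lerD2l lerN2.
have EI : H :&: (A :\ v) = A :\ v.
  by apply/setIidPr; exact: subset_trans (subD1set _ _) AH.
rewrite -{1}EI -csum_rem.
have -> : csum H L (avoidr (A :\ v) z) = count H (rem L (A :\ v) z).
  by rewrite count_rem EI.
rewrite ler_pdivlMl //.
have [zL|zL] := boolP (z \in L v).
  apply: csum_is_at_ub => //; have := hL v vA zL.
  by rewrite /rem !inE eqxx.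
rewrite (_ : csum _ _ _ = 0) ?mulr0 ?count_ge0 //.
rewrite /Colourings.csum big1 // => c /goodP[/(_ v vH)]; rewrite /rem !inE eqxx /= => cv _ _.
by rewrite /is_at; case: eqP => // E; rewrite -E cv in zL.
Qed.

Lemma csum_is_at H L w z : w \in H -> z \in L w ->
  csum H L (is_at w z) = csum (H :\ w) L (avoidr ((H :\ w) :&: nbr w) z).
Proof.
move=> wH zL; rewrite (csum_peel c0 e_sym e_irr _ _ wH) (bigD1 z) //= [X in _ + X]big1 ?addr0.
  rewrite -count_rem; apply: eq_csum_fun => c.
  by rewrite /is_at ffunE eqxx eqxx.
move=> a /andP[_ az]; rewrite /Colourings.csum big1 // => c _.
by rewrite /is_at ffunE eqxx (negPf az).
Qed.

Lemma count_peel H L w : w \in H ->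
  count H L = \sum_(k in L w) csum (H :\ w) L (avoidr ((H :\ w) :&: nbr w) k).
Proof.
move=> wH; rewrite /Colourings.count (csum_peel c0 e_sym e_irr _ _ wH).
by apply: eq_bigr => k _; rewrite -count_rem.
Qed.

Lemma csum_avoid_le H L A k : csum H L (avoidr A k) <= count H L.
Proof. by apply: csum_le => c _; exact: avoidr_le1. Qed.

(** Delete [w]. A colouring of the rest extends to [w] in at most [#|C|] ways, and the extension by
    [z] exists as soon as the neighbours avoid [z], which [avoid_lb] estimates. *)
Lemma is_at_lb H L w z (m d : nat) : (0 < m)%N -> w \in H -> z \in L w ->
  (forall y, y \in H :\ w -> e w y -> z \in L y -> (m + edeg (H :\ w) y <= #|L y|)%N) ->
  (edeg H w <= d)%N ->
  (1 - m%:R^-1) ^+ d / #|C|%:R * count H L <= csum H L (is_at w z).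
Proof.
move=> m0 wH zL hL hd.
have mr : 0 < m%:R :> rat by rewrite ltr0n.
have m1 : m%:R^-1 <= 1 :> rat by rewrite invf_le1 // ler1n.
have mi : 0 <= 1 - m%:R^-1 :> rat by rewrite subr_ge0.
rewrite csum_is_at //.
have C0 : 0 < #|C|%:R :> rat by rewrite ltr0n; apply/card_gt0P; exists z.
have ub : count H L <= #|C|%:R * count (H :\ w) L.
  rewrite (count_peel _ wH); apply: le_trans (_ : \sum_(k in L w) count (H :\ w) L <= _).
    by apply: ler_sum => k _; exact: csum_avoid_le.
  by rewrite sumr_const -(mulr_natl (count _ _)) ler_wpM2r ?count_ge0 // ler_nat max_card.
apply: le_trans (_ : (1 - m%:R^-1) ^+ d * count (H :\ w) L <= _).
  rewrite -mulrA ler_wpM2l ?exprn_ge0 // mulrC ler_pdivrMr // mulrC //.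
apply: le_trans (avoid_lb (A := (H :\ w) :&: nbr w) m0 (subsetIl _ _) _); last first.
  by move=> y; rewrite !inE => /andP[/andP[yw yH] ewy]; apply: hL; rewrite ?inE ?yw.
rewrite ler_wpM2r ?count_ge0 // ler_wiXn2l //; first by rewrite gerBl invr_ge0.
apply: leq_trans hd; apply: subset_leq_card; apply/subsetP=> y.
by rewrite !inE => /andP[/andP[_ ->] ->].
Qed.

(** Chain rule over [J] in the other direction: each vertex takes [z] with probability at least
    [al], even after [z] has been struck from other vertices of [J]. *)
Lemma avoid_ub H L A (J : {set V}) (z : C) (al : rat) : J \subset A -> A \subset H ->
  0 <= al <= 1 ->
  (forall w (B : {set V}), w \in J -> B \subset J :\ w -> let L' := rem L B z in
     al * count H L' <= csum H L' (is_at w z)) ->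
  csum H L (avoidr A z) <= (1 - al) ^+ #|J| * count H L.
Proof.
move=> JA AH /andP[al0 al1] hw.
apply: le_trans (_ : csum H L (avoidr J z) <= _).
  apply: csum_le => c _; rewrite /avoidr ler_nat.
  case: (boolP (avoid A z c)) => // /forall_inP h.
  suff -> : avoid J z c by [].
  by apply/forall_inP=> w wJ; apply: h; exact: (subsetP JA).
have JH := subset_trans JA AH.
have key (J' : {set V}) : J' \subset J -> csum H L (avoidr J' z) <= (1 - al) ^+ #|J'| * count H L.
  have [n] := ubnP #|J'|; elim: n => // n IH in J' * => lt sJ.
  have [->|/set0Pn[v vJ]] := eqVneq J' set0.
    by rewrite cards0 expr0 mul1r csum_avoid_le.
  have EA : avoidr J' z =1 fun c => avoidr (J' :\ v) z c + - (is_at v z c * avoidr (J' :\ v) z c).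
    move=> c; rewrite -{1}(setD1K vJ) /avoidr avoidU1 /is_at.
    by case: (_ == z); case: avoid => /=; rewrite ?mulr0 ?mul0r ?mulr1 ?subrr ?subr0.
  rewrite (eq_csum_fun _ _ _ _ EA) csum_add csum_opp.
  have EI : H :&: (J' :\ v) = J' :\ v.
    by apply/setIidPr; apply: subset_trans (subD1set _ _) (subset_trans sJ JH).
  rewrite -{2}EI -csum_rem.
  have := hw v (J' :\ v) (subsetP sJ v vJ) (setSD _ sJ).
  rewrite /= count_rem EI => h.
  rewrite (cardsD1 v J') vJ exprS -mulrA.
  apply: le_trans (_ : (1 - al) * csum H L (avoidr (J' :\ v) z) <= _).
    by rewrite mulrBl mul1r lerD2l lerN2.
  rewrite ler_wpM2l ?subr_ge0 // IH //.
    by move: lt; rewrite (cardsD1 v) vJ.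
  exact: subset_trans (subD1set _ _) sJ.
exact: key.
Qed.

End Bounds.
End EdgeBounds.

(** * From a one-vertex contraction condition to exponential decay of influence *)

Module SpatialMixing.
Import Colourings EdgeBounds.
Import Order.TTheory GRing.Theory Num.Theory.
Local Open Scope ring_scope.

(** Two weighted averages share the part [(A, P)] and have one atom each of their own. Moving mass
    [Wy] from [Ex] to [Ey] and then dropping the excess [Wx - Wy] costs [B * Wx] in all, so only the
    larger atom is charged and not the sum of both. *)
Lemma average_diff (A P Wx Wy Ex Ey E1 E2 B : rat) :
  0 <= Wy -> Wy <= Wx ->
  E1 * (A + Wy) = P + Wy * Ey -> E2 * (A + Wx) = P + Wx * Ex ->
  `|Ey - Ex| <= B -> `|E1 - Ex| <= B -> 0 <= A + Wx ->
  `|E1 - E2| * (A + Wx) <= B * Wx.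
Proof.
move=> Wy0 Wyx h1 h2 hy h1x AW.
rewrite -{1}(ger0_norm AW) -normrM.
have -> : (E1 - E2) * (A + Wx) = Wy * (Ey - Ex) + (Wx - Wy) * (E1 - Ex).
  by rewrite mulrBl h2 (_ : A + Wx = A + Wy + (Wx - Wy)); [rewrite mulrDr h1|]; ring.
apply: le_trans (ler_normD _ _) _; rewrite !normrM (ger0_norm Wy0) (ger0_norm (_ : 0 <= Wx - Wy)); last lra.
nra.
Qed.

Lemma weighted_average (T : finType) (K : {set T}) (W F : T -> rat) (x B : rat) :
  (forall a, a \in K -> 0 <= W a) -> 0 < \sum_(a in K) W a ->
  (forall a, a \in K -> `|F a - x| <= B) ->
  `|(\sum_(a in K) W a * F a) / (\sum_(a in K) W a) - x| <= B.
Proof.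
move=> W0 S0 hF.
have -> : (\sum_(a in K) W a * F a) / (\sum_(a in K) W a) - x =
    (\sum_(a in K) W a * (F a - x)) / (\sum_(a in K) W a).
  under [in RHS]eq_bigr do rewrite mulrBr.
  by rewrite sumrB -mulr_suml mulrBl [_ * x / _]mulrAC divff ?mul1r // gt_eqF.
rewrite normrM normfV (gtr0_norm S0) ler_pdivrMr // mulr_sumr.
apply: le_trans (ler_norm_sum _ _ _) _; apply: ler_sum => a aK.
rewrite normrM (ger0_norm (W0 a aK)) mulrC ler_wpM2r ?W0 //.
exact: hF.
Qed.

Section Ssm.
Variables (V C : finType) (c0 : C) (e lat : rel V) (Delta : nat).
Hypothesis e_sym : symmetric e.
Hypothesis e_irr : irreflexive e.
Hypothesis lat_sym : symmetric lat.
Hypothesis e_lat : forall v w, e v w -> lat v w.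
Hypothesis Delta_lt : (Delta < #|C|)%N.
Implicit Types (H A Q I : {set V}) (L M : V -> {set C}) (c : {ffun V -> C}).
Notation csum := (csum c0 e).
Notation count := (count c0 e).
Notation nbr := (nbr e).
Notation edeg := (edeg e).
Notation ldeg := (Colourings.edeg lat).

(** That is, [#|C| - #|L v| <= Delta - ldeg H v]: at most one lost colour per absent lattice
    neighbour. The strict form [slk] holds after a lattice neighbour has been deleted and before its
    colour is struck, and it pays for that one removal. *)
Definition cls H L := forall v, v \in H -> (#|C| + ldeg H v <= #|L v| + Delta)%N.
Definition slk H L v := (#|C| + ldeg H v < #|L v| + Delta)%N.

Definition prob H L t k : rat := csum H L (is_at t k) / count H L.

Definition ball t r : {set V} :=
  iter r (fun B : {set V} => B :|: [set w | [exists x in B, e x w]]) [set t].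

Lemma ball_step t r v w : e v w -> v \notin ball t r.+1 -> w \notin ball t r.
Proof.
move=> evw; apply: contra => wB; rewrite /ball iterS !inE; apply/orP; right.
by apply/exists_inP; exists w => //; rewrite e_sym.
Qed.

Lemma ball_center t r : t \in ball t r.
Proof. by elim: r => [|r IH]; rewrite /ball ?iterS !inE ?eqxx // IH. Qed.

Lemma ball_mono t r : ball t r \subset ball t r.+1.
Proof. by rewrite /ball iterS subsetUl. Qed.

Lemma edeg_le H v : (edeg H v <= ldeg H v)%N.
Proof.
apply: subset_leq_card; apply/subsetP=> w; rewrite !inE => /andP[->] /=.
exact: e_lat.
Qed.

Lemma cls_count_gt0 H L : cls H L -> 0 < count H L.
Proof.
move=> h; apply: (count_gt0 c0 e_sym e_irr) => v vH; have := h v vH; have := edeg_le H v.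
by move: Delta_lt; lia.
Qed.

Lemma cls_rem H L Q a : cls H L -> (forall w, w \in H -> w \in Q -> slk H L w) ->
  cls H (rem L Q a).
Proof.
move=> h hs v vH; have := card_rem L Q a v; have := h v vH; have := hs v vH.
by rewrite /slk; case: (v \in Q) => [/(_ isT)|_]; lia.
Qed.

Lemma cls_D1 H L v : cls H L -> cls (H :\ v) L.
Proof.
move=> h w /setD1P[wv wH]; apply: leq_trans (h w wH); rewrite leq_add2l.
by apply: subset_leq_card; apply/subsetP=> y; rewrite !inE => /andP[/andP[_ ->] ->].
Qed.

Lemma slk_D1 H L v w : cls H L -> v \in H -> w \in H -> lat v w -> slk (H :\ v) L w.
Proof.
move=> h vH wH l; have := h w wH.
by rewrite (edegD1 lat w vH) lat_sym l /slk; lia.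
Qed.

Lemma slk_D1W H L v w : slk H L w -> slk (H :\ v) L w.
Proof.
apply: leq_ltn_trans; rewrite leq_add2l.
by apply: subset_leq_card; apply/subsetP=> y; rewrite !inE => /andP[/andP[_ ->] ->].
Qed.

Lemma cls_peel H L v a : cls H L -> v \in H -> cls (H :\ v) (rem L (nbr v) a).
Proof.
move=> h vH; apply: cls_rem; first exact: cls_D1.
by move=> w /setD1P[_ wH]; rewrite inE => /e_lat; apply: slk_D1.
Qed.

Lemma slk_rem1 H L w v a : slk H L w -> w != v -> slk H (rem L [set v] a) w.
Proof. by rewrite /slk /rem inE => h /negbTE->. Qed.

Lemma slk_nonempty H L v : v \in H -> slk H L v -> forall x, (0 < #|L v :\ x|)%N.
Proof.
move=> vH h x; have := cardsD1 x (L v); move: h; rewrite /slk; have := Delta_lt.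
by case: (x \in L v); lia.
Qed.

Lemma cls_slk_rem1 H L v a : cls H L -> slk H L v -> cls H (rem L [set v] a).
Proof. by move=> h s; apply: cls_rem => // w _ /set1P->. Qed.

Lemma prob_range H L t k : cls H L -> 0 <= prob H L t k <= 1.
Proof.
move=> h; have p := cls_count_gt0 h; rewrite /prob; apply/andP; split.
  by apply: divr_ge0; [apply: csum_ge0 => c; exact: ler0n|exact: ltW].
rewrite ler_pdivrMr // mul1r; apply: csum_le => c _.
by rewrite /is_at; case: eqP.
Qed.

Lemma prob_diff1 H L M t k : cls H L -> cls H M -> `|prob H L t k - prob H M t k| <= 1.
Proof.
move=> cL cM; have /andP[a b] := prob_range t k cL; have /andP[a' b'] := prob_range t k cM.
by rewrite ler_norml; apply/andP; split; lra.
Qed.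

Lemma csum_probE H L t k : cls H L -> csum H L (is_at t k) = count H L * prob H L t k.
Proof.
by move=> h; rewrite /prob mulrCA divff ?mulr1 // gt_eqF // cls_count_gt0.
Qed.

Lemma eq_prob H L M t k : (forall v, v \in H -> L v = M v) -> prob H L t k = prob H M t k.
Proof. by move=> E; rewrite /prob /Colourings.count !(eq_csum_lists _ _ _ E). Qed.

Section Step.
Variables (H : {set V}) (L : V -> {set C}) (v t : V) (k : C).
Hypotheses (vH : v \in H) (vt : v != t) (cl : cls H L) (sl : slk H L v).
Let W a := count (H :\ v) (rem L (nbr v) a).
Let F a := prob (H :\ v) (rem L (nbr v) a) t k.

Lemma W_gt0 a : 0 < W a.
Proof. by apply: cls_count_gt0; apply: cls_peel. Qed.

Lemma csum_rem1 x (f : {ffun V -> C} -> rat) :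
  (forall c a, f (upd c v a) = f c) ->
  csum H (rem L [set v] x) f = \sum_(a in L v :\ x) csum (H :\ v) (rem L (nbr v) a) f.
Proof.
move=> hf; rewrite (csum_peel c0 e_sym e_irr _ _ vH) {1}/rem inE eqxx.
apply: eq_bigr => a _; apply: eq_csum => // w /setD1P[wv _].
by rewrite /rem !inE (negPf wv).
Qed.

Lemma is_at_upd c a : is_at t k (upd c v a) = is_at t k c :> rat.
Proof. by rewrite /is_at ffunE [t == v]eq_sym (negPf vt). Qed.

Lemma prob_rem1 x : prob H (rem L [set v] x) t k =
  (\sum_(a in L v :\ x) W a * F a) / \sum_(a in L v :\ x) W a.
Proof.
rewrite /prob /Colourings.count !csum_rem1 //; last exact: is_at_upd.
congr (_ / _); apply: eq_bigr => a _; rewrite csum_probE //.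
exact: cls_peel.
Qed.

Lemma sum_rem1_gt0 x : 0 < \sum_(a in L v :\ x) W a.
Proof.
have /card_gt0P[a aL] := slk_nonempty vH sl x.
rewrite (bigD1 a) //=; apply: ltr_wpDr; last exact: W_gt0.
by apply: sumr_ge0 => b _; apply: ltW; exact: W_gt0.
Qed.

(** Striking [x] or [y] at [v] gives two averages of the same values [F] over colour sets that
    differ in one element. After ordering the weights of [x] and [y], [average_diff] charges only
    the heavier, so the hypothesis is required for each colour separately. *)
Lemma edge_step x y B rho :
  (forall a b, a \in L v -> b \in L v -> `|F a - F b| <= B) -> x != y -> 0 <= rho -> 0 <= B ->
  (forall z, z \in [set x; y] -> z \in L v ->
     W z * B <= rho * (W z + \sum_(a in L v :\ x :\ y) W a)) ->
  `|prob H (rem L [set v] x) t k - prob H (rem L [set v] y) t k| <= rho.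
Proof.
move=> hF xy r0 B0 hz.
pose WW z := if z \in L v then W z else 0.
have WW0 z : 0 <= WW z by rewrite /WW; case: ifP => // _; rewrite ltW ?W_gt0.
wlog le : x y xy hz / WW y <= WW x.
  move=> hw; case: (leP (WW y) (WW x)) => [|/ltW] le; first exact: hw.
  rewrite distrC; apply: hw le => //; first by rewrite eq_sym.
  move=> z; rewrite (setUC [set y]) (_ : L v :\ y :\ x = L v :\ x :\ y).
    exact: hz.
  by rewrite !setDDl setUC.
have spl u z (f : C -> rat) : u != z -> \sum_(a in L v :\ u) f a =
    \sum_(a in L v :\ u :\ z) f a + (if z \in L v then f z else 0).
  move=> uz; case: ifP => zL.
    by rewrite (big_setD1 z) 1?addrC // !inE zL eq_sym uz.
  by rewrite addr0; apply: eq_bigl => a; rewrite !inE; case: (eqVneq a z) => [->|] //=; rewrite zL !andbF.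
have spl' f : \sum_(a in L v :\ y) f a =
    \sum_(a in L v :\ x :\ y) f a + (if x \in L v then f x else 0) :> rat.
  by rewrite (spl y x) 1?eq_sym // setDDl setUC -setDDl.
set A := \sum_(a in L v :\ x :\ y) W a in hz *.
(* If the heavier colour is not in the list, neither is the lighter one, since weights of listed
   colours are positive; then nothing was removed. *)
have [xL|xL] := boolP (x \in L v); last first.
  have W0 : WW y = 0 by apply: le_anti; rewrite WW0 andbT (le_trans le) // /WW (negPf xL).
  have yL : y \notin L v by apply: contraTN isT => yL; move: W0; rewrite /WW yL => h; have := W_gt0 y; rewrite h ltxx.
  have E z : z \notin L v -> L v :\ z = L v.
    by move=> zL; apply/setP=> w; rewrite !inE; case: (eqVneq w z) => [->|] //=; rewrite (negPf zL).
  by rewrite !prob_rem1 !E // subrr normr0.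
have hx := hz x (set21 _ _) xL.
have dx : 0 < A + W x.
  by have := sum_rem1_gt0 y; rewrite spl' xL -/A.
have dy : 0 < A + WW y by have := sum_rem1_gt0 x; rewrite (spl x y) // -/A /WW; case: ifP.
rewrite -(ler_pM2r dx).
apply: le_trans (_ : B * W x <= _); last by rewrite mulrC [A + _]addrC.
pose Ey := if y \in L v then F y else F x.
apply: (@average_diff A (\sum_(a in L v :\ x :\ y) W a * F a) (W x) (WW y) (F x) Ey) => //.
- by move: le; rewrite /WW xL.
- rewrite prob_rem1 !(spl x y) // -/A -/(WW y) mulfVK ?gt_eqF //.
  by rewrite /WW /Ey; case: ifP => // _; rewrite mul0r.
- by rewrite prob_rem1 !spl' xL -/A mulfVK ?gt_eqF.
- by rewrite /Ey; case: ifP => yL; [apply: hF|rewrite subrr normr0].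
- rewrite prob_rem1; apply: weighted_average; first by move=> a _; rewrite ltW ?W_gt0.
    exact: sum_rem1_gt0.
  by move=> a /setD1P[_ aL]; apply: hF.
- exact: ltW.
Qed.

End Step.

(** Hybrid argument: switch the struck colour from [a] to [b] one vertex at a time. Every vertex of
    [s] loses one colour only, so the intermediate lists stay in [cls] and the vertex being switched
    keeps its slack. *)
Lemma telescope H L t k (s : seq V) a b (B : V -> rat) :
  cls H L -> uniq s -> (forall w, w \in s -> w \in H -> slk H L w) ->
  (forall w, 0 <= B w) ->
  (forall w M, w \in s -> w \in H -> cls H M -> slk H M w -> M w = L w ->
    `|prob H (rem M [set w] a) t k - prob H (rem M [set w] b) t k| <= B w) ->
  `|prob H (rem L [set w in s] a) t k - prob H (rem L [set w in s] b) t k|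
    <= \sum_(w <- s | w \in H) B w.
Proof.
elim: s L => [|w s IH] L cl us hs B0 hB.
  have E a' : prob H (rem L [set w in [::]] a') t k = prob H L t k.
    by apply: eq_prob => x _; rewrite /rem !inE.
  by rewrite big_nil !E subrr normr0.
case/andP: us => ws us.
rewrite big_cons; case: ifPn => wH; last first.
  have E a' : prob H (rem L [set x in w :: s] a') t k = prob H (rem L [set x in s] a') t k.
    apply: eq_prob => x xH; rewrite /rem !inE; case: eqP => //= xw.
    by rewrite -xw xH in wH.
  rewrite !E; apply: IH => // x *; [apply: hs|apply: hB] => //; by rewrite inE (_ : x \in s) ?orbT.
pose L1 := rem L [set x in s] a; pose L2 := rem L [set w] b.
have e1 : prob H (rem L [set x in w :: s] a) t k = prob H (rem L1 [set w] a) t k.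
  apply: eq_prob => x xH; rewrite /L1 /rem !inE; case: eqP => [->|] //=.
  by rewrite (negPf ws).
have e2 : prob H (rem L [set x in w :: s] b) t k = prob H (rem L2 [set x in s] b) t k.
  apply: eq_prob => x xH; rewrite /L2 /rem !inE; case: eqP => [->|] //=.
  by rewrite (negPf ws).
have e3 : prob H (rem L1 [set w] b) t k = prob H (rem L2 [set x in s] a) t k.
  apply: eq_prob => x xH; rewrite /L1 /L2 /rem !inE; case: eqP => [->|] //=.
  by rewrite (negPf ws).
rewrite e1 e2 -(subrKA (prob H (rem L1 [set w] b) t k)).
apply: le_trans (ler_normD _ _) _; apply: lerD.
  have L1w : L1 w = L w by rewrite /L1 /rem inE (negPf ws).
  apply: hB => //; rewrite ?mem_head //.
    by apply: cls_rem => // x xH; rewrite inE => xs; apply: hs; rewrite // inE xs orbT.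
  by have := hs w (mem_head _ _) wH; rewrite /slk L1w.
rewrite e3; apply: IH => //.
- by apply: cls_slk_rem1 => //; apply: hs; rewrite ?mem_head.
- move=> x xs xH; apply: slk_rem1; first by apply: hs; rewrite // inE xs orbT.
  by apply: contraNneq ws => <-.
- move=> x M xs xH cM sM EM; apply: hB => //; first by rewrite inE xs orbT.
  by rewrite EM /L2 /rem inE; case: eqP => // xw; rewrite -xw xs in ws.
Qed.

Section Engine.
Variables (Phi : {set V} -> V -> rat) (lam K0 : rat).
Hypothesis Phi_ge : forall H v, 1 <= K0 * Phi H v.
Hypothesis lam01 : 0 <= lam.
Hypothesis K0_gt0 : 0 < K0.
Hypothesis local : forall H L v x y z, cls H L -> v \in H -> slk H L v ->
  x != y -> z \in [set x; y] -> z \in L v ->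
  let W a := count (H :\ v) (rem L (nbr v) a) in
  W z * \sum_(w in (H :\ v) :&: nbr v) Phi (H :\ v) w <=
  lam * Phi H v * (W z + \sum_(a in L v :\ x :\ y) W a).

Lemma Phi_ge0 H v : 0 <= Phi H v.
Proof. by rewrite -(pmulr_rge0 _ K0_gt0) (le_trans ler01). Qed.

Lemma del_telescope H L v t k a b r : v \in H -> cls H L ->
  (forall w M, w \in H :\ v -> e v w -> cls (H :\ v) M -> slk (H :\ v) M w ->
   `|prob (H :\ v) (rem M [set w] a) t k - prob (H :\ v) (rem M [set w] b) t k|
     <= K0 * lam ^+ r * Phi (H :\ v) w) ->
  `|prob (H :\ v) (rem L (nbr v) a) t k - prob (H :\ v) (rem L (nbr v) b) t k|
  <= K0 * lam ^+ r * \sum_(w in (H :\ v) :&: nbr v) Phi (H :\ v) w.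
Proof.
move=> vH cl h.
have E : nbr v = [set w in enum (nbr v)] by apply/setP=> w; rewrite !inE mem_enum inE.
rewrite {1 2}E.
apply: le_trans (telescope (B := fun w => K0 * lam ^+ r * Phi (H :\ v) w) _ _ _ _ _) _.
- exact: cls_D1.
- exact: enum_uniq.
- by move=> w; rewrite mem_enum inE => evw /setD1P[_ wH]; apply: slk_D1 => //; exact: e_lat.
- by move=> w; rewrite !mulr_ge0 ?exprn_ge0 ?Phi_ge0 // ltW.
- by move=> w M; rewrite mem_enum inE => evw wH cM sM _; apply: h.
rewrite -mulr_sumr ler_wpM2l ?mulr_ge0 ?exprn_ge0 ?(ltW K0_gt0) //.
rewrite -[leLHS]big_filter [leLHS](perm_big (enum ((H :\ v) :&: nbr v))) ?big_enum //=.
apply: uniq_perm; [apply: filter_uniq; exact: enum_uniq|exact: enum_uniq|move=> w].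
by rewrite mem_filter !mem_enum !inE.
Qed.

(** By [edge_step], the influence of a struck colour at [v] is the share of one colour times the
    effect of recolouring [v]. The latter splits over the neighbours, one step closer to [t], with
    total at most the sum of their potentials; [local] turns the product into [lam] times the
    potential of [v]. *)
Lemma edge_decay r H L v x y t k : cls H L -> v \in H -> slk H L v ->
  v \notin ball t r ->
  `|prob H (rem L [set v] x) t k - prob H (rem L [set v] y) t k| <=
    K0 * lam ^+ r * Phi H v.
Proof.
elim: r H L v x y => [|r IH] H L v x y cl vH sl vt.
  rewrite expr0 mulr1; apply: le_trans (Phi_ge H v).
  by apply: prob_diff1; apply: cls_slk_rem1.
have vnt : v != t.
  by apply: contraNneq vt => ->; exact: ball_center.
have [->|xy] := eqVneq x y.
  by rewrite subrr normr0 !mulr_ge0 ?exprn_ge0 ?Phi_ge0 // ltW.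
set B := K0 * lam ^+ r * \sum_(w in (H :\ v) :&: nbr v) Phi (H :\ v) w.
have S0 : 0 <= \sum_(w in (H :\ v) :&: nbr v) Phi (H :\ v) w.
  by apply: sumr_ge0 => w _; exact: Phi_ge0.
have KL : 0 <= K0 * lam ^+ r by rewrite mulr_ge0 ?exprn_ge0 // ltW.
apply: (@edge_step H L v t k vH vnt cl sl x y B) => //.
- move=> a b _ _; apply: del_telescope => // w M wH evw cM sM.
  apply: IH => //; exact: ball_step vt.
- by rewrite !mulr_ge0 ?exprn_ge0 ?Phi_ge0 // ltW.
- by rewrite mulr_ge0.
move=> z zxy zL; have := local cl vH sl xy zxy zL; rewrite /= => h.
rewrite /B mulrCA exprSr; apply: le_trans (ler_wpM2l KL h) _.
by rewrite le_eqVlt; apply/orP; left; apply/eqP; ring.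
Qed.

Hypothesis Phi_le1 : forall H v, Phi H v <= 1.
Hypothesis ldeg_le : forall v, (ldeg setT v <= Delta)%N.

Lemma edge_ssm H L s t k a b r : cls H L -> s \in H -> s \notin ball t r.+1 ->
  `|prob (H :\ s) (rem L (nbr s) a) t k - prob (H :\ s) (rem L (nbr s) b) t k| <=
  K0 * Delta%:R * lam ^+ r.
Proof.
move=> cl sH sb; apply: le_trans (del_telescope (r := r) _ _ _) _ => //.
  by move=> w M wH esw cM sM; apply: edge_decay => //; exact: ball_step sb.
rewrite -mulrA [lam ^+ r * _]mulrC mulrA ler_wpM2r ?exprn_ge0 // ler_wpM2l ?(ltW K0_gt0) //.
apply: le_trans (_ : \sum_(w in (H :\ s) :&: nbr s) 1 <= _); first by apply: ler_sum.
rewrite sumr_const ler_nat; apply: leq_trans (ldeg_le s); apply: leq_trans (edeg_le _ _).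
by apply: subset_leq_card; apply/subsetP=> w; rewrite !inE => /andP[].
Qed.

End Engine.
End Ssm.
End SpatialMixing.

Module Locality.
Import Colourings EdgeBounds SpatialMixing.
Import Order.TTheory GRing.Theory Num.Theory.
Local Open Scope ring_scope.

(** Strong spatial mixing in the form used by the estimator: only the colour of [s] varies, and the
    rest of the boundary condition sits in [L], over which the bound is uniform. *)
Definition decay (V C : finType) (c0 : C) (e lat : rel V) (Delta : nat) (K1 lam : rat) :=
  forall (H : {set V}) (L : V -> {set C}) s t k a b r,
    cls lat Delta H L -> s \in H -> s \notin ball e t r.+1 ->
  `|prob c0 e (H :\ s) (rem L (nbr e s) a) t k -
    prob c0 e (H :\ s) (rem L (nbr e s) b) t k| <= K1 * lam ^+ r.

Section Local.
Variables (V C : finType) (c0 : C) (e lat : rel V) (Delta : nat).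
Hypothesis e_sym : symmetric e.
Hypothesis e_irr : irreflexive e.
Hypothesis lat_sym : symmetric lat.
Hypothesis e_lat : forall v w, e v w -> lat v w.
Hypothesis Delta_lt : (Delta < #|C|)%N.
Hypothesis ldeg_le : forall v, (Colourings.edeg lat setT v <= Delta)%N.
Implicit Types (H A Q I : {set V}) (L M : V -> {set C}) (c : {ffun V -> C}).
Notation csum := (csum c0 e).
Notation count := (count c0 e).
Notation nbr := (nbr e).
Notation edeg := (edeg e).
Notation ldeg := (Colourings.edeg lat).
Notation cls := (cls lat Delta).
Notation slk := (slk lat Delta).
Notation s := (#|C| - Delta)%N.

Section Vertex.
Variables (H : {set V}) (L : V -> {set C}) (v : V).
Hypotheses (vH : v \in H) (cl : cls H L) (sl : slk H L v).
Local Notation H' := (H :\ v).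
Local Notation A := ((H :\ v) :&: nbr v).

Lemma sub_nbr : A \subset H'. Proof. exact: subsetIl. Qed.

Lemma nbr_lat w : w \in A -> [/\ w \in H, e v w & lat v w].
Proof. by rewrite !inE => /andP[/andP[_ ->] ev]; split=> //; exact: e_lat. Qed.

Lemma card_nbr_le : (#|A| <= ldeg H v)%N.
Proof.
apply: subset_leq_card; apply/subsetP=> w /nbr_lat[wH _ l].
by rewrite !inE wH.
Qed.

Lemma ldeg_lt : (ldeg H v < Delta)%N.
Proof. by have := sl; rewrite /SpatialMixing.slk; have := subset_leq_card (subsetT (L v)); rewrite cardsT; lia. Qed.

Lemma card_others x y : (s + ldeg H v <= #|L v :\ x :\ y|.+1)%N.
Proof.
have := sl; rewrite /SpatialMixing.slk.
have := cardsD1 x (L v); have := cardsD1 y (L v :\ x).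
by case: (x \in _); case: (y \in _); lia.
Qed.

Lemma nbr_list w I : w \in A -> (s.+1 + edeg (H' :\: I) w <= #|L w|)%N.
Proof.
move=> wA; have [wH _ l] := nbr_lat wA.
have := cl wH; rewrite (edegD1 lat w vH) lat_sym l.
have : (edeg (H' :\: I) w <= ldeg H' w)%N.
  apply: leq_trans (edeg_le e_lat _ _).
  by apply: subset_leq_card; apply/subsetP=> y; rewrite !inE => /andP[/andP[_ ->] ->].
by lia.
Qed.

Lemma local_unused (I : {set V}) (K : {set C}) (m kap : nat) (A0 B0 : rat) :
  I \subset A -> {in I &, forall v w, ~~ e v w} ->
  (0 < m <= s.+1)%N -> 0 <= A0 -> 0 <= B0 -> (kap + #|A| <= #|K| + #|I|)%N ->
  (forall n, (n <= #|I|)%N -> A0 <= (1 - m%:R^-1) ^+ n + B0 * (n%:R / m%:R)) ->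
  (kap%:R * A0 - #|I|%:R * B0) * count H' L <= \sum_(k in K) csum H' L (avoidr A k).
Proof.
move=> IA ind /andP[m0 ms] A00 B00 hK chord; apply: (unused_lb c0 e_sym e_irr (m := m)) => //.
- exact: sub_nbr.
- move=> w /(subsetP IA) /(nbr_list I); lia.
- by rewrite cardsD (setIidPr IA); have := subset_leq_card IA; lia.
Qed.

(** The neighbours that have lost no lattice neighbour except [v]. Their lists are complete, so each
    takes [z] with probability bounded below, whatever [z] is; many of them force the weight of [z]
    to be small. *)
Definition full : {set V} := [set w in A | ldeg H' w == Delta.-1].

Lemma full_list w : w \in full -> L w = setT.
Proof.
rewrite inE => /andP[wA /eqP E]; have [wH _ l] := nbr_lat wA.
apply/eqP; rewrite eqEcard subsetT cardsT.
have := cl wH; rewrite (edegD1 lat w vH) lat_sym l E.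
by have := ldeg_lt; lia.
Qed.

Lemma full_avoid z (al : rat) : 0 <= al <= 1 ->
  (forall w M, w \in full -> z \in M w ->
     (forall y, y \in H' :\ w -> e w y -> z \in M y ->
       (s.+1 + edeg (H' :\ w) y <= #|M y|)%N) ->
     al * count H' M <= csum H' M (is_at w z)) ->
  csum H' L (avoidr A z) <= (1 - al) ^+ #|full| * count H' L.
Proof.
move=> al01 h; apply: avoid_ub => //; first by apply/subsetP=> w; rewrite inE => /andP[].
  exact: sub_nbr.
move=> w B wf BJ; apply: h => //.
  rewrite /rem; case: ifP => wB; last by rewrite full_list // inE.
  by have := subsetP BJ w wB; rewrite !inE eqxx.
move=> y yH' ewy; rewrite /rem; case: ifP => yB; first by rewrite !inE eqxx.
move=> _; have /setD1P[yw /setD1P[yv yH]] := yH'.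
have wA : w \in A by move: wf; rewrite inE => /andP[].
have [wH _ _] := nbr_lat wA.
have := cl yH; rewrite (edegD1 lat y wH) lat_sym (e_lat ewy).
have : (edeg (H' :\ w) y <= ldeg (H :\ w) y)%N.
  apply: leq_trans (edeg_le e_lat _ _).
  apply: subset_leq_card; apply/subsetP=> u; rewrite !inE.
  by move=> /andP[/andP[-> /andP[_ ->]] ->].
move: (edeg _ _) (ldeg _ _) #|L y| #|C| Delta_lt; clear; lia.
Qed.

Definition alpha : rat := (1 - s.+1%:R^-1) ^+ Delta.-1 / #|C|%:R.

Lemma alpha01 : 0 <= alpha <= 1.
Proof.
have C1 : (0 < #|C|)%N by exact: leq_trans Delta_lt.
have C0 : 0 < #|C|%:R :> rat by rewrite ltr0n.
have i0 : 0 <= (s.+1%:R^-1 : rat) <= 1 by rewrite invr_ge0 ler0n invf_le1 ?ler1n ?ltr0n.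
case/andP: i0 => i0 i1.
rewrite /alpha divr_ge0 ?ler0n ?exprn_ge0 ?subr_ge0 //=.
rewrite ler_pdivrMr // mul1r; apply: le_trans (_ : 1 <= _); last by rewrite ler1n.
by rewrite exprn_ile1 ?subr_ge0 // gerBl.
Qed.

Lemma full_avoid_alpha z :
  csum H' L (avoidr A z) <= (1 - alpha) ^+ #|full| * count H' L.
Proof.
apply: full_avoid => [|w M wf zM hM]; first exact: alpha01.
have wA : w \in A by move: wf; rewrite inE => /andP[].
apply: (is_at_lb c0 e_sym e_irr (m := s.+1)) => //; first exact: (subsetP sub_nbr).
move: wf; rewrite inE => /andP[_ /eqP <-]; exact: edeg_le.
Qed.

(** Here [X] is the potential of the neighbours, [Y] the one allowed by [v]. If [X <= Y] the claim
    is immediate. Otherwise the worst case has the weight of [z] as large and the other weights as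
    small as permitted; dividing by the count leaves the numerical condition [hn]. *)
Lemma local_num (phi al Y ga : rat) (K : {set C}) z : 0 <= phi <= 1 -> 0 <= Y -> 0 <= ga ->
  csum H' L (avoidr A z) <= (1 - al) ^+ #|full| * count H' L ->
  ga * count H' L <= \sum_(k in K) csum H' L (avoidr A k) ->
  (1 - al) ^+ #|full| * (#|full|%:R + (#|A| - #|full|)%:R * phi - Y) <= Y * ga ->
  csum H' L (avoidr A z) *
    \sum_(w in A) (if ldeg H' w == Delta.-1 then 1 else phi) <=
  Y * (csum H' L (avoidr A z) + \sum_(k in K) csum H' L (avoidr A k)).
Proof.
move=> phi01 Y0 ga0 hz hK hn.
have -> : \sum_(w in A) (if ldeg H' w == Delta.-1 then 1 else phi) =
    #|full|%:R + (#|A| - #|full|)%:R * phi.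
  rewrite (bigID (fun w => ldeg H' w == Delta.-1)) /=; congr (_ + _).
    rewrite (eq_bigr (fun=> 1)) => [|w /andP[_ ->] //].
    rewrite (eq_bigl (mem full)) ?sumr_const // => w.
    by rewrite /= /full inE.
  rewrite (eq_bigr (fun=> phi)) => [|w /andP[_ /negbTE ->] //].
  rewrite (eq_bigl (mem (A :\: full))); last first.
    move=> w; rewrite /= /full [RHS]inE [w \in [set _ in _ | _]]inE.
    by case: (w \in A); rewrite ?andbT ?andbF.
  rewrite sumr_const -(mulr_natl phi); congr (_%:R * _).
  have fA : full \subset A by apply/subsetP=> w; rewrite /full inE => /andP[].
  by rewrite cardsD (setIidPr fA).
set X : rat := #|full|%:R + (#|A| - #|full|)%:R * phi in hn *.
set Wz : rat := csum _ _ _ in hz *; set T : rat := \sum_(k in K) _ in hK *.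
have N0 : 0 <= count H' L by exact: count_ge0.
have W0 : 0 <= Wz by apply: csum_ge0 => c; exact: avoidr_ge0.
set N : rat := count _ _ in hz hK N0; set P : rat := _ ^+ _ in hz hn.
have T0 : 0 <= Y * T by rewrite mulr_ge0 // (le_trans _ hK) // mulr_ge0.
clearbody X Wz T N P; case: (lerP X Y) => XY; first by have h : Wz * X <= Wz * Y by [rewrite ler_wpM2l]; lra.
have h1 : Wz * (X - Y) <= P * N * (X - Y) by rewrite ler_wpM2r // subr_ge0 ltW.
have h2 : N * (P * (X - Y)) <= N * (Y * ga) by rewrite ler_wpM2l.
have h3 : Y * (ga * N) <= Y * T by rewrite ler_wpM2l.
lra.
Qed.

End Vertex.

Lemma local_count H L v k : count (H :\ v) (rem L (nbr v) k) =
  csum (H :\ v) L (avoidr ((H :\ v) :&: nbr v) k).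
Proof. exact: count_rem. Qed.

Section Finish.
Variables (phi lam : rat).
Hypotheses (phi01 : 1/2 <= phi <= 1) (lam0 : 0 <= lam).
Hypothesis loc : forall H L v x y z, cls H L -> v \in H -> slk H L v -> x != y ->
  exists al ga : rat, [/\ 0 <= ga,
  csum (H :\ v) L (avoidr ((H :\ v) :&: nbr v) z) <=
     (1 - al) ^+ #|full H v| * count (H :\ v) L,
  ga * count (H :\ v) L <=
    \sum_(k in L v :\ x :\ y) csum (H :\ v) L (avoidr ((H :\ v) :&: nbr v) k) &
  let Y := lam * (if ldeg H v == Delta.-1 then 1 else phi) in
  (1 - al) ^+ #|full H v| * (#|full H v|%:R + (#|(H :\ v) :&: nbr v| - #|full H v|)%:R * phi - Y) <= Y * ga].

(** The potential is 1 at vertices that miss exactly one lattice neighbour and [phi] at the others.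
    As [phi] is at least 1/2, the factor 2 covers the trivial bound 1 at distance zero, and [Delta]
    counts the neighbours of the recoloured vertex. *)
Lemma decay_of_local : decay c0 e lat Delta (2 * Delta%:R) lam.
Proof.
case/andP: phi01 => p0 p1.
move=> H L u t k a b r cl uH ub.
apply: (@edge_ssm V C c0 e lat Delta e_sym e_irr lat_sym e_lat Delta_lt
  (fun H v => if ldeg H v == Delta.-1 then 1 else phi) lam 2) => //;
  try by move=> *; case: ifP; lra.
move=> {cl uH ub}H' L' v x y z cl vH sl xy zxy zL /=.
have [al [ga [g0 h1 h2 h3]]] := loc z cl vH sl xy.
under [X in _ * (_ + X)]eq_bigr do rewrite local_count.
rewrite local_count; apply: local_num h1 h2 h3 => //; first by apply/andP; split; lra.
by case: ifP => _; apply: mulr_ge0 => //; lra.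
Qed.
End Finish.

End Local.
End Locality.

(** * Decay for maximum degrees 6, 4 and 3 *)

Module DegreeDecay.
Import Colourings EdgeBounds SpatialMixing Locality.
Import Order.TTheory GRing.Theory Num.Theory.
Local Open Scope ring_scope.

(** The case of five neighbours, [j] of them full. [(4/5)^5 / 10] is [alpha] for ten colours. The
    line [112/125 - 16/25 * (n/5)] meets [(4/5)^n] at [n = 2, 3], and three independent neighbours
    enter [unused_lb] with [kap = 6]. The values [phi = 87/100] and [lam = 99/100] must work for
    every [j]. *)
Lemma num6_5 (j : nat) : (j <= 5)%N ->
  (1 - (4/5) ^+ 5 / 10) ^+ j * (j%:R + (5%:R - j%:R) * (87/100) - 99/100 * 1) <=
  99/100 * 1 * (6 * (112/125) - 3 * (16/25)) :> rat.
Proof. move: j => [|[|[|[|[|[|?]]]]]] h; [lra|lra|lra|lra|lra|lra|discriminate h]. Qed.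

(** Four neighbours of a vertex of potential [87/100]. With two independent neighbours the line
    [24/25 - 4/5 * (n/5)] meets [(4/5)^n] at [n = 1, 2]. *)
Lemma num6_4 (j : nat) : (j <= 4)%N ->
  (1 - (4/5) ^+ 5 / 10) ^+ j * (j%:R + (4%:R - j%:R) * (87/100) - 99/100 * (87/100)) <=
  99/100 * (87/100) * (5 * (24/25) - 2 * (4/5)) :> rat.
Proof. move: j => [|[|[|[|[|?]]]]] h; [lra|lra|lra|lra|lra|discriminate h]. Qed.

(** Three independent neighbours and six colours: the line [20/27 - 4/9 * (n/3)] meets [(2/3)^n] at
    [n = 2, 3]. The bound [8/117] is that of [is_at_lb_four]. *)
Lemma num4_3 (j : nat) : (j <= 3)%N ->
  (1 - 8/117) ^+ j * (j%:R + (3%:R - j%:R) * (31/36) - 499/500 * 1) <=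
  499/500 * 1 * (4 * (20/27) - 3 * (4/9)) :> rat.
Proof. move: j => [|[|[|[|?]]]] h; [lra|lra|lra|lra|discriminate h]. Qed.

Section Deg.
Variables (V C : finType) (c0 : C) (e lat : rel V).
Hypothesis e_sym : symmetric e.
Hypothesis e_irr : irreflexive e.
Hypothesis lat_sym : symmetric lat.
Hypothesis e_lat : forall v w, e v w -> lat v w.
Implicit Types (H A Q I : {set V}) (L M : V -> {set C}) (c : {ffun V -> C}).
Notation csum := (csum c0 e).
Notation count := (count c0 e).
Notation nbr := (nbr e).
Notation edeg := (edeg e).
Notation ldeg := (Colourings.edeg lat).

Lemma full_le D H v : (#|full e lat D H v| <= #|(H :\ v) :&: nbr v|)%N.
Proof. by apply: subset_leq_card; apply/subsetP=> w; rewrite inE => /andP[]. Qed.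

Lemma avoid_trivial H L A z n : csum H L (avoidr A z) <= (1 - 0) ^+ n * count H L.
Proof. by rewrite subr0 expr1n mul1r; exact: csum_avoid_le. Qed.

Lemma trivial_num (phi Y ga : rat) (a j : nat) : phi <= 1 -> (j <= a)%N -> a%:R - Y <= Y * ga ->
  (1 - 0) ^+ j * (j%:R + (a - j)%:R * phi - Y) <= Y * ga.
Proof.
move=> p1 ja; apply: le_trans; rewrite subr0 expr1n mul1r lerD2r natrB //.
have h : 0 <= a%:R - j%:R :> rat by rewrite subr_ge0 ler_nat.
by nra.
Qed.

Lemma chord2 (m : nat) (A0 B0 : rat) : A0 <= 1 -> A0 <= 1 - m%:R^-1 + B0 * (1 / m%:R) ->
  A0 <= (1 - m%:R^-1) ^+ 2 + B0 * (2 / m%:R) ->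
  forall n, (n <= 2)%N -> A0 <= (1 - m%:R^-1) ^+ n + B0 * (n%:R / m%:R).
Proof. by move=> h0 h1 h2 [|[|[|n]]] // _; rewrite ?expr0 ?mul0r ?mulr0 ?addr0 ?expr1. Qed.

Lemma chord3 (m : nat) (A0 B0 : rat) : A0 <= 1 -> A0 <= 1 - m%:R^-1 + B0 * (1 / m%:R) ->
  A0 <= (1 - m%:R^-1) ^+ 2 + B0 * (2 / m%:R) -> A0 <= (1 - m%:R^-1) ^+ 3 + B0 * (3 / m%:R) ->
  forall n, (n <= 3)%N -> A0 <= (1 - m%:R^-1) ^+ n + B0 * (n%:R / m%:R).
Proof. by move=> h0 h1 h2 h3 [|[|[|[|n]]]] // _; rewrite ?expr0 ?mul0r ?mulr0 ?addr0 ?expr1. Qed.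

Lemma local_unused_eq (n i kap : nat) (A0 B0 N T : rat) : n = i ->
  (kap%:R * A0 - n%:R * B0) * N <= T -> (kap%:R * A0 - i%:R * B0) * N <= T.
Proof. by move->. Qed.

Section Six.
Hypothesis ldeg_le : forall v, (ldeg setT v <= 6)%N.
Hypothesis indep3 : forall v A, A \subset [set w | lat v w] -> #|A| = 5 ->
  exists I, [/\ I \subset A, #|I| = 3 & {in I &, forall v w, ~~ lat v w}].
Hypothesis indep2 : forall v A, A \subset [set w | lat v w] -> #|A| = 4 ->
  exists I, [/\ I \subset A, #|I| = 2 & {in I &, forall v w, ~~ lat v w}].

Lemma nbr_sub_lat H v : (H :\ v) :&: nbr v \subset [set w | lat v w].
Proof. by apply/subsetP=> w; rewrite !inE => /andP[_ /e_lat]. Qed.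

Lemma indep_e I : {in I &, forall v w, ~~ lat v w} -> {in I &, forall v w, ~~ e v w}.
Proof. by move=> h v w vI wI; apply: contra (h v w vI wI); exact: e_lat. Qed.

(** Up to three neighbours, or four at a vertex of potential 1, counting one lost colour per
    neighbour is enough. Five neighbours, and four at a vertex of degree four, need both independent
    neighbours and full lists. *)
Lemma decay_six10 : #|C| = 10 -> decay c0 e lat 6 (2 * 6%:R) (99/100).
Proof.
move=> C10; have D_lt : (6 < #|C|)%N by rewrite C10.
apply: (@decay_of_local _ _ c0 e lat 6 e_sym e_irr lat_sym e_lat D_lt ldeg_le (87/100)); [by apply/andP; split; lra|lra|].
move=> H L v x y z cl vH sl xy.
have jA := full_le 6 H v; have aA : (#|(H :\ v) :&: nbr v| <= ldeg H v)%N by exact: card_nbr_le.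
have dlt := ldeg_lt D_lt vH sl.
have cK := card_others D_lt vH sl x y; rewrite C10 in cK.
set K := L v :\ x :\ y in cK *.
have subA := nbr_sub_lat H v.
have alE : alpha C 6 = (4/5) ^+ 5 / 10.
  by rewrite /alpha C10 (_ : 1 - _ = 4/5) //; lra.
have hal := full_avoid_alpha c0 e_sym e_irr lat_sym e_lat D_lt vH cl sl z.
rewrite alE in hal.
move: (erefl #|(H :\ v) :&: nbr v|); set a := {1}#|_| => aE.
have {}aA : (a <= ldeg H v)%N by rewrite aE.
have hK kap : (kap + #|(H :\ v) :&: nbr v| <= #|K|)%N ->
    kap%:R * count (H :\ v) L <=
    \sum_(k in K) csum (H :\ v) L (avoidr ((H :\ v) :&: nbr v) k).
  by move=> h; exact: (unused_trivial c0 e_sym e_irr L (subsetIl _ _) h).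
rewrite /= in dlt.
have [a3|a3] := leqP a 3.
  (* With [al = 0] the full neighbours give no gain: the weight of [z] is bounded by the total
     count. *)
  exists 0, 3; split; [lra|exact: avoid_trivial| |].
    by apply: (hK 3); rewrite -aE; move: aA cK a3; clear; lia.
  apply: trivial_num; [lra|exact: jA|rewrite -aE].
  have : a%:R <= 3 :> rat by rewrite (ler_nat _ a 3).
  by case: ifP => _; lra.
have [d5|d4] := eqVneq (ldeg H v) 5.
  have [a5|a4] := eqVneq a 5.
    have [I [IA I3 ind]] := indep3 subA (etrans (esym aE) a5).
    exists ((4/5) ^+ 5 / 10), (6 * (112/125) - 3 * (16/25)); split; [lra|exact: hal| |].
      apply: (local_unused_eq I3); apply: (local_unused c0 e_sym e_irr lat_sym e_lat D_lt vH cl sl (m := 5)); [exact: IA| | |lra|lra| |].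
      - exact: indep_e.
      - by rewrite C10.
      - by rewrite I3 -aE a5; move: cK; rewrite d5; clear; lia.
      - by rewrite I3; apply: chord3; lra.
    cbv zeta; rewrite (natrB _ jA) -aE a5; cbv iota; move: jA; rewrite -aE a5.
    exact: num6_5.
  have {}a4 : a = 4 by move: aA a3 a4; rewrite d5; clear; lia.
  exists 0, 4; split; [lra|exact: avoid_trivial| |].
    by apply: (hK 4); rewrite -aE a4; move: cK; rewrite d5; clear; lia.
  by apply: trivial_num; [lra|exact: jA|rewrite -aE a4; cbv iota; lra].
have a4 : a = 4 by move: aA a3 d4 dlt; clear; lia.
have dE : ldeg H v = 4 by move: aA dlt d4; rewrite a4; clear; lia.
have [I [IA I2 ind]] := indep2 subA (etrans (esym aE) a4).
exists ((4/5) ^+ 5 / 10), (5 * (24/25) - 2 * (4/5)); split; [lra|exact: hal| |].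
  apply: (local_unused_eq I2); apply: (local_unused c0 e_sym e_irr lat_sym e_lat D_lt vH cl sl (m := 5)); [exact: IA| | |lra|lra| |].
  - exact: indep_e.
  - by rewrite C10.
  - by rewrite I2 -aE a4; move: cK; rewrite dE; clear; lia.
  - by rewrite I2; apply: chord2; lra.
have nf : (ldeg H v == 6.-1) = false by rewrite dE.
cbv zeta; rewrite (natrB _ jA) -aE a4 ?nf; cbv iota; move: jA; rewrite -aE a4.
exact: num6_4.
Qed.

Lemma decay_six11 : (10 < #|C|)%N -> decay c0 e lat 6 (2 * 6%:R) (99/100).
Proof.
move=> C11; have D_lt : (6 < #|C|)%N by exact: leq_trans C11.
apply: (@decay_of_local _ _ c0 e lat 6 e_sym e_irr lat_sym e_lat D_lt ldeg_le (1)); [by apply/andP; split; lra|lra|].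
move=> H L v x y z cl vH sl xy.
have jA := full_le 6 H v; have aA : (#|(H :\ v) :&: nbr v| <= ldeg H v)%N by exact: card_nbr_le.
have dlt := ldeg_lt D_lt vH sl.
have cK := card_others D_lt vH sl x y.
set K := L v :\ x :\ y in cK *.
have {}cK : (5 + ldeg H v <= #|K|.+1)%N.
  by apply: leq_trans cK; move: C11; clear; lia.
have subA := nbr_sub_lat H v.
rewrite if_same.
have [a5|a4] := eqVneq #|(H :\ v) :&: nbr v| 5.
  have [I [IA I3 ind]] := indep3 subA a5.
  exists 0, (7 * (112/125) - 3 * (16/25)); split; [lra|exact: avoid_trivial| |].
  - apply: (local_unused_eq I3); apply: (local_unused c0 e_sym e_irr lat_sym e_lat D_lt vH cl sl (m := 5)); [exact: IA| | |lra|lra| |].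
    + exact: indep_e.
    + by move: C11; clear; lia.
    + by rewrite I3 a5; move: cK aA; rewrite a5; clear; lia.
    + by rewrite I3; apply: chord3; lra.
  by apply: trivial_num; [lra|exact: jA|rewrite a5; lra].
exists 0, 4; split; [lra|exact: avoid_trivial| |].
  apply: (unused_trivial c0 e_sym e_irr L (kap := 4)); first exact: subsetIl.
  by move: cK aA; clear; lia.
apply: trivial_num; [lra|exact: jA|].
have : #|(H :\ v) :&: nbr v|%:R <= 4 :> rat.
  by rewrite (ler_nat _ _ 4); move: aA dlt a4; clear; lia.
by lra.
Qed.

Lemma decay_six : (10 <= #|C|)%N -> decay c0 e lat 6 (2 * 6%:R) (99/100).
Proof. by rewrite leq_eqVlt => /orP[/eqP/esym/decay_six10|/decay_six11]. Qed.

End Six.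

Section TriangleFree.
Hypothesis lat_free : forall u v w, lat u v -> lat u w -> ~~ lat v w.

Lemma indep_nbr H v : {in (H :\ v) :&: nbr v &, forall v w, ~~ e v w}.
Proof.
move=> a b; rewrite !inE => /andP[_ /e_lat la] /andP[_ /e_lat lb].
by apply: contra (lat_free la lb); exact: e_lat.
Qed.

Lemma decay_three : (forall v, (ldeg setT v <= 3)%N) -> (5 <= #|C|)%N ->
  decay c0 e lat 3 (2 * 3%:R) (9/10).
Proof.
move=> ldeg_le C5; have D_lt : (3 < #|C|)%N by exact: leq_trans C5.
apply: (@decay_of_local _ _ c0 e lat 3 e_sym e_irr lat_sym e_lat D_lt ldeg_le (1)); [by apply/andP; split; lra|lra|].
move=> H L v x y z cl vH sl xy.
have jA := full_le 3 H v; have aA : (#|(H :\ v) :&: nbr v| <= ldeg H v)%N by exact: card_nbr_le.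
have dlt := ldeg_lt D_lt vH sl.
have cK := card_others D_lt vH sl x y.
set K := L v :\ x :\ y in cK *.
have {}cK : (2 + ldeg H v <= #|K|.+1)%N.
  by apply: leq_trans cK; move: C5; clear; lia.
rewrite if_same.
have [a2|a1] := eqVneq #|(H :\ v) :&: nbr v| 2.
  exists 0, (3 * (4/9) - 2 * 0); split; [lra|exact: avoid_trivial| |].
    apply: (local_unused_eq a2); apply: (local_unused c0 e_sym e_irr lat_sym e_lat D_lt vH cl sl (m := 3)); [exact: subxx| | |lra|lra| |].
    - exact: indep_nbr.
    - by move: C5; clear; lia.
    - by move: cK aA; rewrite a2; clear; lia.
    - by rewrite a2; apply: chord2; lra.
  by apply: trivial_num; [lra|exact: jA|rewrite a2; lra].
exists 0, 1; split; [lra|exact: avoid_trivial| |].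
  apply: (unused_trivial c0 e_sym e_irr L (kap := 1)); first exact: subsetIl.
  by move: cK aA; clear; lia.
apply: trivial_num; [lra|exact: jA|].
have : #|(H :\ v) :&: nbr v|%:R <= 1 :> rat.
  by rewrite (ler_nat _ _ 1); move: aA dlt a1; clear; lia.
by lra.
Qed.

Section Four.
Hypothesis ldeg_le : forall v, (ldeg setT v <= 4)%N.

Lemma decay_four7 : (6 < #|C|)%N -> decay c0 e lat 4 (2 * 4%:R) (499/500).
Proof.
move=> C7; have D_lt : (4 < #|C|)%N by exact: leq_trans C7.
apply: (@decay_of_local _ _ c0 e lat 4 e_sym e_irr lat_sym e_lat D_lt ldeg_le (1)); [by apply/andP; split; lra|lra|].
move=> H L v x y z cl vH sl xy.
have jA := full_le 4 H v; have aA : (#|(H :\ v) :&: nbr v| <= ldeg H v)%N by exact: card_nbr_le.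
have dlt := ldeg_lt D_lt vH sl.
have cK := card_others D_lt vH sl x y.
set K := L v :\ x :\ y in cK *.
have {}cK : (3 + ldeg H v <= #|K|.+1)%N.
  by apply: leq_trans cK; move: C7; clear; lia.
rewrite if_same.
have [a3|a2] := eqVneq #|(H :\ v) :&: nbr v| 3.
  (* The line [8/9 - 2/3 * (n/3)] meets [(2/3)^n] at [n = 1, 2]. *)
  exists 0, (5 * (8/9) - 3 * (2/3)); split; [lra|exact: avoid_trivial| |].
    apply: (local_unused_eq a3); apply: (local_unused c0 e_sym e_irr lat_sym e_lat D_lt vH cl sl (m := 3)); [exact: subxx| | |lra|lra| |].
    - exact: indep_nbr.
    - by move: C7; clear; lia.
    - by move: cK aA; rewrite a3; clear; lia.
    - by rewrite a3; apply: chord3; lra.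
  by apply: trivial_num; [lra|exact: jA|rewrite a3; lra].
exists 0, 2; split; [lra|exact: avoid_trivial| |].
  apply: (unused_trivial c0 e_sym e_irr L (kap := 2)); first exact: subsetIl.
  by move: cK aA; clear; lia.
apply: trivial_num; [lra|exact: jA|].
have : #|(H :\ v) :&: nbr v|%:R <= 2 :> rat.
  by rewrite (ler_nat _ _ 2); move: aA dlt a2; clear; lia.
by lra.
Qed.

Lemma csum_same H L y1 y2 (m : nat) : y1 \in H -> y2 \in H -> y1 != y2 ->
  (m + edeg H y1 <= #|L y1|)%N ->
  m%:R * csum H L (fun c => (c y1 == c y2)%:R) <= count H L.
Proof.
move=> h1 h2 y12 hL; rewrite /Colourings.count !(csum_peel c0 e_sym e_irr _ _ h2) mulr_sumr.
apply: ler_sum => a aL.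
rewrite (eq_csum_fun _ _ _ _ (g := is_at y1 a)); last first.
  by move=> c; rewrite /is_at !ffunE eqxx (negPf y12).
apply: (csum_is_at_ub c0 e_sym e_irr); first by rewrite !inE y12.
have := card_rem L (nbr y2) a y1; move: hL; rewrite (edegD1 e y1 h2) inE (e_sym y1).
by move: (e y2 y1 : bool) (edeg _ _) #|_| #|_|; clear; lia.
Qed.

(** Sharper than [is_at_lb], since neighbours block colours of [w]. Two neighbours of different
    colours leave at most 4 of the 6, and they agree with probability at most 1/3, which gives back
    one colour; so a colouring of the rest has at most 13/3 extensions on average. All neighbours
    avoid [z] with probability at least [(2/3)^3], and [8/27] over [13/3] is [8/117]. With at most
    one neighbour, [2/3] over 6 is already larger. *)
Lemma is_at_lb_four H L w z : #|C| = 6 -> w \in H -> z \in L w ->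
  (forall y, y \in H :\ w -> e w y -> (3 + edeg (H :\ w) y <= #|L y|)%N) ->
  (edeg H w <= 3)%N ->
  8/117 * count H L <= csum H L (is_at w z).
Proof.
move=> C6 wH zL hL hd.
rewrite (csum_is_at c0 e_sym e_irr wH zL).
set N := (H :\ w) :&: nbr w; set N1 := count (H :\ w) L.
have N10 : 0 <= N1 by exact: count_ge0.
have lb : (1 - 3%:R^-1) ^+ #|N| * N1 <= csum (H :\ w) L (avoidr N z).
  apply: (avoid_lb c0 e_sym e_irr (m := 3)) => [//||y]; first exact: subsetIl.
  by rewrite !inE => /andP[/andP[yw yH] ewy] _; apply: hL; rewrite ?inE ?yw.
have nle : (#|N| <= 3)%N.
  apply: leq_trans hd; apply: subset_leq_card; apply/subsetP=> y.
  by rewrite !inE => /andP[/andP[_ ->] ->].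
have ub : count H L <= \sum_k csum (H :\ w) L (avoidr N k).
  rewrite (count_peel c0 e_sym e_irr _ wH) [leLHS]big_mkcond; apply: ler_sum => k _.
  by case: ifP => // _; apply: csum_ge0 => c; exact: avoidr_ge0.
have [n1|n2] := leqP #|N| 1.
  have {ub} : count H L <= 6 * N1.
    apply: le_trans ub _; apply: le_trans (_ : \sum_(k : C) N1 <= _).
      by apply: ler_sum => k _; exact: csum_avoid_le.
    by rewrite sumr_const C6 mulr_natl.
  move: lb; move: #|N| n1 => [|[|n]] h; [rewrite expr0|rewrite expr1|discriminate h] => lb ub; lra.
have /card_gt1P[y1 [y2 [h1 h2 y12]]] := n2.
have {}ub : count H L <= 4 * N1 + csum (H :\ w) L (fun c => (c y1 == c y2)%:R).
  apply: le_trans ub _; rewrite -csum_bigsum -(csum_cst _ _ _ _ 4) -csum_add.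
  apply: csum_le => c _; apply: le_trans (_ : \sum_(k : C) (k \notin [set c y1; c y2])%:R <= _).
    apply: ler_sum => k _; rewrite /avoidr ler_nat; case: (boolP (avoid _ _ _)) => // /forall_inP h.
    by rewrite !inE negb_or ![k == _]eq_sym !h.
  rewrite -natr_sum -(natrD _ 4) ler_nat.
  have -> : (\sum_k (k \notin [set c y1; c y2]) = #|~: [set c y1; c y2]|)%N.
    rewrite -sum1_card [RHS]big_mkcond /=; apply: eq_bigr => k _.
    by rewrite [k \in ~: _]inE; case: (k \in _).
  have := cardsC [set c y1; c y2]; rewrite cards2 C6.
  by case: (c y1 == c y2) => /=; lia.
have : 3%:R * csum (H :\ w) L (fun c => (c y1 == c y2)%:R) <= N1.
  move: h1 h2; rewrite !inE => /andP[/andP[yw1 yH1] ew1] /andP[/andP[yw2 yH2] _].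
  by apply: csum_same; rewrite ?inE ?yw1 ?yw2 //; apply: hL; rewrite ?inE ?yw1.
move: lb; move: #|N| n2 nle => [|[|[|[|n]]]] g h; [discriminate g|discriminate g| | |discriminate h] => lb same; lra.
Qed.

Lemma decay_four6 : #|C| = 6 -> decay c0 e lat 4 (2 * 4%:R) (499/500).
Proof.
move=> C6; have D_lt : (4 < #|C|)%N by rewrite C6.
apply: (@decay_of_local _ _ c0 e lat 4 e_sym e_irr lat_sym e_lat D_lt ldeg_le (31/36)); [by apply/andP; split; lra|lra|].
move=> H L v x y z cl vH sl xy.
have jA := full_le 4 H v.
have aA : (#|(H :\ v) :&: nbr v| <= ldeg H v)%N by exact: card_nbr_le.
have dlt := ldeg_lt D_lt vH sl.
have cK := card_others D_lt vH sl x y; rewrite C6 in cK.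
set K := L v :\ x :\ y in cK *.
have hal : csum (H :\ v) L (avoidr ((H :\ v) :&: nbr v) z) <=
     (1 - 8/117) ^+ #|full e lat 4 H v| * count (H :\ v) L.
  apply: avoid_ub.
  - by apply/subsetP=> w; rewrite inE => /andP[].
  - exact: subsetIl.
  - by apply/andP; split; lra.
  move=> w B wf BJ; cbv zeta; set M := rem L B z.
  have wA : w \in (H :\ v) :&: nbr v by move: wf; rewrite inE => /andP[].
  have [wH evw lvw] := nbr_lat e_lat wA.
  have wv : w != v by move: wA; rewrite !inE => /andP[/andP[]].
  have wB : w \notin B by apply: contraTN isT => /(subsetP BJ); rewrite !inE eqxx.
  apply: is_at_lb_four => //; first by rewrite !inE wv.
  - by rewrite /M /rem (negPf wB) (full_list lat_sym e_lat D_lt vH cl sl wf) inE.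
  - move=> u /setD1P[uw /setD1P[uv uH]] ewu.
    (* Triangle-freeness: a neighbour of [w] is not adjacent to [v], so its list was not shortened
       by striking [z] in [B]. *)
    have uB : u \notin B.
      apply/negP=> /(subsetP BJ) /setD1P[_]; rewrite inE => /andP[uA _].
      have [_ _ lvu] := nbr_lat e_lat uA.
      by have := lat_free lvw lvu; rewrite (e_lat ewu).
    rewrite /M /rem (negPf uB).
    have := cl u uH; rewrite (edegD1 lat u wH) lat_sym (e_lat ewu) C6.
    have : (edeg ((H :\ v) :\ w) u <= ldeg (H :\ w) u)%N.
      apply: leq_trans (edeg_le e_lat _ _).
      apply: subset_leq_card; apply/subsetP=> a; rewrite !inE.
      by move=> /andP[/andP[-> /andP[_ ->]] ->].
    by move: (edeg _ _) (ldeg _ _) #|_|; clear; lia.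
  - by move: wf; rewrite inE => /andP[_ /eqP E]; have := edeg_le e_lat (H :\ v) w; rewrite E.
move: (erefl #|(H :\ v) :&: nbr v|); set a := {1}#|_| => aE.
have {}aA : (a <= ldeg H v)%N by rewrite aE.
have [a3|a3] := eqVneq a 3.
  have d3 : ldeg H v = 3 by move: aA dlt; rewrite a3; clear; lia.
  exists (8/117), (4 * (20/27) - 3 * (4/9)); split; [lra|exact: hal| |].
    apply: (local_unused_eq (etrans (esym aE) a3)).
    apply: (local_unused c0 e_sym e_irr lat_sym e_lat D_lt vH cl sl (m := 3)); [exact: subxx| | |lra|lra| |].
    - exact: indep_nbr.
    - by rewrite C6.
    - by rewrite -aE a3; move: cK; rewrite d3; clear; lia.
    - by rewrite -aE a3; apply: chord3; lra.
  have nf : (ldeg H v == 4.-1) = true by rewrite d3.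
  cbv zeta; rewrite (natrB _ jA) -aE a3 ?nf; cbv iota; move: jA; rewrite -aE a3.
  exact: num4_3.
have [a2|a2] := eqVneq a 2.
  exists 0, (3 * (4/9) - 2 * 0); split; [lra|exact: avoid_trivial| |].
    apply: (local_unused_eq (etrans (esym aE) a2)).
    apply: (local_unused c0 e_sym e_irr lat_sym e_lat D_lt vH cl sl (m := 3)); [exact: subxx| | |lra|lra| |].
    - exact: indep_nbr.
    - by rewrite C6.
    - by rewrite -aE a2; move: cK aA; rewrite a2; clear; lia.
    - by rewrite -aE a2; apply: chord2; lra.
  by apply: trivial_num; [lra|exact: jA|rewrite -aE a2; case: ifP => _; lra].
exists 0, 1; split; [lra|exact: avoid_trivial| |].
  apply: (unused_trivial c0 e_sym e_irr L (kap := 1)); first exact: subsetIl.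
  by rewrite -aE; move: cK aA; clear; lia.
apply: trivial_num; [lra|exact: jA|rewrite -aE].
have : a%:R <= 1 :> rat by rewrite (ler_nat _ _ 1); move: aA dlt a3 a2; clear; lia.
by case: ifP => _; lra.
Qed.

Lemma decay_four : (6 <= #|C|)%N -> decay c0 e lat 4 (2 * 4%:R) (499/500).
Proof. by rewrite leq_eqVlt => /orP[/eqP/esym/decay_four6|/decay_four7]. Qed.

End Four.
End TriangleFree.
End Deg.
End DegreeDecay.

(** * Independent pairs of vertices and their colour usage *)

Module PairProfiles.
Import Colourings EdgeBounds SpatialMixing Locality.
Import Order.TTheory GRing.Theory Num.Theory.
Local Open Scope ring_scope.

Section Pair.
Variables (V C : finType) (c0 : C) (e : rel V).
Hypothesis e_sym : symmetric e.
Hypothesis e_irr : irreflexive e.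
Implicit Types (H A Q I : {set V}) (L M : V -> {set C}) (c : {ffun V -> C}).
Notation csum := (csum c0 e).
Notation count := (count c0 e).
Notation nbr := (nbr e).
Notation edeg := (edeg e).

Lemma csum_only0 H L f g (A B : {set V}) : A :|: B = H -> [disjoint A & B] ->
  {in A & B, forall a b, ~~ e a b} -> only_on A f -> only_on B g ->
  csum H L (fun c => f c * g c) = csum A L f * csum B L g.
Proof.
have [n] := ubnP #|B|; elim: n => // n IH in H L B g * => lt EH dis sep hf hg.
have [B0|/set0Pn[v vB]] := eqVneq B set0.
  rewrite B0 setU0 in EH; rewrite B0 csum0 EH mulrC -csum_scale.
  apply: eq_csum_fun => c; rewrite mulrC; congr (_ * _).
  by apply: hg => w; rewrite B0 inE.
have vH : v \in H by rewrite -EH inE vB orbT.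
have vA : v \notin A by rewrite (disjointFl dis vB).
rewrite (csum_peel c0 e_sym e_irr _ _ vH) (csum_peel c0 e_sym e_irr _ _ vB) mulr_sumr.
apply: eq_bigr => a aL.
rewrite -(@eq_csum_lists _ _ c0 e A (rem L (nbr v) a)); last first.
  by move=> w wA; rewrite /rem inE e_sym (negPf (sep w v wA vB)).
rewrite -(IH (H :\ v)).
- by apply: eq_csum_fun => c; rewrite (only_on_upd _ _ hf vA).
- by move: lt; rewrite (cardsD1 v) vB.
- apply/setP=> w; rewrite -EH !inE; case: (eqVneq w v) => [->|] //=.
  by rewrite (negPf vA).
- by apply: disjointWr dis; exact: subD1set.
- by move=> x y xA /setD1P[_ yB]; apply: sep.
- exact: hf.
move=> c c' cc; apply: hg => w wB; rewrite !ffunE; case: (eqVneq w v) => // wv.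
by apply: cc; rewrite !inE wv.
Qed.

(* Usage profile of a set of at most two vertices whose lists are large: g k is
   the probability that colour k is unused. *)
Definition profile (n : nat) (g : C -> rat) :=
  (forall k, n.+1%:R^-1 <= g k <= 1) /\ \sum_k (1 - g k) <= n%:R.

(** Up to the factor [count A L], the left side is the expected number of distinct colours used on
    [A]. *)
Lemma usage_le A L :
  \sum_k (count A L - csum A L (avoidr A k)) <= #|A|%:R * count A L.
Proof.
rewrite sumrB sumr_const.
have := @unused_trivial _ _ c0 e e_sym e_irr A L A setT (#|C| - #|A|) (subxx A).
have [le|lt] := leqP #|A| #|C|.
  rewrite cardsT subnK // => /(_ (leqnn _)); rewrite natrB // mulrBl -(mulr_natl (count A L)).
  by rewrite (eq_bigl (fun=> true)) => [|k]; rewrite ?inE //; lra.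
move=> _; rewrite -(mulr_natl (count A L)).
apply: le_trans (_ : #|C|%:R * count A L <= _); last first.
  by rewrite ler_wpM2r ?count_ge0 // ler_nat ltnW.
by rewrite gerBl sumr_ge0 // => k _; apply: csum_ge0 => c; exact: avoidr_ge0.
Qed.

Lemma csum1 v L f : csum [set v] L f = \sum_(a in L v) f (upd [ffun=> c0] v a).
Proof.
rewrite (csum_peel c0 e_sym e_irr _ _ (set11 v)) setDv.
by apply: eq_bigr => a _; rewrite csum0.
Qed.

Lemma count1 v L : count [set v] L = #|L v|%:R.
Proof. by rewrite /Colourings.count csum1 sumr_const. Qed.

(** A union bound over two lists of size three gives 1/3 directly for nonadjacent vertices only
    after refinement. Here [f i] counts the choices at [b2] once [b1] has colour [i], and [f' i]
    those other than [k]; the colourings with [b1] coloured [k] are charged to the other colours of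
    [b1]. *)
Lemma pair_avoid L b1 b2 k : b1 != b2 -> (2 < #|L b1|)%N -> (2 < #|L b2|)%N ->
  count [set b1; b2] L <= 3 * csum [set b1; b2] L (avoidr [set b1; b2] k).
Proof.
move=> b12 h1 h2; set A := [set b1; b2].
have EA : A :\ b1 = [set b2].
  by apply/setP=> w; rewrite !inE; case: (eqVneq w b1) => [->|] //=; rewrite (negPf b12).
have b1A : b1 \in A by rewrite !inE eqxx.
have := count_rem c0 e A L A k; rewrite setIid => <-.
rewrite /Colourings.count !(csum_peel c0 e_sym e_irr _ _ b1A) EA.
rewrite -/(Colourings.count c0 e _ _).
under eq_bigr do rewrite -/(Colourings.count c0 e _ _) count1.
under [X in _ <= _ * X]eq_bigr do rewrite -/(Colourings.count c0 e _ _) count1.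
have remE M Q a w : rem M Q a w = if w \in Q then M w :\ a else M w by [].
have b2A : b2 \in A by rewrite !inE eqxx orbT.
rewrite [rem L A k b1]remE b1A.
pose f i := #|rem L (nbr b1) i b2|; pose f' i := #|rem (rem L A k) (nbr b1) i b2|.
suff : (\sum_(i in L b1) f i <= 3 * \sum_(i in L b1 :\ k) f' i)%N.
  by rewrite -(ler_nat rat) natrM !natr_sum.
have fb i : (#|L b2| <= f i + 1)%N.
  by apply: leq_trans (card_rem L (nbr b1) i b2) _; rewrite leq_add2l leq_b1.
have fu i : (f i <= #|L b2|)%N by apply: subset_leq_card; exact: rem_sub.
have ff i : (f i <= f' i + (k \in L b2))%N.
  rewrite /f /f' !remE b2A inE; case: (e b1 b2); last by rewrite (cardsD1 k (L b2)) addnC.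
  rewrite (cardsD1 k (L b2 :\ i)) addnC setDDl setUC -setDDl leq_add2l.
  by rewrite !inE; case: (_ \in _); rewrite ?andbF // andbT leq_b1.
have fk : (f k <= #|L b2| - (e b1 b2 && (k \in L b2)))%N.
  rewrite /f !remE inE; case: (e b1 b2) => /=; last by rewrite subn0.
  by rewrite (cardsD1 k (L b2)) addKn.
case kL1: (k \in L b1); last first.
  have -> : L b1 :\ k = L b1.
    by apply/setP=> w; rewrite !inE; case: (eqVneq w k) => [->|] //=; rewrite kL1.
  rewrite big_distrr /=; apply: leq_sum => i _.
  by have := ff i; have := fb i; move: h2; case: (_ \in _); clear; lia.
rewrite (big_setD1 k kL1) /=.
have c2 : (2 <= #|L b1 :\ k|)%N by move: h1; rewrite (cardsD1 k) kL1.
(* At least two colours other than [k] remain at [b1]; each can absorb [m] extra colourings, so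
   [f k <= 2 * m] is enough. *)
have key (m : nat) : (forall i, m + f i <= 3 * f' i)%N -> (f k <= 2 * m)%N ->
   (f k + \sum_(i in L b1 :\ k) f i <= 3 * \sum_(i in L b1 :\ k) f' i)%N.
  move=> hm fk2; rewrite big_distrr /=.
  apply: leq_trans (_ : (\sum_(i in L b1 :\ k) (m + f i) <= _)%N); last by apply: leq_sum.
  rewrite big_split /= leq_add2r sum_nat_const; apply: leq_trans fk2 _.
  by rewrite leq_mul2r c2 orbT.
have [kL2|kL2] := boolP (k \in L b2).
  have [e12|e12] := boolP (e b1 b2).
    apply: (key (2 * #|L b2| - 5)%N).
      by move=> i; have := ff i; have := fb i; have := fu i; move: h2; rewrite kL2; clear; lia.
    by move: fk h2; rewrite kL2 e12; clear; lia.
  have fE i : f i = #|L b2| by rewrite /f /rem inE (negPf e12).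
  apply: (key (2 * #|L b2| - 3)%N).
    by move=> i; have := ff i; rewrite fE kL2; move: h2; clear; lia.
  by rewrite fE; move: h2; clear; lia.
apply: (key (2 * #|L b2| - 2)%N).
  by move=> i; have := ff i; have := fb i; rewrite (negPf kL2); clear; lia.
by have := fu k; move: h2; clear; lia.
Qed.

Lemma profileP A L (n : nat) : (#|A| <= n <= 2)%N -> 0 < count A L ->
  (forall w, w \in A -> (n < #|L w|)%N) ->
  profile n (fun k => csum A L (avoidr A k) / count A L).
Proof.
move=> /andP[An n2] p hL; have pn := lt0r_neq0 p; split; last first.
  rewrite (eq_bigr (fun k => (count A L - csum A L (avoidr A k)) / count A L)); last first.
    by move=> k _; rewrite mulrBl divff.
  rewrite -mulr_suml ler_pdivrMr //; apply: le_trans (usage_le A L) _.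
  by apply: ler_wpM2r; [exact: ltW|rewrite ler_nat].
move=> k; apply/andP; split; last by rewrite ler_pdivrMr // mul1r csum_avoid_le.
rewrite ler_pdivlMr // ler_pdivrMl ?ltr0n //.
have [A0|A0] := eqVneq #|A| 0%N.
  have E : csum A L (avoidr A k) = count A L.
    by apply: eq_csum_fun => c; rewrite /avoidr (cards0_eq A0) avoid0.
  by rewrite E -[leLHS]mul1r; apply: ler_wpM2r; [exact: ltW|rewrite ler1n].
have [A1|A1] := eqVneq #|A| 1%N.
  have /eqP/cards1P[v Av] := A1; rewrite Av in hL *.
  have := hL v (set11 v) => hv.
  have := count_rem c0 e [set v] L [set v] k; rewrite setIid => <-.
  rewrite !count1 /rem set11 -natrM ler_nat (cardsD1 k (L v)).
  have := cardsD1 k (L v); have : (0 < n)%N by move: An; rewrite Av cards1.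
  by case: (k \in L v); move: hv; clear; nia.
have E2 : #|A| = 2 by move: An n2 A0 A1; clear; lia.
have nE : n = 2 by move: An n2; rewrite E2; clear; lia.
have /cards2P[b1 [b2 [b12 EA]]] : #|A| == 2 by rewrite E2.
rewrite nE EA; apply: pair_avoid => //.
  by have := hL b1; rewrite nE EA !inE eqxx; apply.
by have := hL b2; rewrite nE EA !inE eqxx orbT; apply.
Qed.

(** Reveal everything outside [A :|: B]. As no edge joins [A] to [B], the two parts become
    independent, and the bilinear form in the joint counts reduces to the same form in a product of
    two profiles. *)
Lemma pair_lift H L (A B : {set V}) (na nb : nat) (coef : C -> C -> rat) :
  A \subset H -> B \subset H -> [disjoint A & B] ->
  {in A & B, forall a b, ~~ e a b} ->
  (#|A| <= na <= 2)%N -> (#|B| <= nb <= 2)%N ->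
  (forall w, w \in A -> (na + edeg (H :\: A) w < #|L w|)%N) ->
  (forall w, w \in B -> (nb + edeg (H :\: B) w < #|L w|)%N) ->
  (forall g h, profile na g -> profile nb h -> 0 <= \sum_i \sum_j coef i j * (g i * h j)) ->
  0 <= \sum_i \sum_j coef i j * csum H L (fun c => avoidr A i c * avoidr B j c).
Proof.
move=> AH BH dis sep hA hB hLA hLB hgh.
have -> : \sum_i \sum_j coef i j * csum H L (fun c => avoidr A i c * avoidr B j c) =
  csum H L (fun c => \sum_i \sum_j coef i j * (avoidr A i c * avoidr B j c)).
  rewrite csum_bigsum; apply: eq_bigr => i _; rewrite csum_bigsum; apply: eq_bigr => j _.
  by rewrite csum_scale.
have ABH : A :|: B \subset H by rewrite subUset AH.
apply: (csum_lift e_sym e_irr ABH).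
  move=> c c' cc; apply: eq_bigr => i _; apply: eq_bigr => j _; congr (_ * (_ * _)).
    by apply: only_on_avoidr => w wA; apply: cc; rewrite inE wA.
  by apply: only_on_avoidr => w wA; apply: cc; rewrite inE wA orbT.
move=> M hM.
have eA w : w \in A -> edeg (H :\: (A :|: B)) w = edeg (H :\: A) w.
  move=> wA; apply: eq_card => y; rewrite !inE; case yB: (y \in B); rewrite ?orbT ?orbF //=.
  by rewrite (negPf (sep w y wA yB)) andbF.
have eB w : w \in B -> edeg (H :\: (A :|: B)) w = edeg (H :\: B) w.
  move=> wB; apply: eq_card => y; rewrite !inE; case yA: (y \in A); rewrite //=.
  by rewrite e_sym (negPf (sep y w yA wB)) andbF.
have mA w : w \in A -> (na < #|M w|)%N.
  move=> wA; have [|_] := hM w _; first by rewrite inE wA.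
  by rewrite eA //; have := hLA w wA; clear; lia.
have mB w : w \in B -> (nb < #|M w|)%N.
  move=> wB; have [|_] := hM w _; first by rewrite inE wB orbT.
  by rewrite eB //; have := hLB w wB; clear; lia.
have cp (D : {set V}) n : (#|D| <= n)%N -> (forall w, w \in D -> (n < #|M w|)%N) -> 0 < count D M.
  move=> Dn hD; apply: (count_gt0 c0 e_sym e_irr) => v vD.
  apply: leq_ltn_trans (hD v vD); apply: leq_trans Dn; apply: subset_leq_card.
  by apply/subsetP=> y; rewrite inE => /andP[].
have [An A2] := andP hA; have [Bn B2] := andP hB.
have pA := cp A na An mA; have pB := cp B nb Bn mB.
have := hgh _ _ (profileP hA pA mA) (profileP hB pB mB) => h.
rewrite csum_bigsum; under eq_bigr do rewrite csum_bigsum.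
have -> : \sum_i \sum_j csum (A :|: B) M (fun c => coef i j * (avoidr A i c * avoidr B j c)) =
   count A M * count B M * \sum_i \sum_j coef i j *
     (csum A M (avoidr A i) / count A M * (csum B M (avoidr B j) / count B M)).
  rewrite mulr_sumr; apply: eq_bigr => i _; rewrite mulr_sumr; apply: eq_bigr => j _.
  rewrite csum_scale (@csum_only0 _ _ _ _ A B) //; last first.
  - exact: only_on_avoidr.
  - exact: only_on_avoidr.
  by field; rewrite !gt_eqF.
by rewrite !mulr_ge0 // ltW.
Qed.

End Pair.
End PairProfiles.

(** * Comparison of two mixtures with three components *)

Module KagomeCosts.
Import Colourings EdgeBounds SpatialMixing Locality.
Import Order.TTheory GRing.Theory Num.Theory.
Local Open Scope ring_scope.

(** A coupling: matched mass [ms] costs nothing because both sides have the same value [sg], matched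
    masses [ma] and [mb] cost [B1] and [B2], and unmatched mass costs at most the length [B1 + B2]
    of the common range. *)
Lemma pair_cost (s a b s' a' b' sg f1 f1' f2 f2' lo B1 B2 ms ma mb : rat) :
  s + a + b = 1 -> s' + a' + b' = 1 ->
  ms <= s -> ms <= s' -> ma <= a -> ma <= a' -> mb <= b -> mb <= b' ->
  0 <= ma -> 0 <= mb ->
  lo <= sg <= lo + (B1 + B2) -> lo <= f1 <= lo + (B1 + B2) -> lo <= f1' <= lo + (B1 + B2) ->
  lo <= f2 <= lo + (B1 + B2) -> lo <= f2' <= lo + (B1 + B2) ->
  `|f1 - f1'| <= B1 -> `|f2 - f2'| <= B2 ->
  `|(s * sg + a * f1 + b * f2) - (s' * sg + a' * f1' + b' * f2')| <=
  ma * B1 + mb * B2 + (1 - ms - ma - mb) * (B1 + B2).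
Proof.
move=> h1 h2 sm sm' am am' bm bm' ma0 mb0 /andP[g1 g2] /andP[p1 p2] /andP[p1' p2'] /andP[q1 q2] /andP[q1' q2'].
rewrite !ler_norml => /andP[u1 u2] /andP[v1 v2].
have m1 := mulr_ge0 ma0 (_ : 0 <= B1 - (f1 - f1')).
have m2 := mulr_ge0 ma0 (_ : 0 <= B1 + (f1 - f1')).
have m3 := mulr_ge0 mb0 (_ : 0 <= B2 - (f2 - f2')).
have m4 := mulr_ge0 mb0 (_ : 0 <= B2 + (f2 - f2')).
have {}m1 := m1 ltac:(lra). have {}m2 := m2 ltac:(lra).
have {}m3 := m3 ltac:(lra). have {}m4 := m4 ltac:(lra).
have P x y : 0 <= x -> 0 <= y -> 0 <= x * y :> rat by exact: mulr_ge0.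
have k1 := P (s - ms) (lo + (B1 + B2) - sg) ltac:(lra) ltac:(lra).
have k2 := P (a - ma) (lo + (B1 + B2) - f1) ltac:(lra) ltac:(lra).
have k3 := P (b - mb) (lo + (B1 + B2) - f2) ltac:(lra) ltac:(lra).
have k4 := P (s' - ms) (sg - lo) ltac:(lra) ltac:(lra).
have k5 := P (a' - ma) (f1' - lo) ltac:(lra) ltac:(lra).
have k6 := P (b' - mb) (f2' - lo) ltac:(lra) ltac:(lra).
have l1 := P (s' - ms) (lo + (B1 + B2) - sg) ltac:(lra) ltac:(lra).
have l2 := P (a' - ma) (lo + (B1 + B2) - f1') ltac:(lra) ltac:(lra).
have l3 := P (b' - mb) (lo + (B1 + B2) - f2') ltac:(lra) ltac:(lra).
have l4 := P (s - ms) (sg - lo) ltac:(lra) ltac:(lra).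
have l5 := P (a - ma) (f1 - lo) ltac:(lra) ltac:(lra).
have l6 := P (b - mb) (f2 - lo) ltac:(lra) ltac:(lra).
have e1 : b = 1 - s - a by lra. have e2 : b' = 1 - s' - a' by lra.
by apply/andP; split; nra.
Qed.

(* The four regimes of the comparison of two normalised weight vectors; u and w
   bound B1 and B2. *)
Lemma pair_cost_case (s a b s' a' b' sg f1 f1' f2 f2' lo B1 B2 X u w : rat) :
  s + a + b = 1 -> s' + a' + b' = 1 -> 0 <= a -> 0 <= b -> 0 <= a' -> 0 <= b' ->
  0 <= s -> s <= s' -> 0 <= u -> 0 <= w -> 0 <= X ->
  lo <= sg <= lo + (B1 + B2) -> lo <= f1 <= lo + (B1 + B2) -> lo <= f1' <= lo + (B1 + B2) ->
  lo <= f2 <= lo + (B1 + B2) -> lo <= f2' <= lo + (B1 + B2) ->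
  `|f1 - f1'| <= B1 -> `|f2 - f2'| <= B2 -> B1 <= u * X -> B2 <= w * X ->
  [\/ [/\ u = 1, w = 1, 1/4 <= s, 8 * s' <= 15 * s & (b - b' <= 7/8 * s) /\ (a - a' <= 7/8 * s)],
      [/\ u = 61/100, w = 1, 2/9 <= s, 2 * s' <= 5 * s & [/\ 2 * b <= 3 * s, a <= 2 * s & 5/8 * a <= 77/80 * s + a']],
      [/\ u = 61/100, w = 61/100 & 1/5 <= s] |
      [/\ u = 0, w <= 1 & 1/6 <= s]] ->
  `|(s * sg + a * f1 + b * f2) - (s' * sg + a' * f1' + b' * f2')| <= 197/200 * X.
Proof.
move=> h1 h2 a0 b0 a0' b0' s0 ss u0 w0 X0 g1 p1 p1' q1 q1' u1 v1 B1u B2w cs.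
have B10 : 0 <= B1 := le_trans (normr_ge0 _) u1.
have B20 : 0 <= B2 := le_trans (normr_ge0 _) v1.
have key ma mb : 0 <= ma -> 0 <= mb -> ma <= a -> ma <= a' -> mb <= b -> mb <= b' ->
   ma * u + mb * w + (1 - s - ma - mb) * (u + w) <= 197/200 ->
   `|(s * sg + a * f1 + b * f2) - (s' * sg + a' * f1' + b' * f2')| <= 197/200 * X.
  move=> m1 m2 m3 m4 m5 m6 le.
  apply: le_trans (pair_cost (ms := s) (ma := ma) (mb := mb) h1 h2 (lexx s) ss m3 m4 m5 m6 m1 m2 g1 p1 p1' q1 q1' u1 v1) _.
  have r0 : 0 <= 1 - s - ma - mb by lra.
  apply: le_trans (_ : (ma * u + mb * w + (1 - s - ma - mb) * (u + w)) * X <= _); last by rewrite ler_wpM2r.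
  have t1 : ma * B1 <= ma * (u * X) by rewrite ler_wpM2l.
  have t2 : mb * B2 <= mb * (w * X) by rewrite ler_wpM2l.
  have t3 : (1 - s - ma - mb) * (B1 + B2) <= (1 - s - ma - mb) * (u * X + w * X) by rewrite ler_wpM2l // lerD.
  by apply: le_trans (lerD (lerD t1 t2) t3) _; rewrite le_eqVlt; apply/orP; left; apply/eqP; ring.
(* [ma] and [mb] are taken as the minima of the two weights, the largest masses that can be
   matched. *)
case: (lerP a a') => ha; case: (lerP b b') => hb.
- apply: (key a b); [exact: a0|exact: b0|exact: lexx|exact: ha|exact: lexx|exact: hb|].
  by case: cs => [[-> -> *]|[-> -> *]|[-> -> *]|[-> w1 *]]; nra.
- apply: (key a b'); [exact: a0|exact: b0'|exact: lexx|exact: ha|exact: ltW hb|exact: lexx|].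
  by case: cs => [[-> -> ? ? [? ?]]|[-> -> ? ? [? ? ?]]|[-> -> ?]|[-> w1 ?]]; nra.
(* The second regime is tight here. The cost is [b + 161/100 * a - a'], and
   [161/100 - 5/8 = 197/200]; since [b <= 3/2 * s], the coefficient of [s] may be
   [197/200 - 3/2 * 3/200 = 77/80]. *)
- apply: (key a' b); [exact: a0'|exact: b0|exact: ltW ha|exact: lexx|exact: lexx|exact: hb|].
  by case: cs => [[-> -> ? ? [? ?]]|[-> -> ? ? [? ? ?]]|[-> -> ?]|[-> w1 ?]]; nra.
- apply: (key a' b'); [exact: a0'|exact: b0'|exact: ltW ha|exact: lexx|exact: ltW hb|exact: lexx|].
  by case: cs => [[-> -> ? ? [? ?]]|[-> -> ? ? [? ? ?]]|[-> -> ?]|[-> w1 ?]]; nra.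
Qed.
End KagomeCosts.

(** * Weights of the colour pairs on two adjacent corners of a triangle *)

Module KagomeWeights.
Import Colourings EdgeBounds SpatialMixing Locality PairProfiles KagomeCosts.
Import Order.TTheory GRing.Theory Num.Theory.
Local Open Scope ring_scope.

Section Profiles.
Variable C : finType.
Implicit Types (g h : C -> rat) (K L : {set C}).

Lemma profile_W (m n : nat) g : (m <= n)%N -> profile m g -> profile n g.
Proof.
move=> mn [h1 h2]; split; last by apply: le_trans h2 _; rewrite ler_nat.
move=> k; have /andP[l u] := h1 k; rewrite u andbT; apply: le_trans l.
by rewrite lef_pV2 ?posrE ?ltr0n // ler_nat ltnS.
Qed.

Lemma profile_sum_lb n g K : profile n g -> #|K|%:R - n%:R <= \sum_(i in K) g i.
Proof.
move=> [h1 h2]; have : \sum_(i in K) (1 - g i) <= n%:R.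
  apply: le_trans h2; rewrite [leLHS]big_mkcond; apply: ler_sum => i _.
  by case: ifP => // _; have /andP[_ u] := h1 i; rewrite subr_ge0.
by rewrite sumrB sumr_const; lra.
Qed.

Lemma profile_sum_min n g K : profile n g -> #|K|%:R / n.+1%:R <= \sum_(i in K) g i.
Proof.
move=> [h1 h2]; rewrite mulr_natl -sumr_const; apply: ler_sum => i _.
by have /andP[] := h1 i.
Qed.

(** The total usage budget [n] is shared with [x] and [y]: what these two consume is not lost on
    [K]. *)
Lemma profile_sum2 n g K x y : profile n g -> x != y -> x \notin K -> y \notin K ->
  #|K|%:R - n%:R + (1 - g x) + (1 - g y) <= \sum_(i in K) g i.
Proof.
move=> p xy xK yK; have := profile_sum_lb (x |: (y |: K)) p.
rewrite !big_setU1 ?inE ?negb_or ?xy //= !cardsU1 !inE negb_or xy xK yK /= !natrD; lra.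
Qed.

(** The weight of the pairs of distinct colours on an edge whose ends see outside profiles [g] and
    [h]. *)
Definition Sgh K K' g h := \sum_(j in K') h j * \sum_(i in K | i != j) g i.

Lemma sum_neq K g j : \sum_(i in K | i != j) g i = \sum_(i in K :\ j) g i.
Proof. by apply: eq_bigl => i; rewrite !inE andbC. Qed.

Lemma Sgh_sym K K' g h : Sgh K K' g h = Sgh K' K h g.
Proof.
rewrite /Sgh; under eq_bigr do rewrite mulr_sumr.
rewrite (exchange_big_dep (mem K)) /=; last by move=> ? ? _ /andP[].
apply: eq_bigr => i iK; rewrite mulr_sumr.
rewrite (eq_bigl (fun j => (j \in K') && (j != i))) => [|j]; last by rewrite iK eq_sym.
by apply: eq_bigr => j _; rewrite mulrC.
Qed.

Lemma Sgh_lb n K K' g h D : profile n h -> (forall j, D <= \sum_(i in K | i != j) g i) ->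
  D * \sum_(j in K') h j <= Sgh K K' g h.
Proof.
move=> [hh _] hD; rewrite mulr_sumr; apply: ler_sum => j _; rewrite mulrC ler_wpM2l //.
by have /andP[l _] := hh j; apply: le_trans l; rewrite invr_ge0 ler0n.
Qed.

Lemma card_D1_ge K j : (#|K| <= #|K :\ j| + 1)%N.
Proof. by rewrite (cardsD1 j K) addnC leq_add2l leq_b1. Qed.

Lemma sum_other_min n g K j : profile n g ->
  (#|K|%:R - 1) / n.+1%:R <= \sum_(i in K | i != j) g i.
Proof.
move=> p; rewrite sum_neq; apply: le_trans (profile_sum_min _ p).
rewrite ler_wpM2r ?invr_ge0 ?ler0n // lerBlDr -(natrD _ _ 1) ler_nat.
exact: card_D1_ge.
Qed.

Lemma sum_other_lb n g K j : profile n g ->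
  #|K|%:R - 1 - n%:R <= \sum_(i in K | i != j) g i.
Proof.
move=> p; rewrite sum_neq; apply: le_trans (profile_sum_lb _ p).
by rewrite lerD2r lerBlDr -(natrD _ _ 1) ler_nat; exact: card_D1_ge.
Qed.

(** Let [Gj j] be the sum of [g] over [K] without [j]. Expanding the sum of the nonnegative products
    [(h j - 1/3) * (Gj j - 2/3)] gives the bound, because the [Gj j] add up to at least
    [(#|K'| - 1) * G]: each colour of [K] is omitted at most once. *)
Lemma Sgh_22 K K' g h : profile 2 g -> profile 2 h -> (2 < #|K|)%N -> (2 < #|K'|)%N ->
  2/3 * (\sum_(i in K) g i + \sum_(j in K') h j - 1) <= Sgh K K' g h.
Proof.
move=> pg ph k3 k3'; set G := \sum_(i in K) g i; set H := \sum_(j in K') h j.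
pose Gj j := \sum_(i in K | i != j) g i.
have cK : 3 <= #|K|%:R :> rat by rewrite (ler_nat _ 3).
have cK' : 3 <= #|K'|%:R :> rat by rewrite (ler_nat _ 3).
have gl i : 3^-1 <= g i by have [/(_ i)/andP[]] := pg.
have hl i : 3^-1 <= h i by have [/(_ i)/andP[]] := ph.
have GjL j : 2/3 <= Gj j.
  by apply: le_trans (sum_other_min K j pg); rewrite ler_pdivlMr; lra.
have G1 : 1 <= G by apply: le_trans (profile_sum_min K pg); rewrite ler_pdivlMr; lra.
have sGj : (#|K'|%:R - 1) * G <= \sum_(j in K') Gj j.
  have -> : (#|K'|%:R - 1) * G = \sum_(j in K') G - G.
    by rewrite sumr_const -(mulr_natl G); ring.
  rewrite lerBlDr; apply: le_trans (_ : \sum_(j in K') (Gj j + (if j \in K then g j else 0)) <= _).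
    apply: ler_sum => j _; rewrite /Gj; case: ifP => jK.
      by rewrite /G (bigD1 j) //= addrC.
    rewrite addr0 /G le_eqVlt; apply/orP; left; apply/eqP; apply: eq_bigl => i.
    by case: (eqVneq i j) => [->|]; rewrite ?jK ?andbT.
  rewrite big_split /= lerD2l /G [leRHS]big_mkcond [leLHS]big_mkcond; apply: ler_sum => j _.
  by case: ifP => _; case: ifP => _ //; apply: le_trans (gl j); rewrite invr_ge0 ler0n.
have : 0 <= \sum_(j in K') (h j - 3^-1) * (Gj j - 2/3).
  by apply: sumr_ge0 => j _; apply: mulr_ge0; rewrite subr_ge0.
have -> : \sum_(j in K') (h j - 3^-1) * (Gj j - 2/3) =
   Sgh K K' g h - 2/3 * H - 3^-1 * \sum_(j in K') Gj j + #|K'|%:R * (2/9).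
  rewrite /Sgh /H !mulr_sumr -(sumr_const (mem K') (1 : rat)) mulr_suml -!sumrB -big_split /=.
  by apply: eq_bigr => j _; rewrite -/(Gj j); field.
move: sGj; set SG := \sum_(j in K') Gj j; set N := #|K'|%:R in cK' *; nra.
Qed.

End Profiles.

Section SideFacts.
Variables (C : finType) (L : {set C}) (x y : C).
Hypothesis xy : x != y.
Let K := L :\ x :\ y.
Variables (nv : nat) (g : C -> rat).
Hypothesis pg : profile nv g.
Let G := \sum_(i in K) g i.
Let gz z := if z \in L then g z else 0.

Lemma Kv_card : (#|L| = (x \in L) + (y \in L) + #|K|)%N.
Proof.
rewrite (cardsD1 x) (cardsD1 y (L :\ x)) addnA; congr (_ + _ + _)%N.
by rewrite !inE eq_sym xy.
Qed.

Lemma gz_range z : 0 <= gz z <= 1.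
Proof.
rewrite /gz; case: ifP => _; last by rewrite lexx ler01.
have [/(_ z)/andP[l u] _] := pg; rewrite u andbT; apply: le_trans l.
by rewrite invr_ge0 ler0n.
Qed.

Lemma G_ge0 : 0 <= G.
Proof.
apply: sumr_ge0 => i _; have [/(_ i)/andP[l u] _] := pg; apply: le_trans l.
by rewrite invr_ge0 ler0n.
Qed.

Lemma gz_min z : z \in L -> nv.+1%:R^-1 <= gz z.
Proof. by rewrite /gz => ->; have [/(_ z)/andP[]] := pg. Qed.

Lemma D_lb j : (3 <= #|L|)%N -> (nv = 1 -> 4 <= #|L|)%N -> (nv = 2 -> 5 <= #|L|)%N -> (nv <= 2)%N ->
  (if nv == 0 then 0 else if nv == 1 then 1/2 else 2/3) <= \sum_(i in K | i != j) g i.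
Proof.
move=> l0 l1 l2 n2; have := Kv_card; move: pg l1 l2; case: nv n2 => [|[|[|n]]] // _ p l1 l2 cK.
- by rewrite /=; apply: sumr_ge0 => i _; have [/(_ i)/andP[l u] _] := p; apply: le_trans l; rewrite invr_ge0 ler0n.
- rewrite /=; apply: le_trans (sum_other_min K j p).
  have : (2 <= #|K|)%N by move: (l1 erefl) cK; case: (x \in L); case: (y \in L); clear; lia.
  by rewrite -(ler_nat rat) => ?; rewrite ler_pdivlMr; lra.
- rewrite /=; apply: le_trans (sum_other_min K j p).
  have : (3 <= #|K|)%N by move: (l2 erefl) cK; case: (x \in L); case: (y \in L); clear; lia.
  by rewrite -(ler_nat rat) => ?; rewrite ler_pdivlMr; lra.
Qed.

End SideFacts.

Section Weights.
Variables (C : finType) (Lv Lw : {set C}) (x y : C).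
Hypothesis xy : x != y.
Let Kv := Lv :\ x :\ y.
Let Kw := Lw :\ x :\ y.
Implicit Type m : C -> C -> rat.

Lemma cKv : #|Lv| = ((x \in Lv) + (y \in Lv) + #|Kv|)%N.
Proof. exact: Kv_card. Qed.

(** The pairs of colours on the edge [v w], split into both outside [{x, y}] ([wS]), [v] coloured
    [z] ([wa]) and [w] coloured [z] ([wb]). All three are linear in [m], which is a product of
    profiles in this part and the actual number of completions later. *)
Definition wS m : rat := \sum_i \sum_j [&& i \in Kv, j \in Kw & i != j]%:R * m i j.
Definition wa z m : rat := \sum_i \sum_j [&& i == z, z \in Lv & j \in Kw]%:R * m i j.
Definition wb z m : rat := \sum_i \sum_j [&& j == z, z \in Lw & i \in Kv]%:R * m i j.

Lemma wSE g h : wS (fun i j => g i * h j) = Sgh Kv Kw g h.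
Proof.
rewrite /wS /Sgh exchange_big /= [RHS]big_mkcond; apply: eq_bigr => j _.
case: (boolP (j \in Kw)) => jK; last by rewrite big1 // => i _; rewrite andbF mul0r.
rewrite mulr_sumr [RHS]big_mkcond; apply: eq_bigr => i _; rewrite /=.
by case: ifP => _; rewrite ?mul0r // mul1r mulrC.
Qed.

Lemma waE z g h : wa z (fun i j => g i * h j) =
  (if z \in Lv then g z else 0) * \sum_(j in Kw) h j.
Proof.
rewrite /wa (bigD1 z) //= [X in _ + X]big1 ?addr0; last first.
  by move=> i iz; apply: big1 => j _; rewrite (negPf iz) mul0r.
rewrite eqxx /=; case: ifP => zL /=; last first.
  by rewrite mul0r; apply: big1 => j _; rewrite mul0r.
rewrite mulr_sumr [RHS]big_mkcond; apply: eq_bigr => j _.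
by case: ifP => _; rewrite ?mul0r ?mul1r.
Qed.

Lemma wbE z g h : wb z (fun i j => g i * h j) =
  (if z \in Lw then h z else 0) * \sum_(i in Kv) g i.
Proof.
rewrite /wb exchange_big /= (bigD1 z) //= [X in _ + X]big1 ?addr0; last first.
  by move=> i iz; apply: big1 => j _; rewrite (negPf iz) mul0r.
rewrite eqxx /=; case: ifP => zL /=; last first.
  by rewrite mul0r; apply: big1 => j _; rewrite mul0r.
rewrite mulr_sumr [RHS]big_mkcond; apply: eq_bigr => j _.
by case: ifP => _; rewrite ?mul0r ?mul1r // mulrC.
Qed.

Section Types.
Variables (nv nw : nat) (g h : C -> rat).
Hypotheses (pg : profile nv g) (ph : profile nw h) (nv2 : (nv <= 2)%N) (nw2 : (nw <= 2)%N).
Hypotheses (lv : (3 + nv <= #|Lv|)%N) (lw : (3 + nw <= #|Lw|)%N).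
Let m : C -> C -> rat := fun i j => g i * h j.
Let G := \sum_(i in Kv) g i.
Let H := \sum_(j in Kw) h j.
Let gz z := if z \in Lv then g z else 0.
Let hz z := if z \in Lw then h z else 0.

(** With no outside corner at [v] the profile [g] is constantly 1. The factor 5 is 2 from [S1] plus
    3 from [S2]. *)
Lemma type_zero : nv = 0%N -> (0 < nw)%N -> forall z, wa z m + wb z m <= 5 * wS m.
Proof.
move=> nv0 nw0 z; rewrite /m wSE waE wbE -/G -/H -/(gz z) -/(hz z).
have g1 i : g i = 1.
  have [/(_ i)/andP[l u] _] := pg; apply: le_anti; rewrite u /=.
  by apply: le_trans l; rewrite nv0 invr1.
have Dw j : 1/2 <= \sum_(i in Kw | i != j) h i.
  have l1 : (3 <= #|Lw|)%N by apply: leq_trans lw; rewrite leq_addr.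
  have l2 : (nw = 1 -> 4 <= #|Lw|)%N by move=> E; move: lw; rewrite E.
  have l3 : (nw = 2 -> 5 <= #|Lw|)%N by move=> E; move: lw; rewrite E.
  apply: le_trans (@D_lb _ _ x y xy nw h ph j l1 l2 l3 nw2).
  by case: (nw) nw0 => [|[|n]] //= _; lra.
have cK := cKv.
have gu := gz_range Lv pg z; have hu := gz_range Lw ph z.
have S1 : 1/2 * G <= Sgh Kv Kw g h.
  by rewrite Sgh_sym; apply: (Sgh_lb _ pg).
have H0 : 0 <= H := G_ge0 Lw x y ph.
have G0 : 0 <= G := G_ge0 Lv x y pg.
(* One colour [k] at [v] already gives the sum of [h] over the colours other than [k]. That sum is
   at least 1/2, and the omitted [h k] is at most 1, so it is at least a third of [H]. *)
have S2 : 1/3 * H <= Sgh Kv Kw g h.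
  have K1 : (1 <= #|Kv|)%N.
    by move: lv cK; case: (x \in Lv); case: (y \in Lv); clear; lia.
  have /card_gt0P[k kK] := K1.
  have D j : (if j == k then 0 else 1) <= \sum_(i in Kv | i != j) g i.
    case: eqP => [_|/eqP jk].
      by apply: sumr_ge0 => i _; rewrite g1 ler01.
    rewrite (bigD1 k) /=; last by rewrite kK eq_sym.
    rewrite g1 lerDl; apply: sumr_ge0 => i _; rewrite g1; exact: ler01.
  apply: le_trans (_ : \sum_(j in Kw) h j * (if j == k then 0 else 1) <= _); last first.
    apply: ler_sum => j _; apply: ler_wpM2l; last exact: D.
    by have [/(_ j)/andP[l u] _] := ph; apply: le_trans l; rewrite invr_ge0 ler0n.
  have -> : \sum_(j in Kw) h j * (if j == k then 0 else 1) = \sum_(j in Kw | j != k) h j.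
    rewrite [RHS]big_mkcondr; apply: eq_bigr => j _.
    by case: (eqVneq j k) => _; rewrite ?mulr0 ?mulr1.
  have hk : h k <= 1 by have [/(_ k)/andP[]] := ph.
  have : H <= \sum_(j in Kw | j != k) h j + h k.
    rewrite /H (bigID (fun j => j != k)) /= lerD2l.
    have hk0 : 0 <= h k by have [/(_ k)/andP[l u] _] := ph; apply: le_trans l; rewrite invr_ge0 ler0n.
    rewrite (eq_bigl (fun j => (j == k) && (k \in Kw))); last first.
      by move=> j; rewrite negbK andbC; case: eqP => // ->.
    case: (k \in Kw); last by rewrite big_pred0 // => j; rewrite andbF.
    by rewrite (eq_bigl (pred1 k)) ?big_pred1_eq // => j; rewrite andbT.
  by have := Dw k; lra.
move: gu hu; rewrite -/(gz z) -/(hz z) => /andP[a1 a2] /andP[b1 b2].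
have t1 : gz z * H <= 1 * H by apply: ler_wpM2r.
have t2 : hz z * G <= 1 * G by apply: ler_wpM2r.
lra.
Qed.

Hypotheses (nv1 : (0 < nv)%N) (nw1 : (0 < nw)%N).

Lemma Dv_lb j : 1/2 <= \sum_(i in Kv | i != j) g i.
Proof.
have l1 : (3 <= #|Lv|)%N by apply: leq_trans lv; rewrite leq_addr.
have l2 : (nv = 1 -> 4 <= #|Lv|)%N by move=> E; move: lv; rewrite E.
have l3 : (nv = 2 -> 5 <= #|Lv|)%N by move=> E; move: lv; rewrite E.
apply: le_trans (@D_lb _ _ x y xy nv g pg j l1 l2 l3 nv2).
by case: (nv) nv1 => [|[|n]] //= _; lra.
Qed.

Lemma Dw_lb j : (if nw == 1 then 1/2 else 2/3) <= \sum_(i in Kw | i != j) h i.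
Proof.
have l1 : (3 <= #|Lw|)%N by apply: leq_trans lw; rewrite leq_addr.
have l2 : (nw = 1 -> 4 <= #|Lw|)%N by move=> E; move: lw; rewrite E.
have l3 : (nw = 2 -> 5 <= #|Lw|)%N by move=> E; move: lw; rewrite E.
apply: le_trans (@D_lb _ _ x y xy nw h ph j l1 l2 l3 nw2).
by case: (nw) nw1 => [|[|n]].
Qed.

Lemma H0 : 0 <= H. Proof. exact: (G_ge0 Lw x y ph). Qed.
Lemma G0 : 0 <= G. Proof. exact: (G_ge0 Lv x y pg). Qed.

Lemma S_H : 1/2 * H <= Sgh Kv Kw g h.
Proof. by apply: (Sgh_lb _ ph); exact: Dv_lb. Qed.

Lemma S_G : (if nw == 1 then 1/2 else 2/3) * G <= Sgh Kv Kw g h.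
Proof. by rewrite Sgh_sym; apply: (Sgh_lb _ pg); exact: Dw_lb. Qed.

Lemma wa_le z : wa z m <= 2 * wS m.
Proof.
have hH := H0; have hG := G0.
rewrite /m wSE waE -/H -/(gz z); have /andP[a1 a2] := gz_range Lv pg z.
have t1 : gz z * H <= 1 * H by apply: ler_wpM2r.
by have := S_H; lra.
Qed.

Lemma wb_le z : wb z m <= (if nw == 1 then 2 else 3/2) * wS m.
Proof.
have hH := H0; have hG := G0.
rewrite /m wSE wbE -/G -/(hz z); have /andP[a1 a2] := gz_range Lw ph z.
have t1 : hz z * G <= 1 * G by apply: ler_wpM2r.
by have := S_G; case: ifP => _; lra.
Qed.

Section OneTwo.
Hypotheses (nvE : nv = 1%N) (nwE : nw = 2%N).
Hypothesis fullw : Lw = setT.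

(** If one of [x], [y] is absent from [Lv], then [Kv] has at least three colours; excluding [j] and
    the unit usage budget leaves 1. *)
Lemma missing z : z \in [set x; y] -> z \notin Lv -> forall j, 1 <= \sum_(i in Kv | i != j) g i.
Proof.
move=> zxy zL j; apply: le_trans (sum_other_lb Kv j pg).
have : (3 <= #|Kv|)%N.
  have := cKv; move: lv zL; rewrite nvE.
  by case/set2P: zxy => ->; case: (x \in Lv); case: (y \in Lv) => l n c //; move: l c; clear; lia.
by rewrite -(ler_nat rat) nvE => ?; lra.
Qed.

Lemma hz_min z : 1/3 <= hz z <= 1.
Proof.
rewrite /hz fullw inE; have [/(_ z)/andP[l u] _] := ph.
by rewrite u andbT; apply: le_trans l; rewrite nwE; lra.
Qed.

Lemma OT_ratio z z' : z \in [set x; y] -> z' \in [set x; y] ->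
  wS m + wa z m + wb z m <= 5/2 * (wS m + wa z' m + wb z' m).
Proof.
have hH := H0; have hG := G0.
move=> hz1 hz2; rewrite /m wSE !waE !wbE -/G -/H -/(gz z) -/(hz z) -/(gz z') -/(hz z').
have /andP[a1 a2] := hz_min z; have /andP[b1 b2] := hz_min z'.
have /andP[c1 c2] := gz_range Lv pg z; have sg := S_G; rewrite nwE /= in sg.
have sh := S_H.
have t1 : gz z * H <= 1 * H by apply: ler_wpM2r.
have t2 : hz z * G <= 1 * G by apply: ler_wpM2r.
have t3 : 1/3 * G <= hz z' * G by apply: ler_wpM2r.
have [zL|zL] := boolP (z' \in Lv).
  have t4 : 1/2 * H <= gz z' * H.
    apply: ler_wpM2r => //; apply: le_trans (gz_min pg zL); rewrite nvE; lra.
  lra.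
have sm : 1 * H <= Sgh Kv Kw g h by apply: (Sgh_lb _ ph); exact: missing hz2 zL.
have t4 : 0 <= gz z' * H by apply: mulr_ge0 => //; have /andP[] := gz_range Lv pg z'.
lra.
Qed.

(** The coefficients are dictated by the tight regime of [pair_cost_case]. Either [z'] is listed,
    and [wa z'] has at least half of [H], or [wa z'] vanishes and [missing] doubles the bound on
    [wS]. *)
Lemma OT_third z z' : z \in [set x; y] -> z' \in [set x; y] ->
  5/8 * wa z m <= 77/80 * wS m + wa z' m.
Proof.
have hH := H0; have hG := G0.
move=> hz1 hz2; rewrite /m wSE !waE -/H -/(gz z) -/(gz z').
have /andP[c1 c2] := gz_range Lv pg z; have sh := S_H.
have t1 : gz z * H <= 1 * H by apply: ler_wpM2r.
have [zL|zL] := boolP (z' \in Lv).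
  have t4 : 1/2 * H <= gz z' * H.
    apply: ler_wpM2r => //; apply: le_trans (gz_min pg zL); rewrite nvE; lra.
  lra.
have sm : 1 * H <= Sgh Kv Kw g h by apply: (Sgh_lb _ ph); exact: missing hz2 zL.
have t4 : 0 <= gz z' * H by apply: mulr_ge0 => //; have /andP[] := gz_range Lv pg z'.
lra.
Qed.
End OneTwo.

Section TwoTwo.
Hypotheses (nvE : nv = 2%N) (nwE : nw = 2%N).
Hypothesis fullv : Lv = setT.
Hypothesis fullw : Lw = setT.
Let n : rat := #|Kv|%:R.

Lemma n_eq : #|Kw|%:R = n.
Proof. by rewrite /n /Kv /Kw fullv fullw. Qed.

Lemma n_ge : 3 <= n.
Proof.
rewrite /n (ler_nat _ 3); have := cKv; move: lv; rewrite nvE.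
by case: (x \in Lv); case: (y \in Lv); clear; lia.
Qed.

Lemma TT_S : 2/3 * (G + H - 1) <= wS m.
Proof.
rewrite /m wSE; apply: Sgh_22.
- by rewrite -nvE.
- by rewrite -nwE.
- by have := n_ge; rewrite /n (ler_nat _ 3).
- by have := n_ge; rewrite -n_eq (ler_nat _ 3).
Qed.

Lemma TT_range (f : C -> rat) z : profile 2 f -> 1/3 <= f z <= 1.
Proof. by move=> [/(_ z)/andP[l u] _]; rewrite u andbT; apply: le_trans l; lra. Qed.

Lemma TT_G z : z \in [set x; y] -> n - 1 - gz z <= G.
Proof.
move=> zxy; rewrite /gz fullv inE.
have pg2 : profile 2 g by rewrite -nvE.
have xK : x \notin Kv by rewrite !inE eqxx andbF.
have yK : y \notin Kv by rewrite !inE eqxx.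
have := profile_sum2 pg2 xy xK yK; rewrite -/G -/n.
have /andP[_ u1] := TT_range x pg2; have /andP[_ u2] := TT_range y pg2.
by case/set2P: zxy => ->; lra.
Qed.

Lemma TT_H z : z \in [set x; y] -> n - 1 - hz z <= H.
Proof.
move=> zxy; rewrite /hz fullw inE.
have ph2 : profile 2 h by rewrite -nwE.
have xK : x \notin Kw by rewrite !inE eqxx andbF.
have yK : y \notin Kw by rewrite !inE eqxx.
have := profile_sum2 ph2 xy xK yK; rewrite -/H n_eq.
have /andP[_ u1] := TT_range x ph2; have /andP[_ u2] := TT_range y ph2.
by case/set2P: zxy => ->; lra.
Qed.

Lemma G_le : G <= n.
Proof.
rewrite /n -sumr_const; apply: ler_sum => i _.
by have [/(_ i)/andP[]] := pg.
Qed.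

Lemma H_le : H <= n.
Proof.
rewrite -n_eq -sumr_const; apply: ler_sum => i _.
by have [/(_ i)/andP[]] := ph.
Qed.

Lemma gz22 z : 1/3 <= gz z <= 1.
Proof. by rewrite /gz fullv inE; apply: TT_range; rewrite -nvE. Qed.
Lemma hz22 z : 1/3 <= hz z <= 1.
Proof. by rewrite /hz fullw inE; apply: TT_range; rewrite -nwE. Qed.

Lemma TT_sum z : wa z m + wb z m <= 3 * wS m.
Proof.
have hH := H0; have hG := G0.
have /andP[a1 a2] := gz22 z; have /andP[b1 b2] := hz22 z.
have sg := S_G; have sh : 2/3 * H <= Sgh Kv Kw g h.
  apply: (Sgh_lb _ ph) => j.
  have l1 : (3 <= #|Lv|)%N by apply: leq_trans lv; rewrite leq_addr.
  have l2 : (nv = 1 -> 4 <= #|Lv|)%N by rewrite nvE.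
  have l3 : (nv = 2 -> 5 <= #|Lv|)%N by move=> E; move: lv; rewrite E.
  by have := @D_lb _ _ x y xy nv g pg j l1 l2 l3 nv2; rewrite nvE.
rewrite nwE /= in sg; rewrite /m wSE waE wbE -/G -/H -/(gz z) -/(hz z).
have t1 : gz z * H <= 1 * H by apply: ler_wpM2r.
have t2 : hz z * G <= 1 * G by apply: ler_wpM2r.
lra.
Qed.

Lemma TT_ratio z z' : z \in [set x; y] -> z' \in [set x; y] ->
  8 * (wS m + wa z m + wb z m) <= 15 * (wS m + wa z' m + wb z' m).
Proof.
have hH := H0; have hG := G0.
move=> h1 h2; have := TT_S; rewrite /m !waE !wbE -/G -/H -/(gz z) -/(hz z) -/(gz z') -/(hz z').
have /andP[a1 a2] := gz22 z; have /andP[b1 b2] := hz22 z.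
have /andP[c1 c2] := gz22 z'; have /andP[d1 d2] := hz22 z'.
have g1 := TT_G h2; have q1 := TT_H h2; have n3 := n_ge.
have t1 : gz z * H <= 1 * H by apply: ler_wpM2r.
have t2 : hz z * G <= 1 * G by apply: ler_wpM2r.
set S := wS _; move=> hS.
have G1 : 1 <= G by lra. have H1 : 1 <= H by lra.
have t3 : 1/3 * H <= gz z' * H by apply: ler_wpM2r.
have t4 : 1/3 * G <= hz z' * G by apply: ler_wpM2r.
(* Above 8/15, a weight of [z'] times 15 covers 8 times the corresponding weight of [z], which is at
   most 1. Below it, [z'] consumes usage budget, so [TT_G] or [TT_H] enlarges [G] or [H], and with
   it [S]. *)
case: (lerP (gz z') (8/15)) => gs; case: (lerP (hz z') (8/15)) => hs.
- lra.
- have t5 : 8/15 * G <= hz z' * G by apply: ler_wpM2r; [exact: hG|exact: ltW].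
  lra.
- have t5 : 8/15 * H <= gz z' * H by apply: ler_wpM2r; [exact: hH|exact: ltW].
  lra.
- have t5 : 8/15 * G <= hz z' * G by apply: ler_wpM2r; [exact: hG|exact: ltW].
  have t6 : 8/15 * H <= gz z' * H by apply: ler_wpM2r; [exact: hH|exact: ltW].
  lra.
Qed.

Lemma TT_b z z' : z \in [set x; y] -> z' \in [set x; y] ->
  8 * (wb z m - wb z' m) <= 7 * wS m.
Proof.
have hH := H0; have hG := G0.
move=> h1 h2; have := TT_S; rewrite /m !wbE -/G -/(hz z) -/(hz z').
have /andP[b1 b2] := hz22 z; have /andP[d1 d2] := hz22 z'.
have q1 := TT_H h2; have n3 := n_ge; have gn := G_le.
set S := wS _; move=> hS.
have t2 : hz z * G <= 1 * G by apply: ler_wpM2r.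
(* The threshold solves [8 * (1 - t) = 7 * 2/3]: above it the bound [TT_S] with [H >= 1] suffices,
   below it [TT_H] makes [H] larger. *)
case: (lerP (hz z') (5/12)) => hs.
  have t4 : 1/3 * G <= hz z' * G by apply: ler_wpM2r.
  lra.
have t5 : 5/12 * G <= hz z' * G by apply: ler_wpM2r; [exact: hG|exact: ltW].
lra.
Qed.

Lemma TT_a z z' : z \in [set x; y] -> z' \in [set x; y] ->
  8 * (wa z m - wa z' m) <= 7 * wS m.
Proof.
have hH := H0; have hG := G0.
move=> h1 h2; have := TT_S; rewrite /m !waE -/H -/(gz z) -/(gz z').
have /andP[b1 b2] := gz22 z; have /andP[d1 d2] := gz22 z'.
have q1 := TT_G h2; have n3 := n_ge; have gn := H_le.
set S := wS _; move=> hS.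
have t2 : gz z * H <= 1 * H by apply: ler_wpM2r.
case: (lerP (gz z') (5/12)) => hs.
  have t4 : 1/3 * H <= gz z' * H by apply: ler_wpM2r.
  lra.
have t5 : 5/12 * H <= gz z' * H by apply: ler_wpM2r; [exact: hH|exact: ltW].
lra.
Qed.
End TwoTwo.
End Types.
End Weights.
End KagomeWeights.

(** * Decay of influence on Kagome subgraphs, triangle by triangle *)

Module KagomeDecay.
Import Colourings EdgeBounds SpatialMixing Locality PairProfiles KagomeCosts KagomeWeights.
Import Order.TTheory GRing.Theory Num.Theory.
Local Open Scope ring_scope.

Section Kagome.
Variables (V C : finType) (c0 : C) (e : rel V) (T : eqType) (cl : bool -> V -> T).
Hypothesis e_sym : symmetric e.
Hypothesis e_irr : irreflexive e.
(** [cl b v] names the triangle of type [b] containing [v]. A vertex belongs to one triangle of each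
    type, and lattice adjacency means sharing a triangle. *)
Definition klat : rel V := fun v w =>
  (v != w) && ((cl true v == cl true w) || (cl false v == cl false w)).
Hypothesis e_lat : forall v w, e v w -> klat v w.
Hypothesis C5 : (5 <= #|C|)%N.
Implicit Types (H A Q P I : {set V}) (L M : V -> {set C}) (c : {ffun V -> C}).

Definition mate (b : bool) H v := [set w in H | (w != v) && (cl b w == cl b v)].
Hypothesis mate_le : forall b v, (#|mate b setT v| <= 2)%N.
Hypothesis cl_inj : forall b v w, cl b v = cl b w -> cl (~~ b) v = cl (~~ b) w -> v = w.
Hypothesis no_square : forall b v w x y, cl b v = cl b w -> v != w ->
  cl (~~ b) x = cl (~~ b) v -> x != v -> cl (~~ b) y = cl (~~ b) w -> y != w ->
  cl b x != cl b y.

Notation csum := (csum c0 e).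
Notation count := (count c0 e).
Notation nbr := (nbr e).
Notation edeg := (edeg e).
Notation ldeg := (Colourings.edeg klat).
Notation cls := (cls klat 4).
Notation slk := (slk klat 4).
Notation prob := (prob c0 e).
Notation ball := (ball e).

Lemma klat_sym : symmetric klat.
Proof. by move=> v w; rewrite /klat eq_sym [cl true v == _]eq_sym [cl false v == _]eq_sym. Qed.

Let D_lt : (4 < #|C|)%N := C5.

Lemma klat_cl b v w : klat v w = (v != w) && ((cl b v == cl b w) || (cl (~~ b) v == cl (~~ b) w)).
Proof. by rewrite /klat; case: b => //=; rewrite orbC. Qed.

Lemma ldegE b H v : ldeg H v = (#|mate b H v| + #|mate (~~ b) H v|)%N.
Proof.
rewrite -cardsUI (_ : mate b H v :&: mate (~~ b) H v = set0) ?cards0 ?addn0.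
  apply: eq_card => w; rewrite !inE (klat_cl b) ![w == v]eq_sym ![_ == cl _ v]eq_sym.
  by case: (w \in H) => //=; case: (v != w).
apply/setP=> w; rewrite !inE; apply/negbTE/negP.
move=> /andP[/and3P[_ wv /eqP h1] /and3P[_ _ /eqP h2]].
by move/eqP: wv; apply; exact: cl_inj h1 h2.
Qed.

Lemma mate_leH b H v : (#|mate b H v| <= 2)%N.
Proof.
apply: leq_trans (mate_le b v); apply: subset_leq_card; apply/subsetP=> w.
by rewrite !inE => /andP[_].
Qed.

Definition seen b H v := mate b H v :&: nbr v.

Lemma nbr_split b H v : (H :\ v) :&: nbr v = seen b H v :|: seen (~~ b) H v.
Proof.
apply/setP=> w; rewrite !inE; case evw: (e v w); rewrite ?andbF ?andbT //=.
have := e_lat evw; rewrite (klat_cl b) => /andP[vw h].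
rewrite eq_sym in vw; rewrite vw; case: (w \in H) => //=.
by move: h; rewrite ![_ == cl _ w]eq_sym => ->.
Qed.

Lemma seen_sub b H v : seen b H v \subset mate b H v. Proof. exact: subsetIl. Qed.
Lemma seen_le b H v : (#|seen b H v| <= #|mate b H v|)%N.
Proof. exact: subset_leq_card (seen_sub _ _ _). Qed.

Lemma seenP b H v w : w \in seen b H v -> [/\ w \in H, w != v, cl b w = cl b v & e v w].
Proof. by rewrite !inE => /andP[/and3P[-> -> /eqP ->] ->]. Qed.

(** The apex [v], the other seen corner and the neighbours of [w] outside the triangle are distinct
    lattice neighbours of [w], so [cls] leaves room for all of them. *)
Lemma seen_list b H L v w : cls H L -> v \in H -> w \in seen b H v ->
  (#|seen b H v| + edeg ((H :\ v) :\: seen b H v) w < #|L w|)%N.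
Proof.
move=> c vH ws; have [wH wv cw evw] := seenP ws.
have := c w wH.
suff : (#|seen b H v| + edeg ((H :\ v) :\: seen b H v) w <= ldeg H w)%N by move: C5; clear; lia.
pose X := v |: (seen b H v :\ w); pose Y := [set y in (H :\ v) :\: seen b H v | e w y].
have <- : #|X| = #|seen b H v|.
  rewrite cardsU1 (cardsD1 w (seen b H v)) ws !inE eqxx /=.
  by rewrite !andbF.
have dis : [disjoint X & Y].
  rewrite -setI_eq0; apply/eqP/setP=> u; rewrite in_set0 in_setI; apply/negP=> /andP[uX].
  rewrite inE => /andP[/setDP[/setD1P[uv uH] us] ewu].
  case/setU1P: uX => [uE|/setD1P[_ us']]; first by rewrite uE eqxx in uv.
  by rewrite us' in us.
rewrite -[edeg _ _]/#|Y|.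
have := cardsUI X Y; rewrite (disjoint_setI0 dis) cards0 addn0 => <-.
apply: subset_leq_card; apply/subsetP=> u.
case/setUP; last first.
  by rewrite !inE => /andP[/andP[_ /andP[_ ->]]] /e_lat ->.
case/setU1P => [->|]; first by rewrite !inE vH klat_sym e_lat.
case/setD1P => uw /seenP[uH uv cu evu]; rewrite !inE uH (klat_cl b) eq_sym uw.
by rewrite cu cw eqxx.
Qed.

Definition nonadj P := [forall v in P, forall w in P, ~~ e v w].
Lemma nonadj2 v w : e v w = false -> nonadj [set v; w].
Proof.
move=> evw; apply/forall_inP=> a /set2P[]->; apply/forall_inP=> a' /set2P[]->;
  by rewrite ?e_irr ?evw // e_sym evw.
Qed.

(** [P] holds the corners left in a triangle without its apex, [Q] those where a colour is struck.
    The values make one step contract by 199/200: a single corner gives [3/5 <= 199/200 * 61/100];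
    an adjacent pair gives 197/200, and one corner of it 966/1000, both at most [199/200 * 99/100];
    two nonadjacent corners give 99/200 each, which needs the value 1 when both are struck. *)
Definition Phi P Q : rat :=
  if (#|P| <= 1)%N then 61/100 else if (Q == P) && nonadj P then 1 else 99/100.

Lemma Phi_range P Q : 61/100 <= Phi P Q <= 1.
Proof. by rewrite /Phi; case: ifP => _; [|case: ifP => _]; apply/andP; split; lra. Qed.

Definition cpart b (kap : T) H := [set w in H | cl b w == kap].

Variables (t : V) (k : C).

Definition tri_bound (r : nat) (X : rat) := forall H L b kap Q x y,
  (#|cpart b kap H| <= 2)%N -> Q \subset cpart b kap H -> cls H L ->
  (forall w, w \in cpart b kap H -> slk H L w) ->
  (forall w, w \in Q -> w \notin ball t r) ->
  `|prob H (rem L Q x) t k - prob H (rem L Q y) t k| <= X * Phi (cpart b kap H) Q.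

Section Step.
Variables (r : nat) (X : rat).
Hypothesis X0 : 0 <= X.
Hypothesis IH : tri_bound r X.

Definition Bd b H v : rat :=
  if mate b H v == set0 then 0 else X * Phi (mate b H v) (seen b H v).

Lemma Bd_ge0 b H v : 0 <= Bd b H v.
Proof.
rewrite /Bd; case: ifP => // _; apply: mulr_ge0 => //.
by have /andP[h _] := Phi_range (mate b H v) (seen b H v); lra.
Qed.

Lemma Bd_le b H v : Bd b H v <=
  (if #|mate b H v| == 0%N then 0 else if #|mate b H v| == 1%N then 61/100 else 1) * X.
Proof.
rewrite /Bd -cards_eq0; case: ifP => _; first by rewrite mul0r.
case: ifP => [/eqP E|_]; first by rewrite /Phi E leqnn mulrC lexx.
rewrite mul1r ler_piMr //; by have /andP[] := Phi_range (mate b H v) (seen b H v).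
Qed.

Lemma child b H H1 M v i j : v \notin ball t r.+1 -> cpart b (cl b v) H1 = mate b H v ->
  cls H1 M -> (forall w, w \in mate b H v -> slk H1 M w) ->
  `|prob H1 (rem M (seen b H v) i) t k - prob H1 (rem M (seen b H v) j) t k| <= Bd b H v.
Proof.
move=> vb E c s; rewrite /Bd; case: ifP => [/eqP m0|_].
  have E' a : prob H1 (rem M (seen b H v) a) t k = prob H1 M t k.
    by apply: eq_prob => w _; rewrite /rem /seen m0 set0I inE.
  by rewrite !E' subrr normr0.
rewrite -E; apply: IH => //; rewrite ?E ?mate_leH ?seen_sub //.
by move=> w /seenP[_ _ _]; move/ball_step; apply.
Qed.

Lemma cpart_D1 b H v : cpart b (cl b v) (H :\ v) = mate b H v.
Proof. by apply/setP=> w; rewrite !inE andbA; case: (w == v); rewrite ?andbF ?andbT. Qed.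

Lemma mate_slk b H L v w : cls H L -> v \in H -> w \in mate b H v -> slk (H :\ v) L w.
Proof.
move=> c vH; rewrite !inE => /and3P[wH wv /eqP cw].
by apply: slk_D1 => //; [exact: klat_sym|rewrite (klat_cl b) eq_sym wv cw eqxx].
Qed.

Lemma ball_neq v : v \notin ball t r.+1 -> v != t.
Proof. by apply: contraNneq => ->; exact: ball_center. Qed.

(** The best [nu] is [1 / (1 + ga)], the largest share of one colour when the others have total
    weight at least [ga]. The factors 1/2, 3/7, 3/5 and 2/3 below come from [ga] equal to 1, 4/3,
    2/3 and 1/2. *)
Lemma nu_of_gamma (nu ga Wz N Sm : rat) : 0 <= nu <= 1 -> 1 - nu <= nu * ga -> 0 <= Wz <= N ->
  ga * N <= Sm -> Wz <= nu * (Wz + Sm).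
Proof.
move=> /andP[n0 n1] h /andP[w0 wN] gs; have N0 : 0 <= N by exact: le_trans wN.
have t1 : (1 - nu) * Wz <= (1 - nu) * N by apply: ler_wpM2l; [lra|].
have t2 : (1 - nu) * N <= nu * ga * N by apply: ler_wpM2r.
have t3 : nu * (ga * N) <= nu * Sm by apply: ler_wpM2l.
lra.
Qed.

Lemma lone_step (nu : rat) b H L v x y : v \in H -> v \notin ball t r.+1 -> cls H L -> slk H L v ->
  seen b H v = set0 -> x != y -> 0 <= nu ->
  (forall z, csum (H :\ v) L (avoidr (seen (~~ b) H v) z) <= nu *
    (csum (H :\ v) L (avoidr (seen (~~ b) H v) z) +
     \sum_(a in L v :\ x :\ y) csum (H :\ v) L (avoidr (seen (~~ b) H v) a))) ->
  `|prob H (rem L [set v] x) t k - prob H (rem L [set v] y) t k| <= nu * Bd (~~ b) H v.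
Proof.
move=> vH vb c s s0 xy nu0 hW.
have Q0 : (H :\ v) :&: nbr v = seen (~~ b) H v by rewrite (nbr_split b) s0 set0U.
apply: (edge_step (Delta := 4) e_sym e_irr klat_sym e_lat D_lt vH (ball_neq vb) c s
   (B := Bd (~~ b) H v)); [ |exact: xy| | |].
- move=> a a' _ _.
  have E i : prob (H :\ v) (rem L (nbr v) i) t k = prob (H :\ v) (rem L (seen (~~ b) H v) i) t k.
    apply: eq_prob => w wH; rewrite /rem.
    by have -> : (w \in nbr v) = (w \in seen (~~ b) H v) by rewrite -Q0 [in RHS]inE wH.
  rewrite !E; apply: child => //; first exact: cpart_D1.
    exact: cls_D1.
  by move=> w; exact: mate_slk.
- by apply: mulr_ge0 => //; exact: Bd_ge0.
- exact: Bd_ge0.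
move=> z _ _; rewrite !count_rem Q0; under eq_bigr do rewrite count_rem Q0.
have h := hW z; have B0 := Bd_ge0 (~~ b) H v; rewrite [leRHS]mulrAC.
by apply: ler_wpM2r.
Qed.

Lemma others_card b H L v x y : v \in H -> slk H L v ->
  (#|mate b H v| + #|mate (~~ b) H v| <= #|L v :\ x :\ y|)%N.
Proof.
move=> vH s; have := card_others D_lt vH s x y; rewrite (ldegE b).
by move: C5; clear; lia.
Qed.

Lemma seen_sub_H b H v : seen b H v \subset H :\ v.
Proof. by apply/subsetP=> w /seenP[wH wv _ _]; rewrite !inE wv. Qed.

Lemma avoid_range H L A z : 0 <= csum H L (avoidr A z) <= count H L.
Proof. by rewrite csum_avoid_le csum_ge0 // => c; exact: avoidr_ge0. Qed.

Lemma lone_trivial b H L v x y : v \in H -> v \notin ball t r.+1 -> cls H L -> slk H L v ->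
  seen b H v = set0 -> x != y ->
  (#|mate (~~ b) H v| < #|L v :\ x :\ y|)%N ->
  `|prob H (rem L [set v] x) t k - prob H (rem L [set v] y) t k| <= 1/2 * Bd (~~ b) H v.
Proof.
move=> vH vb c s s0 xy lt; apply: (lone_step vH vb c s s0 xy) => [|z]; first by lra.
apply: (nu_of_gamma (ga := 1)) (avoid_range _ _ _ _) _; [by apply/andP; split; lra|lra|].
apply: (unused_trivial c0 e_sym e_irr L (kap := 1)); first exact: seen_sub_H.
by rewrite add1n; apply: leq_ltn_trans lt; exact: seen_le.
Qed.

Lemma lone_nonadj b H L v x y : v \in H -> v \notin ball t r.+1 -> cls H L -> slk H L v ->
  seen b H v = set0 -> x != y -> (2 < #|L v :\ x :\ y|)%N ->
  #|seen (~~ b) H v| = 2 -> nonadj (seen (~~ b) H v) ->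
  `|prob H (rem L [set v] x) t k - prob H (rem L [set v] y) t k| <= 3/7 * Bd (~~ b) H v.
Proof.
move=> vH vb c s s0 xy lt s2 na; apply: (lone_step vH vb c s s0 xy) => [|z]; first by lra.
apply: (nu_of_gamma (ga := 3%:R * (4/9) - 2%:R * 0)) (avoid_range _ _ _ _) _; [by apply/andP; split; lra|lra|].
rewrite -[X in _ - X%:R * _]s2.
apply: (unused_lb c0 e_sym e_irr (m := 3)); [exact: subxx|exact: seen_sub_H| |by []|lra|lra| | |].
- by move=> a a' ha ha'; move/forall_inP: na => /(_ a ha)/forall_inP/(_ a' ha').
- by move=> w /(seen_list c vH); rewrite s2.
- by rewrite setDv cards0 addn0.
- by rewrite s2 => -[|[|[|n]]] h; [lra|lra|lra|discriminate h].
Qed.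

Lemma lone_pair b H L v x y : v \in H -> v \notin ball t r.+1 -> cls H L -> slk H L v ->
  seen b H v = set0 -> x != y -> (1 < #|L v :\ x :\ y|)%N -> #|mate (~~ b) H v| = 2 ->
  `|prob H (rem L [set v] x) t k - prob H (rem L [set v] y) t k| <= 3/5 * Bd (~~ b) H v.
Proof.
move=> vH vb c s s0 xy lt m2; apply: (lone_step vH vb c s s0 xy) => [|z]; first by lra.
apply: (nu_of_gamma (ga := 2/3)) (avoid_range _ _ _ _) _; [by apply/andP; split; lra|lra|].
have N0 := count_ge0 c0 e (H :\ v) L.
have := seen_le (~~ b) H v; rewrite m2 leq_eqVlt => /orP[/eqP s2|s1]; last first.
  apply: le_trans (unused_trivial c0 e_sym e_irr L (kap := 1) (seen_sub_H _ _ _) _); first by lra.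
  by apply: leq_trans lt; rewrite add1n.
have h1 a : count (H :\ v) L <= 3 * csum (H :\ v) L (avoidr (seen (~~ b) H v) a).
  rewrite -subr_ge0 /Colourings.count -csum_scale -csum_opp -csum_add.
  apply: (csum_lift e_sym e_irr (seen_sub_H (~~ b) H v)).
    by move=> f f' ff; rewrite (@only_on_avoidr V C (seen (~~ b) H v) a f f' ff).
  move=> M hM; rewrite csum_add csum_opp csum_scale subr_ge0.
  have /cards2P[b1 [b2 [b12 E]]] : #|seen (~~ b) H v| == 2 by rewrite s2.
  have hl w : w \in seen (~~ b) H v -> (2 < #|M w|)%N.
    by move=> ws; have [_] := hM w ws; have := seen_list c vH ws; rewrite s2; clear; lia.
  by rewrite E; apply: pair_avoid => //; apply: hl; rewrite E !inE eqxx ?orbT.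
have : \sum_(a in L v :\ x :\ y) count (H :\ v) L <=
  \sum_(a in L v :\ x :\ y) 3 * csum (H :\ v) L (avoidr (seen (~~ b) H v) a) by apply: ler_sum.
rewrite sumr_const -mulr_sumr -(mulr_natl (count _ _)).
have : 2%:R * count (H :\ v) L <= #|L v :\ x :\ y|%:R * count (H :\ v) L.
  by apply: ler_wpM2r; rewrite // ler_nat.
lra.
Qed.

Lemma lone_single b H L v x y : v \in H -> v \notin ball t r.+1 -> cls H L -> slk H L v ->
  seen b H v = set0 -> x != y -> (0 < #|L v :\ x :\ y|)%N -> (#|mate (~~ b) H v| <= 1)%N ->
  `|prob H (rem L [set v] x) t k - prob H (rem L [set v] y) t k| <= 2/3 * Bd (~~ b) H v.
Proof.
move=> vH vb c s s0 xy lt m1; apply: (lone_step vH vb c s s0 xy) => [|z]; first by lra.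
have s1 := leq_trans (seen_le (~~ b) H v) m1.
apply: (nu_of_gamma (ga := 1%:R * (1/2) - #|seen (~~ b) H v|%:R * 0)) (avoid_range _ _ _ _) _; [by apply/andP; split; lra|lra|].
apply: (unused_lb c0 e_sym e_irr (m := 2)); [exact: subxx|exact: seen_sub_H| |by []|lra|lra| | |].
- move=> a a' ha ha'; have := card_le1_eqP s1 _ _ ha ha' => ->.
  by rewrite e_irr.
- move=> w ws; have := seen_list c vH ws.
  have : (0 < #|seen (~~ b) H v|)%N by apply/card_gt0P; exists w.
  by move: s1; clear; lia.
- by rewrite setDv cards0 addn0.
- by move=> n /leq_trans/(_ s1); case: n => [|[|n]] h; [lra|lra|discriminate h].
Qed.

Lemma cpart2P b kap H v w : cpart b kap H = [set v; w] -> v != w ->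
  [/\ v \in H, cl b v = kap & mate b H v = [set w]].
Proof.
move=> E vw; have : v \in cpart b kap H by rewrite E !inE eqxx.
rewrite inE => /andP[vH /eqP cv]; split=> //; apply/setP=> u.
have := congr1 (fun A : {set V} => u \in A) E; rewrite !inE cv => h.
case: (eqVneq u v) => [->|uv]; first by rewrite andbF (negPf vw).
by rewrite /= h (negPf uv).
Qed.

(** The corner acts only through its other triangle: with two corners there the factor is 3/5, with
    one it is [2/3 * 61/100], and with none there is no influence. *)
Lemma step_single b kap H L v x y : cpart b kap H = [set v] -> cls H L -> slk H L v ->
  v \notin ball t r.+1 -> x != y ->
  `|prob H (rem L [set v] x) t k - prob H (rem L [set v] y) t k| <= 3/5 * X.
Proof.
have X1 := X0.
move=> E c s vb xy; have : v \in cpart b kap H by rewrite E inE.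
rewrite inE => /andP[vH /eqP cv].
have m0 : mate b H v = set0.
  apply/setP=> u; have := congr1 (fun A : {set V} => u \in A) E; rewrite !inE cv => h.
  by case: (eqVneq u v) => [->|uv]; rewrite ?andbF //= h (negPf uv).
have s0 : seen b H v = set0 by rewrite /seen m0 set0I.
have cK := others_card b x y vH s; rewrite m0 cards0 add0n in cK.
have := Bd_le (~~ b) H v; have := mate_leH (~~ b) H v.
have B0 := Bd_ge0 (~~ b) H v.
case E2: #|mate (~~ b) H v| => [|[|[|n]]] n3 hB; last by discriminate n3.
- have {}hB : Bd (~~ b) H v <= 0 * X := hB.
  have {}B0 : Bd (~~ b) H v = 0 by apply: le_anti; rewrite B0 andbT; move: hB; rewrite mul0r.
  have hs : forall z, csum (H :\ v) L (avoidr (seen (~~ b) H v) z) <= 1 *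
    (csum (H :\ v) L (avoidr (seen (~~ b) H v) z) +
     \sum_(a in L v :\ x :\ y) csum (H :\ v) L (avoidr (seen (~~ b) H v) a)).
    move=> z; rewrite mul1r lerDl; apply: sumr_ge0 => a _.
    by have /andP[] := avoid_range (H :\ v) L (seen (~~ b) H v) a.
  by apply: le_trans (lone_step vH vb c s s0 xy ler01 hs) _; rewrite B0 mulr0; lra.
- have {}hB : Bd (~~ b) H v <= 61/100 * X := hB.
  rewrite E2 in cK; have m1 : (#|mate (~~ b) H v| <= 1)%N by rewrite E2.
  apply: le_trans (lone_single vH vb c s s0 xy cK m1) _; lra.
- have {}hB : Bd (~~ b) H v <= 1 * X := hB.
  rewrite E2 in cK; apply: le_trans (lone_pair vH vb c s s0 xy cK E2) _; lra.
Qed.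

(** The missing edge to [w] keeps a colour in reserve. If the other triangle has potential 1 it
    consists of two seen nonadjacent corners, where the factor is 3/7; otherwise its potential is at
    most 99/100 and the factor is 1/2. *)
Lemma step_alone b kap H L v w x y : cpart b kap H = [set v; w] -> v != w -> ~~ e v w ->
  cls H L -> slk H L v -> v \notin ball t r.+1 -> x != y ->
  `|prob H (rem L [set v] x) t k - prob H (rem L [set v] y) t k| <= 99/200 * X.
Proof.
have X1 := X0.
move=> E vw evw c s vb xy; have [vH cv mv] := cpart2P E vw.
have mvP u : (u \in mate b H v) = (u == w) by rewrite mv inE.
have s0 : seen b H v = set0.
  apply/setP=> u; rewrite [LHS]inE mvP [RHS]inE inE.
  by case: eqP => // ->; exact: negbTE.
have cK := others_card b x y vH s; rewrite mv cards1 add1n in cK.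
have [full|nfull] := boolP ((seen (~~ b) H v == mate (~~ b) H v) && nonadj (mate (~~ b) H v) && (#|mate (~~ b) H v| == 2)).
  have [/andP[/eqP E1 na] /eqP m2] := andP full; rewrite m2 in cK.
  have E3 : #|seen (~~ b) H v| = 2 by rewrite E1.
  have na' : nonadj (seen (~~ b) H v) by rewrite E1.
  apply: le_trans (lone_nonadj vH vb c s s0 xy cK E3 na') _.
  have := Bd_le (~~ b) H v; rewrite m2 => hB; have {}hB : Bd (~~ b) H v <= 1 * X := hB; lra.
apply: le_trans (lone_trivial vH vb c s s0 xy cK) _.
suff : Bd (~~ b) H v <= 99/100 * X by lra.
rewrite /Bd; case: ifP => _; first by apply: mulr_ge0; lra.
rewrite [leRHS]mulrC; apply: ler_wpM2l; [exact: X0|rewrite /Phi]; case: ifP => m1; first by lra.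
case: ifP => h; last by lra.
have m2 : #|mate (~~ b) H v| = 2.
  by have := mate_leH (~~ b) H v; move: m1; clear; lia.
by rewrite h m2 in nfull.
Qed.

(** Here [966/1000 = 3/5 * (1 + 61/100)]: recolouring [v] acts on its other triangle, at cost at
    most [X], and on [w], which is then alone in its triangle. *)
Lemma step_path b kap H L v w x y : cpart b kap H = [set v; w] -> v != w -> e v w ->
  cls H L -> slk H L v -> slk H L w -> v \notin ball t r.+1 -> x != y ->
  `|prob H (rem L [set v] x) t k - prob H (rem L [set v] y) t k| <= 966/1000 * X.
Proof.
have X1 := X0.
move=> E vw evw c s sw vb xy; have [vH cv mv] := cpart2P E vw.
have [wH cw mw] : [/\ w \in H, cl b w = kap & mate b H w = [set v]].
  by apply: cpart2P; rewrite 1?setUC // eq_sym.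
have mvP u : (u \in mate b H v) = (u == w) by rewrite mv inE.
have sv : seen b H v = [set w].
  apply/setP=> u; rewrite [LHS]inE mvP [RHS]inE inE.
  by case: eqP => // ->; rewrite evw.
have Q0 : (H :\ v) :&: nbr v = w |: seen (~~ b) H v by rewrite (nbr_split b) sv.
have wns : w \notin seen (~~ b) H v.
  apply/negP=> /seenP[_ wv cw' _]; move/eqP: vw; apply.
  by apply: (cl_inj (b := b)); rewrite ?cv ?cw.
have wHv : w \in H :\ v by rewrite !inE eq_sym vw.
have Bw : Bd (~~ b) H v <= X.
  by apply: le_trans (Bd_le _ _ _) _; rewrite -[leRHS]mul1r; apply: ler_wpM2r => //; case: ifP => _; [|case: ifP => _]; lra.
apply: (edge_step (Delta := 4) e_sym e_irr klat_sym e_lat D_lt vH (ball_neq vb) c s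
   (B := Bd (~~ b) H v + X * (61/100))); [ |exact: xy| | |].
- move=> a a' _ _.
  have E1 i : prob (H :\ v) (rem L (nbr v) i) t k =
      prob (H :\ v) (rem (rem L [set w] i) (seen (~~ b) H v) i) t k.
    apply: eq_prob => u uH; rewrite /rem.
    have -> : (u \in nbr v) = (u \in w |: seen (~~ b) H v) by rewrite -Q0 [in RHS]inE uH.
    rewrite !inE; case: (eqVneq u w) => [->|] //=.
    by move: wns; rewrite !inE => /negbTE ->.
  have E2 i j : prob (H :\ v) (rem (rem L [set w] i) (seen (~~ b) H v) j) t k =
      prob (H :\ v) (rem (rem L (seen (~~ b) H v) j) [set w] i) t k.
    apply: eq_prob => u uH; rewrite /rem !inE; case: (eqVneq u w) => [->|] //=.
    by move: wns; rewrite !inE => /negbTE ->.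
  rewrite !E1 -(subrKA (prob (H :\ v) (rem (rem L [set w] a) (seen (~~ b) H v) a') t k)).
  apply: le_trans (ler_normD _ _) _; apply: lerD.
    apply: child => //; first exact: cpart_D1.
      by apply: (cls_slk_rem1 D_lt); [exact: cls_D1|exact: slk_D1W].
    move=> u um; apply: slk_rem1; first exact: (mate_slk c vH um).
    apply: contraTneq um => ->; rewrite !inE wH eq_sym vw /=.
    apply/eqP=> h; move/eqP: vw; apply; apply: (cl_inj (b := b)); rewrite ?cv ?cw //.
  rewrite !E2.
  have EP : cpart b kap (H :\ v) = [set w].
    by rewrite -cv cpart_D1 mv.
  have := IH (H := H :\ v) (L := rem L (seen (~~ b) H v) a') (b := b) (kap := kap) (Q := [set w]) a a'.
  rewrite EP cards1 subxx /Phi cards1 leqnn; apply; [by []|by []| | |].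
  + apply: (cls_rem D_lt); first exact: cls_D1.
    by move=> u uH us; exact: (mate_slk c vH (subsetP (seen_sub _ _ _) u us)).
  + move=> u /set1P ->; have := slk_D1W v sw; rewrite /SpatialMixing.slk /rem.
    by rewrite (negPf wns).
  + by move=> u /set1P ->; exact: ball_step vb.
- by lra.
- by apply: addr_ge0; [exact: Bd_ge0|lra].
move=> z _ _; rewrite !count_rem Q0; under eq_bigr do rewrite count_rem Q0.
have hW : csum (H :\ v) L (avoidr (w |: seen (~~ b) H v) z) <= 3/5 *
  (csum (H :\ v) L (avoidr (w |: seen (~~ b) H v) z) +
   \sum_(a in L v :\ x :\ y) csum (H :\ v) L (avoidr (w |: seen (~~ b) H v) a)).
  apply: (nu_of_gamma (ga := 1%:R * (2/3) - #|[set w]|%:R * 0)) (avoid_range _ _ _ _) _; [by apply/andP; split; lra|lra|].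
  apply: (unused_lb c0 e_sym e_irr (m := 3)); [|rewrite -Q0; exact: subsetIl| |by []|lra|lra| | |].
  - by rewrite sub1set !inE eqxx.
  - by move=> u u' /set1P -> /set1P ->; rewrite e_irr.
  - move=> u /set1P ->; have := sw; rewrite /SpatialMixing.slk (edegD1 klat w vH) klat_sym e_lat //.
    have : (edeg ((H :\ v) :\: [set w]) w <= ldeg (H :\ v) w)%N.
      apply: leq_trans (edeg_le e_lat _ _); apply: subset_leq_card; apply/subsetP=> u'.
      by rewrite !inE => /andP[/andP[_ ->] ->].
    by move: C5; clear; lia.
  - rewrite setDUl setDv set0U; have := others_card b x y vH s; rewrite mv cards1.
    have : (#|seen (~~ b) H v :\: [set w]| <= #|mate (~~ b) H v|)%N.
      by apply: leq_trans (seen_le _ _ _); apply: subset_leq_card; exact: subsetDl.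
    by clear; lia.
  - by rewrite cards1 => -[|[|n]] h; [lra|lra|discriminate h].
move: hW; set Wz := csum _ _ _; set Sm := \sum_(a in _) _; move=> hW.
have W0 : 0 <= Wz by have /andP[] := avoid_range (H :\ v) L (w |: seen (~~ b) H v) z.
have S0 : 0 <= Sm by apply: sumr_ge0 => a _; have /andP[] := avoid_range (H :\ v) L (w |: seen (~~ b) H v) a.
apply: le_trans (_ : Wz * (161/100 * X) <= _).
  by apply: ler_wpM2l; [exact: W0|lra].
have : Wz * X <= 3/5 * (Wz + Sm) * X by apply: ler_wpM2r; [exact: X1|exact: hW].
lra.
Qed.

Section Side.
Variables (b : bool) (kap : T) (H : {set V}) (L : V -> {set C}) (v w : V) (x y : C).
Hypothesis EP : cpart b kap H = [set v; w].
Hypothesis vw : v != w.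
Hypothesis evw : e v w.
Hypothesis c : cls H L.
Hypothesis sv : slk H L v.
Hypothesis sw : slk H L w.
Hypothesis vb : v \notin ball t r.+1.
Hypothesis wb : w \notin ball t r.+1.

Definition H0 := H :\ v :\ w.
Let Qv := seen (~~ b) H v.
Let Qw := seen (~~ b) H w.
Definition M2 i j := rem (rem L Qv i) Qw j.

Let vF : [/\ v \in H, cl b v = kap & mate b H v = [set w]]. Proof. exact: cpart2P EP vw. Qed.
Let wF : [/\ w \in H, cl b w = kap & mate b H w = [set v]].
Proof. by apply: cpart2P; rewrite 1?setUC // eq_sym. Qed.
Let vH : v \in H. Proof. by case: vF. Qed.
Let wH : w \in H. Proof. by case: wF. Qed.

Lemma cl_diff : cl (~~ b) v != cl (~~ b) w.
Proof.
apply/eqP=> h; move/eqP: vw; apply; have [_ cv _] := vF; have [_ cw _] := wF.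
by apply: (cl_inj (b := b)); rewrite ?cv ?cw.
Qed.

Lemma Qv_neq u : u \in mate (~~ b) H v -> [/\ u \in H0, u \notin Qw & u \notin mate (~~ b) H w].
Proof.
rewrite !inE => /and3P[uH uv /eqP cu]; rewrite uH uv cu (negPf cl_diff) !andbF /= !andbT; split=> //.
by apply/eqP=> uw; move: cl_diff; rewrite -cu uw eqxx.
Qed.

Lemma nbr_v u : u \in H0 -> (u \in nbr v) = (u \in Qv).
Proof.
rewrite !inE => /and3P[uw uv uH]; have /setP/(_ u) := nbr_split b H v.
have [_ _ mv] := vF; rewrite in_setU /seen mv !inE uH uv (negPf uw) /= => ->.
by case: (_ == _).
Qed.

Lemma nbr_w u : u \in H0 -> (u \in nbr w) = (u \in Qw).
Proof.
rewrite !inE => /and3P[uw uv uH]; have /setP/(_ u) := nbr_split b H w.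
have [_ _ mw] := wF; rewrite in_setU /seen mw !inE uH uw (negPf uv) /= => ->.
by case: (_ == _).
Qed.

Lemma cls0 : cls H0 L. Proof. by apply: cls_D1; exact: cls_D1. Qed.
Lemma H0C : H0 = H :\ w :\ v. Proof. by rewrite /H0 !setDDl setUC. Qed.

Lemma slk_v u : u \in mate (~~ b) H v -> slk H0 L u.
Proof. by move=> um; apply: slk_D1W; apply: mate_slk um. Qed.
Lemma slk_w u : u \in mate (~~ b) H w -> slk H0 L u.
Proof. by rewrite H0C => um; apply: slk_D1W; apply: mate_slk um. Qed.

Lemma cls_v i : cls H0 (rem L Qv i).
Proof.
apply: (cls_rem D_lt); first exact: cls0. move=> u _ uQ; apply: slk_v.
exact: (subsetP (seen_sub _ _ _)) uQ.
Qed.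
Lemma cls_w i : cls H0 (rem L Qw i).
Proof.
apply: (cls_rem D_lt); first exact: cls0. move=> u _ uQ; apply: slk_w.
exact: (subsetP (seen_sub _ _ _)) uQ.
Qed.

Lemma cls_vw i j : cls H0 (M2 i j).
Proof.
apply: (cls_rem D_lt); first exact: cls_v. move=> u _ uQ.
have um := subsetP (seen_sub _ _ _) u uQ.
have := slk_w um; rewrite /SpatialMixing.slk /rem.
case: ifP => // uQv; have [_] := Qv_neq (subsetP (seen_sub _ _ _) u uQv).
by rewrite uQ.
Qed.

Lemma p_diff i i' j :
  `|prob H0 (M2 i j) t k - prob H0 (M2 i' j) t k| <= Bd (~~ b) H v.
Proof.
have E a : prob H0 (M2 a j) t k = prob H0 (rem (rem L Qw j) Qv a) t k.
  apply: eq_prob => u _; rewrite /M2 /rem; case: (u \in Qw); case: (u \in Qv) => //.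
  by rewrite !setDDl setUC.
rewrite !E; apply: child => //.
- apply/setP=> u; have := Qv_neq (u := u); rewrite !inE.
  case: (u \in H) => //=; rewrite ?andbF //; case: (u == v); rewrite ?andbF //= ?andbT.
  by case: (cl _ u == _); rewrite ?andbF // => /(_ isT)[-> _ _].
- exact: cls_w.
move=> u um; have := slk_v um; rewrite /SpatialMixing.slk /rem.
by have [_ /negbTE -> _] := Qv_neq um.
Qed.

Definition invariant2 (f : {ffun V -> C} -> rat) :=
  (forall d a, f (upd d v a) = f d) /\ (forall d a, f (upd d w a) = f d).

Lemma invariant2_one : invariant2 (fun=> 1). Proof. by []. Qed.
Lemma invariant2_is_at : invariant2 (is_at t k).
Proof.
by split=> d a; rewrite /is_at ffunE [t == _]eq_sym ?(negPf (ball_neq vb)) ?(negPf (ball_neq wb)).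
Qed.

Lemma split_vw f z : invariant2 f -> csum H (rem L [set v; w] z) f =
  \sum_(i in L v :\ z) \sum_(j in L w :\ z | j != i) csum H0 (M2 i j) f.
Proof.
move=> [fv fw]; rewrite (csum_peel c0 e_sym e_irr _ _ vH).
have -> : rem L [set v; w] z v = L v :\ z by rewrite /rem !inE eqxx.
apply: eq_bigr => i _; rewrite (eq_csum_fun c0 e _ _ (fun d => fv d i)).
have wHv : w \in H :\ v by rewrite !inE eq_sym vw.
rewrite (csum_peel c0 e_sym e_irr _ _ wHv).
have -> : rem (rem L [set v; w] z) (nbr v) i w = L w :\ z :\ i by rewrite /rem !inE evw eqxx orbT.
rewrite [LHS](eq_bigl (fun j => (j \in L w :\ z) && (j != i))); last first.
  by move=> j; rewrite !inE; case: (j == i); rewrite ?andbF ?andbT.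
apply: eq_bigr => j _; rewrite (eq_csum_fun c0 e _ _ (fun d => fw d j)).
apply: eq_csum_lists => u uH; have uH' := uH; rewrite !inE in uH'.
case/and3P: uH' => uw uv _; rewrite /M2 {1 2 3}/rem [in RHS]/rem (nbr_v uH) (nbr_w uH) !inE (negPf uw) (negPf uv).
by [].
Qed.

Definition L2 := rem (rem L [set w] x) [set w] y.

Lemma wQv : w \notin Qv.
Proof. by apply/negP=> /(subsetP (seen_sub _ _ _))/Qv_neq[]; rewrite !inE eqxx. Qed.

Lemma cls_L2 : cls (H :\ v) L2.
Proof.
move=> u uHv; rewrite /L2 /rem in_set1; case: (eqVneq u w) => [->|uw]; last first.
  exact: (@cls_D1 _ _ _ _ _ _ v c u uHv).
have := sw; rewrite /SpatialMixing.slk (edegD1 klat w vH) klat_sym e_lat //.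
have := cardsD1 x (L w); have := cardsD1 y (L w :\ x).
by case: (_ \in _); case: (_ \in _); clear; lia.
Qed.

Lemma slk_L2 u : u \in mate (~~ b) H v -> slk (H :\ v) L2 u.
Proof.
move=> um; have := mate_slk c vH um; rewrite /SpatialMixing.slk /L2 /rem.
have [uH _ _] := Qv_neq um; rewrite !inE in uH; case/and3P: uH => uw _ _.
by rewrite !inE (negPf uw).
Qed.

(** Let [v] have colour [z] and average over the colours of [w] other than [x] and [y]. This is a
    marginal of [H :\ v] with list [L2] at [w], which does not involve [z]; so changing [z] acts
    only through the other triangle of [v]. *)
Lemma side_avg : exists fv : C -> rat,
  (forall z z', `|fv z - fv z'| <= Bd (~~ b) H v) /\
  (forall z, fv z * \sum_(j in L w :\ x :\ y) count H0 (M2 z j) =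
             \sum_(j in L w :\ x :\ y) csum H0 (M2 z j) (is_at t k)).
Proof.
exists (fun z => prob (H :\ v) (rem L2 Qv z) t k); split=> [z z'|z].
  apply: child => //; [exact: cpart_D1|exact: cls_L2|exact: slk_L2].
have E f : invariant2 f -> csum (H :\ v) (rem L2 Qv z) f =
    \sum_(j in L w :\ x :\ y) csum H0 (M2 z j) f.
  move=> [_ fw]; have wHv : w \in H :\ v by rewrite !inE eq_sym vw.
  rewrite (csum_peel c0 e_sym e_irr _ _ wHv).
  have -> : rem L2 Qv z w = L w :\ x :\ y.
    by rewrite /rem (negPf wQv) /L2 /rem !inE eqxx.
  apply: eq_bigr => j _; rewrite (eq_csum_fun c0 e _ _ (fun d => fw d j)).
  apply: eq_csum_lists => u uH; have uH' := uH; rewrite !inE in uH'.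
  case/and3P: uH' => uw uv _; rewrite /M2 /rem (nbr_w uH) /L2 /rem !inE (negPf uw).
  by [].
rewrite -(E _ invariant2_is_at) -(E _ invariant2_one).
rewrite (csum_probE c0 e_sym e_irr e_lat D_lt) 1?mulrC //.
apply: (cls_rem D_lt); first exact: cls_L2. move=> u _ uQ; apply: slk_L2.
exact: (subsetP (seen_sub _ _ _)) uQ.
Qed.

(** When [z] is struck at both ends, only [z'] survives among [x] and [y], and the edge forbids it
    at both ends at once. *)
Lemma rest_sum (G : C -> C -> rat) z z' : x != y -> (z, z') \in [:: (x, y); (y, x)] ->
  \sum_(i in L v :\ z) \sum_(j in L w :\ z | j != i) G i j =
  wS (L v) (L w) x y G + wa (L v) (L w) x y z' G + KagomeWeights.wb (L v) (L w) x y z' G.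
Proof.
move=> xy hz; rewrite /wS /wa /KagomeWeights.wb -!big_split /= big_mkcond; apply: eq_bigr => i _.
rewrite -!big_split /=; case: ifP => iL; last first.
  apply/esym; apply: big1 => j _; move: hz iL; rewrite !inE => /orP[]/eqP[-> ->].
    by case: (eqVneq i y) => [->|iy]; rewrite ?eqxx ?(eq_sym y x) ?(negPf xy) /= ?andbF /= => h; rewrite ?h ?andbF ?mul0r ?addr0.
  by case: (eqVneq i x) => [->|iy]; rewrite ?eqxx ?(negPf xy) /= ?andbF /= => h; rewrite ?h ?andbF ?mul0r ?addr0.
rewrite [LHS]big_mkcond; apply: eq_bigr => j _; rewrite -!mulrDl -natrD -natrD.
move: hz iL; rewrite !inE => /orP[]/eqP[-> ->].
  case: (eqVneq i y) => [->|iy]; case: (eqVneq j y) => [->|jy]; rewrite ?eqxx ?(eq_sym y x) ?(negPf xy) /= ?andbF ?andbT ?(negPf jy) ?(negPf iy) /= ?addn0 ?add0n ?mul0r //.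
  - by move=> ->; case: (_ && _); rewrite ?andbT /= ?mul1r ?mul0r //; case: ifP.
  - by move=> -> /=; case: (y \in L w); rewrite ?mul1r ?mul0r // eq_sym iy.
  - by move=> ->; rewrite [j == i]eq_sym; case: (_ && _); case: (i != j); rewrite /= ?mul1r ?mul0r.
case: (eqVneq i x) => [->|iy]; case: (eqVneq j x) => [->|jy]; rewrite ?eqxx ?(negPf xy) /= ?andbF ?andbT ?(negPf jy) ?(negPf iy) /= ?addn0 ?add0n ?mul0r //.
- by move=> ->; case: (_ && _); rewrite ?andbT /= ?mul1r ?mul0r //; case: ifP.
- by move=> -> /=; case: (x \in L w); rewrite ?mul1r ?mul0r // eq_sym iy.
- by move=> ->; rewrite [j == i]eq_sym; case: (_ && _); case: (i != j); rewrite /= ?mul1r ?mul0r.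
Qed.

Lemma Q_sub0 : Qv \subset H0 /\ Qw \subset H0.
Proof.
split; apply/subsetP=> u uQ; first by have [] := Qv_neq (subsetP (seen_sub _ _ _) u uQ).
have [uH uw cu _] := seenP uQ; rewrite !inE uH uw /= andbT.
by apply/eqP=> uv; move: cl_diff; rewrite -uv cu eqxx.
Qed.

(** By [no_square] the outside triangles of [v] and of [w] are not joined by an edge, so [pair_lift]
    applies: a linear inequality between counts need only be checked on products of profiles. *)
Lemma lift_fact (lf : (C -> C -> rat) -> rat) :
  (exists coef, forall m, lf m = \sum_i \sum_j coef i j * m i j) ->
  (forall g h, profile #|mate (~~ b) H v| g -> profile #|mate (~~ b) H w| h ->
     0 <= lf (fun i j => g i * h j)) ->
  0 <= lf (fun i j => count H0 (M2 i j)).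
Proof.
move=> [coef E] hp; rewrite E; have [sv0 sw0] := Q_sub0.
have -> : \sum_i \sum_j coef i j * count H0 (M2 i j) =
   \sum_i \sum_j coef i j * csum H0 L (fun d => avoidr Qv i d * avoidr Qw j d).
  apply: eq_bigr => i _; apply: eq_bigr => j _; congr (_ * _).
  rewrite /M2 count_rem csum_rem (setIidPr sv0) (setIidPr sw0).
  by apply: eq_csum_fun => d; rewrite mulrC.
have le (A B : {set V}) u : A \subset B -> (edeg A u <= edeg B u)%N.
  move=> /subsetP AB; apply: subset_leq_card; apply/subsetP=> a; rewrite !inE => /andP[/AB -> ->] //.
apply: (@pair_lift V C c0 e e_sym e_irr _ L Qv Qw #|Qv| #|Qw| coef) => //.
- rewrite -setI_eq0; apply/eqP/setP=> u; rewrite !inE; apply/negP=> /andP[uv uw].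
  have uv' : u \in Qv by rewrite !inE.
  have [_] := Qv_neq (subsetP (seen_sub _ _ _) u uv'); rewrite !inE.
  by rewrite uw.
- move=> a a' aQ a'Q; apply/negP=> /e_lat; rewrite (klat_cl b) => /andP[_].
  have [_ av ca _] := seenP aQ; have [_ aw ca' _] := seenP a'Q.
  rewrite ca ca' (negPf cl_diff) orbF; apply/negP.
  have [_ cv _] := vF; have [_ cw _] := wF.
  by apply: (no_square (v := v) (w := w)); rewrite ?cv ?cw.
- by rewrite leqnn (leq_trans (seen_le _ _ _)) ?mate_leH.
- by rewrite leqnn (leq_trans (seen_le _ _ _)) ?mate_leH.
- move=> u uQ; apply: leq_ltn_trans (seen_list c vH uQ); rewrite leq_add2l; apply: le.
  by apply: setSD; exact: subsetDl.
- move=> u uQ; apply: leq_ltn_trans (seen_list c wH uQ); rewrite leq_add2l; apply: le.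
  by apply: setSD; rewrite H0C; exact: subsetDl.
by move=> g h pg ph; rewrite -E; apply: hp; apply: profile_W (seen_le _ _ _) _.
Qed.

Lemma list_size : (3 + #|mate (~~ b) H v| <= #|L v|)%N.
Proof.
have := sv; rewrite /SpatialMixing.slk (ldegE b); have [_ _ ->] := vF; rewrite cards1.
by move: C5; clear; lia.
Qed.

Lemma list_full : #|mate (~~ b) H v| = 2%N -> L v = setT.
Proof.
move=> m2; have h : (#|C| <= #|L v|)%N.
  have := sv; rewrite /SpatialMixing.slk (ldegE b); have [_ _ ->] := vF; rewrite cards1 m2.
  by clear; lia.
by apply/eqP; rewrite eqEcard subsetT cardsT; exact: h.
Qed.

End Side.

(** Dividing by the totals gives the probability vectors of [pair_cost_case]. The four regimes are
    those with (2, 2), (1, 2), (1, 1) and (0, at least 1) outside corners at the two ends. *)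
Lemma pair_ratio (S A B A' B' SF f1 f1' f2 f2' lo B1 B2 u w : rat) :
  0 < S -> 0 <= A -> 0 <= B -> 0 <= A' -> 0 <= B' -> A' + B' <= A + B ->
  0 <= u -> 0 <= w ->
  lo * S <= SF <= (lo + (B1 + B2)) * S ->
  lo <= f1 <= lo + (B1 + B2) -> lo <= f1' <= lo + (B1 + B2) ->
  lo <= f2 <= lo + (B1 + B2) -> lo <= f2' <= lo + (B1 + B2) ->
  `|f1 - f1'| <= B1 -> `|f2 - f2'| <= B2 -> B1 <= u * X -> B2 <= w * X ->
  [\/ [/\ u = 1, w = 1, A + B <= 3 * S, 8 * (S + A + B) <= 15 * (S + A' + B')
         & (8 * (B - B') <= 7 * S) /\ (8 * (A - A') <= 7 * S)],
      [/\ u = 61/100, w = 1, A <= 2 * S, 2 * B <= 3 * S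
         & (2 * (S + A + B) <= 5 * (S + A' + B')) /\ (5/8 * A <= 77/80 * S + A')],
      [/\ u = 61/100, w = 61/100 & A + B <= 4 * S] |
      [/\ u = 0, w <= 1 & A + B <= 5 * S]] ->
  `|(SF + f1 * A + f2 * B) / (S + A + B) - (SF + f1' * A' + f2' * B') / (S + A' + B')| <= 197/200 * X.
Proof.
move=> S0 A0 B0 A0' B0' le u0 w0 /andP[l1 l2] h1 h1' h2 h2' d1 d2 k1 k2 cs.
set Z := S + A + B; set Z' := S + A' + B'.
have Z0 : 0 < Z by rewrite /Z; lra.
have Z0' : 0 < Z' by rewrite /Z'; lra.
pose i := Z^-1; pose i' := Z'^-1.
have iZ : i * Z = 1 by rewrite mulVf // lt0r_neq0.
have iZ' : i' * Z' = 1 by rewrite mulVf // lt0r_neq0.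
have i0 : 0 < i by rewrite invr_gt0.
have i0' : 0 < i' by rewrite invr_gt0.
have ii : i <= i' by rewrite lef_pV2 ?posrE // /Z /Z'; lra.
have Sn := lt0r_neq0 S0.
have -> : (SF + f1 * A + f2 * B) / Z = S * i * (SF / S) + A * i * f1 + B * i * f2.
  by rewrite -/i; field.
have -> : (SF + f1' * A' + f2' * B') / Z' = S * i' * (SF / S) + A' * i' * f1' + B' * i' * f2'.
  by rewrite -/i'; field.
have P a a' : 0 <= a -> 0 <= a' -> 0 <= a * a' :> rat by exact: mulr_ge0.
have si : S * i <= S * i' by apply: ler_wpM2l => //; exact: ltW.
have rat_le (p q : rat) : p * Z <= q * Z' -> p * (S * i') <= q * (S * i).
  move=> h; have := P (S * i * i') (q * Z' - p * Z) (P _ _ (P _ _ (ltW S0) (ltW i0)) (ltW i0')) ltac:(lra).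
  have -> : S * i * i' * (q * Z' - p * Z) = q * (S * i) * (i' * Z') - p * (S * i') * (i * Z) by ring.
  by rewrite iZ iZ' !mulr1 subr_ge0.
have sc p q : p <= q -> p * i <= q * i by move=> h; apply: ler_wpM2r => //; exact: ltW.
have Bi : B' * i <= B' * i' by apply: ler_wpM2l.
have Ai : A' * i <= A' * i' by apply: ler_wpM2l.
apply: (pair_cost_case (lo := lo) (B1 := B1) (B2 := B2) (u := u) (w := w)) => //.
- by rewrite -!mulrDl mulrC.
- by rewrite -!mulrDl mulrC.
- by apply: P => //; exact: ltW.
- by apply: P => //; exact: ltW.
- by apply: P => //; exact: ltW.
- by apply: P => //; exact: ltW.
- by apply: P; exact: ltW.
- by rewrite ler_pdivlMr // ler_pdivrMr // l1 l2.
have iZe : 1 = S * i + A * i + B * i by rewrite -!mulrDl mulrC iZ.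
case: cs => [[-> -> q1 q2 [q3 q4]]|[-> -> q1 q2 [q3 q4]]|[-> -> q1]|[-> q0 q1]].
- apply: Or41; split; [reflexivity|reflexivity| | |].
  + have := sc _ _ q1; lra.
  + exact: rat_le.
  + by have := sc _ _ q3; have := sc _ _ q4; split; lra.
- apply: Or42; split; [reflexivity|reflexivity| | |].
  + have := sc _ _ q1; have := sc _ _ q2; lra.
  + exact: rat_le.
  + by have := sc _ _ q1; have := sc _ _ q2; have := sc _ _ q4; split; lra.
- apply: Or43; split; [reflexivity|reflexivity|]; have := sc _ _ q1; lra.
- apply: Or44; split; [reflexivity|exact: q0|]; have := sc _ _ q1; lra.
Qed.

Lemma wlin2 (Lv Lw : {set C}) (x y z z' : C) (k0 k1 k2 k3 k4 : rat) :
  exists coef : C -> C -> rat, forall m,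
  k0 * wS Lv Lw x y m + k1 * wa Lv Lw x y z m + k2 * wa Lv Lw x y z' m +
  k3 * KagomeWeights.wb Lv Lw x y z m + k4 * KagomeWeights.wb Lv Lw x y z' m = \sum_i \sum_j coef i j * m i j.
Proof.
exists (fun i j => k0 * [&& i \in Lv :\ x :\ y, j \in Lw :\ x :\ y & i != j]%:R +
   k1 * [&& i == z, z \in Lv & j \in Lw :\ x :\ y]%:R + k2 * [&& i == z', z' \in Lv & j \in Lw :\ x :\ y]%:R +
   k3 * [&& j == z, z \in Lw & i \in Lv :\ x :\ y]%:R + k4 * [&& j == z', z' \in Lw & i \in Lv :\ x :\ y]%:R) => m.
rewrite /wS /wa /KagomeWeights.wb !mulr_sumr -!big_split /=; apply: eq_bigr => i _.
by rewrite !mulr_sumr -!big_split /=; apply: eq_bigr => j _; ring.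
Qed.

Lemma wa_sum (Lv Lw : {set C}) (x y z : C) m : wa Lv Lw x y z m =
  if z \in Lv then \sum_(j in Lw :\ x :\ y) m z j else 0.
Proof.
rewrite /wa (bigD1 z) //= [X in _ + X]big1 ?addr0; last first.
  by move=> i iz; apply: big1 => j _; rewrite (negPf iz) mul0r.
rewrite eqxx /=; case: ifP => zL /=; last by apply: big1 => j _; rewrite mul0r.
by rewrite [RHS]big_mkcond; apply: eq_bigr => j _; case: ifP => _; rewrite ?mul0r ?mul1r.
Qed.

Lemma wb_swap (Lv Lw : {set C}) (x y z : C) m : KagomeWeights.wb Lv Lw x y z m = wa Lw Lv x y z (fun i j => m j i).
Proof.
by rewrite /wa /KagomeWeights.wb exchange_big.
Qed.

Lemma pair_range (lo D : rat) (Lv Lw : {set C}) (x y : C) (m F : C -> C -> rat) :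
  (forall i j, lo * m i j <= F i j <= (lo + D) * m i j) ->
  lo * wS Lv Lw x y m <= wS Lv Lw x y F <= (lo + D) * wS Lv Lw x y m.
Proof.
move=> h; rewrite /wS !mulr_sumr; apply/andP; split; apply: ler_sum => i _;
  rewrite mulr_sumr; apply: ler_sum => j _; have /andP[h1 h2] := h i j;
  by case: (_ && _); rewrite ?mul0r ?mulr0 // !mul1r.
Qed.

Section AdjacentPair.
Variables (b : bool) (kap : T) (H : {set V}) (L : V -> {set C}) (v w : V) (x y : C).
Hypothesis EP : cpart b kap H = [set v; w].
Hypothesis vw : v != w.
Hypothesis evw : e v w.
Hypothesis c : cls H L.
Hypothesis sv : slk H L v.
Hypothesis sw : slk H L w.
Hypothesis vb : v \notin ball t r.+1.
Hypothesis wbl : w \notin ball t r.+1.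
Hypothesis xy : x != y.
Let EP' : cpart b kap H = [set w; v]. Proof. by rewrite setUC. Qed.
Let wv : w != v. Proof. by rewrite eq_sym. Qed.
Let ewv : e w v. Proof. by rewrite e_sym. Qed.

Let m i j := count (H0 H v w) (M2 b H L v w i j).
Let F i j := csum (H0 H v w) (M2 b H L v w i j) (is_at t k).
Let p i j := prob (H0 H v w) (M2 b H L v w i j) t k.
Let mc i j : cls (H0 H v w) (M2 b H L v w i j).
Proof. exact: (cls_vw EP vw c). Qed.
Let m_gt0 i j : 0 < m i j.
Proof. exact: (cls_count_gt0 c0 e_sym e_irr e_lat D_lt (mc i j)). Qed.
Let FE i j : F i j = m i j * p i j.
Proof. exact: (csum_probE c0 e_sym e_irr e_lat D_lt _ _ (mc i j)). Qed.

Let swapM f i j : csum (H0 H w v) (M2 b H L w v j i) f = csum (H0 H v w) (M2 b H L v w i j) f.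
Proof.
have -> : H0 H w v = H0 H v w by rewrite /H0 !setDDl setUC.
apply: eq_csum_lists => u _; rewrite /M2 /rem.
case: (u \in seen (~~ b) H w); case: (u \in seen (~~ b) H v) => //.
by rewrite !setDDl setUC.
Qed.

Let p_diff2 i j i' j' : `|p i j - p i' j'| <= Bd (~~ b) H v + Bd (~~ b) H w.
Proof.
rewrite -(subrKA (p i' j)); apply: le_trans (ler_normD _ _) _; apply: lerD.
  exact: (p_diff EP vw c vb).
have E a : p i' a = prob (H0 H w v) (M2 b H L w v a i') t k by rewrite /p /SpatialMixing.prob /Colourings.count !swapM.
by rewrite !E; apply: (p_diff EP' wv c wbl).
Qed.

Lemma pair_prob z z' : (z, z') \in [:: (x, y); (y, x)] ->
  prob H (rem L [set v; w] z) t k =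
  (wS (L v) (L w) x y F + wa (L v) (L w) x y z' F + KagomeWeights.wb (L v) (L w) x y z' F) /
  (wS (L v) (L w) x y m + wa (L v) (L w) x y z' m + KagomeWeights.wb (L v) (L w) x y z' m).
Proof.
move=> hz; rewrite /SpatialMixing.prob /Colourings.count (split_vw L EP vw evw z (invariant2_is_at vb wbl)).
rewrite (split_vw L EP vw evw z (invariant2_one v w)).
by rewrite (rest_sum L v w _ xy hz) (rest_sum L v w _ xy hz).
Qed.

Let bv := #|mate (~~ b) H v|.
Let bw := #|mate (~~ b) H w|.
Let lv : (3 + bv <= #|L v|)%N. Proof. exact: (list_size EP vw sv). Qed.
Let lw : (3 + bw <= #|L w|)%N. Proof. exact: (list_size EP' wv sw). Qed.
Let bv2 : (bv <= 2)%N. Proof. exact: mate_leH. Qed.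
Let bw2 : (bw <= 2)%N. Proof. exact: mate_leH. Qed.

Lemma step_adj_le : (bv <= bw)%N ->
  `|prob H (rem L [set v; w] x) t k - prob H (rem L [set v; w] y) t k| <= 197/200 * X.
Proof.
have X1 := X0; move=> bvw.
set B1 := Bd (~~ b) H v; set B2 := Bd (~~ b) H w.
have B10 : 0 <= B1 by exact: Bd_ge0. have B20 : 0 <= B2 by exact: Bd_ge0.
(* The minimum [lo] of the conditional marginals; by [p_diff2] all of them lie within [B1 + B2]
   above it, the common range required by [pair_cost]. *)
pose ij0 := [arg min_(ij < (x, x)) p ij.1 ij.2]%O.
pose lo := p ij0.1 ij0.2.
have lop i j : lo <= p i j <= lo + (B1 + B2).
  apply/andP; split.
    by rewrite /lo /ij0; case: arg_minP => // ij _ /(_ (i, j) isT).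
  by have := p_diff2 i j ij0.1 ij0.2; rewrite ler_norml -/lo -/B1 -/B2 => /andP[_]; lra.
have Fr i j : lo * m i j <= F i j <= (lo + (B1 + B2)) * m i j.
  have m0 := ltW (m_gt0 i j); have /andP[q1 q2] := lop i j.
  by rewrite FE [m i j * _]mulrC !ler_wpM2r.
have [fv [dv Ev]] := side_avg x y EP vw evw c sw vb wbl.
have [fw [dw Ew]] := side_avg x y EP' wv ewv c sv wbl vb.
have Kne (A : {set C}) : (3 <= #|A|)%N -> exists j, j \in A :\ x :\ y.
  move=> A3; apply/set0Pn; rewrite -card_gt0; have := cardsD1 x A; have := cardsD1 y (A :\ x).
  by move: A3; case: (_ \in _); case: (_ \in _); clear; lia.
have frange (A : {set C}) (mm FF : C -> rat) f : (3 <= #|A|)%N -> (forall j, 0 < mm j) ->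
    (forall j, lo * mm j <= FF j <= (lo + (B1 + B2)) * mm j) ->
    f * \sum_(j in A :\ x :\ y) mm j = \sum_(j in A :\ x :\ y) FF j -> lo <= f <= lo + (B1 + B2).
  move=> A3 mp hF E; have [j0 j0A] := Kne A A3.
  have sp : 0 < \sum_(j in A :\ x :\ y) mm j.
    rewrite (bigD1 j0) //=; apply: ltr_pwDl => //; apply: sumr_ge0 => j _; exact: ltW.
  rewrite -(ler_pM2r sp) -[f <= _](ler_pM2r sp) E !mulr_sumr.
  by apply/andP; split; apply: ler_sum => j _; have /andP[] := hF j.
have fvr z : lo <= fv z <= lo + (B1 + B2).
  by apply: (frange (L w) (m z) (F z)) => //; apply: leq_trans lw; rewrite leq_addr.
have fwr z : lo <= fw z <= lo + (B1 + B2).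
  apply: (frange (L v) (fun j => m j z) (fun j => F j z)) => //; first by apply: leq_trans lv; rewrite leq_addr.
  have := Ew z; rewrite /m /F.
  rewrite [X in _ = X](eq_bigr (fun j => F j z)) => [|j _]; last exact: swapM.
  by rewrite [X in _ * X = _](eq_bigr (fun j => m j z)) // => j _; exact: swapM.
have waF z : wa (L v) (L w) x y z F = fv z * wa (L v) (L w) x y z m.
  by rewrite !wa_sum; case: ifP => _; rewrite ?mulr0 // Ev.
have wbF z : KagomeWeights.wb (L v) (L w) x y z F = fw z * KagomeWeights.wb (L v) (L w) x y z m.
  rewrite !wb_swap !wa_sum; case: ifP => _; rewrite ?mulr0 //.
  have := Ew z.
  rewrite [X in _ = X](eq_bigr (fun j => F j z)) => [|j _]; last exact: swapM.
  by rewrite [X in _ * X = _](eq_bigr (fun j => m j z)) // => j _; exact: swapM.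
set S := wS (L v) (L w) x y m; pose A z := wa (L v) (L w) x y z m; pose B z := KagomeWeights.wb (L v) (L w) x y z m.
have A0 z : 0 <= A z.
  by rewrite /A wa_sum; case: ifP => // _; apply: sumr_ge0 => j _; exact: ltW.
have B0 z : 0 <= B z.
  by rewrite /B wb_swap wa_sum; case: ifP => // _; apply: sumr_ge0 => j _; exact: ltW.
have fact z z' k0 k1 k2 k3 k4 : (forall g h, profile bv g -> profile bw h ->
    0 <= k0 * wS (L v) (L w) x y (fun i j => g i * h j) + k1 * wa (L v) (L w) x y z (fun i j => g i * h j)
      + k2 * wa (L v) (L w) x y z' (fun i j => g i * h j) +
      k3 * KagomeWeights.wb (L v) (L w) x y z (fun i j => g i * h j) + k4 * KagomeWeights.wb (L v) (L w) x y z' (fun i j => g i * h j)) ->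
    0 <= k0 * S + k1 * A z + k2 * A z' + k3 * B z + k4 * B z'.
  by move=> hp; apply: (lift_fact EP vw c (wlin2 (L v) (L w) x y z z' k0 k1 k2 k3 k4) hp).
have rng := pair_range (L v) (L w) x y Fr; rewrite -/S in rng.
have S_ge0 : 0 <= S.
  rewrite /S /wS; apply: sumr_ge0 => i _; apply: sumr_ge0 => j _; apply: mulr_ge0; rewrite ?ler0n //.
  exact: ltW.
have Zpos z z' : (z', z) \in [:: (x, y); (y, x)] -> 0 < S + A z + B z.
  move=> hz; have hc : cls H (rem L [set v; w] z').
    by apply: (cls_rem D_lt); [exact: c|move=> u _ /set2P[] ->].
  have := cls_count_gt0 c0 e_sym e_irr e_lat D_lt hc.
  by rewrite /Colourings.count (split_vw L EP vw evw z' (invariant2_one v w)) (rest_sum L v w _ xy hz).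
have bB1 := Bd_le (~~ b) H v; have bB2 := Bd_le (~~ b) H w.
rewrite -/bv -/B1 in bB1; rewrite -/bw -/B2 in bB2.
suff main z z' : (z', z) \in [:: (x, y); (y, x)] -> A z' + B z' <= A z + B z ->
   `|(wS (L v) (L w) x y F + wa (L v) (L w) x y z F + KagomeWeights.wb (L v) (L w) x y z F) / (S + A z + B z)
    - (wS (L v) (L w) x y F + wa (L v) (L w) x y z' F + KagomeWeights.wb (L v) (L w) x y z' F) / (S + A z' + B z')|
    <= 197/200 * X.
  have i1 : (x, y) \in [:: (x, y); (y, x)] by rewrite inE eqxx.
  have i2 : (y, x) \in [:: (x, y); (y, x)] by rewrite !inE eqxx orbT.
  rewrite (pair_prob i1) (pair_prob i2) -/S -/(A x) -/(A y) -/(B x) -/(B y).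
  by case: (leP (A x + B x) (A y + B y)) => h; [exact: main|rewrite distrC; apply: main => //; exact: ltW].
move=> hz le; rewrite !waF !wbF -/(A z) -/(A z') -/(B z) -/(B z').
have zs : z \in [set x; y] /\ z' \in [set x; y].
  by move: hz; rewrite !inE => /orP[]/eqP[-> ->]; rewrite !eqxx ?orbT.
case: zs => zs zs'; have Zp := Zpos _ _ hz.
(* Without outside corners at either end all conditional marginals equal [lo], and the two averages
   coincide. *)
have [b0|b0] := posnP bw.
  have E1 : B1 = 0.
    have bv0 : bv = 0%N by move: bvw; rewrite b0 leqn0 => /eqP.
    by apply: le_anti; rewrite B10 andbT; move: bB1; rewrite bv0 eqxx mul0r.
  have E2 : B2 = 0 by apply: le_anti; rewrite B20 andbT; move: bB2; rewrite b0 eqxx mul0r.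
  have fvE q : fv q = lo by apply: le_anti; have := fvr q; rewrite E1 E2 !addr0 andbC.
  have fwE q : fw q = lo by apply: le_anti; have := fwr q; rewrite E1 E2 !addr0 andbC.
  have SE : wS (L v) (L w) x y F = lo * S by apply: le_anti; move: rng; rewrite E1 E2 !addr0 andbC.
  have Zp' : 0 < S + A z' + B z'.
    by apply: (Zpos _ z); move: hz; rewrite !inE => /orP[]/eqP[-> ->]; rewrite !eqxx ?orbT.
  have n1 := lt0r_neq0 Zp; have n2 := lt0r_neq0 Zp'.
  rewrite !fvE !fwE SE -!mulrDr (mulfK n1) (mulfK n2) subrr normr0.
  by apply: mulr_ge0; lra.
have [S0 cs] : 0 < S /\
  [\/ [/\ (bv == 2)%N, (bw == 2)%N, A z + B z <= 3 * S, 8 * (S + A z + B z) <= 15 * (S + A z' + B z')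
         & (8 * (B z - B z') <= 7 * S) /\ (8 * (A z - A z') <= 7 * S)],
      [/\ (bv == 1)%N, (bw == 2)%N, A z <= 2 * S, 2 * B z <= 3 * S
         & (2 * (S + A z + B z) <= 5 * (S + A z' + B z')) /\ (5/8 * A z <= 77/80 * S + A z')],
      [/\ (bv == 1)%N, (bw == 1)%N & A z + B z <= 4 * S] |
      [/\ (bv == 0)%N, (0 < bw)%N & A z + B z <= 5 * S]].
  have [v0|v0] := posnP bv.
    have q : A z + B z <= 5 * S.
      have := fact z z' 5 (-1) 0 (-1) 0; rewrite !mul0r !addr0 => q.
      have {}q := q ltac:(by move=> g h pg ph; have := type_zero xy pg ph bw2 lv lw v0 b0 z; lra); lra.
    by split; [lra|apply: Or44; split; [by []|by []|exact: q]].
  have wa2 : A z <= 2 * S.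
    have := fact z z' 2 (-1) 0 0 0; rewrite !mul0r !addr0 => q.
    have {}q := q ltac:(by move=> g h pg ph; have := wa_le (L w) xy pg ph bv2 lv v0 z; lra); lra.
  have wb2 : if bw == 1%N then B z <= 2 * S else B z <= 3/2 * S.
    case E1 : (bw == 1%N).
      have := fact z z' 2 0 0 (-1) 0; rewrite !mul0r !addr0 => q.
      have {}q := q ltac:(by move=> g h pg ph; have := wb_le (L v) xy pg ph bw2 lw b0 z; rewrite E1; lra); lra.
    have := fact z z' (3/2) 0 0 (-1) 0; rewrite !mul0r !addr0 => q.
    have {}q := q ltac:(by move=> g h pg ph; have := wb_le (L v) xy pg ph bw2 lw b0 z; rewrite E1; lra); lra.
  case Ew2 : (bw == 2)%N; last first.
    have w1 : bw = 1%N by move/eqP: Ew2; move: bw2 b0; clear; lia.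
    have v1 : bv = 1%N by move: bvw v0; rewrite w1; clear; lia.
    rewrite w1 in wb2; have {}wb2 : B z <= 2 * S by exact: wb2.
    split; first by lra.
    by apply: Or43; rewrite v1 w1; split; [by []|by []|lra].
  have w2 := eqP Ew2; rewrite w2 in wb2.
  have {}wb2 : B z <= 3/2 * S by exact: wb2.
  have fw2 := list_full EP' wv sw w2.
  have S1 : 0 < S by lra.
  split=> //; case Ev2 : (bv == 2)%N.
    have v2 := eqP Ev2; have fv2 := list_full EP vw sv v2.
    apply: Or41; split=> //.
    - have := fact z z' 3 (-1) 0 (-1) 0; rewrite !mul0r !addr0 => q.
      have {}q := q ltac:(by move=> g h pg ph; have := TT_sum xy pg ph bv2 bw2 lv lw b0 v2 w2 fv2 fw2 z; lra); lra.
    - have := fact z z' 7 (-8) 15 (-8) 15 => q.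
      have {}q := q ltac:(by move=> g h pg ph; have := TT_ratio xy pg ph lv v2 w2 fv2 fw2 zs zs'; lra); lra.
    split.
      have := fact z z' 7 0 0 (-8) 8; rewrite !mul0r !addr0 => q.
      have {}q := q ltac:(by move=> g h pg ph; have := TT_b xy pg ph lv v2 w2 fv2 fw2 zs zs'; lra); lra.
    have := fact z z' 7 (-8) 8 0 0; rewrite !mul0r !addr0 => q.
    have {}q := q ltac:(by move=> g h pg ph; have := TT_a xy pg ph lv v2 w2 fv2 fw2 zs zs'; lra); lra.
  have v1 : bv = 1%N by move/eqP: Ev2; move: bv2 v0; clear; lia.
  apply: Or42; rewrite v1; split; [by []|by []|lra|lra|].
  split.
    have := fact z z' (3/2) (-1) (5/2) (-1) (5/2) => q.
    have {}q := q ltac:(by move=> g h pg ph; have := OT_ratio xy pg ph bv2 bw2 lv lw v0 b0 v1 w2 fw2 zs zs'; lra); lra.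
  have := fact z z' (77/80) (-(5/8)) 1 0 0; rewrite !mul0r !addr0 => q.
  have {}q := q ltac:(by move=> g h pg ph; have := OT_third (L w) xy pg ph bv2 lv v0 v1 zs zs'; lra); lra.
apply: (pair_ratio S0 (A0 z) (B0 z) (A0 z') (B0 z') le (u := if bv == 0%N then 0 else if bv == 1%N then 61/100 else 1)
  (w := if bw == 0%N then 0 else if bw == 1%N then 61/100 else 1) _ _ rng (fvr z) (fvr z') (fwr z) (fwr z') (dv z z') (dw z z') bB1 bB2).
- by case: ifP => _; [|case: ifP => _]; lra.
- by case: ifP => _; [|case: ifP => _]; lra.
case: cs => [[/eqP -> /eqP -> q1 q2 q3]|[/eqP -> /eqP -> q1 q2 q3]|[/eqP -> /eqP -> q1]|[/eqP -> q0 q1]].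
- by apply: Or41; split; [reflexivity|reflexivity|exact: q1|exact: q2|exact: q3].
- by apply: Or42; split; [reflexivity|reflexivity|exact: q1|exact: q2|exact: q3].
- by apply: Or43; split; [reflexivity|reflexivity|exact: q1].
- by apply: Or44; split; [reflexivity| |exact: q1]; case: ifP => _; [|case: ifP => _]; lra.
Qed.

End AdjacentPair.

Lemma step_adj b kap H L v w x y : cpart b kap H = [set v; w] -> v != w -> e v w ->
  cls H L -> slk H L v -> slk H L w -> v \notin ball t r.+1 -> w \notin ball t r.+1 -> x != y ->
  `|prob H (rem L [set v; w] x) t k - prob H (rem L [set v; w] y) t k| <= 197/200 * X.
Proof.
move=> EP vw evw c sv sw vb wbl xy.
case/orP: (leq_total #|mate (~~ b) H v| #|mate (~~ b) H w|) => h; first exact: (step_adj_le EP).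
rewrite setUC; apply: (step_adj_le (b := b) (kap := kap)) => //; first by rewrite setUC.
- by rewrite eq_sym.
- by rewrite e_sym.
Qed.

Lemma tri_step : tri_bound r.+1 (199/200 * X).
Proof.
have X1 := X0; move=> H L b kap Q x y P2 QP c sl hb.
have [->|xy] := eqVneq x y.
  rewrite subrr normr0; apply: mulr_ge0; first by lra.
  by have /andP[h _] := Phi_range (cpart b kap H) Q; lra.
have [Q0|Qn0] := eqVneq Q set0.
  have E a : prob H (rem L Q a) t k = prob H L t k by apply: eq_prob => u _; rewrite /rem Q0 inE.
  rewrite !E subrr normr0; apply: mulr_ge0; first by lra.
  by have /andP[h _] := Phi_range (cpart b kap H) Q; lra.
have single v : Q = [set v] -> v \in cpart b kap H /\ v \notin ball t r.+1.
  by move=> E; split; [apply: (subsetP QP)|apply: hb]; rewrite E inE.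
have [P1|P1] := leqP #|cpart b kap H| 1.
  have Q1 : #|Q| == 1%N.
    rewrite eqn_leq (leq_trans (subset_leq_card QP) P1) /= card_gt0 //.
  case/cards1P: Q1 => v Ev; have [vP vb] := single v Ev.
  have EP : cpart b kap H = [set v].
    by apply/esym/eqP; rewrite eqEcard sub1set vP cards1.
  have := step_single EP c (sl v vP) vb xy; rewrite -Ev /Phi P1; lra.
have /cards2P[v [w [vw EP]]] : #|cpart b kap H| == 2 by rewrite eqn_leq P2.
have vP : v \in cpart b kap H by rewrite EP !inE eqxx.
have wP : w \in cpart b kap H by rewrite EP !inE eqxx orbT.
have wv : w != v by rewrite eq_sym.
have EP' : cpart b kap H = [set w; v] by rewrite setUC.
have PhiE : Phi (cpart b kap H) Q = if (Q == cpart b kap H) && nonadj (cpart b kap H) then 1 else 99/100.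
  by rewrite /Phi leqNgt P1.
have Phi_ge : 99/100 <= Phi (cpart b kap H) Q by rewrite PhiE; case: ifP => _; lra.
have PX : 99/100 * X <= Phi (cpart b kap H) Q * X by apply: ler_wpM2r.
have one a a' : cpart b kap H = [set a; a'] -> a != a' -> Q = [set a] ->
   `|prob H (rem L Q x) t k - prob H (rem L Q y) t k| <= 199/200 * X * Phi (cpart b kap H) Q.
  move=> Ea aa Eq; have [aP ab] := single a Eq.
  have a'P : a' \in cpart b kap H by rewrite Ea !inE eqxx orbT.
  rewrite Eq in PX *; case eaa: (e a a').
    have := step_path Ea aa eaa c (sl a aP) (sl a' a'P) ab xy; lra.
  have := step_alone Ea aa (negbT eaa) c (sl a aP) ab xy; lra.
have [QE|QN] := eqVneq Q (cpart b kap H); last first.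
  have Q1 : #|Q| == 1%N.
    have : Q \proper cpart b kap H by rewrite properEneq QN.
    move/proper_card; rewrite EP cards2 vw => h; rewrite eqn_leq -ltnS h /= card_gt0 //.
  case/cards1P: Q1 => u Eu; have [uP _] := single u Eu.
  have : u \in [set v; w] by rewrite -EP.
  case/set2P=> [uv|uw]; first by apply: (one v w EP vw); rewrite Eu uv.
  by apply: (one w v EP' wv); rewrite Eu uw.
have vb : v \notin ball t r.+1 by apply: hb; rewrite QE.
have wbl : w \notin ball t r.+1 by apply: hb; rewrite QE.
case evw: (e v w).
  have h := step_adj EP vw evw c (sl v vP) (sl w wP) vb wbl xy; rewrite -EP -QE in h; lra.
have -> : Phi (cpart b kap H) Q = 1.
  rewrite PhiE QE eqxx (_ : nonadj (cpart b kap H) = true); first by reflexivity.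
  by rewrite EP; exact: nonadj2.
(* Two nonadjacent corners are switched one after the other, at [99/200 * X] each. *)
have QS : Q = [set u in [:: v; w]] by rewrite QE EP; apply/setP=> u; rewrite !inE.
have [Bx EB] : exists y : rat, y = 99/200 * X by exists (99/200 * X).
have B0 : 0 <= Bx by rewrite EB; lra.
have F2 : Bx + (Bx + 0) <= 199/200 * X * 1 by rewrite EB; lra.
have F1 : Bx + 0 <= 199/200 * X * 1 by rewrite EB; lra.
have F0 : 0 <= 199/200 * X * 1 by lra.
have := @telescope V C c0 e klat 4 D_lt H L t k [:: v; w] x y (fun=> Bx) c.
rewrite -QS /= !inE vw /= => h.
apply: le_trans (h isT _ _ _) _.
- by move=> u; rewrite !inE => /orP[]/eqP -> _; apply: sl.
- by move=> u; exact: B0.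
- move=> u M uQ uH cM sM _; rewrite EB; move: uQ; rewrite !inE => /orP[]/eqP E; rewrite {}E in sM *.
    by apply: (step_alone EP vw (negbT evw) cM sM vb xy).
  by apply: (step_alone EP' wv _ cM sM wbl xy); rewrite e_sym evw.
rewrite !big_cons big_nil; case: ifP => _; case: ifP => _; [exact: F2|exact: F1|exact: F1|exact: F0].
Qed.

End Step.

Lemma tri_decay r : tri_bound r (2 * (199/200) ^+ r).
Proof.
elim: r => [|r IH]; last first.
  rewrite exprS mulrCA; apply: tri_step IH; apply: mulr_ge0; first by lra.
  by apply: exprn_ge0; lra.
move=> H L b kap Q x y P2 QP c sl _.
have hc a : cls H (rem L Q a).
  by apply: (cls_rem D_lt); [exact: c|move=> w _ wQ; apply: sl; exact: (subsetP QP)].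
apply: le_trans (prob_diff1 c0 e_sym e_irr e_lat D_lt t k (hc x) (hc y)) _.
(* The factor 2 suffices because twice the least potential 61/100 exceeds the trivial bound 1. *)
by have /andP[h _] := Phi_range (cpart b kap H) Q; rewrite expr0; lra.
Qed.

End Kagome.

(** A recoloured vertex acts through its two triangles, each at cost [2 * (199/200) ^+ r]; switching
    them one after the other gives the factor 4. *)
Lemma decay_kagome (V C : finType) (c0 : C) (e : rel V) (T : eqType) (cl : bool -> V -> T) :
  symmetric e -> irreflexive e -> (forall v w, e v w -> klat cl v w) -> (5 <= #|C|)%N ->
  (forall b v, (#|mate cl b setT v| <= 2)%N) ->
  (forall b v w, cl b v = cl b w -> cl (~~ b) v = cl (~~ b) w -> v = w) ->
  (forall b v w x y, cl b v = cl b w -> v != w ->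
     cl (~~ b) x = cl (~~ b) v -> x != v -> cl (~~ b) y = cl (~~ b) w -> y != w ->
     cl b x != cl b y) ->
  decay c0 e (klat cl) 4 4 (199/200).
Proof.
move=> e_sym e_irr e_lat C5 mate_le cl_inj nsq H L s t k a a' r c sH sb.
have tb : tri_bound c0 e cl t k r (2 * (199/200) ^+ r) by apply: tri_decay.
have D_lt : (4 < #|C|)%N := C5.
pose Q b := seen e cl b H s.
have E i : prob c0 e (H :\ s) (rem L (nbr e s) i) t k =
    prob c0 e (H :\ s) (rem (rem L (Q true) i) (Q false) i) t k.
  apply: eq_prob => u uH; have /setP/(_ u) := nbr_split e_lat true H s.
  rewrite in_setI uH in_setU /= -/(Q true) -/(Q false) => h.
  rewrite /rem h; case: (u \in Q true); case: (u \in Q false) => //=.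
  by rewrite setDDl setUid.
have sl b w : w \in mate cl b H s -> slk (klat cl) 4 (H :\ s) L w.
  exact: (mate_slk C5).
have sQ b w : w \in Q b -> w \in mate cl b H s by exact: (subsetP (seen_sub _ _ _ _ _)).
have cQ b i : cls (klat cl) 4 (H :\ s) (rem L (Q b) i).
  by apply: (cls_rem D_lt); [exact: cls_D1|move=> w _ /sQ; exact: sl].
have one b i (hi : forall w, w \in mate cl b H s -> w \notin Q (~~ b)) :
  `|prob c0 e (H :\ s) (rem (rem L (Q (~~ b)) i) (Q b) a) t k -
    prob c0 e (H :\ s) (rem (rem L (Q (~~ b)) i) (Q b) a') t k| <= 2 * (199/200) ^+ r.
  have := tb (H :\ s) (rem L (Q (~~ b)) i) b (cl b s) (Q b) a a'.
  rewrite cpart_D1 => h; apply: le_trans (h _ _ _ _ _) _.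
  - exact: mate_leH.
  - exact: seen_sub.
  - exact: cQ.
  - move=> w wm; have := sl b w wm; rewrite /slk /rem.
    by rewrite (negPf (hi w wm)).
  - by move=> w /seenP[_ _ _ esw]; exact: (ball_step e_sym esw sb).
  have /andP[_ p1] := Phi_range e (mate cl b H s) (Q b).
  have P0 : 0 <= (199/200 : rat) ^+ r by apply: exprn_ge0; lra.
  rewrite -[leRHS]mulr1; apply: ler_wpM2l => //; apply: mulr_ge0 => //; lra.
have hi b w : w \in mate cl b H s -> w \notin Q (~~ b).
  rewrite inE => /and3P[_ ws /eqP h]; apply/negP=> /seenP[_ _ h' _].
  by move/eqP: ws; apply; exact: cl_inj h h'.
have sw i j : prob c0 e (H :\ s) (rem (rem L (Q true) i) (Q false) j) t k =
   prob c0 e (H :\ s) (rem (rem L (Q false) j) (Q true) i) t k.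
  apply: eq_prob => u _; rewrite /rem; case: (u \in Q true); case: (u \in Q false) => //.
  by rewrite !setDDl setUC.
rewrite !E -(subrKA (prob c0 e (H :\ s) (rem (rem L (Q true) a) (Q false) a') t k)).
apply: le_trans (ler_normD _ _) _.
have h1 := one false a (hi false); have h2 := one true a' (hi true).
rewrite /= in h1 h2; rewrite [X in _ + `|X - _|]sw [X in _ + `|_ - X|]sw; lra.
Qed.
End KagomeDecay.

(** * The five lattices: degrees, geometry, growth of balls *)

Module Lattices.
Import Defs Colourings SpatialMixing Locality DegreeDecay KagomeDecay.
Import Order.TTheory GRing.Theory Num.Theory.
Local Open Scope ring_scope.

(** What the algorithm needs from a lattice. The growth bound counts a cube of integer points with
    one extra bit; planar lattices use a zero third coordinate, and the bit separates the classes of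
    the honeycomb lattice. *)
Definition tame (q Delta : nat) (K1 lam : rat) (G : graph) := exists lat : rel 'I_(order G),
  [/\ symmetric lat, forall v w, adj v w -> lat v w,
      forall v, (edeg lat setT v <= Delta)%N,
      forall c0 : 'I_q, decay c0 (@adj G) lat Delta K1 lam
    & forall t r, (#|ball (@adj G) t r| <= 2 * (2 * r + 1) ^ 3)%N].

Lemma card_by_list (V : finType) (T : eqType) (f : V -> T) (s : seq T) (A : {set V}) :
  injective f -> (forall w, w \in A -> f w \in s) -> (#|A| <= size s)%N.
Proof.
move=> fi h; rewrite cardE -(size_map f); apply: uniq_leq_size; first by rewrite map_inj_uniq ?enum_uniq.
by move=> x /mapP[w]; rewrite mem_enum => /h wA ->.
Qed.

Definition near1 (x y : int) := (`|x - y| <= 1)%R.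

Section Growth.
Variables (V : finType) (e : rel V) (co : V -> int * int * int * bool).
Hypothesis co_inj : injective co.
Hypothesis co_step : forall v w, e v w -> [&& near1 (co v).1.1.1 (co w).1.1.1,
  near1 (co v).1.1.2 (co w).1.1.2 & near1 (co v).1.2 (co w).1.2].

Lemma ball_coord t r v : v \in ball e t r ->
  [&& `|(co v).1.1.1 - (co t).1.1.1| <= r%:Z, `|(co v).1.1.2 - (co t).1.1.2| <= r%:Z
    & `|(co v).1.2 - (co t).1.2| <= r%:Z].
Proof.
elim: r v => [|r IH] v; first by move/set1P->; rewrite !subrr normr0.
case/setUP => [/IH|].
  by case/and3P; clear; lia.
rewrite inE => /existsP[x /andP[/IH/and3P[h1 h2 h3] /co_step/and3P[]]].
by rewrite /near1; move: h1 h2 h3; clear; lia.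
Qed.

Lemma ball_growth t r : (#|ball e t r| <= 2 * (2 * r + 1) ^ 3)%N.
Proof.
pose off (x y : int) : 'I_(2 * r).+1 := inord (absz (x - y + r%:Z)).
have offI (x x' y : int) : `|x - y| <= r%:Z -> `|x' - y| <= r%:Z -> off x y = off x' y -> x = x'.
  move=> h1 h2 /(congr1 val); rewrite /off /= !inordK; move: h1 h2; clear; lia.
pose g v := (off (co v).1.1.1 (co t).1.1.1, off (co v).1.1.2 (co t).1.1.2, off (co v).1.2 (co t).1.2, (co v).2).
rewrite -(card_in_imset (f := g)); last first.
  move=> v w /ball_coord/and3P[a1 a2 a3] /ball_coord/and3P[b1 b2 b3] [e1 e2 e3 e4]; apply: co_inj.
  move: (offI _ _ _ a1 b1 e1) (offI _ _ _ a2 b2 e2) (offI _ _ _ a3 b3 e3) e4.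
  by case: (co v) => [[[? ?] ?] ?]; case: (co w) => [[[? ?] ?] ?] /= -> -> -> ->.
apply: leq_trans (max_card _) _; rewrite !card_prod card_bool !card_ord !expnS expn0.
by clear; lia.
Qed.
End Growth.

Lemma tri_free_indep (V : finType) (lat : rel V) (n m : nat) : symmetric lat ->
  irreflexive lat -> (forall u v w, lat u v -> lat u w -> ~~ lat v w) -> (m <= n)%N ->
  forall v (A : {set V}), A \subset [set w | lat v w] -> #|A| = n ->
  exists I : {set V}, [/\ I \subset A, #|I| = m & {in I &, forall v w, ~~ lat v w}].
Proof.
move=> ls li free mn v A /subsetP AN An.
have lt : (m <= size (enum A))%N by rewrite -cardE An.
exists [set u in take m (enum A)]; split.
- by apply/subsetP=> u; rewrite inE => /mem_take; rewrite mem_enum.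
- rewrite cardsE (card_uniqP _) ?size_takel //; exact: take_uniq (enum_uniq _).
have sub u : u \in take m (enum A) -> lat v u.
  by move/mem_take; rewrite mem_enum => /AN; rewrite inE.
by move=> u w; rewrite !inE => /sub h1 /sub h2; exact: free h1 h2.
Qed.

Section Instances.
Variable G : graph.
Notation V := 'I_(order G).

Lemma Z2_tame q : (6 <= q)%N -> subgraph_of Z2_lattice G -> tame q 4 (2 * 4%:R) (499/500) G.
Proof.
move=> q6 [f fi fe]; pose lat : rel V := fun v w => Z2_lattice (f v) (f w).
have ls : symmetric lat by move=> v w; rewrite /lat /Z2_lattice; clear; apply/idP/idP; lia.
have deg v : (edeg lat setT v <= 4)%N.
  apply: (card_by_list (f := f) (s := [:: ((f v).1 + 1, (f v).2); ((f v).1 - 1, (f v).2);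
     ((f v).1, (f v).2 + 1); ((f v).1, (f v).2 - 1)])) => // w.
  rewrite !inE /lat /Z2_lattice; case: (f v) => a b; case: (f w) => a' b' /=.
  by rewrite !xpair_eqE; clear; lia.
have free u v w : lat u v -> lat u w -> ~~ lat v w.
  by rewrite /lat /Z2_lattice; clear; lia.
exists lat; split=> //.
- by move=> c0; apply: decay_four => //; [exact: adj_sym|exact: adj_irr|rewrite card_ord].
move=> t r; apply: (@ball_growth _ _ (fun v => ((f v).1, (f v).2, 0, true))).
  by move=> v w [h1 h2]; apply: fi; move: h1 h2; case: (f v) => a b; case: (f w) => a' b' /= -> ->.
by move=> v w /fe; rewrite /Z2_lattice /near1 /=; clear; lia.
Qed.

Lemma Z3_tame q : (10 <= q)%N -> subgraph_of Z3_lattice G -> tame q 6 (2 * 6%:R) (99/100) G.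
Proof.
move=> q10 [f fi fe]; pose lat : rel V := fun v w => Z3_lattice (f v) (f w).
have ls : symmetric lat by move=> v w; rewrite /lat /Z3_lattice; clear; apply/idP/idP; lia.
have nb v w : lat v w -> f w \in [:: ((f v).1.1 + 1, (f v).1.2, (f v).2); ((f v).1.1 - 1, (f v).1.2, (f v).2);
     ((f v).1.1, (f v).1.2 + 1, (f v).2); ((f v).1.1, (f v).1.2 - 1, (f v).2);
     ((f v).1.1, (f v).1.2, (f v).2 + 1); ((f v).1.1, (f v).1.2, (f v).2 - 1)].
  rewrite !inE /lat /Z3_lattice; case: (f v) => [[a b] d]; case: (f w) => [[a' b'] d'] /=.
  by rewrite !xpair_eqE; clear; lia.
have deg v : (edeg lat setT v <= 6)%N.
  apply: (card_by_list (f := f) (s := [:: ((f v).1.1 + 1, (f v).1.2, (f v).2); ((f v).1.1 - 1, (f v).1.2, (f v).2);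
     ((f v).1.1, (f v).1.2 + 1, (f v).2); ((f v).1.1, (f v).1.2 - 1, (f v).2);
     ((f v).1.1, (f v).1.2, (f v).2 + 1); ((f v).1.1, (f v).1.2, (f v).2 - 1)])) => // w.
  by rewrite inE => /andP[_]; exact: nb.
have free u v w : lat u v -> lat u w -> ~~ lat v w.
  move=> /nb h1 /nb h2; rewrite /lat /Z3_lattice.
  move: h1 h2; rewrite !inE; case: (f u) => [[a b] d] /=.
  do 5?[case/orP]; move/eqP=> ->; do 5?[case/orP]; move/eqP=> -> /=; clear; lia.
have li : irreflexive lat by move=> u; rewrite /lat /Z3_lattice; apply/negP; lia.
exists lat; split=> //.
- move=> c0; apply: decay_six => //; rewrite ?card_ord //; try exact: adj_sym; try exact: adj_irr.
  + exact: tri_free_indep.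
  + exact: tri_free_indep.
move=> t r; apply: (@ball_growth _ _ (fun v => ((f v).1.1, (f v).1.2, (f v).2, true))).
  by move=> v w [h1 h2 h3]; apply: fi; move: h1 h2 h3; case: (f v) => [[a b] d]; case: (f w) => [[a' b'] d'] /= -> -> ->.
by move=> v w /fe; rewrite /Z3_lattice /near1 /=; clear; lia.
Qed.

Lemma honeycomb_tame q : (5 <= q)%N -> subgraph_of honeycomb_lattice G -> tame q 3 (2 * 3%:R) (9/10) G.
Proof.
move=> q5 [f fi fe]; pose lat : rel V := fun v w => honeycomb_lattice (f v) (f w).
have ls : symmetric lat by move=> v w; rewrite /lat /honeycomb_lattice orbC.
have deg v : (edeg lat setT v <= 3)%N.
  pose s : int := if (f v).2 then 1 else -1.
  apply: (card_by_list (f := f) (s := [:: ((f v).1.1, (f v).1.2, ~~ (f v).2); ((f v).1.1 + s, (f v).1.2, ~~ (f v).2);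
     ((f v).1.1, (f v).1.2 + s, ~~ (f v).2)])) => // w.
  rewrite !inE /s /lat /honeycomb_lattice; case: (f v) => [[a b] d]; case: (f w) => [[a' b'] d'] /=.
  by rewrite !inE !xpair_eqE; case: d; case: d' => //=; rewrite ?andbF ?andbT ?orbF /=; clear; lia.
have free u v w : lat u v -> lat u w -> ~~ lat v w.
  by rewrite /lat /honeycomb_lattice /=; case: (f u).2; case: (f v).2; case: (f w).2.
exists lat; split=> //.
- by move=> c0; apply: decay_three => //; [exact: adj_sym|exact: adj_irr|rewrite card_ord].
move=> t r; apply: (@ball_growth _ _ (fun v => ((f v).1.1, (f v).1.2, 0, (f v).2))).
  by move=> v w [h1 h2 h3]; apply: fi; move: h1 h2 h3; case: (f v) => [[a b] d]; case: (f w) => [[a' b'] d'] /= -> -> ->.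
move=> v w /fe; rewrite /honeycomb_lattice /near1 /= !inE !xpair_eqE.
by case: (f v).2; case: (f w).2 => //=; rewrite ?orbF; clear; lia.
Qed.

Lemma triangular_tame q : (10 <= q)%N -> subgraph_of triangular_lattice G -> tame q 6 (2 * 6%:R) (99/100) G.
Proof.
move=> q10 [f fi fe]; pose lat : rel V := fun v w => triangular_lattice (f v) (f w).
have ls : symmetric lat.
  by move=> v w; rewrite /lat /triangular_lattice !inE !xpair_eqE; clear; apply/idP/idP; lia.
(* The six neighbours form a hexagon, whose alternate corners are two independent triples. By
   pigeonhole five neighbours contain three of one triple, and four contain two. *)
pose even_nb v := [:: ((f v).1 + 1, (f v).2); ((f v).1 - 1, (f v).2 + 1); ((f v).1, (f v).2 - 1)].
pose odd_nb v := [:: ((f v).1, (f v).2 + 1); ((f v).1 - 1, (f v).2); ((f v).1 + 1, (f v).2 - 1)].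
have nb v w : lat v w -> f w \in even_nb v ++ odd_nb v.
  rewrite !inE /lat /triangular_lattice; case: (f v) => a b; case: (f w) => a' b' /=.
  by rewrite !inE !xpair_eqE; clear; lia.
have deg v : (edeg lat setT v <= 6)%N.
  apply: (card_by_list (f := f) (s := even_nb v ++ odd_nb v)) => // w.
  by rewrite inE => /andP[_]; exact: nb.
have ind v (s : seq (int * int)) : s \in [:: even_nb v; odd_nb v] ->
    {in [set w | f w \in s] &, forall u w, ~~ lat u w}.
  move=> hs u w; rewrite !inE /lat /triangular_lattice.
  move: hs; rewrite !inE => /orP[]/eqP->; rewrite ?/even_nb ?/odd_nb !inE; case: (f u) => a b; case: (f w) => a' b';
   case: (f v) => x y /=; rewrite ?inE !xpair_eqE; clear; lia.
have indep n m : (n = 5 /\ m = 3 \/ n = 4 /\ m = 2)%N -> forall v (A : {set V}),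
    A \subset [set w | lat v w] -> #|A| = n ->
    exists I : {set V}, [/\ I \subset A, #|I| = m & {in I &, forall v w, ~~ lat v w}].
  move=> nm v A /subsetP AN An.
  have pick s : s \in [:: even_nb v; odd_nb v] -> (m <= #|A :&: [set w | f w \in s]|)%N ->
      exists I : {set V}, [/\ I \subset A, #|I| = m & {in I &, forall v w, ~~ lat v w}].
    move=> hs hm; have hm' : (m <= size (enum (A :&: [set w | f w \in s])))%N by rewrite -cardE.
    have sub u : u \in take m (enum (A :&: [set w | f w \in s])) -> (u \in A) && (u \in [set w | f w \in s]).
      by move/mem_take; rewrite mem_enum in_setI.
    exists [set u in take m (enum (A :&: [set w | f w \in s]))]; split.
    - by apply/subsetP=> u; rewrite inE => /sub/andP[].
    - rewrite cardsE (card_uniqP _) ?size_takel //; exact: take_uniq (enum_uniq _).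
    move=> u w; rewrite inE => /sub/andP[_ h1]; rewrite inE => /sub/andP[_ h2].
    exact: (ind v s hs).
  have c3 s : size s = 3%N -> (#|A :&: [set w | f w \in s]| <= 3)%N.
    move=> <-; apply: (card_by_list fi) => w; rewrite !inE => /andP[] //.
  have h1 := c3 (even_nb v) erefl; have h2 := c3 (odd_nb v) erefl.
  have : (#|A| <= #|A :&: [set w | f w \in even_nb v]| + #|A :&: [set w | f w \in odd_nb v]|)%N.
    rewrite -cardsUI; apply: leq_trans (leq_addr _ _); apply: subset_leq_card; apply/subsetP=> w wA.
    have := AN w wA; rewrite inE => /nb; rewrite mem_cat !in_setU !in_setI wA !inE.
    by [].
  rewrite An => h3.
  have [h|h] := leqP m #|A :&: [set w | f w \in even_nb v]|; first by apply: pick h; rewrite !inE eqxx.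
  apply: (pick (odd_nb v)); first by rewrite !inE eqxx orbT.
  have X (a b n' m' : nat) : (n' = 5 /\ m' = 3 \/ n' = 4 /\ m' = 2)%N ->
    (a < m')%N -> (n' <= a + b)%N -> (m' <= b)%N by clear; lia.
  exact: (X _ _ _ _ nm h h3).
exists lat; split=> //.
- move=> c0; apply: decay_six => //; rewrite ?card_ord //; try exact: adj_sym; try exact: adj_irr.
  + by apply: indep; left.
  + by apply: indep; right.
move=> t r; apply: (@ball_growth _ _ (fun v => ((f v).1, (f v).2, 0, true))).
  by move=> v w [h1 h2]; apply: fi; move: h1 h2; case: (f v) => a b; case: (f w) => a' b' /= -> ->.
by move=> v w /fe; rewrite /triangular_lattice !inE !xpair_eqE /near1 /=; clear; lia.
Qed.

(* Kagome triangles, labelled by a deleted or even-parity corner of the cell: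
   type true points up, type false points down. *)
Definition kcl (b : bool) (p : int * int) : int * int :=
  let s : int := if b then -1 else 1 in
  if (2 %| p.1)%Z then (p.1 + s, p.2)
  else if (2 %| p.2)%Z then (p.1, p.2 + s) else p.

Lemma kagome_cases (p : int * int) : ~~ ((2 %| p.1)%Z && (2 %| p.2)%Z) ->
  exists a c : int, [\/ p = (2 * a + 1, 2 * c + 1) /\ forall b, kcl b p = p,
    p = (2 * a, 2 * c + 1) /\ forall b : bool, kcl b p = (2 * a + (if b then -1 else 1), 2 * c + 1)
  | p = (2 * a + 1, 2 * c) /\ forall b : bool, kcl b p = (2 * a + 1, 2 * c + (if b then -1 else 1))].
Proof.
case: p => x y /=; rewrite /kcl /=.
have par (z : int) : {a | (2 %| z)%Z /\ z = 2 * a} + {a | ~~ (2 %| z)%Z /\ z = 2 * a + 1}.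
  case: (boolP (2 %| z)%Z) => h; [left|right]; exists (z %/ 2)%Z; split=> //.
    by have := divz_eq z 2; rewrite (dvdz_mod0P h) addr0 mulrC.
  have := divz_eq z 2; have := ltz_pmod z (isT : 0 < 2 :> int); have := modz_ge0 z (isT : 2 != 0 :> int).
  have : (z %% 2)%Z != 0 by apply: contraNneq h => h0; apply/dvdz_mod0P.
  by clear; lia.
case: (par x) => [[a [h1 E1]]|[a [h1 E1]]]; case: (par y) => [[c [h2 E2]]|[c [h2 E2]]]; rewrite ?h1 ?h2 ?(negPf h1) ?(negPf h2) // => _;
  exists a, c.
- by apply: Or32; rewrite E1 E2.
- by apply: Or33; rewrite E1 E2.
- by apply: Or31; rewrite E1 E2.
Qed.

Lemma kagome_tame q : (5 <= q)%N -> subgraph_of kagome_lattice G -> tame q 4 4 (199/200) G.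
Proof.
move=> q5 [f fi fe]; pose g v := sval (f v).
have gi : injective g by move=> v w /val_inj; exact: fi.
have gP v : ~~ ((2 %| (g v).1)%Z && (2 %| (g v).2)%Z) by exact: (valP (f v)).
have K v := kagome_cases (gP v).
pose cl b v := kcl b (g v).
have mate_le b v : (#|mate cl b setT v| <= 2)%N.
  pose k := cl b v; pose s : int := if b then -1 else 1.
  have : (#|v |: mate cl b setT v| <= 3)%N.
    (* The label [k] of a triangle is its corner with both coordinates odd; the other two corners
       differ from it by [s] in one coordinate. *)
    apply: (card_by_list (f := g) (s := [:: k; (k.1 - s, k.2); (k.1, k.2 - s)])) => // w.
    have -> : (w \in v |: mate cl b setT v) = (cl b w == k).
      by rewrite !inE; case: (eqVneq w v) => [->|] //=; rewrite eqxx.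
    rewrite /cl => /eqP <-; have [a [c [[E ->]|[E ->]|[E ->]]]] := K w; rewrite E !inE !xpair_eqE /s /= ?addrK ?eqxx ?orbT //.
  by rewrite cardsU1 !inE eqxx.
have cl_inj b v w : cl b v = cl b w -> cl (~~ b) v = cl (~~ b) w -> v = w.
  move=> /eqP h1 /eqP h2; apply: gi; apply/eqP; move: h1 h2; rewrite /cl.
  have [a [c [[E K1]|[E K1]|[E K1]]]] := K v; have [a' [c' [[E' K2]|[E' K2]|[E' K2]]]] := K w;
  rewrite !K1 !K2 ?E ?E' !xpair_eqE; case: b; clear; rewrite /=; lia.
have nsq b v w x y : cl b v = cl b w -> v != w -> cl (~~ b) x = cl (~~ b) v -> x != v ->
    cl (~~ b) y = cl (~~ b) w -> y != w -> cl b x != cl b y.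
  have ne u u' : u != u' -> g u != g u' by apply: contra => /eqP/gi ->.
  move=> /eqP h1 /ne h2 /eqP h3 /ne h4 /eqP h5 /ne h6; move: h1 h2 h3 h4 h5 h6; rewrite /cl.
  have [a1 [c1 [[E1 K1]|[E1 K1]|[E1 K1]]]] := K v; have [a2 [c2 [[E2 K2]|[E2 K2]|[E2 K2]]]] := K w;
  rewrite !K1 !K2 ?E1 ?E2 !xpair_eqE => h1 h2; try (exfalso; move: h1 h2; case: b; clear; rewrite /=; lia);
  have [a3 [c3 [[E3 K3]|[E3 K3]|[E3 K3]]]] := K x; rewrite !K3 ?E3 !xpair_eqE => h3 h4;
  try (exfalso; move: h1 h2 h3 h4; case: b; clear; rewrite /=; lia);
  have [a4 [c4 [[E4 K4]|[E4 K4]|[E4 K4]]]] := K y; rewrite !K4 ?E4 !xpair_eqE => h5 h6;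
  move: h1 h2 h3 h4 h5 h6; case: b; clear; rewrite /=; lia.
have e_lat v w : adj v w -> klat cl v w.
  move=> avw; have vw : v != w by apply: contraTneq avw => ->; rewrite adj_irr.
  rewrite /klat vw /=; have := fe v w avw.
  rewrite /kagome_lattice -/(g v) -/(g w) /triangular_lattice /cl !inE.
  have [a [c [[E K1]|[E K1]|[E K1]]]] := K v; have [a' [c' [[E' K2]|[E' K2]|[E' K2]]]] := K w;
  rewrite !K1 !K2 ?E ?E' !xpair_eqE; clear; rewrite /=; lia.
exists (klat cl); split=> //.
- exact: klat_sym.
- by move=> v; rewrite (ldegE cl_inj true) (leq_add (mate_le _ _) (mate_le _ _)).
- move=> c0; apply: decay_kagome => //; [exact: adj_sym|exact: adj_irr|by rewrite card_ord].
move=> t r; apply: (@ball_growth _ _ (fun v => ((g v).1, (g v).2, 0, true))).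
  by move=> v w [h1 h2]; apply: gi; move: h1 h2; case: (g v) => a b; case: (g w) => a' b' /= -> ->.
by move=> v w /fe; rewrite /kagome_lattice -/(g v) -/(g w) /triangular_lattice !inE !xpair_eqE /near1 /=; clear; lia.
Qed.

End Instances.
End Lattices.

(** * The recursive estimator of marginals and its error *)

Module Estimator.
Import Colourings EdgeBounds SpatialMixing Locality.
Import Order.TTheory GRing.Theory Num.Theory.
Local Open Scope ring_scope.

Section Pins.
Variables (V C : finType) (c0 : C) (e lat : rel V) (Delta : nat).
Hypotheses (e_sym : symmetric e) (e_irr : irreflexive e) (lat_sym : symmetric lat).
Hypothesis e_lat : forall v w, e v w -> lat v w.
Hypothesis D_lt : (Delta < #|C|)%N.
Hypothesis deg_le : forall v, (edeg lat setT v <= Delta)%N.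

Definition pins := {ffun V -> option C}.
Implicit Types (p : pins) (v s w : V) (a b : C) (H A : {set V}).
Definition free p := [set v | p v == None].
Definition allowed p v : {set C} := [set a | [forall w, e v w ==> (p w != Some a)]].
Definition pin p v a : pins := [ffun w => if w == v then Some a else p w].

Lemma free_pin p v a : free (pin p v a) = free p :\ v.
Proof. by apply/setP=> w; rewrite !inE ffunE; case: (w == v). Qed.

Lemma allowed_pin p v a w : v \in free p ->
  allowed (pin p v a) w = rem (allowed p) (nbr e v) a w.
Proof.
rewrite inE => /eqP pv; apply/setP=> b; rewrite /rem [w \in nbr e v]inE e_sym; case: ifP => ewv.
  rewrite !inE; apply/forallP/andP => [h|[ba /forallP h] u].
    split.
      have := h v; rewrite ewv ffunE eqxx /=; apply: contraNneq => ->; exact: eqxx.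
    apply/forallP=> u; have := h u; rewrite ffunE; case: (eqVneq u v) => [-> _|//].
    by rewrite pv implybT.
  have := h u; rewrite ffunE; case: (eqVneq u v) => [-> _|//]; apply/implyP=> _.
  by apply: contraNneq ba => -[->].
rewrite !inE; apply: eq_forallb => u; rewrite ffunE; case: (eqVneq u v) => [->|//].
by rewrite ewv.
Qed.

(** Distinct struck colours sit on distinct pinned lattice neighbours. *)
Lemma cls_allowed p : cls lat Delta (free p) (allowed p).
Proof.
move=> v vf; pose B := [set w in ~: free p | lat v w].
have h1 : (edeg lat (free p) v + #|B| <= Delta)%N.
  apply: leq_trans (deg_le v); rewrite /edeg /B -cardsUI.
  rewrite [X in (_ + X)%N](_ : _ = 0%N) ?addn0; last first.
    apply/eqP; rewrite cards_eq0; apply/eqP/setP=> w; rewrite !inE.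
    by case: (_ == None); rewrite ?andbF.
  by apply: subset_leq_card; apply/subsetP=> w; rewrite !inE -andb_orl => /andP[_ ->].
have h2 : (#|~: allowed p v| <= #|B|)%N.
  apply: leq_trans (leq_imset_card (fun w => odflt c0 (p w)) B); apply: subset_leq_card.
  apply/subsetP=> a; rewrite !inE negb_forall => /existsP[w]; rewrite negb_imply negbK => /andP[evw /eqP pw].
  by apply/imsetP; exists w; rewrite ?inE ?pw // e_lat.
have := cardsC (allowed p v); move: h1 h2; clear; lia.
Qed.

Lemma cls_sub (H A : {set V}) (L : V -> {set C}) : A \subset H -> cls lat Delta H L -> cls lat Delta A L.
Proof.
move=> /subsetP AH c v vA; apply: leq_trans (c v (AH v vA)); rewrite leq_add2l.
by apply: subset_leq_card; apply/subsetP=> w; rewrite !inE => /andP[/AH -> ->].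
Qed.

Definition Pr p v a : rat := prob c0 e (free p) (allowed p) v a.
Definition Z p : rat := count c0 e (free p) (allowed p).

Lemma Z_gt0 p : 0 < Z p.
Proof. exact: (cls_count_gt0 c0 e_sym e_irr e_lat D_lt (@cls_allowed p)). Qed.

Lemma csum_at H (L : V -> {set C}) v a : v \in H -> csum c0 e H L (is_at v a) =
  if a \in L v then count c0 e (H :\ v) (rem L (nbr e v) a) else 0.
Proof.
move=> vH; rewrite (csum_peel c0 e_sym e_irr _ _ vH).
have E b : csum c0 e (H :\ v) (rem L (nbr e v) b) (fun c => is_at v a (upd c v b)) =
    if b == a then count c0 e (H :\ v) (rem L (nbr e v) b) else 0.
  rewrite (eq_csum_fun c0 e _ _ (g := fun=> (b == a)%:R)) => [|c]; last by rewrite /is_at ffunE eqxx.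
  by rewrite csum_cst; case: (b == a); rewrite ?mul1r ?mul0r.
rewrite (eq_bigr _ (fun b _ => E b)) -big_mkcondr; case: ifP => aL.
  rewrite (big_pred1 a) // => b /=; case: (eqVneq b a) => [->|]; rewrite ?aL ?andbF //.
by rewrite big_pred0 // => b; case: (eqVneq b a) => [->|]; rewrite ?aL ?andbF.
Qed.

Lemma prob_sum H (L : V -> {set C}) v : v \in H -> 0 < count c0 e H L ->
  \sum_(a in L v) prob c0 e H L v a = 1.
Proof.
move=> vH p0; rewrite /prob -mulr_suml; under eq_bigr => a aL do rewrite csum_at // aL.
have -> : \sum_(a in L v) count c0 e (H :\ v) (rem L (nbr e v) a) = count c0 e H L.
  by rewrite [RHS]/count (csum_peel c0 e_sym e_irr _ _ vH).
by rewrite divff // lt0r_neq0.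
Qed.

Lemma prob_ge0 H (L : V -> {set C}) v a : 0 <= prob c0 e H L v a.
Proof.
by apply: mulr_ge0; [apply: csum_ge0 => c; exact: ler0n|rewrite invr_ge0; exact: count_ge0].
Qed.

Lemma Z_pin p v a : v \in free p -> a \in allowed p v -> Z (pin p v a) = Pr p v a * Z p.
Proof.
move=> vf aL; rewrite /Pr /prob csum_at // aL mulfVK ?lt0r_neq0 ?Z_gt0 //.
rewrite /Z free_pin; apply: eq_csum_lists => w _; exact: allowed_pin.
Qed.

Lemma Pr_pin p v s a c : s \in free p ->
  Pr (pin p s a) v c = prob c0 e (free p :\ s) (rem (allowed p) (nbr e s) a) v c.
Proof. by move=> sf; rewrite /Pr free_pin; apply: eq_prob => w _; exact: allowed_pin. Qed.

Lemma Pr_total p v s c : s \in free p -> s != v ->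
  Pr p v c = \sum_(a in allowed p s) Pr p s a * Pr (pin p s a) v c.
Proof.
move=> sf sv; rewrite {1}/Pr /prob (csum_peel c0 e_sym e_irr _ _ sf) mulr_suml.
apply: eq_bigr => a aL.
rewrite (eq_csum_fun c0 e _ _ (g := is_at v c)) => [|d]; last by rewrite /is_at ffunE [v == s]eq_sym (negPf sv).
have W0 := Z_gt0 (pin p s a); have Z0 := Z_gt0 p.
have := Z_pin sf aL; rewrite (Pr_pin _ _ _ sf) /prob.
have -> : count c0 e (free p :\ s) (rem (allowed p) (nbr e s) a) = Z (pin p s a).
  by rewrite /Z free_pin; apply: eq_csum_lists => w _; rewrite allowed_pin.
move=> ->; rewrite -/(Z p); set x := csum _ _ _ _ _.
have P0 : Pr p s a != 0.
  apply/eqP=> h; move: W0; rewrite (Z_pin sf aL) h mul0r ltxx //.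
by field; rewrite P0 lt0r_neq0.
Qed.

Section Estimate.
Variable r : nat.
(** Radius [r + 2] exactly: its vertices lie outside the ball of radius [r + 1], as [decay] with
    exponent [r] demands, and they separate that ball from the rest. *)
Definition sphere p v := [seq s <- enum V | (s \in ball e v r.+2) && (s \notin ball e v r.+1) && (p s == None)].
Definition inner p v := [set s in free p | s \in ball e v r.+1].
Definition loc p v a := prob c0 e (inner p v) (allowed p) v a.

(** The expectation of [g] when the vertices of [S] are pinned in turn, each with the law [E] given
    the earlier pins. *)
Fixpoint walk (E : pins -> V -> C -> rat) (S : seq V) (g : pins -> rat) p : rat :=
  if S is s :: S' then \sum_(b in allowed p s) E p s b * walk E S' g (pin p s b) else g p.

Definition first p v := nth c0 [seq a <- enum C | a \in allowed p v] 0.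

(** Depth zero is a point mass, so that the estimates at every depth are nonnegative and sum to one,
    on which [walk_err] relies. *)
Fixpoint est k p v a : rat :=
  if k is k'.+1 then walk (est k') (sphere p v) (fun p' => loc p' v a) p
  else (a == first p v)%:R.

Lemma allowed_n0 p v : v \in free p -> (0 < #|allowed p v|)%N.
Proof. by move=> vf; have := cls_allowed vf; move: D_lt; clear; lia. Qed.

Lemma first_allowed p v : v \in free p -> first p v \in allowed p v.
Proof.
move=> vf; have : first p v \in [seq a <- enum C | a \in allowed p v].
  apply: mem_nth; rewrite size_filter -has_count; have /card_gt0P[a aL] := allowed_n0 vf.
  by apply/hasP; exists a; rewrite ?mem_enum.
by rewrite mem_filter => /andP[].
Qed.

Definition reach (S : seq V) p (p' : pins) :=
  (forall s, s \notin S -> p' s = p s) /\ (forall s, s \in S -> p' s != None).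

Lemma reach_pin s S p b p' : s \notin S -> reach S (pin p s b) p' -> reach (s :: S) p p'.
Proof.
move=> sS [h1 h2]; split=> u; rewrite inE.
  by rewrite negb_or => /andP[us /h1 ->]; rewrite ffunE (negPf us).
by case/orP=> [/eqP ->|/h2 //]; rewrite (h1 s sS) ffunE eqxx.
Qed.

Lemma pin_free p s b S : s \notin S -> (forall u, u \in s :: S -> u \in free p) ->
  forall u, u \in S -> u \in free (pin p s b).
Proof.
move=> sS fS u uS; rewrite free_pin in_setD1 fS ?inE ?uS ?orbT // andbT.
by apply: contraNneq sS => <-.
Qed.

Lemma walk_sum (E : pins -> V -> C -> rat) S (A : {set C}) (g : C -> pins -> rat) p :
  (forall p' s, s \in free p' -> \sum_(b in allowed p' s) E p' s b = 1) ->
  uniq S -> (forall s, s \in S -> s \in free p) ->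
  (forall p', reach S p p' -> \sum_(a in A) g a p' = 1) ->
  \sum_(a in A) walk E S (g a) p = 1.
Proof.
move=> hE; elim: S p => [|s S IH] p /= uS fS hg; first by apply: hg; split.
case/andP: uS => sS uS; rewrite exchange_big /=.
have sf : s \in free p by apply: fS; rewrite inE eqxx.
rewrite -[RHS](hE p s sf); apply: eq_bigr => b _; rewrite -mulr_sumr IH ?mulr1 //.
  exact: pin_free sS fS.
by move=> p' /(reach_pin sS); exact: hg.
Qed.

Lemma walk_ge0 (E : pins -> V -> C -> rat) S (g : pins -> rat) p :
  (forall p' s b, 0 <= E p' s b) -> (forall p', 0 <= g p') -> 0 <= walk E S g p.
Proof.
move=> hE hg; elim: S p => [|s S IH] p //=.
by apply: sumr_ge0 => b _; apply: mulr_ge0.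
Qed.

Lemma sphereP p v s : s \in sphere p v ->
  [/\ s \in ball e v r.+2, s \notin ball e v r.+1, s \in free p & s != v].
Proof.
rewrite mem_filter => /andP[/andP[/andP[h1 h2] h3] _].
have sf : s \in free p by rewrite inE h3.
split=> //.
by apply: contraNneq h2 => ->; exact: ball_center.
Qed.

Lemma ball_edge v x n w : x \in ball e v n -> e x w -> w \in ball e v n.+1.
Proof. by move=> xb exw; rewrite /ball iterS; apply/setUP; right; rewrite inE; apply/existsP; exists x; rewrite xb. Qed.

Lemma reach_center p v p' : v \in free p -> reach (sphere p v) p p' ->
  v \in free p' /\ allowed p v = allowed p' v.
Proof.
move=> vf [h1 h2].
have E w : w \in ball e v r.+1 -> p' w = p w.
  by move=> wb; apply: h1; apply/negP=> /sphereP[_]; rewrite wb.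
split; first by move: vf; rewrite !inE E ?ball_center.
apply/setP=> a; rewrite !inE; apply: eq_forallb => w; case evw: (e v w) => //=.
by rewrite E //; apply: ball_edge evw; exact: ball_center.
Qed.

Lemma inner_cls p v : cls lat Delta (inner p v) (allowed p).
Proof. by apply: cls_sub (@cls_allowed p); apply/subsetP=> w; rewrite inE => /andP[]. Qed.

Lemma est_sum k p v : v \in free p -> \sum_(a in allowed p v) est k p v a = 1.
Proof.
elim: k p v => [|k IH] p v vf /=.
  rewrite (bigD1 (first p v)) ?first_allowed //= eqxx big1 ?addr0 // => a /andP[_ /negbTE ->] //.
apply: walk_sum => //.
- exact: filter_uniq (enum_uniq _).
- by move=> s /sphereP[].
move=> p' hr; have [vf' ->] := reach_center vf hr.
apply: prob_sum; first by rewrite inE vf' ball_center.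
exact: (cls_count_gt0 c0 e_sym e_irr e_lat D_lt (@inner_cls p' v)).
Qed.

Lemma est_ge0 k p v a : 0 <= est k p v a.
Proof.
elim: k p v a => [|k IH] p v a /=; first exact: ler0n.
by apply: walk_ge0 => // p'; exact: prob_ge0.
Qed.

(** Once the sphere is pinned, no free vertex outside touches the inner ball. The centred indicator
    [f] sums to zero inside, and [csum_lift_eq0] carries this to all free vertices. *)
Lemma loc_exact p v a : v \in free p ->
  (forall s, s \in free p -> s \in ball e v r.+2 -> s \in ball e v r.+1) -> loc p v a = Pr p v a.
Proof.
move=> vf hs; set A := inner p v; have AH : A \subset free p.
  by apply/subsetP=> w; rewrite inE => /andP[].
have vA : v \in A by rewrite inE vf ball_center.
have cA := cls_count_gt0 c0 e_sym e_irr e_lat D_lt (@inner_cls p v).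
pose f (c : {ffun V -> C}) : rat := is_at v a c - loc p v a.
have E H : csum c0 e H (allowed p) f = csum c0 e H (allowed p) (is_at v a) - loc p v a * count c0 e H (allowed p).
  by rewrite -csum_cst -csum_opp -csum_add.
have : csum c0 e (free p) (allowed p) f = 0.
  apply: (csum_lift_eq0 e_sym e_irr AH) => //.
  - by move=> c c' cc; rewrite /f /is_at cc.
  - move=> w y; rewrite /A /inner in_set => /andP[wf wb] yf; rewrite in_set yf /= => yb.
    apply/negP=> ewy; move/negP: yb; apply; apply: hs => //.
    exact: ball_edge wb ewy.
  rewrite E /loc /prob -/A mulfVK ?subrr //; exact: lt0r_neq0.
rewrite E => /eqP; rewrite subr_eq0 => /eqP h.
by rewrite /Pr /prob h mulfK // lt0r_neq0 // Z_gt0.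
Qed.

Section Error.
Variables (K1 lam : rat).
Hypothesis dec : decay c0 e lat Delta K1 lam.
Let eta := K1 * lam ^+ r.

(** Exchange the true marginals for [E] one vertex at a time. Both laws sum to one, so the value at
    a reference colour [b0] can be subtracted; each colour then costs the error [delta] of [E] times
    the influence [eta], a product of two small quantities. *)
Lemma walk_err (E : pins -> V -> C -> rat) (delta : rat) S (g : pins -> rat) p v c :
  (forall p' s b, 0 <= E p' s b) ->
  (forall p' s, s \in free p' -> \sum_(b in allowed p' s) E p' s b = 1) ->
  (forall p' s b, s \in free p' -> `|E p' s b - Pr p' s b| <= delta) -> 0 <= delta -> 0 <= eta ->
  uniq S -> (forall s, s \in S -> s \in free p) -> (forall s, s \in S -> s \notin ball e v r.+1) ->
  (forall p', reach S p p' -> g p' = Pr p' v c) ->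
  `|walk E S g p - Pr p v c| <= (size S)%:R * (#|C|%:R * (delta * eta)).
Proof.
move=> hE0 hE hd d0 eta0; elim: S p => [|s S IH] p /= uS fS bS hg.
  by rewrite hg ?subrr ?normr0 ?mul0r //; split.
case/andP: uS => sS uS; have sf : s \in free p by apply: fS; rewrite inE eqxx.
have sb : s \notin ball e v r.+1 by apply: bS; rewrite inE eqxx.
have sv : s != v by apply: contraNneq sb => ->; exact: ball_center.
set X := #|C|%:R * (delta * eta).
have {}IH b : `|walk E S g (pin p s b) - Pr (pin p s b) v c| <= (size S)%:R * X.
  apply: IH => //; first exact: pin_free sS fS.
  - by move=> u uS'; apply: bS; rewrite inE uS' orbT.
  - by move=> p' /(reach_pin sS); exact: hg.
set b0 := first p s.
have -> : \sum_(b in allowed p s) E p s b * walk E S g (pin p s b) - Pr p v c =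
   \sum_(b in allowed p s) E p s b * (walk E S g (pin p s b) - Pr (pin p s b) v c) +
   \sum_(b in allowed p s) (E p s b - Pr p s b) * (Pr (pin p s b) v c - Pr (pin p s b0) v c).
  rewrite (Pr_total c sf sv).
  have E0 : \sum_(b in allowed p s) (E p s b - Pr p s b) * Pr (pin p s b0) v c = 0.
    rewrite -mulr_suml sumrB hE //.
    by rewrite (prob_sum sf (Z_gt0 p)) subrr mul0r.
  rewrite [X in _ = _ + X](eq_bigr (fun b => (E p s b - Pr p s b) * Pr (pin p s b) v c -
      (E p s b - Pr p s b) * Pr (pin p s b0) v c)) => [|b _]; last by rewrite mulrBr.
  rewrite [X in _ = _ + X]sumrB E0 subr0 -sumrB -big_split /=; apply: eq_bigr => b _; ring.
apply: le_trans (ler_normD _ _) _; rewrite mulrSr mulrDl mul1r; apply: lerD.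
  apply: le_trans (ler_norm_sum _ _ _) _.
  apply: le_trans (_ : \sum_(b in allowed p s) E p s b * ((size S)%:R * X) <= _); last first.
    by rewrite -mulr_suml hE // mul1r.
  apply: ler_sum => b _.
  by rewrite normrM (ger0_norm (hE0 _ _ _)); apply: ler_wpM2l.
apply: le_trans (ler_norm_sum _ _ _) _.
apply: le_trans (_ : \sum_(b in allowed p s) delta * eta <= _).
  apply: ler_sum => b _; rewrite normrM; apply: ler_pM => //; first exact: hd.
  by rewrite !(Pr_pin _ _ _ sf); apply: dec => //; exact: cls_allowed.
rewrite sumr_const -[_ *+ _]mulr_natl; apply: ler_wpM2r; first exact: mulr_ge0.
by rewrite ler_nat; exact: max_card.
Qed.

Variable Smax : nat.
Hypothesis sphere_le : forall p v, (size (sphere p v) <= Smax)%N.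
Hypothesis eta0 : 0 <= eta.
Hypothesis small : Smax%:R * (#|C|%:R * eta) <= 1 / 2.

Lemma est_err k p v a : v \in free p -> `|est k p v a - Pr p v a| <= (1/2) ^+ k.
Proof.
elim: k p v a => [|k IH] p v a vf.
  rewrite /= expr0; have /andP[h1 h2] := prob_range c0 e_sym e_irr e_lat D_lt v a (@cls_allowed p).
  rewrite -/(Pr p v a) in h1 h2; have hb (b : bool) : 0 <= (b%:R : rat) <= 1 by case: b; rewrite ?ler01 ?lexx ?andbT.
  by have /andP[g1 g2] := hb (a == first p v); rewrite ler_norml; apply/andP; split; lra.
have d0 : 0 <= (1/2 : rat) ^+ k by apply: exprn_ge0; lra.
have := @walk_err (est k) ((1/2) ^+ k) (sphere p v) (fun p' => loc p' v a) p v a.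
move=> h; apply: le_trans (h _ _ _ d0 eta0 _ _ _ _) _.
- exact: est_ge0.
- by move=> p' s; exact: est_sum.
- by move=> p' s b; exact: IH.
- exact: filter_uniq (enum_uniq _).
- by move=> s /sphereP[].
- by move=> s /sphereP[].
- move=> p' hr; have [vf' _] := reach_center vf hr; apply: loc_exact => // s sf sb.
  apply/negPn/negP=> sb'; case: hr => h1 h2; move: sf; rewrite inE => sf.
  have [sS|sS] := boolP (s \in sphere p v); first by move: (h2 s sS); rewrite sf.
  have hs := h1 s sS; by move: sS; rewrite mem_filter sb sb' mem_enum -hs sf.
rewrite exprS; apply: le_trans (_ : Smax%:R * (#|C|%:R * eta) * (1/2) ^+ k <= _).
  have -> : Smax%:R * (#|C|%:R * eta) * (1/2) ^+ k = Smax%:R * (#|C|%:R * ((1/2) ^+ k * eta)) by ring.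
  apply: ler_wpM2r; last by rewrite ler_nat.
  by apply: mulr_ge0; [exact: ler0n|exact: mulr_ge0].
by apply: ler_wpM2r.
Qed.

(** A lower bound on the marginal of an allowed colour: [is_at_lb] with lists that exceed the degree
    by two after the deletion of [v]. It converts additive errors into relative ones. *)
Definition rho : rat := (1/2) ^+ Delta / #|C|%:R.

Lemma rho_gt0 : 0 < rho.
Proof.
apply: divr_gt0; first by apply: exprn_gt0; lra.
by rewrite ltr0n; move: D_lt; clear; lia.
Qed.

Lemma Pr_lb p v a : v \in free p -> a \in allowed p v -> rho <= Pr p v a.
Proof.
move=> vf aL; rewrite /Pr /prob ler_pdivlMr; last exact: Z_gt0.
have := @is_at_lb V C c0 e e_sym e_irr (free p) (allowed p) v a 2 Delta isT vf aL.
have -> : (1 - 2%:R^-1 : rat) = 1/2 by lra.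
apply.
  move=> y /setD1P[yv yf] evy _; have := cls_allowed yf.
  rewrite (edegD1 lat y vf) lat_sym e_lat //.
  by have := edeg_le e_lat (free p :\ v) y; move: D_lt; clear; lia.
apply: leq_trans (edeg_le e_lat _ _) _; apply: leq_trans (deg_le v).
by apply: subset_leq_card; apply/subsetP=> w; rewrite !inE => /andP[_ ->].
Qed.

Fixpoint prodest k (vs : seq V) p : rat :=
  if vs is v :: vs' then (est k p v (first p v))^-1 * prodest k vs' (pin p v (first p v)) else 1.

(** Both directions are stated with the factor [1 - n * tau], so the induction only uses [(1 - n *
    tau) * (1 - tau) >= 1 - (n + 1) * tau], up to nonnegative terms, and no upper factor has to be
    inverted. *)
Lemma prodest_bounds k (tau : rat) vs p : uniq vs -> free p = [set v in vs] ->
  0 <= tau -> (size vs)%:R * tau <= 1 / 2 -> (1/2) ^+ k <= rho * tau ->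
  [/\ 0 < prodest k vs p, (1 - (size vs)%:R * tau) * Z p <= prodest k vs p
    & (1 - (size vs)%:R * tau) * prodest k vs p <= Z p].
Proof.
elim: vs p => [|v vs IH] p /=.
  move=> _ fp _ _ _; have -> : Z p = 1.
    by rewrite /Z /count (_ : free p = set0) ?csum0 // fp; apply/setP=> w; rewrite !inE.
  by rewrite mul0r subr0 !mul1r; split; lra.
move=> /andP[vvs uvs] fp t0 nt hk; have vf : v \in free p by rewrite fp !inE eqxx.
set a := first p v; have aL : a \in allowed p v by exact: first_allowed.
have fp' : free (pin p v a) = [set w in vs].
  rewrite free_pin fp; apply/setP=> w; rewrite !inE; case: (eqVneq w v) => [->|] //=.
  by rewrite (negPf vvs).
rewrite -natr1 mulrDl mul1r in nt *; set n := (size vs)%:R in nt IH *.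
have n0 : 0 <= n by exact: ler0n.
have nt0 : 0 <= n * tau by exact: mulr_ge0.
have [|X0 lo hi] := IH _ uvs fp' t0 _ hk; first by lra.
set X := prodest _ _ _ in X0 lo hi *.
have ZE := Z_pin vf aL; set P := Pr p v a in ZE; set E := est k p v a.
have P0 : rho <= P by exact: Pr_lb.
have rg := rho_gt0; have Pp : 0 < P by lra.
have EP : `|E - P| <= rho * tau by apply: le_trans hk; exact: est_err.
have rP : rho * tau <= P * tau by apply: ler_wpM2r.
move: EP; rewrite ler_norml => /andP[E1 E2].
have P1 : 0 < P * (1 - tau) by apply: mulr_gt0; lra.
have Ep : 0 < E by lra.
have Z0 := Z_gt0 p.
rewrite ZE in lo hi; split.
- by apply: mulr_gt0; rewrite ?invr_gt0.
- rewrite ler_pdivlMl //.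
  have t1 : E * Z p <= P * (1 + tau) * Z p by apply: ler_wpM2r; lra.
  have t2 := mulr_ge0 (mulr_ge0 (ltW Pp) (ltW Z0)) (mulr_ge0 nt0 t0).
  have t3 := mulr_ge0 (mulr_ge0 (ltW Pp) (ltW Z0)) (mulr_ge0 t0 t0).
  apply: le_trans (_ : (1 - (n * tau + tau)) * (P * (1 + tau) * Z p) <= _).
    by rewrite mulrCA; apply: ler_wpM2l => //; lra.
  by lra.
rewrite [E^-1 * X]mulrC mulrA ler_pdivrMr //.
have t1 : P * (1 - tau) * Z p <= E * Z p by apply: ler_wpM2r; lra.
have t2 := mulr_ge0 (ltW X0) (mulr_ge0 nt0 t0).
have t3 : (1 - tau) * ((1 - n * tau) * X) <= (1 - tau) * (P * Z p) by apply: ler_wpM2l; lra.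
lra.
Qed.

Lemma prodest_approx k (eps : rat) vs p : uniq vs -> free p = [set v in vs] -> 0 < eps < 1 ->
  (2 * (size vs)%:R + 1) * (1/2) ^+ k <= rho * eps ->
  0 < prodest k vs p /\ (1 - eps) * Z p <= prodest k vs p <= (1 + eps) * Z p.
Proof.
move=> uvs fp /andP[e0 e1] hk; set n := (size vs)%:R in hk *.
have n0 : 0 <= n by exact: ler0n.
pose tau := eps / (2 * n + 1).
have d0 : 0 < 2 * n + 1 by lra.
have tE : tau * (2 * n + 1) = eps by rewrite mulfVK // lt0r_neq0.
have t0 : 0 <= tau by apply: mulr_ge0; rewrite ?invr_ge0; lra.
have nt : n * tau <= eps / 2 by lra.
have hk' : (1/2) ^+ k <= rho * tau by rewrite mulrA ler_pdivlMr // mulrC.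
have [|X0 lo hi] := prodest_bounds uvs fp t0 _ hk'; first by rewrite -/n; lra.
rewrite -/n in lo hi; split=> //; have Z0 := Z_gt0 p; set X := prodest _ _ _ in X0 lo hi *.
have t1 : (n * tau) * Z p <= eps / 2 * Z p by apply: ler_wpM2r => //; exact: ltW.
have t2 : (n * tau) * X <= eps / 2 * X by apply: ler_wpM2r => //; exact: ltW.
have t5 : 0 <= eps * Z p by apply: mulr_ge0; exact: ltW.
apply/andP; split; first by lra.
have t3 : (1 + eps) * ((1 - eps/2) * X) <= (1 + eps) * Z p by apply: ler_wpM2l; lra.
have t4 : 0 <= eps * (1 - eps) * X by apply: mulr_ge0; [apply: mulr_ge0|]; lra.
lra.
Qed.

End Error.
End Estimate.
End Pins.

Lemma bernoulli (h : rat) m : 0 <= h -> 1 + m%:R * h <= (1 + h) ^+ m.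
Proof.
move=> h0; elim: m => [|m IH]; first by rewrite mul0r addr0 expr0.
rewrite exprS -natr1; apply: le_trans (_ : (1 + h) * (1 + m%:R * h) <= _).
  have : 0 <= h * (m%:R * h) by rewrite !mulr_ge0 ?ler0n.
  lra.
by apply: ler_wpM2l => //; lra.
Qed.

(** With [lam = 1 - h], Bernoulli and [(1 - h) * (1 + h) <= 1] give [lam ^+ m <= 1 / (m * h)]. The
    fourth power of this, at radius [4 * m], beats the cubic growth of the balls once [m] exceeds
    [B]. *)
Lemma decay_radius (A lam : rat) : 0 <= A -> 0 <= lam < 1 ->
  exists r, (2 * (2 * r.+2 + 1) ^ 3)%:R * (A * lam ^+ r) <= 1 / 2.
Proof.
move=> A0 /andP[l0 l1]; have [h [h0 hE]] : exists h : rat, 0 < h /\ lam = 1 - h.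
  by exists (1 - lam); split; lra.
have h4 : 0 < h ^+ 4 by exact: exprn_gt0.
have [B [B0 BE]] : exists B : rat, 0 <= B /\ B * h ^+ 4 = 4 * A * 13%:R ^+ 3.
  exists (4 * A * 13%:R ^+ 3 / h ^+ 4); rewrite mulfVK ?lt0r_neq0 //; split=> //.
  apply: mulr_ge0; last by rewrite invr_ge0 ltW.
  by apply: mulr_ge0; [apply: mulr_ge0; [lra|exact: A0]|exact/exprn_ge0/ler0n].
have [m [mp mB]] : exists m : nat, (0 < m)%N /\ B <= m%:R.
  exists (Num.bound B).+1; split=> //.
  by apply: ltW; apply: lt_trans (archi_boundP B0) _; rewrite ltr_nat.
have m1 : 1 <= m%:R :> rat by rewrite ler1n.
have key : lam ^+ m * (m%:R * h) <= 1.
  have b := @bernoulli h m (ltW h0).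
  apply: le_trans (_ : lam ^+ m * (1 + h) ^+ m <= _).
    by apply: ler_wpM2l; [exact: exprn_ge0|lra].
  rewrite -exprMn; apply: exprn_ile1; first by apply: mulr_ge0 => //; lra.
  by have := mulr_ge0 (ltW h0) (ltW h0); rewrite hE; lra.
exists (4 * m)%N; set y := lam ^+ m in key.
have y0 : 0 <= y by exact: exprn_ge0.
have -> : lam ^+ (4 * m) = y ^+ 4 by rewrite mulnC exprM.
(* Twice [4 * m + 2] plus one is [8 * m + 5], at most [13 * m] for positive [m]. *)
have sz : (2 * (2 * (4 * m).+2 + 1) ^ 3)%:R <= 2 * (13%:R * m%:R) ^+ 3 :> rat.
  rewrite -natrM -natrX -natrM ler_nat leq_mul2l /= leq_exp2r //.
  by move: mp; clear; lia.
have mh : 0 < m%:R * h by apply: mulr_gt0 => //; lra.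
have y4 : y ^+ 4 * (m%:R * h) ^+ 4 <= 1.
  by rewrite -exprMn; apply: exprn_ile1 => //; apply: mulr_ge0 => //; exact: ltW.
apply: le_trans (_ : 2 * (13%:R * m%:R) ^+ 3 * (A * y ^+ 4) <= _).
  by apply: ler_wpM2r => //; apply: mulr_ge0 => //; exact: exprn_ge0.
have m4 : 0 < m%:R ^+ 3 :> rat by apply: exprn_gt0; lra.
have t1 : 4 * A * 13%:R ^+ 3 <= m%:R * h ^+ 4 by rewrite -BE; apply: ler_wpM2r => //; exact: ltW.
have t2 : (4 * A * 13%:R ^+ 3) * (m%:R ^+ 3 * y ^+ 4) <= (m%:R * h ^+ 4) * (m%:R ^+ 3 * y ^+ 4).
  by apply: ler_wpM2r => //; apply: mulr_ge0; [exact: ltW|exact: exprn_ge0].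
have t3 : (m%:R * h ^+ 4) * (m%:R ^+ 3 * y ^+ 4) = y ^+ 4 * (m%:R * h) ^+ 4 by ring.
have t4 : 2 * (13%:R * m%:R) ^+ 3 * (A * y ^+ 4) = (4 * A * 13%:R ^+ 3) * (m%:R ^+ 3 * y ^+ 4) / 2.
  by field.
rewrite t4; lra.
Qed.
End Estimator.

(** * Tree functions computable in time polynomial in a unary clock *)

Module PolyTime.
Import Defs.
Definition fn := nat -> tree -> tree.
Definition hd (t : tree) := if t is Node a _ then a else Leaf.
Definition tl (t : tree) := if t is Node _ a then a else Leaf.
Fixpoint spine (t : tree) : seq tree := if t is Node x u then x :: spine u else [::].

(** Register 1 holds the clock, a list of length [N]. The program for [f] works in register [b],
    takes scratch space above it and preserves everything below. The time depends on [N] only and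
    not on the data, since copying a tree is a single step and loops run over the clock; this is why
    the class is closed under composition. *)
Definition PT (f : fn) : Prop := exists K d, forall b, 1 < b -> exists c, forall s, exists k s',
  [/\ exec c s k s', k <= K * (size (spine (s 1))).+1 ^ d,
      s' b = f (size (spine (s 1))) (s b) & forall i, i < b -> s' i = s i].

Lemma update_eq s x t : update s x t x = t. Proof. by rewrite /update eqxx. Qed.
Lemma update_neq s x t y : y != x -> update s x t y = s y.
Proof. by rewrite /update => /negbTE ->. Qed.

Ltac upd := rewrite ?update_eq; repeat (rewrite update_neq; [|by lia]); rewrite ?update_eq.

Lemma pow_pad K d d' N : K * N.+1 ^ d <= K * N.+1 ^ (d + d').
Proof. by rewrite leq_mul2l leq_pexp2l ?leq_addr ?orbT. Qed.

Lemma pow_const m d N : m <= m * N.+1 ^ d.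
Proof. by rewrite leq_pmulr // expn_gt0. Qed.

Lemma PT_expr (f : fn) E : (forall s b N, eval s (E b) = f N (s b)) ->
  (forall b, cost (E b) <= 9) -> PT f.
Proof.
move=> hE hc; exists 10, 0 => b b1; exists (Assign b (E b)) => s.
exists (cost (E b)).+1, (update s b (eval s (E b))); split.
- exact: exec_assign.
- by rewrite expn0 muln1 ltnS.
- by rewrite update_eq; exact: hE.
by move=> i ib; upd.
Qed.

Lemma PT_id : PT (fun _ t => t).
Proof. exact: (@PT_expr _ EVar). Qed.
Lemma PT_leaf : PT (fun _ _ => Leaf).
Proof. exact: (@PT_expr _ (fun _ => ELeaf)). Qed.
Lemma PT_hd0 : PT (fun _ t => hd t).
Proof. exact: (@PT_expr _ (fun b => EFst (EVar b))). Qed.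
Lemma PT_tl0 : PT (fun _ t => tl t).
Proof. exact: (@PT_expr _ (fun b => ESnd (EVar b))). Qed.

Lemma PT_comp (g f : fn) : PT g -> PT f -> PT (fun N t => g N (f N t)).
Proof.
move=> [Kg [dg hg]] [Kf [df hf]]; exists (Kg + Kf + 1), (dg + df) => b b1.
have [cg {}hg] := hg b b1; have [cf {}hf] := hf b b1; exists (Seq cf cg) => s.
have [k1 [s1 [e1 t1 r1 p1]]] := hf s; have [k2 [s2 [e2 t2 r2 p2]]] := hg s1.
exists (k1 + k2).+1, s2; split; first exact: exec_seq e1 e2.
- rewrite p1 // in t2; have := pow_pad Kg dg df (size (spine (s 1))).
  have := pow_pad Kf df dg (size (spine (s 1))); rewrite [df + dg]addnC.
  have := pow_const 1 (dg + df) (size (spine (s 1))); rewrite !mulnDl.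
  by move: t1 t2; clear; lia.
- by rewrite r2 r1 p1.
by move=> i ib; rewrite p2 // p1.
Qed.

Lemma PT_hd f : PT f -> PT (fun N t => hd (f N t)).
Proof. exact: PT_comp PT_hd0. Qed.
Lemma PT_tl f : PT f -> PT (fun N t => tl (f N t)).
Proof. exact: PT_comp PT_tl0. Qed.

Lemma PT_node (f g : fn) : PT f -> PT g -> PT (fun N t => Node (f N t) (g N t)).
Proof.
move=> [Kf [df hf]] [Kg [dg hg]]; exists (Kg + Kf + 12), (dg + df) => b b1.
have [cf {}hf] := hf b.+1 (ltnW b1); have [cg {}hg] := hg b.+2 (ltnW (ltnW b1)).
exists (Seq (Assign b.+1 (EVar b)) (Seq cf (Seq (Assign b.+2 (EVar b))
  (Seq cg (Assign b (ENode (EVar b.+1) (EVar b.+2))))))) => s.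
have [k1 [s1 [e1 t1 r1 p1]]] := hf (update s b.+1 (s b)).
have [k2 [s2 [e2 t2 r2 p2]]] := hg (update s1 b.+2 (s1 b)).
exists (2 + (k1 + (2 + (k2 + 4).+1).+1).+1).+1, (update s2 b (Node (s2 b.+1) (s2 b.+2))); split.
- apply: exec_seq; first exact: exec_assign.
  apply: exec_seq e1 _; apply: exec_seq; first exact: exec_assign.
  by apply: exec_seq e2 _; exact: exec_assign.
- have E1 : update s1 b.+2 (s1 b) 1 = s 1 by upd; rewrite p1 ?update_neq //; lia.
  have E0 : update s b.+1 (s b) 1 = s 1 by upd.
  rewrite E1 in t2; rewrite E0 in t1.
  have := pow_pad Kg dg df (size (spine (s 1))).
  have := pow_pad Kf df dg (size (spine (s 1))); rewrite [df + dg]addnC.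
  have := pow_const 12 (dg + df) (size (spine (s 1))); rewrite !mulnDl.
  by move: t1 t2; clear; lia.
- have E0 : update s b.+1 (s b) 1 = s 1 by upd.
  have E1 : s1 1 = s 1 by rewrite p1 ?update_neq //; lia.
  have E2 : s1 b = s b by rewrite p1 ?update_neq //; lia.
  rewrite update_eq r2 p2 // ?update_eq ?E2 update_neq; [|by lia].
  by rewrite r1 update_eq E0 update_neq ?E1 //; lia.
move=> i ib; rewrite update_neq ?p2 ?update_neq ?p1 ?update_neq //; lia.
Qed.

Lemma PT_ite (h f g : fn) : PT h -> PT f -> PT g ->
  PT (fun N t => if truthy (h N t) then f N t else g N t).
Proof.
move=> [Kh [dh hh]] [Kf [df hf]] [Kg [dg hg]]; exists (Kh + (Kf + Kg) + 12), (dh + (df + dg)) => b b1.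
have [ch {}hh] := hh b.+1 (ltnW b1); have [cf {}hf] := hf b b1; have [cg {}hg] := hg b b1.
exists (Seq (Assign b.+1 (EVar b)) (Seq ch (If (EVar b.+1) cf cg))) => s.
have [k1 [s1 [e1 t1 r1 p1]]] := hh (update s b.+1 (s b)).
have E0 : update s b.+1 (s b) 1 = s 1 by upd.
have E1 : s1 1 = s 1 by rewrite p1 ?update_neq //; lia.
have E2 : s1 b = s b by rewrite p1 ?update_neq //; lia.
rewrite E0 update_eq in t1 r1; set N := size (spine (s 1)) in t1 r1 *.
have [k2 [s2 [e2 t2 r2 p2]]] : exists k s', [/\ exec (if truthy (eval s1 (EVar b.+1)) then cf else cg) s1 k s',
   k <= (Kf + Kg) * N.+1 ^ (df + dg), s' b = (if truthy (h N (s b)) then f N (s b) else g N (s b))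
   & forall i, i < b -> s' i = s1 i].
  rewrite /= r1; case: ifP => _.
    have [k2 [s2 [e2 t2 r2 p2]]] := hf s1; exists k2, s2; split=> //; last by rewrite r2 E1 E2.
    rewrite E1 in t2; apply: leq_trans t2 _; apply: leq_trans (pow_pad _ _ dg _) _.
    by rewrite leq_mul2r leq_addr orbT.
  have [k2 [s2 [e2 t2 r2 p2]]] := hg s1; exists k2, s2; split=> //; last by rewrite r2 E1 E2.
  rewrite E1 in t2; apply: leq_trans t2 _; apply: leq_trans (pow_pad _ _ df _) _.
  by rewrite addnC leq_mul2r leq_addl orbT.
exists (2 + (k1 + (1 + k2).+1).+1).+1, s2; split.
- apply: exec_seq; first exact: exec_assign.
  apply: exec_seq e1 _; exact: exec_if.
- have := pow_pad Kh dh (df + dg) N; have := pow_pad (Kf + Kg) (df + dg) dh N.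
  rewrite [df + dg + dh]addnC; have := pow_const 12 (dh + (df + dg)) N; rewrite !mulnDl.
  by move: t1 t2; rewrite mulnDl; clear; lia.
- by [].
move=> i ib; rewrite p2 // p1 ?update_neq //; lia.
Qed.

Lemma while_exec (T b : nat) (c : cmd) (f : tree -> tree) (s0 : store) : 1 < b ->
  (forall s, (forall i, i < b -> s i = s0 i) -> exists k s', [/\ exec c s k s', k <= T,
     s' b = f (s b), s' b.+1 = tl (s b.+1) & forall i, i < b -> s' i = s i]) ->
  forall u s, s b.+1 = u -> (forall i, i < b -> s i = s0 i) -> exists k s',
   [/\ exec (While (EVar b.+1) c) s k s', k <= size (spine u) * (T + 2) + 2,
     s' b = iter (size (spine u)) f (s b) & forall i, i < b -> s' i = s i].
Proof.
move=> b1 hc; elim=> [|x _ u IH] s su sE.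
  by exists 2, s; split=> //; apply: exec_while_done; rewrite /= su.
have [k [s1 [e1 t1 r1 u1 p1]]] := hc s sE; rewrite su /= in u1.
have sE1 i : i < b -> s1 i = s0 i by move=> ib; rewrite p1 // sE.
have [k2 [s2 [e2 t2 r2 p2]]] := IH s1 u1 sE1.
exists (1 + k + k2).+1, s2; split.
- by apply: exec_while_step e1 e2; rewrite /= su.
- by move: t1 t2; rewrite /= mulSn; clear; lia.
- by rewrite r2 r1 -iterSr.
by move=> i ib; rewrite p2 // p1.
Qed.

(** A copy of the clock in the register above is consumed as the loop counter, and the degree rises
    by one. *)
Lemma PT_loop (f : fn) : PT f -> PT (fun N t => iter N (f N) t).
Proof.
move=> [K [d hf]]; exists (K + 20), d.+1 => b b1.
have [c {}hf] := hf b.+2 (ltnW (ltnW b1)).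
pose body := Seq (Assign b.+2 (EVar b)) (Seq c (Seq (Assign b (EVar b.+2)) (Assign b.+1 (ESnd (EVar b.+1))))).
exists (Seq (Assign b.+1 (EVar 1)) (While (EVar b.+1) body)) => s.
set N := size (spine (s 1)).
have hb s1 : (forall i, i < b -> s1 i = s i) -> exists k s', [/\ exec body s1 k s', k <= K * N.+1 ^ d + 10,
     s' b = f N (s1 b), s' b.+1 = tl (s1 b.+1) & forall i, i < b -> s' i = s1 i].
  move=> sE; have [k [s2 [e2 t2 r2 p2]]] := hf (update s1 b.+2 (s1 b)).
  have E1 : update s1 b.+2 (s1 b) 1 = s 1 by rewrite update_neq ?sE //; lia.
  rewrite E1 in t2 r2.
  set s3 := update s2 b (s2 b.+2).
  exists (2 + (k + (2 + 3).+1).+1).+1, (update s3 b.+1 (eval s3 (ESnd (EVar b.+1)))); split.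
  - apply: exec_seq; first exact: exec_assign.
    by apply: exec_seq e2 _; apply: exec_seq; exact: exec_assign.
  - by move: t2; rewrite -/N; clear; lia.
  - rewrite update_neq; last by lia.
    by rewrite /s3 update_eq r2 update_eq.
  - rewrite update_eq /= /s3 update_neq; last by lia.
    rewrite p2 ?update_neq //; lia.
  by move=> i ib; rewrite update_neq ?/s3 ?update_neq ?p2 ?update_neq //; lia.
have [||k [s' [e1 t1 r1 p1]]] := while_exec b1 hb (u := s 1) (s := update s b.+1 (s 1)).
- by rewrite update_eq.
- by move=> i ib; rewrite update_neq //; lia.
exists (2 + k).+1, s'; split.
- by apply: exec_seq e1; exact: exec_assign.
- apply: leq_trans (_ : 3 + (N * (K * N.+1 ^ d + 10 + 2) + 2) <= _); first by move: t1; rewrite -/N; clear; lia.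
  have P1 : 0 < N.+1 ^ d by rewrite expn_gt0.
  rewrite expnS; move: P1; set P := _ ^ d; clear; nia.
- by rewrite r1 update_neq //; lia.
by move=> i ib; rewrite p1 ?update_neq //; lia.
Qed.

Definition fold_step (body : fn) : fn := fun N u =>
  if truthy (hd u) then
    Node (tl (hd u)) (Node (body N (Node (hd (hd u)) (tl u))) (tl (tl u)))
  else u.
(* Argument: Node list (Node accumulator context). *)
Definition tfold (body : fn) : fn := fun N u => hd (tl (iter N (fold_step body N) u)).

Lemma PT_fold body : PT body -> PT (tfold body).
Proof.
move=> pb; apply/PT_hd/PT_tl/PT_loop/PT_ite; last exact: PT_id.
  exact/PT_hd/PT_id.
apply: PT_node; first exact/PT_tl/PT_hd/PT_id.
apply: PT_node; last exact/PT_tl/PT_tl/PT_id.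
apply: (PT_comp pb); apply: PT_node; [exact/PT_hd/PT_hd/PT_id|exact/PT_tl/PT_id].
Qed.

Lemma tfoldE body N l acc ctx : size (spine l) <= N ->
  tfold body N (Node l (Node acc ctx)) =
  foldl (fun a x => body N (Node x (Node a ctx))) acc (spine l).
Proof.
rewrite /tfold; have st a c m : iter m (fold_step body N) (Node Leaf (Node a c)) = Node Leaf (Node a c).
  by elim: m => //= m ->.
move: {1 2}N => m; elim: l acc m => [|x _ l IH] acc m /= lm; first by rewrite st.
case: m lm => // m lm; rewrite iterSr /fold_step /=; exact: IH.
Qed.

Ltac pt0 := match goal with
  | |- PT (fun _ t => t) => exact: PT_id
  | |- PT (fun _ _ => Leaf) => exact: PT_leaf
  | |- PT (fun N t => hd _) => apply: PT_hd
  | |- PT (fun N t => tl _) => apply: PT_tl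
  | |- PT (fun N t => Node _ _) => apply: PT_node
  | |- PT (fun N t => if truthy _ then _ else _) => apply: PT_ite
  | |- PT (tfold _) => apply: PT_fold
  | |- PT (fun N t => tfold ?b N _) => apply: (@PT_comp (tfold b)); [apply: PT_fold|]
  | |- PT ?g => solve [auto with pt]
  | |- PT (fun N t => ?g N _) => apply: (@PT_comp g); [solve [auto with pt]|]
  end.
Ltac pt := repeat pt0.
Create HintDb pt.

Lemma spine_seq s : spine (tree_of_seq s) = s.
Proof. by elim: s => //= x s ->. Qed.
End PolyTime.

(** * Lists, binary arithmetic and fractions on trees *)

Module TreeArithmetic.
Import Defs PolyTime.
Notation tb := tree_of_bool.
Notation T := (Node Leaf Leaf).

Fixpoint crev (t out : tree) : tree := if t is Node x u then crev u (Node x out) else out.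
Lemma crevK t : crev (crev t Leaf) Leaf = t.
Proof.
suff gen u o : crev (crev u o) Leaf = crev o u by exact: gen.
by elim: u o => [|x _ u IH] o //=; rewrite IH.
Qed.
Lemma crev_seq s o : crev (tree_of_seq s) o = tree_of_seq (catrev s (spine o)).
Proof.
elim: s o => [|x s IH] o /=; last by rewrite IH.
by elim: o => //= x _ o {1}->.
Qed.
Lemma foldl_crev t o : foldl (fun a x => Node x a) o (spine t) = crev t o.
Proof. by elim: t o => //= x _ u IH o; rewrite IH. Qed.
Lemma size_crev t o : size (spine (crev t o)) = size (spine t) + size (spine o).
Proof. by elim: t o => //= x _ u IH o; rewrite IH /= addnS. Qed.

(* [revcat] takes [Node l out]. *)
Definition revcat : fn := fun N t =>
  tfold (fun N u => Node (hd u) (hd (tl u))) N (Node (hd t) (Node (tl t) Leaf)).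
Lemma PT_revcat : PT revcat. Proof. rewrite /revcat; pt. Qed.
#[global] Hint Resolve PT_revcat : pt.
Lemma revcatE N l o : size (spine l) <= N -> revcat N (Node l o) = crev l o.
Proof. by move=> h; rewrite /revcat tfoldE //= foldl_crev. Qed.

Definition trev : fn := fun N t => revcat N (Node t Leaf).
Lemma PT_trev : PT trev. Proof. rewrite /trev; pt. Qed.
#[global] Hint Resolve PT_trev : pt.
Lemma trevE N l : size (spine l) <= N -> trev N l = crev l Leaf.
Proof. exact: revcatE. Qed.

Lemma PT_const t : PT (fun _ _ => t).
Proof. by elim: t => [|x IHx y IHy]; [exact: PT_leaf|exact: PT_node]. Qed.
#[global] Hint Resolve PT_const : pt.

Definition bit (c : nat) (t : tree) := hd (iter c tl t).
Lemma bitE c t : bit c t = nth Leaf (spine t) c.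
Proof.
rewrite /bit; elim: c t => [|c IH] t; first by case: t.
by rewrite iterSr IH; case: t => //=; rewrite nth_nil.
Qed.
Lemma PT_bit c : PT (fun _ t => bit c t).
Proof. by apply: PT_hd; elim: c => [|c IH]; [exact: PT_id|exact: PT_tl]. Qed.

(** Least significant digit first and exactly [m] digits, so addition and multiplication are exact
    modulo [2 ^ m]; the clock is later made longer than every number that occurs. *)
Fixpoint enc (m a : nat) : tree := if m is m'.+1 then Node (tb (odd a)) (enc m' a./2) else Leaf.
Lemma size_enc m a : size (spine (enc m a)) = m.
Proof. by elim: m a => //= m IH a; rewrite IH. Qed.

Lemma enc_mod m a b : enc m (a + 2 ^ m * b) = enc m a.
Proof.
elim: m a b => //= m IH a b; rewrite expnS -mulnA oddD oddM addbF; congr Node.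
by rewrite mul2n halfD odd_double andbF add0n doubleK IH.
Qed.

Definition txor (a b : tree) := if truthy a then (if truthy b then Leaf else T) else (if truthy b then T else Leaf).
Definition tmaj (a b c : tree) := if truthy a then (if truthy b then T else if truthy c then T else Leaf)
  else if truthy b then (if truthy c then T else Leaf) else Leaf.

(* State: Node x (Node y (Node carry out)). *)
Definition add_step : fn := fun _ s =>
  Node (tl (hd s)) (Node (tl (hd (tl s)))
   (Node (tmaj (hd (hd s)) (hd (hd (tl s))) (hd (tl (tl s))))
     (Node (txor (txor (hd (hd s)) (hd (hd (tl s)))) (hd (tl (tl s)))) (tl (tl (tl s)))))).
(** The initial [T] is [Node Leaf Leaf], read here as carry zero with an empty output. *)
Definition add : fn := fun N t =>
  trev N (tl (tl (tl (iter N (add_step N) (Node (hd t) (Node (tl t) T)))))).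
Lemma PT_txor f g : PT f -> PT g -> PT (fun N t => txor (f N t) (g N t)).
Proof. by move=> hf hg; rewrite /txor; pt. Qed.
Lemma PT_add : PT add.
Proof.
rewrite /add; apply: (PT_comp PT_trev); do 3!apply: PT_tl.
apply: (@PT_comp (fun N t => iter N (add_step N) t)); last by pt.
apply: PT_loop; rewrite /add_step; apply: PT_node; first by pt.
apply: PT_node; first by pt.
apply: PT_node; first by rewrite /tmaj; pt.
apply: PT_node; last by pt.
by apply: PT_txor; [apply: PT_txor|]; pt.
Qed.
#[global] Hint Resolve PT_add : pt.

Lemma add_iter N m a b (c : bool) o : tl (tl (tl (iter m (add_step N)
    (Node (enc m a) (Node (enc m b) (Node (tb c) o)))))) = crev (enc m (a + b + c)) o.
Proof.
elim: m a b c o => [|m IH] a b c o //; rewrite iterSr.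
have -> : add_step N (Node (enc m.+1 a) (Node (enc m.+1 b) (Node (tb c) o))) =
  Node (enc m a./2) (Node (enc m b./2) (Node (tb (1 < odd a + odd b + c)) (Node (tb (odd (a + b + c))) o))).
  by rewrite /add_step /= !oddD; case: (odd a); case: (odd b); case: c.
rewrite IH /=; congr (crev (enc m _) _).
have := odd_double_half a; have := odd_double_half b; have := odd_double_half (a + b + c).
rewrite !oddD -!muln2; case: (odd a); case: (odd b); case: c => /=; clear; lia.
Qed.

Lemma addE N a b : add N (Node (enc N a) (enc N b)) = enc N (a + b).
Proof.
rewrite /add /=; have := add_iter N N a b false Leaf; rewrite addn0 /= => ->.
by rewrite trevE ?crevK // size_crev size_enc addn0.
Qed.

(* State: Node x (Node y acc). *)
Definition mul_step : fn := fun N s =>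
  Node (tl (hd s)) (Node (add N (Node (hd (tl s)) (hd (tl s))))
    (if truthy (hd (hd s)) then add N (Node (tl (tl s)) (hd (tl s))) else tl (tl s))).
Definition zero : fn := fun N _ => iter N (fun t => Node Leaf t) Leaf.
Definition one : fn := fun N t => Node T (tl (zero N t)).
Definition mul : fn := fun N t =>
  tl (tl (iter N (mul_step N) (Node (hd t) (Node (tl t) (zero N t))))).
Lemma PT_zero : PT zero.
Proof.
apply: (@PT_comp (fun N t => iter N (fun t => Node Leaf t) t) (fun _ _ => Leaf)); last exact: PT_leaf.
by apply: (@PT_loop (fun _ t => Node Leaf t)); pt.
Qed.
#[global] Hint Resolve PT_zero : pt.
Lemma PT_one : PT one. Proof. by rewrite /one; pt. Qed.
#[global] Hint Resolve PT_one : pt.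
Lemma PT_mul : PT mul.
Proof.
rewrite /mul; do 2!apply: PT_tl.
apply: (@PT_comp (fun N t => iter N (mul_step N) t)); last by pt.
by apply: PT_loop; rewrite /mul_step; pt.
Qed.
#[global] Hint Resolve PT_mul : pt.

Lemma zeroE N t : zero N t = enc N 0.
Proof. by rewrite /zero; elim: N => //= N ->. Qed.
Lemma oneE N t : 0 < N -> one N t = enc N 1.
Proof. by case: N => // N _; rewrite /one zeroE. Qed.

Fixpoint low (m a : nat) : nat := if m is m'.+1 then odd a + (low m' a./2).*2 else 0.
Lemma lowE m a : a = low m a + 2 ^ m * (a %/ 2 ^ m).
Proof.
elim: m a => [|m IH] a; first by rewrite divn1 mul1n.
rewrite expnS divnMA divn2 -mulnA -addnA mul2n -doubleD -IH.
by rewrite odd_double_half.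
Qed.

Lemma mul_iter N m a b c : tl (tl (iter m (mul_step N)
    (Node (enc m a) (Node (enc N b) (enc N c))))) = enc N (c + b * low m a).
Proof.
elim: m a b c => [|m IH] a b c; first by rewrite /= muln0 addn0.
rewrite iterSr.
have -> : mul_step N (Node (enc m.+1 a) (Node (enc N b) (enc N c))) =
  Node (enc m a./2) (Node (enc N (b + b)) (enc N (c + b * odd a))).
  by rewrite /mul_step /= !addE; case: (odd a); rewrite /= ?muln1 ?muln0 ?addn0.
by rewrite IH /= mulnDr addnA -mul2n mulnA [b * 2]mulnC addnn mul2n.
Qed.

Lemma mulE N a b : mul N (Node (enc N a) (enc N b)) = enc N (a * b).
Proof.
rewrite /mul zeroE; have := mul_iter N N a b 0; rewrite add0n /= => ->.
by rewrite mulnC [in RHS](lowE N a) mulnDl -mulnA enc_mod.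
Qed.

(* Fractions: Node numerator denominator. *)
Definition fadd : fn := fun N t =>
  Node (add N (Node (mul N (Node (hd (hd t)) (tl (tl t)))) (mul N (Node (hd (tl t)) (tl (hd t))))))
       (mul N (Node (tl (hd t)) (tl (tl t)))).
Definition fmul : fn := fun N t =>
  Node (mul N (Node (hd (hd t)) (hd (tl t)))) (mul N (Node (tl (hd t)) (tl (tl t)))).
Lemma PT_fadd : PT fadd. Proof. by rewrite /fadd; pt. Qed.
Lemma PT_fmul : PT fmul. Proof. by rewrite /fmul; pt. Qed.
#[global] Hint Resolve PT_fadd PT_fmul : pt.

Definition fenc N (f : nat * nat) := Node (enc N f.1) (enc N f.2).
Definition faddn (f g : nat * nat) := (f.1 * g.2 + g.1 * f.2, f.2 * g.2).
Definition fmuln (f g : nat * nat) := (f.1 * g.1, f.2 * g.2).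
Lemma faddE N f g : fadd N (Node (fenc N f) (fenc N g)) = fenc N (faddn f g).
Proof. by rewrite /fadd /= !mulE addE. Qed.
Lemma fmulE N f g : fmul N (Node (fenc N f) (fenc N g)) = fenc N (fmuln f g).
Proof. by rewrite /fmul /= !mulE. Qed.

(* Zipped fold: Node A (Node B (Node acc ctx)); B is read along A and padded with Leaf. *)
Definition zfold (body : fn) : fn := fun N t =>
  tl (tfold (fun N u => Node (tl (hd (hd (tl u))))
         (body N (Node (hd u) (Node (hd (hd (hd (tl u)))) (Node (tl (hd (tl u))) (tl (tl u)))))))
    N (Node (hd t) (Node (Node (hd (tl t)) (hd (tl (tl t)))) (tl (tl (tl t)))))).
Lemma PT_zfold body : PT body -> PT (zfold body).
Proof. by move=> h; rewrite /zfold; pt. Qed.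

Lemma foldl_map (I J R : Type) (f : R -> J -> R) (g : I -> J) a s :
  foldl f a (map g s) = foldl (fun a i => f a (g i)) a s.
Proof. by elim: s a => //= x s IH a. Qed.

Lemma zip_iotaS (I : Type) (s : seq I) i : zip s (iota i.+1 (size s)) =
  [seq (xi.1, xi.2.+1) | xi <- zip s (iota i (size s))].
Proof. by elim: s i => //= x s IH i; rewrite IH. Qed.

Lemma zfoldE (I : Type) (s : seq I) (F : I -> tree) body N B acc ctx : size s <= N ->
  zfold body N (Node (tree_of_seq (map F s)) (Node B (Node acc ctx))) =
  foldl (fun a xi => body N (Node (F xi.1) (Node (nth Leaf (spine B) xi.2) (Node a ctx)))) acc
    (zip s (iota 0 (size s))).
Proof.
move=> hN; rewrite /zfold tfoldE /= ?spine_seq ?size_map //.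
elim: s {hN} B acc => //= x s IH B acc; rewrite IH zip_iotaS foldl_map /=.
have -> : hd B = nth Leaf (spine B) 0 by case: B.
elim: (zip _ _) (body _ _) => //= y z IHz a; rewrite IHz; congr (foldl _ (body _ (Node _ (Node _ _))) _).
by case: B {IHz} => //=; rewrite nth_nil.
Qed.

Lemma zfold_ord n (F : 'I_n -> tree) body N B acc ctx : n <= N ->
  zfold body N (Node (tree_of_seq [seq F v | v <- enum 'I_n]) (Node B (Node acc ctx))) =
  foldl (fun a v => body N (Node (F v) (Node (nth Leaf (spine B) (val v)) (Node a ctx)))) acc (enum 'I_n).
Proof.
move=> hN; rewrite zfoldE ?size_enum_ord //.
have -> : zip (enum 'I_n) (iota 0 n) = [seq (v, val v) | v <- enum 'I_n].
  by rewrite -val_enum_ord; elim: (enum _) => //= x s ->.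
by rewrite foldl_map.
Qed.

Lemma foldl_flag (I : Type) (s : seq I) (P : pred I) (a : tree) :
  foldl (fun a v => if P v then T else a) a s = if has P s then T else a.
Proof. by elim: s a => //= x s IH a; rewrite IH; case: (P x) => //; case: (has P s). Qed.

Lemma foldl_cons (I : Type) (s : seq I) (G : I -> tree) a :
  foldl (fun a v => Node (G v) a) a s = crev (tree_of_seq (map G s)) a.
Proof. by elim: s a => //= x s IH a. Qed.

Lemma truthy_tb b : truthy (tb b) = b. Proof. by case: b. Qed.

Lemma foldl_filter (I : Type) (s : seq I) (P : pred I) (G : I -> tree) a :
  foldl (fun a v => if P v then Node (G v) a else a) a s = crev (tree_of_seq [seq G v | v <- s & P v]) a.
Proof. by elim: s a => //= x s IH a; rewrite IH; case: (P x). Qed.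

Lemma eq_foldl (I R : Type) (f g : R -> I -> R) a s : (forall a x, f a x = g a x) -> foldl f a s = foldl g a s.
Proof. by move=> h; elim: s a => //= x s IH a; rewrite h IH. Qed.
End TreeArithmetic.

(** * Programs on encoded graphs and pinnings *)

Module TreeGraphs.
Import Defs Colourings SpatialMixing Estimator PolyTime TreeArithmetic.
(** Vertices and colours are named by a marked position, so that equality tests and lookups are
    folds along two lists and no numbers are compared. *)
Definition onehot (c : nat) : tree := tree_of_seq (rcons (nseq c Leaf) T).
Lemma onehotE c i : truthy (nth Leaf (spine (onehot c)) i) = (i == c).
Proof.
rewrite spine_seq nth_rcons size_nseq nth_nseq; case: ltngtP => //= h; by rewrite ?h ?eqxx.
Qed.

(** The argument is a pinning followed by the adjacency row of a vertex. The trailing [T] is again a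
    pair of leaves, an empty accumulator and an empty context. *)
Definition forb (c : nat) : fn := fun N t =>
  zfold (fun _ u => if truthy (hd (tl u)) then (if truthy (bit c (hd u)) then T else hd (tl (tl u)))
                    else hd (tl (tl u))) N (Node (hd t) (Node (tl t) T)).
Definition pinf (c : nat) : fn := fun N t =>
  trev N (zfold (fun _ u => Node (if truthy (hd (tl u)) then onehot c else hd u) (hd (tl (tl u)))) N
    (Node (hd t) (Node (tl t) T))).
(* The entry of the list [tl t] at the position marked by [hd t]. *)
Definition look : fn := fun N t =>
  zfold (fun _ u => if truthy (hd u) then hd (tl u) else hd (tl (tl u))) N (Node (hd t) (Node (tl t) T)).
Definition anyb : fn := fun N t =>
  zfold (fun _ u => if truthy (hd u) then (if truthy (hd (tl u)) then T else hd (tl (tl u)))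
                    else hd (tl (tl u))) N (Node (hd t) (Node (tl t) T)).

Lemma PT_bitc c f : PT f -> PT (fun N t => bit c (f N t)).
Proof. by move=> h; apply: (@PT_comp (fun _ t => bit c t)) => //; exact: PT_bit. Qed.

Ltac pt1 := first [ pt0 | apply: PT_bitc | match goal with
  | |- PT (fun N t => zfold ?b N _) => apply: (@PT_comp (zfold b)); [apply: PT_zfold|] end ].
Ltac ptz := repeat pt1.

Lemma PT_forb c : PT (forb c). Proof. by rewrite /forb; ptz. Qed.
Lemma PT_pinf c : PT (pinf c).
Proof. by rewrite /pinf; ptz. Qed.
Lemma PT_look : PT look. Proof. by rewrite /look; ptz. Qed.
Lemma PT_anyb : PT anyb. Proof. by rewrite /anyb; ptz. Qed.
#[global] Hint Resolve PT_forb PT_pinf PT_look PT_anyb : pt.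

(* Argument: Node p (Node x extra); the colours forbidden at x are skipped. *)
Definition each (F : nat -> fn) (cs : seq nat) : fn :=
  foldr (fun c (g : fn) => fun N t =>
    if truthy (forb c N (Node (hd t) (tl (hd (tl t))))) then g N t else Node (F c N t) (g N t))
  (fun _ _ => Leaf) cs.
Lemma PT_each F cs : (forall c, PT (F c)) -> PT (each F cs).
Proof.
move=> hF; elim: cs => [|c cs IH]; first exact: PT_leaf.
by rewrite /each /= -/(each F cs); apply: PT_ite; [pt|exact: IH|apply: PT_node; [exact: hF|exact: IH]].
Qed.

Section Colours.
Variable q : nat.

Definition ext : fn := fun N t =>
  each (fun c N t => pinf c N (Node (hd t) (hd (hd (tl t))))) (iota 0 q) N (Node (hd t) (Node (tl t) Leaf)).
Definition extw : fn :=
  each (fun c N t => Node (pinf c N (Node (hd t) (hd (hd (tl t)))))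
                          (fmul N (Node (hd (tl (tl t))) (bit c (tl (tl (tl t))))))) (iota 0 q).
Lemma PT_ext : PT ext.
Proof.
rewrite /ext; apply: (@PT_comp (each _ (iota 0 q))); last by pt.
by apply: PT_each => c; pt.
Qed.
Lemma PT_extw : PT extw. Proof. by apply: PT_each => c; ptz. Qed.
#[local] Hint Resolve PT_ext PT_extw : pt.

Definition expand : fn := fun N t =>
  tfold (fun N u => revcat N (Node (ext N (Node (hd u) (tl (tl u)))) (hd (tl u)))) N
    (Node (hd t) (Node Leaf (tl t))).
Lemma PT_expand : PT expand. Proof. by rewrite /expand; pt. Qed.
#[local] Hint Resolve PT_expand : pt.

Definition nextball : fn := fun N t =>
  trev N (tfold (fun N u => Node (if truthy (look N (Node (hd (hd u)) (tl (tl u)))) then T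
     else if truthy (anyb N (Node (tl (hd u)) (tl (tl u)))) then T else Leaf) (hd (tl u))) N
    (Node (tl t) (Node Leaf (hd t)))).
Lemma PT_nextball : PT nextball. Proof. by rewrite /nextball; pt. Qed.
#[local] Hint Resolve PT_nextball : pt.

Fixpoint ballf (k : nat) : fn := fun N t =>
  if k is k'.+1 then nextball N (Node (ballf k' N t) (tl t)) else hd t.
Lemma PT_ballf k : PT (ballf k).
Proof. elim: k => [|k IH]; first exact: PT_hd0. by apply: (PT_comp PT_nextball); apply: PT_node; pt. Qed.
#[local] Hint Resolve PT_ballf : pt.

Variable r : nat.
(* Argument of both: Node p (Node x vs). *)
Definition innf : fn := fun N t =>
  trev N (tfold (fun N u => if truthy (look N (Node (hd (hd u)) (hd (tl (tl u))))) then hd (tl u)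
     else if truthy (look N (Node (hd (hd u)) (tl (tl (tl u))))) then Node (hd u) (hd (tl u)) else hd (tl u)) N
   (Node (tl (tl t)) (Node Leaf (Node (hd t) (ballf r.+1 N (Node (hd (hd (tl t))) (tl (tl t)))))))).
Definition sphf : fn := fun N t =>
  trev N (tfold (fun N u => if truthy (look N (Node (hd (hd u)) (hd (tl (tl u))))) then hd (tl u)
     else if truthy (look N (Node (hd (hd u)) (hd (tl (tl (tl u)))))) then hd (tl u)
     else if truthy (look N (Node (hd (hd u)) (tl (tl (tl (tl u)))))) then Node (hd u) (hd (tl u)) else hd (tl u)) N
   (Node (tl (tl t)) (Node Leaf (Node (hd t) (Node (ballf r.+1 N (Node (hd (hd (tl t))) (tl (tl t))))
     (ballf r.+2 N (Node (hd (hd (tl t))) (tl (tl t))))))))).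
Lemma PT_innf : PT innf. Proof. by rewrite /innf; pt. Qed.
Lemma PT_sphf : PT sphf. Proof. by rewrite /sphf; pt. Qed.
#[local] Hint Resolve PT_innf PT_sphf : pt.

(* Argument: Node p (Node x vs). *)
Definition fullf : fn := fun N t =>
  tfold (fun N u => expand N (Node (hd (tl u)) (hd u))) N (Node (innf N t) (Node (Node (hd t) Leaf) Leaf)).
Lemma PT_fullf : PT fullf. Proof. by rewrite /fullf; pt. Qed.
#[local] Hint Resolve PT_fullf : pt.
Definition locf (c : nat) : fn := fun N t =>
  Node (tfold (fun N u => if truthy (bit c (look N (Node (tl (tl u)) (hd u)))) then add N (Node (hd (tl u)) (one N u))
           else hd (tl u)) N (Node (fullf N t) (Node (zero N t) (hd (hd (tl t))))))
       (tfold (fun N u => add N (Node (hd (tl u)) (one N u))) N (Node (fullf N t) (Node (zero N t) Leaf))).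
Lemma PT_locf c : PT (locf c). Proof. by rewrite /locf; ptz. Qed.
#[local] Hint Resolve PT_locf : pt.

(* Argument: Node (Node p x) vs. *)
Definition subtasks : fn := fun N t =>
  trev N (tl (tfold (fun N u => Node (expand N (Node (hd (hd (tl u))) (hd u)))
       (tfold (fun N u' => Node (Node (hd u') (tl (tl u'))) (hd (tl u'))) N
          (Node (hd (hd (tl u))) (Node (tl (hd (tl u))) (hd u)))))
    N (Node (sphf N (Node (hd (hd t)) (Node (tl (hd t)) (tl t)))) (Node (Node (Node (hd (hd t)) Leaf) Leaf) Leaf)))).
Lemma PT_subtasks : PT subtasks. Proof. by rewrite /subtasks; pt. Qed.

(* Argument: Node (Node p x) (Node vals vs). The result is the final list of
   weighted pinnings and the remaining values. *)
Definition weighted : fn := fun N t =>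
  tfold (fun N u => tfold (fun N u' =>
      Node (revcat N (Node (extw N (Node (hd (hd u')) (Node (tl (tl u')) (Node (tl (hd u')) (hd (tl (hd (tl u')))))))) (hd (hd (tl u')))))
           (tl (tl (hd (tl u'))))) N
     (Node (hd (hd (tl u))) (Node (Node Leaf (tl (hd (tl u)))) (hd u))))
  N (Node (sphf N (Node (hd (hd t)) (Node (tl (hd t)) (tl (tl t)))))
    (Node (Node (Node (Node (hd (hd t)) (Node (one N t) (one N t))) Leaf) (hd (tl t))) Leaf)).
Lemma PT_weighted : PT weighted. Proof. by rewrite /weighted; pt. Qed.
#[local] Hint Resolve PT_weighted : pt.

(* Argument: Node W (Node x vs). *)
Definition valuef (c : nat) : fn := fun N t =>
  tfold (fun N u => fadd N (Node (hd (tl u)) (fmul N (Node (tl (hd u)) (locf c N (Node (hd (hd u)) (tl (tl u)))))))) N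
    (Node (hd t) (Node (Node (zero N t) (one N t)) (tl t))).
Definition vecf (F : nat -> fn) (cs : seq nat) : fn :=
  foldr (fun c (g : fn) => fun N t => Node (F c N t) (g N t)) (fun _ _ => Leaf) cs.
Lemma PT_vecf F cs : (forall c, PT (F c)) -> PT (vecf F cs).
Proof.
move=> hF; elim: cs => [|c cs IH]; first exact: PT_leaf.
by rewrite /vecf /= -/(vecf F cs); apply: PT_node; [exact: hF|exact: IH].
Qed.
Lemma PT_valuef c : PT (valuef c). Proof. by rewrite /valuef; pt. Qed.
Definition combine : fn := fun N t =>
  Node (vecf valuef (iota 0 q) N (Node (hd (weighted N t)) (Node (tl (hd t)) (tl (tl t))))) (tl (weighted N t)).
Lemma PT_combine : PT combine.
Proof.
rewrite /combine; apply: PT_node; last by pt.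
apply: (@PT_comp (vecf valuef (iota 0 q))); last by pt.
by apply: PT_vecf; exact: PT_valuef.
Qed.

Fixpoint base (cs : seq nat) : fn := fun N t =>
  if cs is c :: cs' then
    if truthy (forb c N (Node (hd t) (tl (tl t)))) then Node (Node (zero N t) (one N t)) (base cs' N t)
    else Node (Node (one N t) (one N t)) (vecf (fun _ N t => Node (zero N t) (one N t)) cs' N t)
  else Leaf.
Lemma PT_base cs : PT (base cs).
Proof.
elim: cs => [|c cs IH]; first exact: PT_leaf.
rewrite /=; apply: PT_ite; first by pt.
  by apply: PT_node; [pt|exact: IH].
by apply: PT_node; [pt|apply: PT_vecf => d; pt].
Qed.

Fixpoint pick (cs : seq nat) : fn := fun N t =>
  if cs is c :: cs' then
    if truthy (forb c N (Node (hd (hd t)) (tl (tl (hd t))))) then pick cs' N t else bit c (tl t)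
  else Leaf.
Lemma PT_pick cs : PT (pick cs).
Proof.
elim: cs => [|c cs IH]; first exact: PT_leaf.
by rewrite /=; apply: PT_ite; [pt|exact: IH|ptz].
Qed.

End Colours.
End TreeGraphs.

(** * Correctness of the graph programs *)

Module TreeGraphsCorrect.
Import Defs Colourings SpatialMixing Estimator PolyTime TreeArithmetic TreeGraphs.
Lemma map_catrev (I J : Type) (f : I -> J) s t : map f (catrev s t) = catrev (map f s) (map f t).
Proof. by elim: s t => //= x s IH t; rewrite IH. Qed.

#[local] Arguments ball : simpl never.
#[local] Arguments ballf : simpl never.
#[local] Arguments tfold : simpl never.
#[local] Arguments zfold : simpl never.
#[local] Arguments revcat : simpl never.
#[local] Arguments trev : simpl never.
#[local] Arguments look : simpl never.
#[local] Arguments anyb : simpl never.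
#[local] Arguments forb : simpl never.
#[local] Arguments pinf : simpl never.
#[local] Arguments ext : simpl never.
#[local] Arguments extw : simpl never.
#[local] Arguments expand : simpl never.
#[local] Arguments nextball : simpl never.
#[local] Arguments innf : simpl never.
#[local] Arguments sphf : simpl never.
#[local] Arguments fullf : simpl never.
#[local] Arguments locf : simpl never.
#[local] Arguments add : simpl never.
#[local] Arguments mul : simpl never.
#[local] Arguments fadd : simpl never.
#[local] Arguments fmul : simpl never.
#[local] Arguments one : simpl never.
#[local] Arguments zero : simpl never.

Section Correct.
Variables (n q r N : nat) (e : rel 'I_n) (c0 : 'I_q).
Hypothesis e_sym : symmetric e.
Notation V := 'I_n.
Notation C := 'I_q.
Notation pins := (pins 'I_n 'I_q).
Implicit Types (p : pins) (v w s : V) (c : C) (Q : seq pins).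
Hypotheses (hn : n <= N) (hq : q <= N) (hN : 0 < N).

Definition encO (o : option C) := if o is Some c then onehot c else Leaf.
Definition encP p := tree_of_seq [seq encO (p w) | w <- enum V].
Definition row v := tree_of_seq [seq tb (e v w) | w <- enum V].
Definition obj v := Node (onehot v) (row v).
Definition vsT := tree_of_seq [seq obj v | v <- enum V].
Lemma spine_vs : spine vsT = [seq obj v | v <- enum V]. Proof. exact: spine_seq. Qed.
Definition encM (A : {set V}) := tree_of_seq [seq tb (w \in A) | w <- enum V].

Lemma nth_enc (F : V -> tree) w : nth Leaf (spine (tree_of_seq [seq F v | v <- enum V])) w = F w.
Proof. by rewrite spine_seq (nth_map w) ?size_enum_ord // nth_ord_enum. Qed.

Lemma encOE o c : truthy (bit c (encO o)) = (o == Some c).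
Proof.
rewrite bitE; case: o => [d|] /=; last by rewrite nth_nil.
by rewrite onehotE eq_sym.
Qed.

Lemma forbE p v c : truthy (forb c N (Node (encP p) (row v))) = (c \notin allowed e p v).
Proof.
rewrite /forb /= /encP zfold_ord //.
rewrite (@eq_foldl _ _ _ (fun a w => if e v w && (p w == Some c) then T else a)); last first.
  by move=> a w /=; rewrite /row nth_enc truthy_tb encOE; case: (e v w).
rewrite foldl_flag inE negb_forall; set h := has _ _.
have -> : truthy (if h then T else Leaf) = h by case: h.
apply/hasP/existsP => [[w _ h1]|[w h1]]; exists w; rewrite ?mem_enum //.
  by rewrite negb_imply negbK.
by move: h1; rewrite negb_imply negbK.
Qed.

Lemma trev_map (I : Type) (G : I -> tree) (s : seq I) : size s <= N ->
  trev N (crev (tree_of_seq (map G s)) Leaf) = tree_of_seq (map G s).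
Proof. by move=> h; rewrite trevE ?crevK // size_crev addn0 spine_seq size_map. Qed.

Lemma pinfE p v c : pinf c N (Node (encP p) (onehot v)) = encP (pin p v c).
Proof.
rewrite /pinf /= {1}/encP zfold_ord //.
rewrite (@eq_foldl _ _ _ (fun a w => Node (encO (pin p v c w)) a)); last first.
  by move=> a w /=; rewrite onehotE ffunE -val_eqE; case: (_ == _).
by rewrite foldl_cons trev_map // size_enum_ord.
Qed.

Lemma eachE F p v X (cs : seq C) : each F (map val cs) N (Node (encP p) (Node (obj v) X)) =
  tree_of_seq [seq F (val c) N (Node (encP p) (Node (obj v) X)) | c <- cs & c \in allowed e p v].
Proof.
elim: cs => //= c cs IH; rewrite forbE IH; by case: (c \in _).
Qed.

Definition exts p v := [seq pin p v c | c <- enum C & c \in allowed e p v].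
Lemma size_exts p v : size (exts p v) <= q.
Proof. by rewrite size_map size_filter (leq_trans (count_size _ _)) // size_enum_ord. Qed.

Lemma extE p v : ext q N (Node (encP p) (obj v)) = tree_of_seq [seq encP p' | p' <- exts p v].
Proof.
rewrite /ext -val_enum_ord eachE -map_comp; congr tree_of_seq.
by apply: eq_map => c /=; rewrite pinfE.
Qed.

Definition xpd v Q := catrev (flatten [seq exts p v | p <- Q]) [::].
Lemma size_flatten_le (I J : Type) (F : I -> seq J) (m : nat) (s : seq I) :
  (forall x, size (F x) <= m) -> size (flatten (map F s)) <= m * size s.
Proof.
move=> h; elim: s => //= x s IH; rewrite size_cat mulnS; exact: leq_add.
Qed.
Lemma size_xpd v Q : size (xpd v Q) <= q * size Q.
Proof.
by rewrite /xpd catrevE cats0 size_rev; apply: size_flatten_le => p; exact: size_exts.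
Qed.

Lemma expandE Q v : size Q <= N ->
  expand q N (Node (tree_of_seq (map encP Q)) (obj v)) = tree_of_seq (map encP (xpd v Q)).
Proof.
move=> hQ; rewrite /expand /= tfoldE ?spine_seq ?size_map //= foldl_map /xpd.
rewrite -[Leaf]/(tree_of_seq (map encP [::])); move: [::] => A.
elim: Q {hQ} A => //= p Q IH A; rewrite extE revcatE; last first.
  by rewrite spine_seq size_map (leq_trans (size_exts _ _)).
by rewrite crev_seq spine_seq -map_catrev IH catrev_catl.
Qed.

Lemma lookE B v : look N (Node (onehot v) B) = nth Leaf (spine B) v.
Proof.
rewrite /look /= /onehot -[rcons _ _]map_id zfoldE; last first.
  by rewrite size_rcons size_nseq (leq_trans (ltn_ord v)).
rewrite size_rcons size_nseq -[iota 0 v.+1]/(iota 0 v.+1) -addn1 iotaD /= add0n -cats1 zip_cat; last first.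
  by rewrite size_nseq size_iota.
by rewrite foldl_cat.
Qed.

(** Membership instead of equality with [encM A]: the ball of radius zero is represented by
    [onehot v], a shorter list completed by the default [Leaf]. *)
Definition isA B (A : {set V}) := forall w : V, truthy (nth Leaf (spine B) w) = (w \in A).
Lemma isA_encM A : isA (encM A) A.
Proof. by move=> w; rewrite /encM nth_enc truthy_tb. Qed.

Lemma anybE v B A : isA B A -> truthy (anyb N (Node (row v) B)) = [exists w in A, e v w].
Proof.
move=> hA; rewrite /anyb /= /row zfold_ord //.
rewrite (@eq_foldl _ _ _ (fun a w => if (w \in A) && e v w then T else a)); last first.
  by move=> a w /=; rewrite truthy_tb hA; case: (e v w); rewrite ?andbF ?andbT.
rewrite foldl_flag; set h := has _ _.
have -> : truthy (if h then T else Leaf) = h by case: h.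
by apply/hasP/existsP => [[w _ h1]|[w h1]]; exists w; rewrite ?mem_enum.
Qed.

Lemma nextballE B A : isA B A ->
  nextball N (Node B vsT) = encM (A :|: [set w | [exists x in A, e x w]]).
Proof.
move=> hA; rewrite /nextball /= tfoldE; last by rewrite spine_vs size_map size_enum_ord.
rewrite spine_vs foldl_map /=.
rewrite (@eq_foldl _ _ _ (fun a w => Node (tb (w \in A :|: [set w | [exists x in A, e x w]])) a)); last first.
  move=> a w /=; rewrite lookE hA (anybE _ hA) !inE; case: (w \in A) => //=.
  have -> : [exists w0 in A, e w w0] = [exists x in A, e x w].
    by apply: eq_existsb => x; rewrite e_sym.
  by [].
by rewrite foldl_cons trev_map // size_enum_ord.
Qed.

Lemma ballfE k v : isA (ballf k N (Node (onehot v) vsT)) (ball e v k).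
Proof.
elim: k => [|k IH]; first by move=> w; rewrite /= onehotE val_eqE !inE.
rewrite -[ballf k.+1 N _]/(nextball N (Node (ballf k N (Node (onehot v) vsT)) vsT)).
by rewrite (nextballE IH); exact: isA_encM.
Qed.

Definition innerS p v := [seq s <- enum V | (p s == None) && (s \in ball e v r.+1)].
Lemma innE p v : innf r N (Node (encP p) (Node (obj v) vsT)) = tree_of_seq [seq obj s | s <- innerS p v].
Proof.
rewrite /innf /= tfoldE; last by rewrite spine_vs size_map size_enum_ord.
rewrite spine_vs foldl_map /=.
rewrite (@eq_foldl _ _ _ (fun a w => if (p w == None) && (w \in ball e v r.+1) then Node (obj w) a else a)); last first.
  move=> a w /=; rewrite !lookE (ballfE r.+1 v) /encP nth_enc.
  by case: (p w) => [c|] //=; rewrite /onehot; case: (nat_of_ord c).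
rewrite foldl_filter trev_map //.
by rewrite size_filter (leq_trans (count_size _ _)) // size_enum_ord.
Qed.

Lemma sphE p v : sphf r N (Node (encP p) (Node (obj v) vsT)) = tree_of_seq [seq obj s | s <- sphere e r p v].
Proof.
rewrite /sphf /= tfoldE; last by rewrite spine_vs size_map size_enum_ord.
rewrite spine_vs foldl_map /=.
rewrite (@eq_foldl _ _ _ (fun a w => if (w \in ball e v r.+2) && (w \notin ball e v r.+1) && (p w == None) then Node (obj w) a else a)); last first.
  move=> a w /=; rewrite !lookE (ballfE r.+1 v) (ballfE r.+2 v) /encP nth_enc.
  case: (p w) => [c|]; first by rewrite /= andbF /onehot; case: (nat_of_ord c).
  by rewrite /= andbT; case: (w \in ball e v r.+1); rewrite ?andbF ?andbT.
rewrite foldl_filter trev_map //.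
by rewrite size_filter (leq_trans (count_size _ _)) // size_enum_ord.
Qed.

Lemma size_inner p v : size (innerS p v) <= n.
Proof. by rewrite size_filter (leq_trans (count_size _ _)) // size_enum_ord. Qed.
Lemma size_sphere p v : size (sphere e r p v) <= n.
Proof. by rewrite size_filter (leq_trans (count_size _ _)) // size_enum_ord. Qed.

Definition full p v := foldl (fun Q s => xpd s Q) [:: p] (innerS p v).

Lemma size_xpds (S : seq V) Q : size (foldl (fun Q s => xpd s Q) Q S) <= size Q * q ^ size S.
Proof.
elim: S Q => [|s S IH] Q /=; first by rewrite muln1.
apply: leq_trans (IH _) _; rewrite expnS mulnA leq_mul2r (mulnC (size Q) q) size_xpd orbT //.
Qed.

Hypothesis hI : forall p v, q ^ size (innerS p v) <= N.
Hypothesis hS : forall p v, q ^ size (sphere e r p v) <= N.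
Hypothesis q0 : 0 < q.

Lemma fullE p v : fullf q r N (Node (encP p) (Node (obj v) vsT)) = tree_of_seq (map encP (full p v)).
Proof.
rewrite /fullf innE tfoldE /= ?spine_seq ?size_map ?(leq_trans (size_inner _ _)) // foldl_map /full.
have : size [:: p] * q ^ size (innerS p v) <= N by rewrite mul1n; exact: hI.
rewrite -[Node (encP p) Leaf]/(tree_of_seq (map encP [:: p])).
elim: (innerS p v) [:: p] => //= s S IH Q hQ.
have hQ1 : size Q <= N by apply: leq_trans hQ; rewrite leq_pmulr // expn_gt0 q0.
rewrite expandE // IH //; apply: leq_trans hQ; rewrite expnS mulnA leq_mul2r (mulnC (size Q) q) size_xpd orbT //.
Qed.

Lemma size_full p v : size (full p v) <= N.
Proof. by apply: leq_trans (size_xpds _ _) _; rewrite mul1n. Qed.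

Definition locF p v c : nat * nat := (seq.count (fun p' : pins => p' v == Some c) (full p v), size (full p v)).

Lemma locfE p v c : locf q r c N (Node (encP p) (Node (obj v) vsT)) = fenc N (locF p v c).
Proof.
have hf := size_full p v.
rewrite /locf /fenc; congr Node.
  rewrite /= tfoldE ?fullE ?spine_seq ?size_map // foldl_map zeroE /locF /=.
  rewrite -[seq.count _ _]add0n; move: 0; elim: (full p v) {hf} => [|p' Q IH] a /=; first by rewrite addn0.
  rewrite lookE /encP nth_enc encOE -/(encP p'); case: (p' v == Some c); last by rewrite add0n IH.
  by rewrite oneE // addE IH addnA.
rewrite tfoldE ?fullE ?spine_seq ?size_map // foldl_map zeroE /locF /=.
rewrite -[size _]add0n; move: 0; elim: (full p v) {hf} => [|p' Q IH] a /=; first by rewrite addn0.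
by rewrite oneE // addE IH -addnA add1n.
Qed.

(** The calls made for one marginal: for each sphere vertex, one call per pinning of the earlier
    ones. The order matters, because [weighted] consumes the returned values in exactly this
    order. *)
Fixpoint subs (S : seq V) Q : seq (pins * V) :=
  if S is s :: S' then [seq (p, s) | p <- Q] ++ subs S' (xpd s Q) else [::].
Definition encT (t : pins * V) := Node (encP t.1) (obj t.2).

Lemma size_subs S Q : size (subs S Q) <= size S * (size Q * q ^ size S).
Proof.
elim: S Q => //= s S IH Q; rewrite size_cat size_map mulSn; apply: leq_add.
  by rewrite leq_pmulr // expn_gt0 q0.
apply: leq_trans (IH _) _; rewrite leq_mul2l expnS mulnA leq_mul2r (mulnC (size Q) q) size_xpd !orbT //.
Qed.

Hypothesis hSub : forall p v, size (subs (sphere e r p v) [:: p]) <= N.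

Lemma subtasksE p v : subtasks q r N (Node (encT (p, v)) vsT) =
  tree_of_seq (map encT (subs (sphere e r p v) [:: p])).
Proof.
rewrite /subtasks [hd _]/= [tl _]/= sphE tfoldE /= ?spine_seq ?size_map ?(leq_trans (size_sphere _ _)) // foldl_map.
have key S Q o : size Q * q ^ size S <= N ->
  tl (foldl (fun a s => Node (expand q N (Node (hd a) (obj s)))
       (tfold (fun _ u' => Node (Node (hd u') (tl (tl u'))) (hd (tl u'))) N (Node (hd a) (Node (tl a) (obj s)))))
     (Node (tree_of_seq (map encP Q)) o) S) = crev (tree_of_seq (map encT (subs S Q))) o.
  elim: S Q o => //= s S IH Q o hQ.
  have hQ1 : size Q <= N by apply: leq_trans hQ; rewrite leq_pmulr // expn_gt0 q0.
  rewrite expandE // tfoldE ?spine_seq ?size_map // foldl_map IH; last first.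
    apply: leq_trans hQ; rewrite expnS mulnA leq_mul2r (mulnC (size Q) q) size_xpd orbT //.
  rewrite map_cat !crev_seq catrev_catl /= -map_comp; congr (tree_of_seq (catrev _ _)).
  by rewrite (foldl_cons Q (fun p => Node (encP p) (obj s))) crev_seq spine_seq.
have := key (sphere e r p v) [:: p] Leaf; rewrite mul1n => -> //.
by rewrite trev_map.
Qed.

Variable g : pins -> V -> C -> nat * nat.
Implicit Type W : seq (pins * (nat * nat)).
Definition encW (pw : pins * (nat * nat)) := Node (encP pw.1) (fenc N pw.2).
Definition encVal (h : C -> nat * nat) := tree_of_seq [seq fenc N (h c) | c <- enum C].
Definition wexts s (pw : pins * (nat * nat)) :=
  [seq (pin pw.1 s c, fmuln pw.2 (g pw.1 s c)) | c <- enum C & c \in allowed e pw.1 s].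
Definition wxpd s W := catrev (flatten (map (wexts s) W)) [::].
Definition wfin (S : seq V) W := foldl (fun W s => wxpd s W) W S.

Lemma extwE s pw : extw q N (Node (encP pw.1) (Node (obj s) (Node (fenc N pw.2) (encVal (g pw.1 s))))) =
  tree_of_seq (map encW (wexts s pw)).
Proof.
rewrite /extw -val_enum_ord eachE /wexts -map_comp; congr tree_of_seq; apply: eq_map => c /=.
rewrite pinfE /encW /= bitE /encVal spine_seq (nth_map c) ?size_enum_ord // nth_ord_enum.
by rewrite fmulE.
Qed.

Lemma fst_wxpd s W : map fst (wxpd s W) = xpd s (map fst W).
Proof.
rewrite /wxpd /xpd map_catrev map_flatten -!map_comp; congr (catrev (flatten _) _).
by apply: eq_map => pw /=; rewrite /wexts /exts -map_comp.
Qed.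
Lemma size_wxpd s W : size (wxpd s W) = size (xpd s (map fst W)).
Proof. by rewrite -fst_wxpd size_map. Qed.

Lemma weightedE p v rest : weighted q r N (Node (encT (p, v)) (Node (tree_of_seq
    ([seq encVal (g t.1 t.2) | t <- subs (sphere e r p v) [:: p]] ++ rest)) vsT)) =
  Node (tree_of_seq (map encW (wfin (sphere e r p v) [:: (p, (1, 1))]))) (tree_of_seq rest).
Proof.
have key S W rest' : size W * q ^ size S <= N ->
  foldl (fun a s => tfold (fun N u' =>
      Node (revcat N (Node (extw q N (Node (hd (hd u')) (Node (tl (tl u')) (Node (tl (hd u')) (hd (tl (hd (tl u')))))))) (hd (hd (tl u')))))
           (tl (tl (hd (tl u'))))) N (Node (hd a) (Node (Node Leaf (tl a)) (obj s))))
   (Node (tree_of_seq (map encW W)) (tree_of_seq ([seq encVal (g t.1 t.2) | t <- subs S (map fst W)] ++ rest'))) S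
  = Node (tree_of_seq (map encW (wfin S W))) (tree_of_seq rest').
  elim: S W => //= s S IH W hW.
  have hW1 : size W <= N by apply: leq_trans hW; rewrite leq_pmulr // expn_gt0 q0.
  rewrite tfoldE ?spine_seq ?size_map // foldl_map map_cat -catA.
  set rest2 := _ ++ rest'.
  have inner A : foldl (fun a (pw : pins * (nat * nat)) => Node (revcat N (Node (extw q N (Node (encP pw.1) (Node (obj s)
       (Node (fenc N pw.2) (hd (tl a)))))) (hd a))) (tl (tl a)))
      (Node (tree_of_seq (map encW A)) (tree_of_seq ([seq encVal (g t.1 t.2) | t <- [seq (p, s) | p <- map fst W]] ++ rest2))) W =
      Node (tree_of_seq (map encW (catrev (flatten (map (wexts s) W)) A))) (tree_of_seq rest2).
    elim: W {hW hW1 IH rest2} A (rest2) => //= pw W IHW A rest3.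
    rewrite extwE revcatE; last first.
      by rewrite spine_seq size_map size_map size_filter (leq_trans (count_size _ _)) // size_enum_ord.
    by rewrite crev_seq spine_seq -map_catrev IHW catrev_catl.
  have := inner [::]; rewrite /= => ->.
  rewrite -/(wxpd s W) /rest2 -fst_wxpd IH //.
  rewrite size_wxpd; apply: leq_trans hW; rewrite expnS mulnA leq_mul2r (mulnC (size W) q).
  by rewrite (leq_trans (size_xpd _ _)) ?orbT // size_map.
rewrite /weighted [hd _]/= [tl _]/= sphE tfoldE ?spine_seq ?size_map ?(leq_trans (size_sphere _ _)) // foldl_map.
have := key (sphere e r p v) [:: (p, (1, 1))] rest; rewrite mul1n => <- //.
by rewrite /= oneE.
Qed.

Definition value (W : seq (pins * (nat * nat))) v c : nat * nat :=
  foldl (fun acc pw => faddn acc (fmuln pw.2 (locF pw.1 v c))) (0, 1) W.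

Lemma valuefE W v c : size W <= N ->
  valuef q r c N (Node (tree_of_seq (map encW W)) (Node (obj v) vsT)) = fenc N (value W v c).
Proof.
move=> hW; rewrite /valuef tfoldE [hd _]/= ?spine_seq ?size_map // foldl_map zeroE oneE //.
rewrite -[Node (enc N 0) (enc N 1)]/(fenc N (0, 1)) /value; move: (0, 1).
elim: W {hW} => //= pw W IH f; by rewrite locfE fmulE faddE IH.
Qed.

Lemma vecfE (F : nat -> fn) (h : C -> nat * nat) t : (forall c : C, F c N t = fenc N (h c)) ->
  vecf F (iota 0 q) N t = encVal h.
Proof.
move=> hF; rewrite -val_enum_ord /encVal; elim: (enum C) => //= c cs IH.
by rewrite hF IH.
Qed.

Lemma size_wfin S W : size (wfin S W) <= size W * q ^ size S.
Proof.
rewrite /wfin; elim: S W => [|s S IH] W /=; first by rewrite muln1.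
apply: leq_trans (IH _) _; rewrite expnS mulnA leq_mul2r size_wxpd (mulnC (size W) q).
by rewrite (leq_trans (size_xpd _ _)) ?orbT // size_map.
Qed.

Definition estS p v c := value (wfin (sphere e r p v) [:: (p, (1, 1))]) v c.

Lemma combineE p v rest : combine q r N (Node (encT (p, v)) (Node (tree_of_seq
    ([seq encVal (g t.1 t.2) | t <- subs (sphere e r p v) [:: p]] ++ rest)) vsT)) =
  Node (encVal (estS p v)) (tree_of_seq rest).
Proof.
rewrite /combine weightedE; congr Node; apply: vecfE => c.
by apply: valuefE; apply: leq_trans (size_wfin _ _) _; rewrite mul1n.
Qed.

Definition estB p v c : nat * nat := ((c == first c0 e p v) : nat, 1).

Lemma baseE p v : v \in free p -> (exists c, c \in allowed e p v) ->
  base (iota 0 q) N (encT (p, v)) = encVal (estB p v).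
Proof.
move=> vf [c1 c1a]; rewrite -val_enum_ord /encVal /estB /first.
have hz (cs : seq C) t : vecf (fun _ N t => Node (zero N t) (one N t)) (map val cs) N t =
    tree_of_seq [seq fenc N (0, 1) | c <- cs].
  by elim: cs => //= c cs ->; rewrite zeroE oneE.
have : uniq (enum C) by exact: enum_uniq.
have : has (mem (allowed e p v)) (enum C) by apply/hasP; exists c1; rewrite ?mem_enum.
elim: (enum C) => //= c cs IH hh /andP[ccs ucs].
rewrite forbE; case ca: (c \in allowed e p v) => /=.
  rewrite eqxx hz oneE //; congr (Node _ (tree_of_seq _)); apply/esym/eq_in_map => d dcs.
  by case: eqP => // E; rewrite -E dcs in ccs.
move: hh; rewrite ca /= => hh; rewrite IH // zeroE oneE //; congr (Node _ _).
rewrite (_ : (c == _) = false) //; apply/eqP=> E; move: ccs; rewrite E.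
have : nth c0 [seq a <- cs | a \in allowed e p v] 0 \in [seq a <- cs | a \in allowed e p v].
  by apply: mem_nth; rewrite size_filter -has_count.
by rewrite mem_filter => /andP[_ ->].
Qed.

Lemma pickE p v (h : C -> nat * nat) : (exists c, c \in allowed e p v) ->
  pick (iota 0 q) N (Node (encT (p, v)) (encVal h)) = fenc N (h (first c0 e p v)).
Proof.
move=> [c1 c1a]; rewrite -val_enum_ord /first.
have bE c : bit c (encVal h) = fenc N (h c).
  by rewrite bitE /encVal spine_seq (nth_map c) ?size_enum_ord // nth_ord_enum.
set X := encVal h in bE *.
have : has (mem (allowed e p v)) (enum C) by apply/hasP; exists c1; rewrite ?mem_enum.
elim: (enum C) => //= c cs IH hh; rewrite forbE; case ca: (c \in allowed e p v) => /=.
  by rewrite bE.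
by move: hh; rewrite ca /=; exact: IH.
Qed.

End Correct.
End TreeGraphsCorrect.

(** * Values and bit lengths of the computed fractions *)

Module EstimatorProgram.
Import Defs Colourings EdgeBounds SpatialMixing Estimator PolyTime TreeArithmetic TreeGraphs TreeGraphsCorrect.
Import Order.TTheory GRing.Theory Num.Theory.
Local Open Scope ring_scope.

Definition fval (f : nat * nat) : rat := f.1%:R / f.2%:R.
(** Fractions stay unreduced, so the quantity to control is the number of binary digits of both
    parts. *)
Definition fb (m : nat) (f : nat * nat) := ((f.1 <= 2 ^ m) && (f.2 <= 2 ^ m))%N.

Lemma fval_add f g : (0 < f.2)%N -> (0 < g.2)%N -> fval (faddn f g) = fval f + fval g.
Proof.
move=> f0 g0; rewrite /fval /faddn /= natrD !natrM.
have a : f.2%:R != 0 :> rat by rewrite pnatr_eq0 -lt0n.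
have b : g.2%:R != 0 :> rat by rewrite pnatr_eq0 -lt0n.
by field; rewrite a b.
Qed.
Lemma fval_mul f g : fval (fmuln f g) = fval f * fval g.
Proof. by rewrite /fval /fmuln /= !natrM invfM mulrACA. Qed.

Lemma fb_mul m m' f g : fb m f -> fb m' g -> fb (m + m') (fmuln f g).
Proof.
by move=> /andP[a b] /andP[c d]; rewrite /fb /fmuln /= expnD !leq_mul.
Qed.
Lemma fb_add m m' f g : fb m f -> fb m' g -> fb (m + m' + 1) (faddn f g).
Proof.
move=> /andP[a b] /andP[c d]; rewrite /fb /faddn /= addn1 expnS.
have h1 := leq_mul a d; have h2 := leq_mul c b; have h3 := leq_mul b d.
by rewrite expnD; move: h1 h2 h3; set x := (2 ^ m)%N; set y := (2 ^ m')%N; nia.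
Qed.
Lemma fb_le m m' f : (m <= m')%N -> fb m f -> fb m' f.
Proof. by move=> h /andP[a b]; rewrite /fb !(leq_trans _ (leq_pexp2l _ h)) //. Qed.

Section Semantics.
Variables (n q r : nat) (e lat : rel 'I_n) (c0 : 'I_q) (Delta : nat).
Notation V := 'I_n.
Notation C := 'I_q.
Notation pins := (pins 'I_n 'I_q).
Hypotheses (e_sym : symmetric e) (e_irr : irreflexive e).
Hypothesis e_lat : forall v w, e v w -> lat v w.
Hypothesis D_lt : (Delta < #|C|)%N.
Hypothesis deg_le : forall v, (edeg lat setT v <= Delta)%N.
Implicit Types (p : pins) (v w s : V) (c : C) (Q : seq pins) (W : seq (pins * (nat * nat))).

Lemma eq_walk (E E' : pins -> V -> C -> rat) S (G G' : pins -> rat) p : uniq S ->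
  (forall s, s \in S -> s \in free p) ->
  (forall p' s c, s \in free p' -> E p' s c = E' p' s c) ->
  (forall p', reach S p p' -> G p' = G' p') -> walk e E S G p = walk e E' S G' p.
Proof.
move=> + + hE; elim: S p => [|s S IH] p /= uS fS hG; first by apply: hG; split.
case/andP: uS => sS uS; apply: eq_bigr => b _; rewrite hE ?fS ?inE ?eqxx //; congr (_ * _).
apply: IH => //; first exact: pin_free sS fS.
by move=> p' /(reach_pin sS); exact: hG.
Qed.

Lemma sum_allowed (F : C -> rat) p v :
  \sum_(c <- enum C | c \in allowed e p v) F c = \sum_(c in allowed e p v) F c.
Proof. by rewrite big_enum_cond; apply: eq_bigl => c. Qed.

Lemma sum_xpd (h : pins -> rat) s Q :
  \sum_(p <- xpd e s Q) h p = \sum_(p <- Q) \sum_(c in allowed e p s) h (pin p s c).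
Proof.
rewrite /xpd catrevE cats0 (perm_big _ (permEl (perm_rev _))) big_flatten /= big_map.
by apply: eq_bigr => p _; rewrite /exts big_map big_filter sum_allowed.
Qed.

Lemma sum_xpds (h : pins -> rat) S Q :
  \sum_(p <- foldl (fun Q s => xpd e s Q) Q S) h p = \sum_(p <- Q) walk e (fun _ _ _ => 1) S h p.
Proof.
elim: S Q => //= s S IH Q; rewrite IH sum_xpd; apply: eq_bigr => p _; apply: eq_bigr => c _.
by rewrite mul1r.
Qed.

Lemma set_cons s (S : seq V) : s \notin S -> [set w in s :: S] :\ s = [set w in S].
Proof.
move=> sS; apply/setP=> w; rewrite !inE; case: (eqVneq w s) => [->|] //=.
by rewrite (negPf sS).
Qed.

Lemma walk_count S p : uniq S -> (forall s, s \in S -> s \in free p) ->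
  walk e (fun _ _ _ => 1) S (fun=> 1) p = count c0 e [set s in S] (allowed e p).
Proof.
elim: S p => [|s S IH] p /= uS fS.
  by rewrite /count (_ : [set s in [::]] = set0) ?csum0 //; apply/setP=> w; rewrite !inE.
case/andP: uS => sS uS; have sf : s \in free p by apply: fS; rewrite inE eqxx.
have sI : s \in [set w in s :: S] by rewrite !inE eqxx.
rewrite /count (csum_peel c0 e_sym e_irr _ _ sI) set_cons //; apply: eq_bigr => b _.
rewrite mul1r IH //; last exact: pin_free sS fS.
by apply: eq_csum_lists => w _; rewrite allowed_pin.
Qed.

Lemma walk_csum v a S p : uniq S -> (forall s, s \in S -> s \in free p) ->
  walk e (fun _ _ _ => 1) S (fun p' => (p' v == Some a)%:R) p =
  csum c0 e [set s in S] (allowed e p) (fun d => if v \in S then (d v == a)%:R else (p v == Some a)%:R).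
Proof.
elim: S p => [|s S IH] p /= uS fS.
  by rewrite (_ : [set s in [::]] = set0) ?csum0 //; apply/setP=> w; rewrite !inE.
case/andP: uS => sS uS; have sf : s \in free p by apply: fS; rewrite inE eqxx.
have sI : s \in [set w in s :: S] by rewrite !inE eqxx.
rewrite (csum_peel c0 e_sym e_irr _ _ sI) set_cons //; apply: eq_bigr => b _.
rewrite mul1r IH //; last exact: pin_free sS fS.
apply: eq_csum => [w _|d _]; first by rewrite allowed_pin.
rewrite inE !ffunE; case: (eqVneq v s) => [->|] //=.
by rewrite (negPf sS).
Qed.

Lemma inner_set p v : [set s in innerS r e p v] = inner e r p v.
Proof. by apply/setP=> s; rewrite [LHS]in_set mem_filter mem_enum andbT [RHS]in_set [s \in free p]in_set. Qed.
Lemma inner_uniq p v : uniq (innerS r e p v). Proof. exact: filter_uniq (enum_uniq _). Qed.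
Lemma inner_free p v s : s \in innerS r e p v -> s \in free p.
Proof. by rewrite mem_filter => /andP[/andP[h _] _]; rewrite inE. Qed.

Lemma locF_val p v c : v \in free p ->
  (0 < (locF r e p v c).2)%N /\ fval (locF r e p v c) = loc c0 e r p v c.
Proof.
move=> vf; have vI : v \in innerS r e p v by rewrite mem_filter ball_center mem_enum; move: vf; rewrite inE => ->.
have sz : (size (full r e p v))%:R = count c0 e (inner e r p v) (allowed e p).
  rewrite -inner_set -(walk_count (inner_uniq p v) (@inner_free p v)).
  have := sum_xpds (fun=> 1) (innerS r e p v) [:: p]; rewrite big_seq1 => <-.
  by rewrite big_const_seq count_predT iter_addr_0.
have ct : (seq.count (fun p' : pins => p' v == Some c) (full r e p v))%:R =
    csum c0 e (inner e r p v) (allowed e p) (is_at v c).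
  have := walk_csum v c (inner_uniq p v) (@inner_free p v); rewrite vI inner_set => <-.
  have := sum_xpds (fun p' => (p' v == Some c)%:R) (innerS r e p v) [:: p]; rewrite big_seq1 => <-.
  by rewrite -sum1_count natr_sum big_mkcond; apply: eq_bigr => p' _; case: (_ == _).
have pos : 0 < count c0 e (inner e r p v) (allowed e p).
  by apply: (cls_count_gt0 c0 e_sym e_irr e_lat D_lt); exact: inner_cls.
split; first by rewrite -(ltr_nat rat) sz.
by rewrite /fval /= ct sz.
Qed.

Section Step.
Variables (g : pins -> V -> C -> nat * nat) (m : nat).
Hypothesis g_pos : forall p v c, v \in free p -> (0 < (g p v c).2)%N /\ fb m (g p v c).

Lemma mem_wxpd s W pw' : pw' \in wxpd e g s W -> exists pw c, [/\ pw \in W, c \in allowed e pw.1 s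
  & pw' = (pin pw.1 s c, fmuln pw.2 (g pw.1 s c))].
Proof.
rewrite /wxpd catrevE cats0 mem_rev => /flatten_mapP[pw pwW] /mapP[c]; rewrite mem_filter => /andP[ca _] ->.
by exists pw, c.
Qed.

Lemma wfin_inv S m0 W : uniq S ->
  (forall pw, pw \in W -> [/\ forall s, s \in S -> s \in free pw.1, (0 < pw.2.2)%N & fb m0 pw.2]) ->
  forall pw', pw' \in wfin e g S W -> exists pw, [/\ pw \in W, reach S pw.1 pw'.1, (0 < pw'.2.2)%N
    & fb (m0 + size S * m) pw'.2].
Proof.
elim: S m0 W => [|s S IH] m0 W /=.
  move=> _ hW pw' pW; have [_ a b] := hW pw' pW; exists pw'; rewrite mul0n addn0; split=> //.
case/andP=> sS uS hW pw' hp.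
have [|pw1 [h1 h2 h3 h4]] := IH (m0 + m)%N (wxpd e g s W) uS _ pw' hp.
  move=> pw2 /mem_wxpd[pw [c [pW _ ->]]]; have [a1 a2 a3] := hW pw pW.
  have sf : s \in free pw.1 by apply: a1; rewrite inE eqxx.
  have [b1 b2] := g_pos c sf; split=> /=; last exact: fb_mul.
    by apply: pin_free sS a1.
  by rewrite muln_gt0 a2.
have [pw [c [pW _ E]]] := mem_wxpd h1; exists pw; split=> //.
  by apply: (reach_pin (b := c) sS); move: h2; rewrite E.
by rewrite mulSn addnA.
Qed.

Lemma sum_wfin (G : pins -> rat) S W :
  \sum_(pw <- wfin e g S W) fval pw.2 * G pw.1 =
  \sum_(pw <- W) fval pw.2 * walk e (fun p s c => fval (g p s c)) S G pw.1.
Proof.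
elim: S W => //= s S IH W; rewrite IH /wxpd catrevE cats0 (perm_big _ (permEl (perm_rev _))) big_flatten /= big_map.
apply: eq_bigr => pw _; rewrite /wexts big_map big_filter sum_allowed mulr_sumr.
by apply: eq_bigr => c _; rewrite /= fval_mul mulrA.
Qed.

Lemma value_sum v c W : (forall pw, pw \in W -> (0 < pw.2.2)%N /\ (0 < (locF r e pw.1 v c).2)%N) ->
  (0 < (value r e W v c).2)%N /\
  fval (value r e W v c) = \sum_(pw <- W) fval pw.2 * fval (locF r e pw.1 v c).
Proof.
rewrite /value => hW.
suff gen f : (0 < f.2)%N -> let F := foldl (fun acc pw => faddn acc (fmuln pw.2 (locF r e pw.1 v c))) f W in
   (0 < F.2)%N /\ fval F = fval f + \sum_(pw <- W) fval pw.2 * fval (locF r e pw.1 v c).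
  by have [a ->] := gen (0%N, 1%N) isT; split=> //; rewrite {1}/fval /= mul0r add0r.
elim: W hW f => [|pw W IH] hW f f0 /=; first by rewrite big_nil addr0.
have [a b] := hW pw (mem_head _ _).
have ab : (0 < (fmuln pw.2 (locF r e pw.1 v c)).2)%N by rewrite /= muln_gt0 a.
have [||h1 h2] := IH _ (faddn f (fmuln pw.2 (locF r e pw.1 v c))).
- by move=> pw' h; apply: hW; rewrite inE h orbT.
- by rewrite /= muln_gt0 f0.
by split=> //; rewrite h2 fval_add // fval_mul big_cons addrA.
Qed.

Lemma value_fb v c W mw Lb : (forall pw, pw \in W -> fb mw pw.2 /\ fb Lb (locF r e pw.1 v c)) ->
  fb (size W * (mw + Lb + 1)) (value r e W v c).
Proof.
rewrite /value => hW.
suff gen f m1 : fb m1 f -> fb (m1 + size W * (mw + Lb + 1))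
   (foldl (fun acc pw => faddn acc (fmuln pw.2 (locF r e pw.1 v c))) f W) by exact: (gen (0%N, 1%N) 0%N).
elim: W hW f m1 => [|pw W IH] hW f m1 f0 /=; first by rewrite mul0n addn0.
have [a b] := hW pw (mem_head _ _).
rewrite mulSn addnA; apply: IH; first by move=> pw' h; apply: hW; rewrite inE h orbT.
by rewrite addnA; apply: fb_add => //; exact: fb_mul.
Qed.

Variables (Smax Wmax Lb : nat).
Hypothesis hSmax : forall p v, (size (sphere e r p v) <= Smax)%N.
Hypothesis hWmax : forall p v, (q ^ size (sphere e r p v) <= Wmax)%N.
Hypothesis hLb : forall p v, (q ^ size (innerS r e p v) <= 2 ^ Lb)%N.
Variable E : pins -> V -> C -> rat.
Hypothesis gE : forall p v c, v \in free p -> fval (g p v c) = E p v c.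

Lemma estS_val p v c : v \in free p ->
  [/\ (0 < (estS r e g p v c).2)%N, fb (Wmax * (Smax * m + Lb + 1)) (estS r e g p v c)
  & fval (estS r e g p v c) = walk e E (sphere e r p v) (fun p' => loc c0 e r p' v c) p].
Proof.
move=> vf; set S := sphere e r p v; rewrite /estS -/S; set W := wfin _ _ _ _.
have uS : uniq S by exact: filter_uniq (enum_uniq _).
have fS s : s \in S -> s \in free p by case/sphereP.
have hW pw : pw \in W -> [/\ reach S p pw.1, (0 < pw.2.2)%N & fb (Smax * m) pw.2].
  move=> pW; have [|pw1 [h1 h2 h3 h4]] := wfin_inv (m0 := 0%N) (W := [:: (p, (1%N, 1%N))]) uS _ pW.
    by move=> pw1 /[1!inE]/eqP ->; split.
  move: h1 h2; rewrite inE => /eqP -> h2; split=> //; apply: fb_le h4.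
  by rewrite add0n leq_mul2r hSmax orbT.
have loc0 pw : pw \in W -> v \in free pw.1.
  by move=> /hW[h _ _]; have [] := reach_center vf h.
have [|a b] := @value_sum v c W.
  by move=> pw pW; have [_ h _] := hW pw pW; split=> //; have [] := locF_val c (loc0 _ pW).
split=> //.
  have := @value_fb v c W (Smax * m) Lb => h; apply: fb_le (h _); last first.
    move=> pw pW; have [_ _ h2] := hW pw pW; split=> //.
    have sz : (size (full r e pw.1 v) <= 2 ^ Lb)%N.
      by apply: leq_trans (size_xpds _ _ _) _; rewrite mul1n; exact: hLb.
    by rewrite /fb /locF /= sz (leq_trans (count_size _ _) sz).
  rewrite leq_mul2r; apply/orP; right; apply: leq_trans (size_wfin _ _ _ _) _.
  by rewrite mul1n; exact: hWmax.
rewrite b (eq_big_seq (fun pw => fval pw.2 * loc c0 e r pw.1 v c)); last first.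
  by move=> pw pW; have [_ ->] := locF_val c (loc0 _ pW).
rewrite (sum_wfin (fun p' => loc c0 e r p' v c)) big_seq1 /= {1}/fval divff // mul1r.
by apply: eq_walk => // p' s d; exact: gE.
Qed.
End Step.

Variables (Smax Wmax Lb M : nat).
Hypothesis hSmax : forall p v, (size (sphere e r p v) <= Smax)%N.
Hypothesis hWmax : forall p v, (q ^ size (sphere e r p v) <= Wmax)%N.
Hypothesis hLb : forall p v, (q ^ size (innerS r e p v) <= 2 ^ Lb)%N.
Hypothesis hM : (Wmax * (Smax + Lb + 1) <= M)%N.
Hypothesis hM0 : (0 < M)%N.

Fixpoint estF k : pins -> V -> C -> nat * nat :=
  if k is k'.+1 then estS r e (estF k') else estB e c0.

(** One level combines at most [Wmax] terms, each a product of at most [Smax] inputs and a local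
    fraction, so it multiplies the number of digits by at most [M]. *)
Lemma estF_val k p v c : v \in free p ->
  [/\ (0 < (estF k p v c).2)%N, fb (M ^ k) (estF k p v c) & fval (estF k p v c) = est c0 e r k p v c].
Proof.
elim: k p v c => [|k IH] p v c vf.
  by rewrite /= /estB /fval /fb /= divr1; split=> //; case: (_ == _).
have [||a b d] := @estS_val (estF k) (M ^ k) _ Smax Wmax Lb hSmax hWmax hLb (est c0 e r k) _ p v c vf.
- by move=> p' v' c' /(IH p' v' c')[].
- by move=> p' v' c' /(IH p' v' c')[].
split=> //; apply: fb_le b; rewrite expnS; apply: leq_trans (leq_mul hM (leqnn _)).
rewrite -mulnA leq_mul2l; apply/orP; right.
have : (0 < M ^ k)%N by rewrite expn_gt0 hM0.
by set x := (M ^ k)%N; clear; nia.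
Qed.

End Semantics.
End EstimatorProgram.

(** * The complete program: layers of calls, product, output *)

Module MainProgram.
Import Defs Colourings SpatialMixing Locality Estimator PolyTime TreeArithmetic TreeGraphs TreeGraphsCorrect EstimatorProgram.
Import Order.TTheory GRing.Theory Num.Theory.

Section Programs.
Variables q r : nat.

(* Argument: Node tasks vs. *)
Definition nextf : fn := fun N t =>
  trev N (tfold (fun N u => revcat N (Node (subtasks q r N (Node (hd u) (tl (tl u)))) (hd (tl u)))) N
    (Node (hd t) (Node Leaf (tl t)))).
(* Argument: Node klist (Node tasks vs); the result is the stack of all layers. *)
Definition downf : fn := fun N t =>
  tfold (fun N u => Node (nextf N (Node (hd (hd (tl u))) (tl (tl u)))) (hd (tl u))) N
    (Node (hd t) (Node (Node (hd (tl t)) Leaf) (tl (tl t)))).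
(* Argument: Node layer (Node vals vs). *)
Definition layerf : fn := fun N t =>
  trev N (hd (tfold (fun N u =>
      (fun N w => Node (Node (hd (hd w)) (tl w)) (tl (hd w))) N
        (Node (combine q r N (Node (hd u) (Node (tl (hd (tl u))) (tl (tl u))))) (hd (hd (tl u))))) N
    (Node (hd t) (Node (Node Leaf (hd (tl t))) (tl (tl t)))))).
Definition basef : fn := fun N t =>
  trev N (tfold (fun N u => Node (base (iota 0 q) N (hd u)) (hd (tl u))) N (Node t T)).
(* Argument: Node stack vs. *)
Definition upf : fn := fun N t =>
  tfold (fun N u => layerf N (Node (hd u) (tl u))) N
    (Node (tl (hd t)) (Node (basef N (hd (hd t))) (tl t))).
(** Walks down the rows while prefixing a [Leaf] to the current name, from [onehot i] to
    [onehot i.+1]. *)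
Definition mkvs : fn := fun N t =>
  trev N (tl (tfold (fun N u => Node (Node Leaf (hd (hd (tl u)))) (Node (Node (hd (hd (tl u))) (hd u)) (tl (hd (tl u)))))
    N (Node t (Node (Node (Node T Leaf) Leaf) Leaf)))).
Definition emptyf : fn := fun N t => tfold (fun N u => Node Leaf (hd (tl u))) N (Node t T).
(* Argument: Node p vs. *)
Definition topf : fn := fun N t =>
  trev N (tl (tfold (fun N u => Node (hd (ext q N (Node (hd (hd (tl u))) (hd u))))
      (Node (Node (hd (hd (tl u))) (hd u)) (tl (hd (tl u))))) N
    (Node (tl t) (Node (Node (hd t) Leaf) Leaf)))).
(* Argument: Node tasks vals. *)
Definition prodf : fn := fun N t =>
  zfold (fun N u => fmul N (Node (hd (tl (tl u)))
      ((fun N w => Node (tl w) (hd w)) N (pick (iota 0 q) N (Node (hd u) (hd (tl u))))))) N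
    (Node (hd t) (Node (tl t) (Node (Node (one N t) (one N t)) Leaf))).
Definition stripf : fn := fun N t =>
  iter N (fun t => if truthy (hd (hd t)) then t else if truthy (tl (hd t)) then t else tl t) t.
(** Pairing the digits while reversing both numbers puts the most significant digit first; stripping
    the leading pairs of zeros then yields the padding required by [tree_of_fraction]. *)
Definition outf : fn := fun N t =>
  stripf N (tl (tl (iter N (fun s => Node (tl (hd s)) (Node (tl (hd (tl s)))
     (Node (Node (hd (hd s)) (hd (hd (tl s)))) (tl (tl s))))) (Node (hd t) (Node (tl t) Leaf))))).
(* Argument: Node rows klist. *)
Definition withvs : fn := fun N t => (* Node (Node klist vs) tasks *)
  Node (Node (tl t) (mkvs N (hd t))) (topf N (Node (emptyf N (hd t)) (mkvs N (hd t)))).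
Definition solve : fn := fun N t => (* from Node (Node klist vs) tasks *)
  outf N (prodf N (Node (tl t) (upf N (Node (downf N (Node (hd (hd t)) (Node (tl t) (tl (hd t))))) (tl (hd t)))))).
Definition mainf : fn := fun N t => solve N (withvs N t).

Lemma PT_swapw : PT (fun (_ : nat) w => Node (Node (hd (hd w)) (tl w)) (tl (hd w))). Proof. by pt. Qed.
Lemma PT_swap : PT (fun (_ : nat) w => Node (tl w) (hd w)). Proof. by pt. Qed.
#[local] Hint Resolve PT_subtasks PT_combine PT_base PT_pick PT_ext : pt.
Lemma PT_nextf : PT nextf. Proof. by rewrite /nextf; pt. Qed.
#[local] Hint Resolve PT_nextf : pt.
Lemma PT_downf : PT downf. Proof. by rewrite /downf; pt. Qed.
Lemma PT_layerf : PT layerf.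
Proof.
rewrite /layerf; apply: (PT_comp PT_trev); apply: PT_hd.
apply: (@PT_comp (tfold _)); last by pt.
by apply: PT_fold; apply: (PT_comp PT_swapw); pt.
Qed.
Lemma PT_basef : PT basef. Proof. by rewrite /basef; pt. Qed.
#[local] Hint Resolve PT_downf PT_layerf PT_basef : pt.
Lemma PT_upf : PT upf. Proof. by rewrite /upf; pt. Qed.
Lemma PT_mkvs : PT mkvs. Proof. by rewrite /mkvs; pt. Qed.
Lemma PT_emptyf : PT emptyf. Proof. by rewrite /emptyf; pt. Qed.
Lemma PT_topf : PT topf. Proof. by rewrite /topf; pt. Qed.
Lemma PT_prodf : PT prodf.
Proof.
rewrite /prodf; apply: (@PT_comp (zfold _)); last by pt.
apply: PT_zfold; apply: (PT_comp PT_fmul); apply: PT_node; first by pt.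
by apply: (PT_comp PT_swap); pt.
Qed.
Lemma PT_stripf : PT stripf. Proof. by apply: PT_loop; pt. Qed.
Lemma PT_outf : PT outf.
Proof.
rewrite /outf; apply: (PT_comp PT_stripf); do 2!apply: PT_tl.
pose st : fn := fun _ s => Node (tl (hd s)) (Node (tl (hd (tl s))) (Node (Node (hd (hd s)) (hd (hd (tl s)))) (tl (tl s)))).
apply: (@PT_comp (fun N t => iter N (st N) t)); last by pt.
by apply: PT_loop; rewrite /st; pt.
Qed.
#[local] Hint Resolve PT_upf PT_mkvs PT_emptyf PT_topf PT_prodf PT_outf : pt.
Lemma PT_mainf : PT mainf.
Proof. by apply: PT_comp; [rewrite /solve|rewrite /withvs]; pt. Qed.
End Programs.

#[local] Arguments ball : simpl never.
#[local] Arguments tfold : simpl never.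
#[local] Arguments zfold : simpl never.
#[local] Arguments revcat : simpl never.
#[local] Arguments trev : simpl never.
#[local] Arguments ext : simpl never.
#[local] Arguments subtasks : simpl never.
#[local] Arguments combine : simpl never.
#[local] Arguments base : simpl never.
#[local] Arguments pick : simpl never.
#[local] Arguments fmul : simpl never.
#[local] Arguments one : simpl never.
#[local] Arguments zero : simpl never.
#[local] Arguments subs : simpl never.

Lemma enc_digit N a : enc N a = tree_of_seq [seq tb (binary_digit a i) | i <- iota 0 N].
Proof.
elim: N a => //= N IH a; rewrite /binary_digit expn0 divn1; congr Node.
rewrite IH (iotaDl 1 0 N) -map_comp; congr tree_of_seq; apply: eq_map => i /=.
by rewrite /binary_digit -divn2 -divnMA -expnS.
Qed.

Lemma outfE N a b : a < 2 ^ N -> b < 2 ^ N -> 0 < b -> outf N (fenc N (a, b)) = tree_of_fraction a b.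
Proof.
move=> aN bN b0; rewrite /outf /=.
pose F i := Node (tb (binary_digit a i)) (tb (binary_digit b i)).
have zipE m i o : tl (tl (iter m (fun s => Node (tl (hd s)) (Node (tl (hd (tl s)))
     (Node (Node (hd (hd s)) (hd (hd (tl s)))) (tl (tl s)))))
     (Node (tree_of_seq [seq tb (binary_digit a i) | i <- iota i m])
       (Node (tree_of_seq [seq tb (binary_digit b i) | i <- iota i m]) o)))) =
   crev (tree_of_seq (map F (iota i m))) o.
  by elim: m i o => // m IH i o; rewrite iterSr /= IH.
rewrite !enc_digit zipE crev_seq catrevE cats0 -map_rev.
rewrite /tree_of_fraction -/F; set L := up_log _ _.
have LN : L <= N.
  have : (maxn a b).+1 <= 2 ^ N by rewrite gtn_max aN.
  by move=> h; rewrite /L; have := @up_log_min 2 (maxn a b).+1 N isT h.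
have mL : (maxn a b).+1 <= 2 ^ L by exact: up_logP.
have L0 : 0 < L by rewrite /L up_log_gt0 /= ltnS leq_max b0 orbT.
(* The leading digit of the larger number is one, so stripping stops exactly at the common
   length. *)
have top : truthy (hd (F L.-1)) || truthy (tl (F L.-1)).
  rewrite /F /= !truthy_tb.
  have P : 0 < 2 ^ L.-1 by rewrite expn_gt0.
  have lo : 2 ^ L.-1 <= maxn a b.
    rewrite leqNgt; apply/negP=> h; have := @up_log_min 2 (maxn a b).+1 L.-1 isT h.
    by rewrite -/L; move: L0; clear; lia.
  have dig x : x <= maxn a b -> 2 ^ L.-1 <= x -> binary_digit x L.-1.
    move=> xm xl; rewrite /binary_digit; have -> : x %/ 2 ^ L.-1 = 1 => //.
    apply/eqP; rewrite eqn_leq divn_gt0 // xl andbT -ltnS ltn_divLR // -expnS prednK //.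
    exact: leq_ltn_trans xm mL.
  case/orP: (leq_total a b) => h; rewrite ?(maxn_idPr h) ?(maxn_idPl h) in lo *.
    by rewrite (dig b) ?orbT // leq_maxr.
  by rewrite (dig a) // leq_maxl.
have -> : iota 0 N = iota 0 L ++ iota L (N - L) by rewrite -iotaD subnKC.
rewrite rev_cat map_cat /stripf.
have zeros i : L <= i -> F i = T.
  move=> Li; rewrite /F /binary_digit !divn_small //.
  - by apply: leq_trans (leq_pexp2l _ Li); rewrite // (leq_trans _ mL) // ltnS leq_maxr.
  - by apply: leq_trans (leq_pexp2l _ Li); rewrite // (leq_trans _ mL) // ltnS leq_maxl.
have stop m : iter m (fun t => if truthy (hd (hd t)) then t else if truthy (tl (hd t)) then t else tl t)
    (tree_of_seq (map F (rev (iota 0 L)))) = tree_of_seq (map F (rev (iota 0 L))).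
  have -> : rev (iota 0 L) = L.-1 :: rev (iota 0 L.-1).
    by rewrite -{1}(prednK L0) -addn1 iotaD /= rev_cat.
  elim: m => // m IH; rewrite iterS IH /=; move: top; rewrite /F /= !truthy_tb.
  by case: (binary_digit a _); case: (binary_digit b _).
have al : all (fun i => L <= i) (rev (iota L (N - L))).
  by rewrite all_rev; apply/allP=> i; rewrite mem_iota => /andP[].
have sz : size (rev (iota L (N - L))) <= N by rewrite size_rev size_iota leq_subr.
have fin s m : size s <= m -> all (fun i => L <= i) s -> iter m (fun t => if truthy (hd (hd t)) then t
    else if truthy (tl (hd t)) then t else tl t)
    (tree_of_seq (map F s ++ map F (rev (iota 0 L)))) = tree_of_seq (map F (rev (iota 0 L))).
  elim: s m => [|i s IH] m /= sm; first by rewrite stop.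
  case/andP=> Li ls; case: m sm => // m sm; rewrite iterSr.
  rewrite [X in iter m _ X](_ : _ = tree_of_seq (map F s ++ map F (rev (iota 0 L)))); first exact: IH.
  by rewrite (zeros i Li).
exact: fin.
Qed.

Section CorrectMain.
Variables (n q r N : nat) (e lat : rel 'I_n) (c0 : 'I_q) (Delta : nat).
Notation V := 'I_n.
Notation C := 'I_q.
Notation pins := (pins 'I_n 'I_q).
Hypotheses (e_sym : symmetric e) (e_irr : irreflexive e).
Hypothesis e_lat : forall v w, e v w -> lat v w.
Hypothesis D_lt : Delta < #|C|.
Hypothesis deg_le : forall v, edeg lat setT v <= Delta.
Implicit Types (p : pins) (v w s : V) (c : C) (Q : seq pins) (ts : seq (pins * V)).
Variables (Smax Wmax Lb M K : nat).
Hypothesis hSmax : forall p v, size (sphere e r p v) <= Smax.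
Hypothesis hWmax : forall p v, q ^ size (sphere e r p v) <= Wmax.
Hypothesis hLb : forall p v, q ^ size (innerS r e p v) <= 2 ^ Lb.
Hypothesis hM : Wmax * (Smax + Lb + 1) <= M.
Hypothesis hM0 : 0 < M.
Hypotheses (hn : n <= N) (hq : q <= N) (hN : 0 < N) (q0 : 0 < q).
Hypotheses (hWN : Wmax <= N) (hLN : 2 ^ Lb <= N) (hSN : Smax * Wmax <= N) (hKN : K < N).
Hypothesis hT : n * M ^ K < N.

Notation encT := (encT e).
Notation vsT := (vsT e).
Notation encVal := (encVal N).
Notation estF := (estF r e c0).

Let hI p v : q ^ size (innerS r e p v) <= N. Proof. exact: leq_trans (hLb p v) hLN. Qed.
Let hS p v : q ^ size (sphere e r p v) <= N. Proof. exact: leq_trans (hWmax p v) hWN. Qed.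
Definition sub1 (t : pins * V) := subs e (sphere e r t.1 t.2) [:: t.1].
Lemma size_sub1 t : size (sub1 t) <= Smax * Wmax.
Proof.
apply: leq_trans (size_subs _ q0 _ _) _; rewrite mul1n; apply: leq_mul => //; exact: hSmax.
Qed.
Let hSub p v : size (subs e (sphere e r p v) [:: p]) <= N.
Proof. exact: leq_trans (size_sub1 (p, v)) hSN. Qed.
Let SWM : Smax * Wmax <= M.
Proof. by apply: leq_trans hM; rewrite mulnC leq_mul2l -addnA leq_addr orbT. Qed.

Definition nxt ts := flatten (map sub1 ts).
Lemma size_nxt ts : size (nxt ts) <= M * size ts.
Proof. by apply: size_flatten_le => t; exact: leq_trans (size_sub1 t) SWM. Qed.

Lemma nextfE ts : size ts <= N -> size (nxt ts) <= N ->
  nextf q r N (Node (tree_of_seq (map encT ts)) vsT) = tree_of_seq (map encT (nxt ts)).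
Proof.
move=> h1 h2; rewrite /nextf /= tfoldE ?spine_seq ?size_map // foldl_map /=.
have gen (A : seq (pins * V)) ts' : foldl (fun a t => revcat N (Node (subtasks q r N (Node (encT t) vsT)) a))
    (tree_of_seq (map encT A)) ts' = tree_of_seq (map encT (catrev (flatten (map sub1 ts')) A)).
  elim: ts' A => //= -[p v] ts' IH A.
  rewrite subtasksE // revcatE; last by rewrite spine_seq size_map.
  by rewrite crev_seq spine_seq -map_catrev IH catrev_catl.
have := gen [::] ts; rewrite -/(nxt ts) /= => ->.
rewrite catrevE cats0 trevE ?spine_seq ?size_map ?size_rev // crev_seq catrevE cats0.
by rewrite -map_rev revK.
Qed.

(** The recursion tree made explicit: layer [i] lists all calls at depth [i]. The stack has the
    deepest layer first, the order in which [upf] evaluates it. *)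
Fixpoint layer i ts := if i is i'.+1 then nxt (layer i' ts) else ts.
Fixpoint stack i ts : seq (seq (pins * V)) := if i is i'.+1 then layer i ts :: stack i' ts else [:: ts].

Lemma size_layer i ts : size (layer i ts) <= M ^ i * size ts.
Proof.
elim: i => [|i IH] /=; first by rewrite mul1n.
by apply: leq_trans (size_nxt _) _; rewrite expnS -mulnA leq_mul2l IH orbT.
Qed.
Lemma size_layerN i ts : i <= K -> size ts <= n -> size (layer i ts) <= N.
Proof.
move=> iK tn; apply: leq_trans (size_layer _ _) _; apply: leq_trans (ltnW hT).
by rewrite mulnC; apply: leq_mul => //; apply: leq_pexp2l.
Qed.

Definition encL ts := tree_of_seq (map encT ts).
Lemma downfE kl ts : size (spine kl) = K -> size ts <= n ->
  downf q r N (Node kl (Node (encL ts) vsT)) = tree_of_seq (map encL (stack K ts)).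
Proof.
move=> sk tn; rewrite /downf /= tfoldE ?sk ?(ltnW hKN) //.
have gen m (s : seq tree) : size s = m -> m <= K ->
   foldl (fun a x => Node (nextf q r N (Node (hd a) vsT)) a) (Node (encL ts) Leaf) s =
   tree_of_seq (map encL (stack m ts)).
  elim: m s => [|m IH] s; first by case: s.
  case/lastP: s => // s x; rewrite size_rcons => -[sm] mK; rewrite -cats1 foldl_cat /= IH //; last exact: ltnW.
  congr Node.
  have -> : hd (tree_of_seq (map encL (stack m ts))) = encL (layer m ts) by case: m {IH sm mK} => //.
  rewrite nextfE //; first by apply: size_layerN => //; exact: ltnW.
  by apply: (size_layerN mK).
exact: gen.
Qed.

Definition okts ts := forall t, t \in ts -> t.2 \in free t.1.

Lemma subs_free S Q : uniq S -> (forall p, p \in Q -> forall s, s \in S -> s \in free p) ->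
  forall t, t \in subs e S Q -> t.2 \in free t.1.
Proof.
elim: S Q => //= s S IH Q /andP[sS uS] hQ t; rewrite mem_cat => /orP[/mapP[p pQ ->]|].
  by apply: hQ pQ _ _; rewrite inE eqxx.
apply: IH => // p; rewrite /xpd catrevE cats0 mem_rev => /flatten_mapP[p1 p1Q] /mapP[c _ ->] u uS'.
exact: (@pin_free 'I_n 'I_q p1 s c S sS (hQ p1 p1Q) u uS').
Qed.
Lemma okts_nxt ts : okts ts -> okts (nxt ts).
Proof.
move=> h t /flatten_mapP[[p v] pv]; apply: subs_free; first exact: filter_uniq (enum_uniq _).
by move=> p1 /[1!inE]/eqP -> s /sphereP[].
Qed.
Lemma okts_layer i ts : okts ts -> okts (layer i ts).
Proof. by move=> h; elim: i => //= i; exact: okts_nxt. Qed.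

Lemma allowed_ex p v : v \in free p -> exists c, c \in allowed e p v.
Proof. by move=> vf; apply/card_gt0P; exact: (allowed_n0 c0 e_lat D_lt deg_le vf). Qed.

Definition encVs k ts := tree_of_seq [seq encVal (estF k t.1 t.2) | t <- ts].

Lemma basefE ts : size ts <= N -> okts ts -> basef q N (encL ts) = encVs 0 ts.
Proof.
move=> h ok; rewrite /basef tfoldE /= ?spine_seq ?size_map // foldl_map /=.
rewrite (_ : foldl _ _ _ = crev (encVs 0 ts) Leaf).
  by rewrite trevE ?crevK // size_crev addn0 spine_seq size_map.
rewrite /encVs; move: Leaf; elim: ts ok {h} => //= -[p v] ts IH ok o.
have vf : v \in free p by apply: (ok (p, v)); rewrite inE eqxx.
have ex := allowed_ex vf; rewrite (@baseE n q N e c0) // IH // => t tt; apply: ok; by rewrite inE tt orbT.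
Qed.

Lemma layerfE k ts : size ts <= N ->
  layerf q r N (Node (encL ts) (Node (encVs k (nxt ts)) vsT)) = encVs k.+1 ts.
Proof.
move=> h; have cE p v rest : combine q r N (Node (encT (p, v)) (Node (tree_of_seq
    ([seq encVal (estF k t.1 t.2) | t <- sub1 (p, v)] ++ rest)) vsT)) =
    Node (encVal (estF k.+1 p v)) (tree_of_seq rest) by apply: combineE.
rewrite /layerf; move: (combine q r) cE => cmb cE.
rewrite /= tfoldE ?spine_seq ?size_map // foldl_map /=.
have gen o rest ts' : foldl (fun a t => Node (Node (hd (cmb N (Node (encT t) (Node (tl a) vsT)))) (hd a))
       (tl (cmb N (Node (encT t) (Node (tl a) vsT)))))
     (Node o (tree_of_seq ([seq encVal (estF k t.1 t.2) | t <- nxt ts'] ++ rest))) ts' =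
     Node (crev (encVs k.+1 ts') o) (tree_of_seq rest).
  elim: ts' o => // -[p v] ts' IH o.
  rewrite -[nxt _]/(sub1 (p, v) ++ nxt ts') map_cat -catA [foldl _ _ _]/= cE /= IH.
  by [].
have := gen Leaf [::] ts; rewrite cats0 => -> /=.
by rewrite trevE ?crevK // size_crev addn0 spine_seq size_map.
Qed.

Lemma upfE ts : size ts <= n -> okts ts ->
  upf q r N (Node (tree_of_seq (map encL (stack K ts))) vsT) = encVs K ts.
Proof.
move=> tn ok; rewrite /upf /=.
have gen m j : m + j = K ->
  foldl (fun a x => layerf q r N (Node x (Node a vsT))) (encVs j (layer m ts)) (map encL (behead (stack m ts))) = encVs K ts.
  elim: m j => [|m IH] j; first by rewrite add0n => ->.
  move=> mj /=; have -> : stack m ts = layer m ts :: behead (stack m ts) by case: (m).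
  rewrite /= layerfE; last by apply: size_layerN => //; move: mj; clear; lia.
  by rewrite (IH j.+1) // addnS.
have E : tree_of_seq (map encL (stack K ts)) = Node (encL (layer K ts)) (tree_of_seq (map encL (behead (stack K ts)))).
  by case: (K).
rewrite E /= tfoldE ?spine_seq ?size_map.
  rewrite basefE ?gen ?addn0 //; first exact: size_layerN.
  exact: okts_layer.
suff -> : size (behead (stack K ts)) = K by exact: ltnW.
by rewrite size_behead; elim: (K) => //= m; case: (m) => //= m' ->.
Qed.

Lemma mkvsE : mkvs N (tree_of_seq [seq row e v | v <- enum V]) = vsT.
Proof.
rewrite /mkvs tfoldE; last by rewrite spine_seq size_map size_enum_ord.
rewrite spine_seq foldl_map /=.
have gen (s : seq V) i o : map val s = iota i (size s) ->
  tl (foldl (fun a v => Node (Node Leaf (hd a)) (Node (Node (hd a) (row e v)) (tl a))) (Node (onehot i) o) s) =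
  crev (tree_of_seq [seq obj e v | v <- s]) o.
  elim: s i o => //= v s IH i o [vi si].
  have := IH i.+1 (Node (Node (onehot i) (row e v)) o) si.
  by rewrite /onehot /= => ->; rewrite /obj /onehot vi.
have := gen (enum V) 0 Leaf; rewrite size_enum_ord val_enum_ord => /(_ erefl) /= ->.
by rewrite trev_map // size_enum_ord.
Qed.

Definition none : pins := [ffun=> None].
Lemma emptyfE : emptyf N (tree_of_seq [seq row e v | v <- enum V]) = encP none.
Proof.
rewrite /emptyf tfoldE; last by rewrite spine_seq size_map size_enum_ord.
rewrite spine_seq foldl_map /=.
rewrite /encP (eq_map (g := fun=> Leaf)) => [|w]; last by rewrite ffunE.
suff gen (s : seq V) o : foldl (fun a _ => Node Leaf a) o s = foldr Node o [seq Leaf | _ <- s] by exact: gen.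
elim: s o => //= v s IH o; rewrite IH; elim: s {IH} => //= v' s ->.
by [].
Qed.

Fixpoint tops (vs : seq V) p : seq (pins * V) :=
  if vs is v :: vs' then (p, v) :: tops vs' (pin p v (first c0 e p v)) else [::].

Lemma free_step v vs p : uniq (v :: vs) -> free p = [set w in v :: vs] ->
  v \in free p /\ free (pin p v (first c0 e p v)) = [set w in vs].
Proof.
case/andP=> vvs _ fp; split; first by rewrite fp !inE eqxx.
rewrite free_pin fp; apply/setP=> w; rewrite !inE; case: (eqVneq w v) => [->|] //=.
by rewrite (negPf vvs).
Qed.

Lemma size_tops vs p : size (tops vs p) = size vs.
Proof. by elim: vs p => //= v vs IH p; rewrite IH. Qed.

Lemma okts_tops vs p : uniq vs -> free p = [set w in vs] -> okts (tops vs p).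
Proof.
elim: vs p => //= v vs IH p uvs fp; have [vf fp'] := free_step uvs fp.
have uv : uniq vs by case/andP: uvs.
by move=> t; rewrite inE => /orP[/eqP -> //|h]; exact: (IH _ uv fp' t h).
Qed.

Lemma topfE p vs o : uniq vs -> free p = [set w in vs] ->
  tl (foldl (fun a x => Node (hd (ext q N (Node (hd a) x))) (Node (Node (hd a) x) (tl a)))
    (Node (encP p) o) [seq obj e v | v <- vs]) = crev (encL (tops vs p)) o.
Proof.
elim: vs p o => //= v vs IH p o uvs fp; have [vf fp'] := free_step uvs fp.
have uv : uniq vs by case/andP: uvs.
rewrite extE // -[crev _ _]/(crev (encL (tops vs (pin p v (first c0 e p v)))) (Node (encT (p, v)) o)) -IH //.
congr (tl (foldl _ (Node _ _) _)).
have [c ca] := allowed_ex vf.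
have : has (mem (allowed e p v)) (enum C) by apply/hasP; exists c; rewrite ?mem_enum.
rewrite /exts /first has_count -size_filter; by case: [seq _ <- _ | _].
Qed.

Definition fswap (f : nat * nat) := (f.2, f.1).
Definition prodF ts := foldl (fun acc t => fmuln acc (fswap (estF K t.1 t.2 (first c0 e t.1 t.2)))) (1, 1) ts.

Lemma prodfE ts : size ts <= N -> okts ts ->
  prodf q N (Node (encL ts) (encVs K ts)) = fenc N (prodF ts).
Proof.
move=> h ok; rewrite /prodf /= /encL zfoldE // oneE //.
rewrite -[Node (enc N 1) (enc N 1)]/(fenc N (1, 1)) /prodF /encVs spine_seq.
have E : forall t0, zip ts (iota 0 (size ts)) = [seq (nth t0 ts i, i) | i <- iota 0 (size ts)].
  move=> t0; rewrite -[X in zip X _](mkseq_nth t0 ts) /mkseq.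
  by elim: (iota _ _) => //= i s ->.
have [->|[t0 t0in]] : ts = [::] \/ exists t0, t0 \in ts.
  by case: (ts) => [|t l]; [left|right; exists t; rewrite inE eqxx].
  by [].
rewrite (E t0).
rewrite foldl_map -[in RHS](mkseq_nth t0 ts) /mkseq [in RHS]foldl_map.
have : all (fun i => i < size ts) (iota 0 (size ts)) by apply/allP=> i; rewrite mem_iota.
move: (1, 1); elim: (iota _ _) => //= i s IH f /andP[il al].
rewrite (nth_map t0) //; have tin : nth t0 ts i \in ts by exact: mem_nth.
have tf := ok _ tin; case: (nth t0 ts i) tf => p v vf.
have ex := allowed_ex vf; rewrite (pickE c0) //=.
by rewrite -[Node (enc N _) (enc N _)]/(fenc N (fswap (estF K p v (first c0 e p v)))) fmulE IH.
Qed.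

Lemma fb_prodF ts : okts ts -> fb (size ts * M ^ K) (prodF ts).
Proof.
move=> ok; rewrite /prodF.
suff gen f m : fb m f -> fb (m + size ts * M ^ K)
  (foldl (fun acc t => fmuln acc (fswap (estF K t.1 t.2 (first c0 e t.1 t.2)))) f ts) by exact: (gen (1, 1) 0).
elim: ts ok f m => [|[p v] ts IH] ok f m hf /=; first by rewrite mul0n addn0.
rewrite mulSn addnA; apply: IH; first by move=> t tt; apply: ok; rewrite inE tt orbT.
apply: fb_mul => //.
have vf : v \in free p by apply: (ok (p, v)); rewrite inE eqxx.
have [_ + _] : [/\ 0 < (estF K p v (first c0 e p v)).2, fb (M ^ K) (estF K p v (first c0 e p v))
   & fval (estF K p v (first c0 e p v)) = est c0 e r K p v (first c0 e p v)] by exact: (estF_val c0 e_sym e_irr e_lat D_lt deg_le hSmax hWmax hLb hM hM0).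
by rewrite /fb /fswap /= andbC.
Qed.

Lemma prodF_val vs p f : uniq vs -> free p = [set w in vs] -> (0 < prodest c0 e r K vs p)%R ->
  0 < f.2 ->
  let F := foldl (fun acc t => fmuln acc (fswap (estF K t.1 t.2 (first c0 e t.1 t.2)))) f (tops vs p) in
  0 < F.2 /\ fval F = (fval f * prodest c0 e r K vs p)%R.
Proof.
elim: vs p f => [|v vs IH] p f /= uvs fp pp f0; first by rewrite mulr1.
have [vf fp'] := free_step uvs fp; case/andP: uvs => _ uvs.
have [a _ b] : [/\ 0 < (estF K p v (first c0 e p v)).2, fb (M ^ K) (estF K p v (first c0 e p v))
   & fval (estF K p v (first c0 e p v)) = est c0 e r K p v (first c0 e p v)] by exact: (estF_val c0 e_sym e_irr e_lat D_lt deg_le hSmax hWmax hLb hM hM0).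
have e0 : (0 <= est c0 e r K p v (first c0 e p v))%R by exact: est_ge0.
have en : (est c0 e r K p v (first c0 e p v) != 0)%R.
  by apply: contraTneq pp => ->; rewrite invr0 mul0r ltxx.
have ep : (0 < est c0 e r K p v (first c0 e p v))%R by rewrite lt0r en.
have num : 0 < (estF K p v (first c0 e p v)).1.
  rewrite lt0n; apply: contraNneq en => h; rewrite -b /fval h mul0r //.
have pp' : (0 < prodest c0 e r K vs (pin p v (first c0 e p v)))%R.
  by move: pp; rewrite pmulr_rgt0 // invr_gt0.
have [h1 h2] := IH _ (fmuln f (fswap (estF K p v (first c0 e p v)))) uvs fp' pp' ltac:(by rewrite /= muln_gt0 f0).
split=> //; rewrite h2 fval_mul -mulrA; congr (_ * (_ * _))%R.
by rewrite -b /fval /fswap /= invf_div.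
Qed.

Lemma mainfE kl : size (spine kl) = K -> (0 < prodest c0 e r K (enum V) none)%R ->
  exists a b : nat, [/\ 0 < b, (prodest c0 e r K (enum V) none = a%:R / b%:R)%R
   & mainf q r N (Node (tree_of_seq [seq row e v | v <- enum V]) kl) = tree_of_fraction a b].
Proof.
move=> sk pp; have uV : uniq (enum V) by exact: enum_uniq.
have fp : free none = [set w in enum V] by apply/setP=> w; rewrite !inE ffunE eqxx mem_enum.
set ts := tops (enum V) none.
have ok : okts ts by exact: okts_tops.
have sz : size ts = n by rewrite size_tops size_enum_ord.
have [h1 h2] := prodF_val (f := (1, 1)) uV fp pp isT.
exists (prodF ts).1, (prodF ts).2; split=> //.
  by move: h2; rewrite /= {2}/fval divff // mul1r => <-.
rewrite /mainf /withvs /solve /= mkvsE emptyfE.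
have -> : topf q N (Node (encP none) vsT) = encL ts.
  rewrite /topf /= tfoldE; last by rewrite spine_vs size_map size_enum_ord.
  rewrite spine_vs topfE //.
  by rewrite trevE ?crevK // size_crev addn0 spine_seq size_map sz.
rewrite downfE ?sz // upfE ?sz // prodfE ?sz //.
have /andP[f1 f2] := fb_prodF ok; rewrite sz in f1 f2.
have lt : 2 ^ (n * M ^ K) < 2 ^ N by rewrite ltn_exp2l.
have h1' : 0 < (prodF ts).2 by exact: h1.
move: f1 f2 h1'; case: (prodF ts) => a b /= f1 f2 h1'.
by apply: outfE => //; [exact: leq_ltn_trans f1 lt|exact: leq_ltn_trans f2 lt].
Qed.

End CorrectMain.
End MainProgram.

(** * Building the clock from the graph and the accuracy *)

Module Clock.
Import Defs PolyTime TreeArithmetic.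
Fixpoint bigf (d : nat) : fn := fun N t => if d is d'.+1 then iter N (bigf d' N) t else Node Leaf t.
Lemma PT_bigf d : PT (bigf d).
Proof. by elim: d => [|d IH]; [rewrite /bigf; pt|exact: PT_loop]. Qed.
Lemma size_bigf d N t : size (spine (bigf d N t)) = N ^ d + size (spine t).
Proof.
elim: d t => [|d IH] t /=; first by rewrite expn0 add1n.
rewrite expnS; move: {1 3}N => m; elim: m => //= m IHm.
by rewrite IH IHm mulSn addnA.
Qed.

Definition half_step (s : tree) :=
  if truthy (tl (hd s)) then Node (tl (tl (hd s))) (Node Leaf (tl s)) else s.
Definition halff : fn := fun N t => tl (iter N half_step (Node t Leaf)).
Definition log_step : fn := fun N s =>
  if truthy (hd s) then Node (halff N (hd s)) (Node Leaf (tl s)) else s.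
(** The binary length of [N] in unary: one node for each halving of a list of [N] nodes. *)
Definition kf : fn := fun N t => tl (iter N (log_step N) (Node (zero N t) Leaf)).
Lemma PT_halff : PT halff.
Proof.
apply: PT_tl; apply: (@PT_comp (fun N t => iter N half_step t)); last by pt.
by apply: (@PT_loop (fun _ s => half_step s)); rewrite /half_step; pt.
Qed.
#[global] Hint Resolve PT_halff : pt.
Lemma PT_kf : PT kf.
Proof.
apply: PT_tl; apply: (@PT_comp (fun N t => iter N (log_step N) t)); last by pt.
by apply: PT_loop; rewrite /log_step; pt.
Qed.
#[global] Hint Resolve PT_kf : pt.

Lemma iter_fixed (A : Type) (f : A -> A) x m : f x = x -> iter m f x = x.
Proof. by move=> h; elim: m => //= m ->. Qed.

Lemma halffE N t : size (spine t) <= N -> size (spine (halff N t)) = (size (spine t))./2.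
Proof.
rewrite /halff; have gen m u o : size (spine u) <= m ->
    size (spine (tl (iter m half_step (Node u o)))) = (size (spine u))./2 + size (spine o).
  elim: m u o => [|m IH] u o; first by case: u.
  case: u => [|x [|y u]] h; rewrite iterSr.
  - by rewrite iter_fixed.
  - by rewrite iter_fixed.
  rewrite /half_step /= -/half_step IH ?addnS //; by move: h => /=; clear; lia.
by move=> h; rewrite gen // addn0.
Qed.

Lemma kfE N t : 0 < N -> exists k, [/\ size (spine (kf N t)) = k, N < 2 ^ k & 2 ^ k <= 2 * N].
Proof.
move=> N0; rewrite /kf.
have gen i l o : size (spine l) <= i -> size (spine l) <= N -> exists k,
   [/\ size (spine (tl (iter i (log_step N) (Node l o)))) = k + size (spine o), size (spine l) < 2 ^ k,
       size (spine l) = 0 -> k = 0 & 0 < size (spine l) -> 2 ^ k <= 2 * size (spine l)].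
  elim: i l o => [|i IH] l o; first by case: l => // _ _; exists 0.
  case: l => [|x u] h hN.
    by exists 0; rewrite iter_fixed.
  rewrite iterSr [log_step N _]/= -[log_step N _]/(Node (halff N (Node x u)) (Node Leaf o)).
  have hh := halffE hN; have [||k [h1 h2 h3 h4]] := IH (halff N (Node x u)) (Node Leaf o).
  - by rewrite hh; move: h => /=; clear; lia.
  - by rewrite hh; move: hN => /=; clear; lia.
  exists k.+1; rewrite hh /= in h1 h2 h3 h4 *; split=> //.
  - by rewrite h1 addnS.
  - by rewrite expnS; move: h2; clear; lia.
  move=> _; rewrite expnS; case: (posnP (size (spine u)).+1./2) => [z|p].
    by rewrite (h3 z); clear; lia.
  by have := h4 p; clear; lia.
have sz : size (spine (zero N t)) = N by rewrite zeroE size_enc.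
have [||k [h1 h2 _ h4]] := gen N (zero N t) Leaf; rewrite ?sz //.
rewrite sz in h2 h4; exists k; rewrite h1 addn0; split=> //; exact: h4.
Qed.

Definition addc (c : nat) (t : tree) := iter c (Node Leaf) t.
Lemma PT_addc c f : PT f -> PT (fun N t => addc c (f N t)).
Proof. by move=> h; rewrite /addc; elim: c => //= c IH; apply: PT_node; pt. Qed.
Lemma size_addc c t : size (spine (addc c t)) = c + size (spine t).
Proof. by rewrite /addc; elim: c => //= c ->. Qed.

(** Run on the small clock, it produces the large clock, a power of the small one, together with the
    recursion depth; the main program then runs on the large clock. *)
Definition stage1 (D c : nat) : fn := fun N t => Node (bigf D N Leaf) (addc c (kf N Leaf)).
Lemma PT_stage1 D c : PT (stage1 D c).
Proof.
apply: PT_node; first by apply: (PT_comp (PT_bigf D)); pt.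
by apply: PT_addc; apply: (PT_comp PT_kf); pt.
Qed.

Definition double_body := Seq (Assign 1 (ENode ELeaf (EVar 1))) (Assign 5 (ESnd (EVar 5))).
Lemma double_exec u s : s 5 = u -> exists k s', [/\ exec (While (EVar 5) double_body) s k s',
  k <= 10 * size (spine u) + 2, size (spine (s' 1)) = size (spine (s 1)) + size (spine u)
  & forall i, i != 1 -> i != 5 -> s' i = s i].
Proof.
elim: u s => [|x _ u IH] s s5.
  by exists 2, s; split=> //; [apply: exec_while_done; rewrite /= s5|rewrite addn0].
set s1 := update s 1 (Node Leaf (s 1)); set s2 := update s1 5 u.
have e1 : exec double_body s 8 s2.
  have -> : s2 = update s1 5 (eval s1 (ESnd (EVar 5))) by rewrite /= /s1 update_neq // s5.
  by apply: (@exec_seq _ _ _ _ _ 4 3); [exact: exec_assign|exact: exec_assign].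
have [|k [s' [e2 t2 r2 p2]]] := IH s2; first by rewrite /s2 update_eq.
exists (1 + 8 + k).+1, s'; split.
- by apply: exec_while_step e1 e2; rewrite /= s5.
- by move: t2 => /=; clear; lia.
- by rewrite r2 /s2 update_neq // /s1 update_eq /= addnS.
by move=> i i1 i5; rewrite p2 // /s2 update_neq // /s1 update_neq.
Qed.

Definition scan_body := If (EFst (EFst (EVar 3))) (Assign 4 ELeaf)
  (Seq (Assign 3 (ESnd (EVar 3))) (Seq (Assign 5 (EVar 1)) (While (EVar 5) double_body))).
(** The clock doubles for each leading zero of the numerator and the scan stops at the first one.
    Later digits are never read, so the time does not depend on the length of the accuracy. *)
Lemma scan_exec j s : truthy (s 4) -> (forall i, i < j -> ~~ truthy (hd (nth Leaf (spine (s 3)) i))) ->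
  truthy (hd (nth Leaf (spine (s 3)) j)) -> 0 < size (spine (s 1)) ->
  exists k s', [/\ exec (While (EVar 4) scan_body) s k s',
    k <= 40 * (j.+1 * (size (spine (s 1)) * 2 ^ j)),
    size (spine (s' 1)) = size (spine (s 1)) * 2 ^ j, s' 0 = s 0 & s' 2 = s 2].
Proof.
elim: j s => [|j IH] s t4 hz ht p1.
  have ht' : truthy (eval s (EFst (EFst (EVar 3)))).
    by move: ht => /=; case: (s 3) => //= -[].
  exists (1 + 6 + 2).+1, (update s 4 Leaf); split.
  - apply: (@exec_while_step _ (update s 4 Leaf)) => //.
    + by apply: (@exec_if _ _ _ _ _ 2); rewrite ht'; exact: exec_assign.
    + by apply: exec_while_done.
  - by rewrite expn0; move: p1; clear; lia.
  - by rewrite update_neq // muln1.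
  - by rewrite update_neq.
  - by rewrite update_neq.
have hz0 : ~~ truthy (eval s (EFst (EFst (EVar 3)))).
  by have := hz 0 isT => /=; case: (s 3) => //= -[].
set s1 := update s 3 (tl (s 3)); set s2 := update s1 5 (s1 1).
have [|k [s3 [e3 t3 r3 p3]]] := double_exec (s := s2) (u := s 1).
  by rewrite /s2 update_eq /s1 update_neq.
have E1 : s2 1 = s 1 by rewrite /s2 update_neq // /s1 update_neq.
rewrite E1 in r3.
have E3 : s3 3 = tl (s 3) by rewrite p3 // /s2 update_neq // /s1 update_eq.
have sh i : nth Leaf (spine (s3 3)) i = nth Leaf (spine (s 3)) i.+1.
  by rewrite E3; case: (s 3) => //=; rewrite nth_nil.
have eb : exec scan_body s (3 + (3 + (2 + k).+1).+1).+1 s3.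
  apply: exec_if; rewrite (negPf hz0); apply: exec_seq; first exact: (exec_assign s 3 (ESnd (EVar 3))).
  by apply: exec_seq e3; exact: (exec_assign s1 5 (EVar 1)).
have [||||k2 [s' [e4 t4' r4 a4 b4]]] := IH s3.
- by rewrite p3 // /s2 update_neq // /s1 update_neq.
- by move=> i ij; rewrite sh; exact: hz.
- by rewrite sh.
- by rewrite r3; move: p1; clear; lia.
exists (1 + (3 + (3 + (2 + k).+1).+1).+1 + k2).+1, s'; split.
- exact: exec_while_step eb e4.
- rewrite r3 in t4'; move: t3 t4' p1; rewrite expnS; have : 0 < 2 ^ j by rewrite expn_gt0.
  by move: (size _) (2 ^ j) => L P; clear; nia.
- by rewrite r4 r3 expnS addnn -mul2n mulnA [_ * 2]mulnC.
- by rewrite a4 p3 // /s2 update_neq // /s1 update_neq.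
- by rewrite b4 p3 // /s2 update_neq // /s1 update_neq.
Qed.

Lemma run_program (f1 f2 : fn) : PT f1 -> PT f2 -> (forall N t, f1 N t = f1 N Leaf) ->
  exists (p : cmd) (K d : nat), forall rows t j,
   (forall i, i < j -> ~~ truthy (hd (nth Leaf (spine t) i))) -> truthy (hd (nth Leaf (spine t) j)) ->
   let N0 := (size (spine rows)).+2 * 2 ^ j in let N1 := size (spine (hd (f1 N0 Leaf))) in
   exists k, computes p (Node rows t) k (f2 N1 (Node rows (tl (f1 N0 Leaf)))) /\
     k <= K * (N0.+1 * N1.+1) ^ d.
Proof.
move=> [K1 [d1 h1]] [K2 [d2 h2]] f1c; have [c1 {}h1] := h1 3 isT; have [c2 {}h2] := h2 3 isT.
(* Registers: 0 input and output, 1 clock, 2 rows of the graph, 3 argument of both stages, 4 flag of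
   the scan, 5 counter of the doubling. Both stages run at [b = 3] and so preserve registers 0 to
   2. *)
exists (Seq (Assign 2 (EFst (EVar 0))) (Seq (Assign 3 (ESnd (EVar 0)))
 (Seq (Assign 1 (ENode ELeaf (ENode ELeaf (EVar 2)))) (Seq (Assign 4 (ENode ELeaf ELeaf))
 (Seq (While (EVar 4) scan_body) (Seq c1 (Seq (Assign 1 (EFst (EVar 3)))
 (Seq (Assign 3 (ENode (EVar 2) (ESnd (EVar 3)))) (Seq c2 (Assign 0 (EVar 3))))))))))).
exists (K1 + K2 + 100), (d1 + d2 + 2) => rows t j hz ht N0 N1.
set i0 := update (fun=> Leaf) 0 (Node rows t); set i1 := update i0 2 rows; set i2 := update i1 3 t.
set i3 := update i2 1 (Node Leaf (Node Leaf rows)); set i4 := update i3 4 T.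
have i43 : i4 3 = t by [].
have i41 : i4 1 = Node Leaf (Node Leaf rows) by [].
have [||||ka [s1 [e1 t1 r1 _ b1]]] := @scan_exec j i4; rewrite ?i43 ?i41 //.
rewrite i41 /= -/N0 in r1 t1.
have [kb [s2 [e2 t2 r2 p2]]] := h1 s1; rewrite r1 f1c in r2; rewrite r1 in t2.
set s3 := update s2 1 (hd (s2 3)); set s4 := update s3 3 (Node (s3 2) (tl (s3 3))).
have [kc [s5 [e5 t5 r5 p5]]] := h2 s4.
have s41 : s4 1 = hd (f1 N0 Leaf) by rewrite /s4 /s3 /update /= r2.
have s43 : s4 3 = Node rows (tl (f1 N0 Leaf)).
  by rewrite /s4 /s3 /update /= r2 p2 // b1.
rewrite s41 s43 -/N1 in r5; rewrite s41 -/N1 in t5.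
exists (3 + (3 + (6 + (4 + (ka + (kb + (3 + (5 + (kc + 2).+1).+1).+1).+1).+1).+1).+1).+1).+1; split.
  exists (update s5 0 (s5 3)); last by rewrite update_eq r5.
  apply: exec_seq; first exact: (exec_assign i0 2 (EFst (EVar 0))).
  apply: exec_seq; first exact: (exec_assign i1 3 (ESnd (EVar 0))).
  apply: exec_seq; first exact: (exec_assign i2 1 (ENode ELeaf (ENode ELeaf (EVar 2)))).
  apply: exec_seq; first exact: (exec_assign i3 4 (ENode ELeaf ELeaf)).
  apply: exec_seq e1 _; apply: exec_seq e2 _.
  apply: exec_seq; first exact: (exec_assign s2 1 (EFst (EVar 3))).
  apply: exec_seq; first exact: (exec_assign s3 3 (ENode (EVar 2) (ESnd (EVar 3)))).
  by apply: exec_seq e5 _; exact: (exec_assign s5 0 (EVar 3)).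
set X := N0.+1 * N1.+1.
have X0 : N0.+1 <= X by rewrite leq_pmulr.
have X1 : N1.+1 <= X by rewrite leq_pmull.
have Xp : 0 < X by exact: leq_trans X0.
have le d' x : x <= X -> d' <= d1 + d2 + 2 -> x ^ d' <= X ^ (d1 + d2 + 2).
  move=> xX dd; apply: leq_trans (leq_pexp2l Xp dd).
  by case: d' {dd} => [|d']; rewrite ?expn0 // leq_exp2r.
set Y := X ^ (d1 + d2 + 2) in le *.
have y1 : N0.+1 ^ d1 <= Y by apply: le => //; rewrite -addnA leq_addr.
have y2 : N1.+1 ^ d2 <= Y by apply: le => //; rewrite addnAC leq_addl.
have y3 : N0.+1 ^ 2 <= Y by apply: le => //; rewrite leq_addl.
have y0 : 1 <= Y by rewrite expn_gt0 Xp.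
have jN : j.+1 <= N0.
  by apply: leq_trans (ltn_expl j (isT : 1 < 2)) _; rewrite leq_pmull.
have z1 : kb <= K1 * Y by apply: leq_trans t2 _; rewrite leq_mul2l y1 orbT.
have z2 : kc <= K2 * Y by apply: leq_trans t5 _; rewrite leq_mul2l y2 orbT.
have z3 : ka <= 40 * Y.
  apply: leq_trans t1 _; rewrite leq_mul2l /=; apply: leq_trans y3.
  by rewrite -mulnn; apply: leq_mul; [exact: leqW|exact: leqnSn].
by rewrite !mulnDl; move: z1 z2 z3 y0; clear; lia.
Qed.
End Clock.

(** * Choice of the parameters and the approximation scheme *)

Module Reduction.
Import Defs Colourings EdgeBounds SpatialMixing Locality Estimator PolyTime TreeArithmetic TreeGraphs TreeGraphsCorrect EstimatorProgram MainProgram Clock Lattices.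
Import Order.TTheory GRing.Theory Num.Theory.

(** [j] is the difference of the binary lengths of [b] and [a], so [2 ^ j] equals the inverse of the
    accuracy up to a factor two. *)
Lemma leading_digit a b : 0 < a -> a < b -> exists j,
  [/\ forall i, i < j -> ~~ truthy (hd (nth Leaf (spine (tree_of_fraction a b)) i)),
      truthy (hd (nth Leaf (spine (tree_of_fraction a b)) j)),
      b < 2 ^ j.+1 * a & 2 ^ j * a < 2 * b].
Proof.
move=> a0 ab; rewrite /tree_of_fraction (maxn_idPr (ltnW ab)); set L := up_log 2 b.+1.
set l := up_log 2 a.+1.
have P m : 0 < 2 ^ m by rewrite expn_gt0.
have bL : b < 2 ^ L by exact: up_logP.
have al : a < 2 ^ l by exact: up_logP.
have low x : 0 < x -> 2 ^ (up_log 2 x.+1).-1 <= x /\ 0 < up_log 2 x.+1.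
  move=> x0; have u0 : 0 < up_log 2 x.+1 by rewrite up_log_gt0 /= ltnS.
  split=> //; rewrite leqNgt; apply/negP=> h.
  by have := @up_log_min 2 x.+1 _ isT h; move: u0; clear; lia.
have [a1 l0] := low a a0; have [b1 L0] := low b (ltn_trans a0 ab).
have lL : l <= L by apply: up_log_min => //; exact: ltn_trans ab bL.
rewrite -/l -/L in a1 l0 b1 L0.
have dig i : i < L -> hd (nth Leaf (spine (tree_of_seq [seq Node (tb (binary_digit a i)) (tb (binary_digit b i))
   | i <- rev (iota 0 L)])) i) = tb (binary_digit a (L - i.+1)).
  move=> iL; rewrite spine_seq (nth_map 0) ?size_rev ?size_iota // nth_rev ?size_iota // nth_iota ?add0n //.
  by move: iL; clear; lia.
exists (L - l); split.
- move=> i ij; rewrite dig; last by move: ij; clear; lia.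
  rewrite truthy_tb /binary_digit divn_small //; apply: leq_trans al _; apply: leq_pexp2l => //.
  by move: ij; clear; lia.
- rewrite dig; last by move: l0 lL; clear; lia.
  have -> : L - (L - l).+1 = l.-1 by move: l0 lL; clear; lia.
  rewrite truthy_tb /binary_digit; have -> : a %/ 2 ^ l.-1 = 1 => //.
  by apply/eqP; rewrite eqn_leq divn_gt0 // a1 andbT -ltnS ltn_divLR // -expnS prednK.
- apply: leq_trans bL _; apply: leq_trans (_ : 2 ^ (L - l).+1 * 2 ^ l.-1 <= _); last by rewrite leq_mul2l a1 orbT.
  by rewrite -expnD; apply: leq_pexp2l => //; move: l0 lL; clear; lia.
apply: leq_trans (_ : 2 ^ (L - l) * 2 ^ l <= _); first by rewrite ltn_mul2l P.
rewrite -expnD subnK // -(prednK L0) expnS leq_mul2l /=; exact: b1.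
Qed.

Section Main.
Local Open Scope ring_scope.

Lemma num_coloursE q (G : graph) (c0 : 'I_q) :
  (num_colourings q G)%:R = Z c0 (@adj G) (none (order G) q).
Proof.
rewrite /num_colourings /Z /count /csum -sum1_card natr_sum.
have fE : free (none (order G) q) = setT by apply/setP=> v; rewrite !inE ffunE.
have aE v : allowed (@adj G) (none (order G) q) v = setT.
  by apply/setP=> c; rewrite !inE; apply/forallP=> w; rewrite ffunE implybT.
apply: eq_bigl => c; rewrite inE /good fE /proper_colouring.
have -> : [forall v, (if v \in [set: 'I_(order G)] then c v \in allowed (@adj G) (none (order G) q) v else c v == c0)] = true.
  by apply/forallP=> v; rewrite inE aE inE.
apply: eq_forallb => v; rewrite inE /=; apply: eq_forallb => w; by rewrite inE.
Qed.

Lemma accuracy_bound (n P Q c rho eps : rat) : 0 <= n -> 0 < rho -> 0 < eps ->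
  4 <= c * rho -> 1 < 2 * P * eps -> (n + 2) * P * c <= Q -> 2 * n + 1 <= rho * eps * Q.
Proof.
move=> n0 r0 e0 h4 hP hQ.
have t2 : rho * eps * ((n + 2) * P * c) <= rho * eps * Q.
  by apply: ler_wpM2l => //; apply: mulr_ge0; exact: ltW.
apply: le_trans t2.
have -> : rho * eps * ((n + 2) * P * c) = (c * rho) * ((n + 2) * (P * eps)) by ring.
apply: le_trans (_ : 4 * ((n + 2) * (1/2)) <= _); first by lra.
apply: ler_pM => //; [by apply: mulr_ge0; lra|].
by apply: ler_wpM2l; lra.
Qed.

(** Both [n + 2] and [2 ^ j] are at most [2 * (n + 1 / eps)], so the small clock is at most
    quadratic; 5 instead of 4 absorbs the additional 1. *)
Lemma time_bound (n P eps : rat) : 0 <= n -> 0 <= P -> 0 < eps -> eps < 1 -> P * eps < 2 ->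
  1 <= n + eps^-1 /\ (n + 2) * P + 1 <= 5 * (n + eps^-1) ^+ 2.
Proof.
move=> n0 P0 e0 e1 hP; have ei : 1 < eps^-1 by rewrite invf_gt1.
have hj : P <= 2 * eps^-1 by rewrite -ler_pdivrMr ?invr_gt0 // invrK; exact: ltW.
move: {e0 e1 hP} eps^-1 ei hj => y ei hj; set x := n + y.
have x1 : 1 <= x by rewrite /x; lra.
split=> //; have xx : x <= x * x by rewrite ler_peMr //; lra.
have t1 : n + 2 <= 2 * x by rewrite /x; lra.
have t3 : P <= 2 * x by rewrite /x; lra.
have t2 : (n + 2) * P <= (2 * x) * (2 * x) by apply: ler_pM => //; lra.
by rewrite expr2; lra.
Qed.

Theorem FPTAS_of_tame (q Delta : nat) (K1 lam : rat) (Cl : graph -> Prop) :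
  (Delta < q)%N -> 0 <= K1 -> 0 <= lam < 1 ->
  (forall G, Cl G -> tame q Delta K1 lam G) -> has_FPTAS Cl (num_colourings q).
Proof.
move=> Dq K10 hlam htame; have q0 : (0 < q)%N by exact: leq_ltn_trans Dq.
pose c0 : 'I_q := Ordinal q0.
have [r hr] := decay_radius (mulr_ge0 (ler0n rat q) K10) hlam.
(* [Smax] bounds spheres and inner balls, [Wmax] the pinnings of a sphere and [2 ^ Lb] those of an
   inner ball. [M] is taken as a power of two, so that [M ^ K] is a power of [2 ^ K] and thus
   polynomial in the small clock. *)
pose Smax := (2 * (2 * r.+2 + 1) ^ 3)%N; pose Wmax := (q ^ Smax)%N; pose Lb := (q * Smax)%N.
pose mu := (Wmax * (Smax + Lb + 1))%N; pose M := (2 ^ mu)%N.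
have [c1 hc1] : exists c1 : nat, 4 <= (2 ^ c1)%:R * rho 'I_q Delta.
  have rp : 0 < rho 'I_q Delta by apply: rho_gt0; rewrite card_ord.
  exists (Num.bound (4 / rho 'I_q Delta)).
  rewrite -ler_pdivrMr //; apply: ltW.
  have h0 : 0 <= 4 / rho 'I_q Delta by apply: mulr_ge0; [lra|rewrite invr_ge0 ltW].
  apply: lt_le_trans (archi_boundP h0) _; rewrite ler_nat; apply: ltnW; exact: ltn_expl.
pose X := (q + Wmax + Lb + Smax * Wmax)%N.
(* The term [1 + (2 + c1) * mu] makes the clock exceed the [n * M ^ K] digits of the product,
   [2 + c1] makes it exceed the depth, and [X] covers the constants, since the small clock is at
   least 2. *)
pose D := (1 + (2 + c1) * mu + (2 + c1) + X)%N.
have [p [Kp [dp hp]]] := run_program (PT_stage1 D c1) (PT_mainf q r) (fun _ _ => erefl).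
exists p, (Kp * 5 ^ (D.+2 * dp))%N, (2 * (D.+2 * dp))%N => G eps t ClG /andP[e0 e1] [a [b [b0 eE tE]]].
have [lat [ls elat deg dec grow]] := htame G ClG.
have bR : 0 < b%:R :> rat by rewrite ltr0n.
have a0 : (0 < a)%N.
  by rewrite lt0n; apply: contraTneq e0 => E; rewrite eE E mul0r ltxx.
have ab : (a < b)%N by move: e1; rewrite eE ltr_pdivrMr // mul1r ltr_nat.
have [j [hz ht j1 j2]] := leading_digit a0 ab; rewrite -tE in hz ht.
pose n := order G; pose N0 := (n.+2 * 2 ^ j)%N.
pose rows := tree_of_seq [seq row (@adj G) v | v <- enum 'I_n].
have rowsE : tree_of_graph G = rows by [].
have srows : size (spine rows) = n by rewrite spine_seq size_map size_enum_ord.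
have N02 : (2 <= N0)%N.
  have : (0 < 2 ^ j)%N by rewrite expn_gt0.
  by rewrite /N0; move: (2 ^ j)%N => P; clear; nia.
have [k0 [kE kN1 kN2]] := @kfE N0 Leaf (ltnW N02).
(* [2 ^ k0] exceeds the small clock, which accounts for [n] and the accuracy; the [c1] further
   levels absorb the constant [rho]. *)
pose K := (c1 + k0)%N; pose N := (N0 ^ D)%N.
have N1E : size (spine (hd (stage1 D c1 N0 Leaf))) = N by rewrite -[hd _]/(bigf D N0 Leaf) size_bigf addn0.
have klE : size (spine (tl (stage1 D c1 N0 Leaf))) = K by rewrite -[tl _]/(addc c1 (kf N0 Leaf)) size_addc kE.
have [k [cE ktime]] := hp rows t j hz ht; rewrite srows -/N0 N1E in cE ktime.
have pw x i : (x <= N0 ^ i)%N -> (i <= D)%N -> (x <= N)%N.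
  by move=> h iD; apply: leq_trans h _; apply: leq_pexp2l => //; exact: ltnW.
have two m : (2 ^ m <= N0 ^ m)%N by case: m => // m; rewrite leq_exp2r.
have cst x : (x <= X)%N -> (2 ^ x <= N)%N.
  by move=> xX; apply: (pw _ x) (two x) _; rewrite /D; move: xX; clear; lia.
have cst1 x : (x <= X)%N -> (x <= N)%N.
  by move=> xX; apply: leq_trans (cst x xX); apply: ltnW; exact: ltn_expl.
have K2 : (2 ^ K <= N0 ^ (2 + c1))%N.
  rewrite /K expnD; apply: leq_trans (leq_mul (two c1) kN2) _; rewrite expnD mulnC leq_mul2r.
  by apply/orP; right; rewrite -mulnn leq_mul2r N02 orbT.
have sphere_le (p' : pins 'I_n 'I_q) v : (size (sphere (@adj G) r p' v) <= Smax)%N.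
  apply: leq_trans (grow v r.+2); rewrite -(card_uniqP (filter_uniq _ (enum_uniq _))).
  by apply: subset_leq_card; apply/subsetP=> s /sphereP[].
have inner_le (p' : pins 'I_n 'I_q) v : (size (innerS r (@adj G) p' v) <= Smax)%N.
  apply: leq_trans (_ : #|ball (@adj G) v r.+2| <= _)%N; last exact: grow.
  rewrite -(card_uniqP (filter_uniq _ (enum_uniq _))).
  apply: subset_leq_card; apply/subsetP=> s; rewrite mem_filter => /andP[/andP[_ h] _].
  exact: (subsetP (ball_mono _ _ _)) h.
have Dlt : (Delta < #|'I_q|)%N by rewrite card_ord.
have eta0 : 0 <= K1 * lam ^+ r by apply: mulr_ge0 => //; apply: exprn_ge0; case/andP: hlam.
have small : Smax%:R * (#|'I_q|%:R * (K1 * lam ^+ r)) <= 1 / 2.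
  by rewrite card_ord [q%:R * _]mulrA; exact: hr.
have hq2 : (q <= 2 ^ q)%N by apply: ltnW; exact: ltn_expl.
have fp : free (none n q) = [set w in enum 'I_n] by apply/setP=> w; rewrite !inE ffunE eqxx mem_enum.
have jeps : 1 < (2 ^ j.+1)%:R * eps.
  by rewrite eE mulrA ltr_pdivlMr // mul1r -natrM ltr_nat.
have jeps2 : (2 ^ j)%:R * eps < 2.
  by rewrite eE mulrA ltr_pdivrMr // -!natrM ltr_nat.
have acc : (2 * (size (enum 'I_n))%:R + 1) * (1/2) ^+ K <= rho 'I_q Delta * eps.
  rewrite size_enum_ord; have P2 m : 0 < (2 ^ m)%:R :> rat by rewrite ltr0n expn_gt0.
  have -> : (1/2 : rat) ^+ K = ((2 ^ K)%:R)^-1 by rewrite div1r exprVn natrX.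
  rewrite ler_pdivrMr //.
  have rp : 0 < rho 'I_q Delta by exact: rho_gt0.
  apply: (accuracy_bound (ler0n rat n) rp e0 hc1 (P := (2 ^ j)%:R)).
    by rewrite -natrM -expnS.
  rewrite -(natrD _ n 2) addn2 -!natrM ler_nat /K expnD mulnC leq_mul2l.
  by rewrite (ltnW kN1) orbT.
have [pp bounds] := prodest_approx (@adj_sym G) (@adj_irr G) ls elat Dlt deg (dec c0) sphere_le eta0 small
   (enum_uniq _) fp (introT andP (conj e0 e1)) acc.
have [A [B [B0 vE mE]]] : exists a b : nat, [/\ (0 < b)%N, prodest c0 (@adj G) r K (enum 'I_n) (none n q) = a%:R / b%:R
   & mainf q r N (Node rows (tl (stage1 D c1 N0 Leaf))) = tree_of_fraction a b].
  apply: (@mainfE n q r N (@adj G) lat c0 Delta (@adj_sym G) (@adj_irr G) elat Dlt deg Smax Wmax Lb M K) => //.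
  - by move=> p' v; apply: leq_pexp2l.
  - move=> p' v; apply: leq_trans (_ : q ^ Smax <= _)%N; first exact: leq_pexp2l.
    rewrite /Lb expnM; case: (Smax) => // s; by rewrite leq_exp2r.
  - by apply: ltnW; exact: ltn_expl.
  - by rewrite expn_gt0.
  - apply: (pw _ 1%N); last by rewrite /D -!addnA.
    rewrite expn1; apply: leq_trans (leq_trans (leqnSn n) (leqnSn n.+1)) _.
    by rewrite /N0 leq_pmulr // expn_gt0.
  - by apply: cst1; rewrite /X; clear; lia.
  - by rewrite /N expn_gt0 (ltnW N02).
  - by apply: cst1; rewrite /X; clear; lia.
  - by apply: cst; rewrite /X; clear; lia.
  - by apply: cst1; rewrite /X; clear; lia.
  - apply: leq_trans (ltn_expl K (isT : 1 < 2)%N) _; apply: (pw _ (2 + c1)%N) K2 _.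
    by rewrite /D; clear; lia.
  - have t1 : (M ^ K <= N0 ^ ((2 + c1) * mu))%N.
      rewrite /M -expnM mulnC expnM [in leqRHS]expnM; case: (mu) => // m; by rewrite leq_exp2r.
    apply: leq_trans (_ : (N0 ^ (1 + (2 + c1) * mu) <= _)%N); last first.
      by apply: leq_pexp2l; [exact: ltnW|rewrite /D; clear; lia].
    rewrite expnD expn1; apply: leq_trans (_ : (n.+1 * M ^ K <= _)%N).
      by rewrite ltn_mul2r expn_gt0 expn_gt0 /= ltnSn.
    apply: leq_mul t1; apply: leq_trans (leqnSn _) _; by rewrite /N0 leq_pmulr // expn_gt0.
rewrite mE in cE; exists k, (tree_of_fraction A B), (A%:R / B%:R); split.
- by rewrite rowsE.
- have [x1 N0x] := time_bound (ler0n rat n) (ler0n rat (2 ^ j)) e0 e1 jeps2.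
  rewrite -(natrD _ n 2) addn2 -natrM natr1 -/N0 in N0x.
  have kb : (k <= Kp * N0.+1 ^ (D.+2 * dp))%N.
    apply: leq_trans ktime _; rewrite leq_mul2l; apply/orP; right; rewrite expnM.
    case: (dp) => // d; rewrite leq_exp2r // expnS leq_mul2l; apply/orP; right.
    rewrite /N expnS; apply: leq_trans (_ : N0.+1 ^ D + N0.+1 ^ D <= _)%N.
      rewrite -addn1; apply: leq_add; last by rewrite expn_gt0.
      by case: (D) => // d'; rewrite leq_exp2r.
    by rewrite addnn -mul2n leq_mul2r ltnS (ltnW N02) orbT.
  apply: le_trans (_ : (Kp * N0.+1 ^ (D.+2 * dp))%:R <= _); first by rewrite ler_nat.
  rewrite !natrM -mulrA; apply: ler_wpM2l; first exact: ler0n.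
  rewrite !natrX [_ ^+ (2 * _)]exprM -exprMn; apply: lerXn2r; rewrite ?nnegrE ?ler0n //.
  exact: le_trans (ler0n _ _) N0x.
- by exists A, B.
by rewrite (num_coloursE G c0) -vE.
Qed.

End Main.
End Reduction.

(** * Assembly for the five lattices *)

Theorem theoremB7 :
  [/\ forall q : nat, 6 <= q ->
        has_FPTAS (subgraph_of Z2_lattice) (num_colourings q),
      forall q : nat, 10 <= q ->
        has_FPTAS (subgraph_of Z3_lattice) (num_colourings q),
      forall q : nat, 10 <= q ->
        has_FPTAS (subgraph_of triangular_lattice) (num_colourings q),
      forall q : nat, 5 <= q ->
        has_FPTAS (subgraph_of honeycomb_lattice) (num_colourings q)
    & forall q : nat, 5 <= q ->
        has_FPTAS (subgraph_of kagome_lattice) (num_colourings q)].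
Proof.
split=> q hq.
- apply: (@Reduction.FPTAS_of_tame q 4 (2 * 4%:R)%R (499/500)%R _ _ _ _ (fun G => Lattices.Z2_tame hq)).
  + exact: leq_trans hq.
  + lra.
  + by apply/andP; split; lra.
- apply: (@Reduction.FPTAS_of_tame q 6 (2 * 6%:R)%R (99/100)%R _ _ _ _ (fun G => Lattices.Z3_tame hq)).
  + exact: leq_trans hq.
  + lra.
  + by apply/andP; split; lra.
- apply: (@Reduction.FPTAS_of_tame q 6 (2 * 6%:R)%R (99/100)%R _ _ _ _ (fun G => Lattices.triangular_tame hq)).
  + exact: leq_trans hq.
  + lra.
  + by apply/andP; split; lra.
- apply: (@Reduction.FPTAS_of_tame q 3 (2 * 3%:R)%R (9/10)%R _ _ _ _ (fun G => Lattices.honeycomb_tame hq)).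
  + exact: leq_trans hq.
  + lra.
  + by apply/andP; split; lra.
- apply: (@Reduction.FPTAS_of_tame q 4 4%R (199/200)%R _ _ _ _ (fun G => Lattices.kagome_tame hq)).
  + exact: leq_trans hq.
  + lra.
  + by apply/andP; split; lra.
Qed.
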